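(* Fix $b_1,b_2>0$, $m_v\in\mathbb{Z}_{>0}$, $m_w\in\mathbb{Z}$ and $\varepsilon=(\varepsilon_1,\varepsilon_2,\varepsilon_3)\in\{\pm1\}^3$ (with $\varepsilon_3=1$ if $m_v$ is odd). For $r>0$ consider the three-dimensional Heisenberg manifold with parameters $$A=b_1r,\qquad r,\qquad w_2=b_2\sqrt r,\qquad m_v,\qquad m_w,$$ and spin structure $\varepsilon$. As $r$ varies over $(0,\infty)$, the eta invariant $\eta(0)$ of the spin Dirac operator $D$ is constant, while the eigenvalues of $D$ differ for different $r$ (even the number $-\frac1{4A}$, the point of symmetry appearing in the description of the spectrum, varies with $r$).
   Context: $G$ is the three-dimensional Heisenberg group, i.e. $\mathbb{R}^3$ with product $(x,y,z)(x',y',z')=(x+x',y+y',z+z'+xy')$, with left-invariant fields $X,Y,Z$ satisfying $[X,Y]=Z$. The left-invariant metric is the one for which $\{\frac1{\sqrt A}X,\frac1{\sqrt A}Y,Z\}$ is orthonormal. The lattice is $\Gamma=\{(h_1v+h_2w,\,hr):h_1,h_2,h\in\mathbb{Z}\}$ with $v=\left(\frac{rm_v}{w_2},0\right)$, $w=\left(\frac{rm_w}{w_2},w_2\right)$; the Heisenberg manifold with parameters $A,r,w_2>0$, $m_v\in\mathbb{Z}_{>0}$, $m_w\in\mathbb{Z}$ is $\Gamma\backslash G$. Spin structures correspond to homomorphisms $\varepsilon:\Gamma\to\{\pm1\}$, recorded by $\varepsilon_1=\varepsilon(v,0)$, $\varepsilon_2=\varepsilon(w,0)$, $\varepsilon_3=\varepsilon(0,0,r)$;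 the only constraint is $\varepsilon_3^{m_v}=1$. Spinors are functions $f:G\to\mathbb{C}^2$ with $f(\gamma x)=\varepsilon(\gamma)f(x)$, and with $E_1=\frac{X}{\sqrt A},E_2=\frac Y{\sqrt A},E_3=Z$ the Dirac operator is $D=\sum_{i=1}^3(E_i\diamond)\partial_{E_i}-\frac1{4A}$, where Clifford multiplication satisfies $v\diamond v\diamond=-|v|^2$ and $(E_3\diamond E_1\diamond E_2\diamond)=-\mathbf1$. The eta function is $\eta(s)=\sum_{\lambda\ne0}\mathrm{sgn}(\lambda)|\lambda|^{-s}$ (sum over eigenvalues of $D$ with multiplicity, large $\mathrm{Re}(s)$), extended meromorphically, and the eta invariant is $\eta(0)$. *)

(* Defs.v *)
(* Stdlib reals with Coquelicot's complex numbers, derivatives and series. *)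
From Stdlib Require Import Reals ZArith Lra Lia List.
From Coquelicot Require Import Coquelicot.
Open Scope R_scope.

Definition heis : Type := (R * R * R)%type.

Definition hmul (p q : heis) : heis :=
  let '(x, y, z) := p in
  let '(x', y', z') := q in
  (x + x', y + y', z + z' + x * y').

Record params := Params {
  par_A : R;
  par_r : R;
  par_w2 : R;
  par_mv : Z;
  par_mw : Z
}.

(* The element (h1 v + h2 w, h r) of the lattice. *)
Definition lattice_pt (P : params) (h1 h2 h : Z) : heis :=
  (IZR h1 * (par_r P * IZR (par_mv P) / par_w2 P)
     + IZR h2 * (par_r P * IZR (par_mw P) / par_w2 P),
   IZR h2 * par_w2 P,
   IZR h * par_r P).

Definition in_lattice (P : params) (g : heis) : Prop :=
  exists h1 h2 h : Z, g = lattice_pt P h1 h2 h.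

(* [chi] is a homomorphism to {1, -1} on the lattice; its values elsewhere
   are irrelevant. *)
Record spin_structure (P : params) (eps1 eps2 eps3 : R) (chi : heis -> R)
  : Prop := {
  spin_sign : forall g, in_lattice P g -> chi g = 1 \/ chi g = -1;
  spin_mul : forall g g', in_lattice P g -> in_lattice P g' ->
    chi (hmul g g') = chi g * chi g';
  spin_v : chi (lattice_pt P 1 0 0) = eps1;
  spin_w : chi (lattice_pt P 0 1 0) = eps2;
  spin_r : chi (lattice_pt P 0 0 1) = eps3
}.

Definition C2 : Type := (C * C)%type.

(* [e1], [e2], [e3] are the Clifford multiplications by the orthonormal frame
   E1, E2, E3. *)
Record clifford (e1 e2 e3 : C2 -> C2) : Prop := {
  clifford_linear : forall e, e = e1 \/ e = e2 \/ e = e3 ->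
    forall (a b : C) (u v : C2),
    e (plus (scal a u) (scal b v)) = plus (scal a (e u)) (scal b (e v));
  clifford_square : forall (v1 v2 v3 : R) (u : C2),
    let mul (u : C2) : C2 :=
      plus (plus (scal (RtoC v1) (e1 u)) (scal (RtoC v2) (e2 u)))
           (scal (RtoC v3) (e3 u)) in
    mul (mul u) = scal (RtoC (- (v1 ^ 2 + v2 ^ 2 + v3 ^ 2))) u;
  clifford_orientation : forall u : C2, e3 (e1 (e2 u)) = opp u
}.

Definition d_x (u : heis -> R) (p : heis) : R :=
  let '(x, y, z) := p in Derive (fun t => u (t, y, z)) x.
Definition d_y (u : heis -> R) (p : heis) : R :=
  let '(x, y, z) := p in Derive (fun t => u (x, t, z)) y.
Definition d_z (u : heis -> R) (p : heis) : R :=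
  let '(x, y, z) := p in Derive (fun t => u (x, y, t)) z.

Fixpoint Ck (n : nat) (u : heis -> R) : Prop :=
  (forall p, continuous u p) /\
  match n with
  | O => True
  | S m =>
      (forall x y z,
         ex_derive (fun t => u (t, y, z)) x /\
         ex_derive (fun t => u (x, t, z)) y /\
         ex_derive (fun t => u (x, y, t)) z) /\
      Ck m (d_x u) /\ Ck m (d_y u) /\ Ck m (d_z u)
  end.

Definition smooth (f : heis -> C2) : Prop :=
  forall n,
    Ck n (fun p => Re (fst (f p))) /\ Ck n (fun p => Im (fst (f p))) /\
    Ck n (fun p => Re (snd (f p))) /\ Ck n (fun p => Im (snd (f p))).

Definition Derive_C2 (u : R -> C2) (t : R) : C2 :=
  ((Derive (fun s => Re (fst (u s))) t, Derive (fun s => Im (fst (u s))) t),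
   (Derive (fun s => Re (snd (u s))) t, Derive (fun s => Im (snd (u s))) t)).

(* The left-invariant fields differentiate along right translation by the
   one-parameter subgroups of the three coordinate axes; in coordinates
   X = d/dx, Y = d/dy + x d/dz, Z = d/dz, so that [X, Y] = Z. *)
Definition field_X (f : heis -> C2) (p : heis) : C2 :=
  Derive_C2 (fun t => f (hmul p (t, 0, 0))) 0.
Definition field_Y (f : heis -> C2) (p : heis) : C2 :=
  Derive_C2 (fun t => f (hmul p (0, t, 0))) 0.
Definition field_Z (f : heis -> C2) (p : heis) : C2 :=
  Derive_C2 (fun t => f (hmul p (0, 0, t))) 0.

Definition spinor (P : params) (chi : heis -> R) (f : heis -> C2) : Prop :=
  smooth f /\
  forall g p, in_lattice P g -> f (hmul g p) = scal (RtoC (chi g)) (f p).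

(* Apart from one family of eigenvalues on its left, the spectrum is symmetric
   about this number. *)
Definition symmetry_point (P : params) : R := - (1 / (4 * par_A P)).

Definition dirac (P : params) (e1 e2 e3 : C2 -> C2) (f : heis -> C2)
  (p : heis) : C2 :=
  plus
    (plus (plus (e1 (scal (RtoC (1 / sqrt (par_A P))) (field_X f p)))
                (e2 (scal (RtoC (1 / sqrt (par_A P))) (field_Y f p))))
          (e3 (field_Z f p)))
    (scal (RtoC (symmetry_point P)) (f p)).

Definition eigenspinor (P : params) (chi : heis -> R) (e1 e2 e3 : C2 -> C2)
  (mu : R) (f : heis -> C2) : Prop :=
  spinor P chi f /\
  forall p, dirac P e1 e2 e3 f p = scal (RtoC mu) (f p).

(* The operator is symmetric, so all its eigenvalues are real. *)
Definition eigenvalue (P : params) (chi : heis -> R) (e1 e2 e3 : C2 -> C2)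
  (mu : R) : Prop :=
  exists f, eigenspinor P chi e1 e2 e3 mu f /\ exists p, f p <> zero.

(* The [mu]-eigenspace has complex dimension [n], witnessed by a basis
   b 1, ..., b n. *)
Definition multiplicity (P : params) (chi : heis -> R) (e1 e2 e3 : C2 -> C2)
  (mu : R) (n : nat) : Prop :=
  exists b : nat -> heis -> C2,
    (forall i, (1 <= i <= n)%nat -> eigenspinor P chi e1 e2 e3 mu (b i)) /\
    (forall c : nat -> C,
       (forall p, sum_n_m (fun i => scal (c i) (b i p)) 1 n = zero) ->
       forall i, (1 <= i <= n)%nat -> c i = 0%C) /\
    (forall f, eigenspinor P chi e1 e2 e3 mu f ->
       exists c : nat -> C,
         forall p, f p = sum_n_m (fun i => scal (c i) (b i p)) 1 n).

(* [lam] lists the nonzero eigenvalues, each one exactly as often as its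
   multiplicity. *)
Definition nonzero_spectrum (P : params) (chi : heis -> R)
  (e1 e2 e3 : C2 -> C2) (lam : nat -> R) : Prop :=
  (forall k, lam k <> 0) /\
  forall mu, mu <> 0 ->
    exists l : list nat,
      NoDup l /\ (forall k, In k l <-> lam k = mu) /\
      multiplicity P chi e1 e2 e3 mu (length l).

Definition Cexp (s : C) : C :=
  (exp (Re s) * cos (Im s), exp (Re s) * sin (Im s)).

(* sgn(mu) |mu|^(-s) *)
Definition eta_term (mu : R) (s : C) : C :=
  (RtoC (sign mu) * Cexp (- s * RtoC (ln (Rabs mu))))%C.

Definition holomorphic_at (F : C -> C) (p : C) : Prop :=
  exists d : R, 0 < d /\ forall s : C, Cmod (s - p)%C < d ->
    ex_derive (K := C_AbsRing) (V := C_NormedModule) F s.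

(* The value of [F] at the point [p] itself is irrelevant. *)
Definition meromorphic_at (F : C -> C) (p : C) : Prop :=
  exists (n : nat) (G : C -> C) (d : R),
    holomorphic_at G p /\ 0 < d /\
    forall s : C, s <> p -> Cmod (s - p)%C < d ->
      ((s - p) ^ n * F s)%C = G s.

(* [c] is eta(0): the eta series converges absolutely for large Re s, and its
   sum extends to a function [F], meromorphic on a half-plane around 0 and
   holomorphic at 0, with F 0 = c.  By the identity theorem [c] does not
   depend on the half-plane, on [F] or on the enumeration [lam]. *)
Definition eta_invariant (P : params) (chi : heis -> R)
  (e1 e2 e3 : C2 -> C2) (c : C) : Prop :=
  exists (lam : nat -> R) (F : C -> C) (s0 delta : R),
    nonzero_spectrum P chi e1 e2 e3 lam /\
    (forall s : C, s0 < Re s ->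
       ex_series (fun k => Cmod (eta_term (lam k) s)) /\
       is_series (K := C_AbsRing) (V := C_NormedModule)
         (fun k => eta_term (lam k) s) (F s)) /\
    0 < delta /\
    (forall p : C, - delta < Re p -> meromorphic_at F p) /\
    holomorphic_at F 0%C /\
    F 0%C = c.

Definition heis_family (b1 b2 : R) (mv mw : Z) (r : R) : params :=
  Params (b1 * r) r (b2 * sqrt r) mv mw.

Lemma clifford_exists : exists e1 e2 e3, clifford e1 e2 e3.
Proof.
exists (fun u => (Ci * snd u, Ci * fst u)%C).
exists (fun u => (snd u, - fst u)%C).
exists (fun u => (- Ci * fst u, Ci * snd u)%C).
split.
- intros e [-> | [-> | ->]] a b [[u1 u1'] [u2 u2']] [[v1 v1'] [v2 v2']];
    unfold plus, scal, mult; simpl; unfold prod_plus, prod_scal, plus, scal,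
    mult; simpl; unfold scal; simpl; unfold mult; simpl;
    f_equal; ring.
- intros v1 v2 v3 [[u1 u1'] [u2 u2']]; simpl.
  unfold plus, scal; simpl; unfold prod_plus, prod_scal, plus, scal; simpl.
  unfold mult; simpl; unfold Cplus, Cmult, Copp, Ci, RtoC; simpl.
  f_equal; f_equal; ring.
- intros [[u1 u1'] [u2 u2']]; simpl.
  unfold opp; simpl; unfold prod_opp, opp; simpl.
  unfold Cmult, Copp, Ci; simpl; f_equal; f_equal; ring.
Qed.

Definition sign_pow (eps : R) (n : Z) : R := if Z.even n then 1 else eps.

Lemma sign_pow_pm eps n : eps = 1 \/ eps = -1 ->
  sign_pow eps n = 1 \/ sign_pow eps n = -1.
Proof. unfold sign_pow; destruct (Z.even n); tauto. Qed.

Lemma sign_pow_add eps m n : eps = 1 \/ eps = -1 ->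
  sign_pow eps (m + n) = sign_pow eps m * sign_pow eps n.
Proof.
unfold sign_pow; rewrite Z.even_add.
intros [-> | ->]; destruct (Z.even m), (Z.even n); simpl; ring.
Qed.

Lemma Int_part_IZR (n : Z) : Int_part (IZR n) = n.
Proof. symmetry; apply Int_part_spec; lra. Qed.

Lemma spin_structure_exists (P : params) (eps1 eps2 eps3 : R) :
  0 < par_r P -> 0 < par_w2 P -> (0 < par_mv P)%Z ->
  eps1 = 1 \/ eps1 = -1 -> eps2 = 1 \/ eps2 = -1 -> eps3 = 1 \/ eps3 = -1 ->
  (Z.Odd (par_mv P) -> eps3 = 1) ->
  exists chi, spin_structure P eps1 eps2 eps3 chi.
Proof.
destruct P as [A r w mv mw]; simpl; intros hr hw hmv H1 H2 H3 Ho.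
set (k := fun a b c : Z => (c - mw * (b * (b - 1) / 2) - mv * (a * b))%Z).
set (F := fun a b c : Z =>
  sign_pow eps1 a * sign_pow eps2 b * sign_pow eps3 (k a b c)).
set (chi := fun p : heis =>
  let '(x, y, z) := p in
  let b := Int_part (y / w) in
  let a := Int_part ((x - IZR b * (r * IZR mw / w)) / (r * IZR mv / w)) in
  F a b (Int_part (z / r))).
pose (P := Params A r w mv mw).
assert (hv : 0 < IZR mv) by (apply IZR_lt; exact hmv).
assert (E : forall a b c, chi (lattice_pt P a b c) = F a b c).
{ intros a b c; unfold chi, lattice_pt; simpl.
  replace (IZR b * w / w) with (IZR b) by (field; lra).
  rewrite Int_part_IZR.
  replace (IZR c * r / r) with (IZR c) by (field; lra).
  rewrite Int_part_IZR.
  match goal with |- F (Int_part ?t) _ _ = _ =>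
    replace t with (IZR a) by (field; lra) end.
  now rewrite Int_part_IZR. }
assert (Hmv : forall n, sign_pow eps3 (mv * n) = 1).
{ intros n; unfold sign_pow; rewrite Z.even_mul.
  destruct (Z.even mv) eqn:Ev; [reflexivity | simpl].
  rewrite Ho; [now destruct (Z.even n) |].
  apply Z.odd_spec; now rewrite <- Z.negb_even, Ev. }
fold P; exists chi; split.
- intros g (a & b & c & ->); rewrite E; unfold F.
  destruct (sign_pow_pm eps1 a H1) as [-> | ->],
    (sign_pow_pm eps2 b H2) as [-> | ->],
    (sign_pow_pm eps3 (k a b c) H3) as [-> | ->]; lra.
- intros g g' (a & b & c & ->) (a' & b' & c' & ->).
  replace (hmul (lattice_pt P a b c) (lattice_pt P a' b' c')) with
    (lattice_pt P (a + a') (b + b') (c + c' + (mv * a + mw * b) * b')).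
  2:{ unfold hmul, lattice_pt; simpl; repeat rewrite ?plus_IZR, ?mult_IZR.
      f_equal; [f_equal; ring | field; lra]. }
  rewrite !E; unfold F.
  assert (K : k (a + a')%Z (b + b')%Z (c + c' + (mv * a + mw * b) * b')%Z
     = (k a b c + k a' b' c' + mv * (- (a' * b)))%Z).
  { unfold k.
    assert (D : ((b + b') * (b + b' - 1) / 2
       = b * (b - 1) / 2 + b' * (b' - 1) / 2 + b * b')%Z).
    { assert (Q : forall n, (n * (n - 1) = 2 * (n * (n - 1) / 2))%Z).
      { intros n; apply Z_div_exact_full_2; [lia |].
        rewrite Zmod_even, Z.even_mul, Z.even_sub; simpl.
        now destruct (Z.even n). }
      pose proof (Q b); pose proof (Q b'); pose proof (Q (b + b')%Z); nia. }
    rewrite D; ring. }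
  rewrite K. rewrite !sign_pow_add, Hmv by assumption; ring.
- rewrite E; unfold F, k, sign_pow; simpl.
  rewrite !Z.mul_0_r; simpl; ring.
- rewrite E; unfold F, k, sign_pow.
  replace (0 - mw * (1 * (1 - 1) / 2) - mv * (0 * 1))%Z with 0%Z
    by (simpl; rewrite !Z.mul_0_r; reflexivity).
  simpl; ring.
- rewrite E; unfold F, k, sign_pow.
  replace (1 - mw * (0 * (0 - 1) / 2) - mv * (0 * 0))%Z with 1%Z
    by (simpl; rewrite !Z.mul_0_r; reflexivity).
  simpl; ring.
Qed.

(* Main.v *)
(* The left action of the centre and of v splits a spinor into Fourier modes in z
   and x; the remaining action permutes these modes, so each is a function of one
   variable.  On a mode with nonzero central frequency the Dirac operator is built
   from the annihilation and creation operators of a harmonic oscillator, whose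
   ground states are theta series; the modes with zero central frequency give a
   flat torus.  The eigenvalues are -1/(4A) +- mu with both signs (excited and torus
   modes), and -1/(4A) - c for the ground states of central frequency +- c (c > 0).
   With A = b1 r and w2 = b2 sqrt r they are 1/r times those at r = 1, so that
   eta_r(s) = r^s eta_1(s) and eta_r(0) = eta_1(0).  For the continuation, expanding
   in -1/(4A) around each pair reduces eta_1 to Hurwitz and Epstein sums, continued
   by the Euler-Maclaurin formula and by differences of the Epstein sum along the
   lattice.  The spectra differ because the nonzero eigenvalues are bounded away
   from 0, so the spectrum is not invariant under a dilation. *)
Require Import Defs.
From Stdlib Require Import Reals ZArith Lra Lia List Psatz Permutation Cantor.
From Stdlib Require Import Classical ClassicalEpsilon FunctionalExtensionality.
From Coquelicot Require Import Coquelicot.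
Open Scope R_scope.

(** * Unordered sums *)

(* A pair of eigenvalues $-a\pm\mu$ with $a=1/(4A)$ contributes $(\mu-a)^{-s}-(\mu+a)^{-s}$, which
   is odd in $a$. Keeping two terms leaves a remainder of order $\mu^{-s-5}$. The series in
   $\mu^{-e}$ are controlled for $e>4$, so the remainders sum to a function holomorphic for
   $\mathrm{Re}\,s>-1$. The kept terms carry the factors $s$ and $s(s+1)(s+2)$; these cancel the
   denominators that the continued zeta functions could bring to $0$, which makes eta regular there.

   Every summand lies in a small class of entire functions closed under differentiation, and
   Cauchy's estimate for that class turns majorants into holomorphic sums.

   Completeness of the modes is the other obstacle. Each listed eigenspinor is paired with a linear
   functional (a Fourier transform, after lowering to the ground level), and the functionals are
   dual to the list. An eigenspinor killed by all of them vanishes mode by mode: a bounded solution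
   of $T''=(\text{positive})\,T$ has convex $|T|^2$, hence is $0$, and the lower levels follow by
   descending the ladder. Multiplicities then become counts of indices. *)
Tactic Notation "funext" simple_intropattern(x) :=
  apply functional_extensionality; intros x.

Ltac Ctri := eapply Rle_trans; [apply Cmod_triangle|].

Ltac pos := repeat first [lra | apply Rmult_lt_0_compat | apply Rdiv_lt_0_compat | apply Rinv_0_lt_compat
  | apply Rmult_le_pos | apply Rplus_le_le_0_compat | apply exp_pos | apply pow_lt | apply pow2_ge_0
  | apply Cmod_ge_0 | apply Rabs_pos | apply pos_INR | apply Rlt_le].

Ltac fin := solve [auto | lra | lia | ring | reflexivity | field; lra | pos | nra | f_equal; (ring || lra)].

Lemma Cmod_diag (a : C) : Cmod (a - a)%C = 0.
Proof. replace (a - a)%C with (RtoC 0) by ring. apply Cmod_0. Qed.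

Definition lsum {I : Type} (g : I -> C) (l : list I) : C :=
  fold_right (fun i s => (g i + s)%C) 0%C l.

Definition rsum {I : Type} (a : I -> R) (l : list I) : R :=
  fold_right (fun i s => a i + s) 0 l.

Definition rbounded {I : Type} (a : I -> R) (M : R) : Prop :=
  forall l, NoDup l -> rsum a l <= M.

Definition rsummable {I : Type} (a : I -> R) : Prop :=
  (forall i, 0 <= a i) /\ exists M, rbounded a M.

Definition csummable {I : Type} (g : I -> C) : Prop :=
  rsummable (fun i => Cmod (g i)).

(** Convergence along the net of finite subsets, coded as duplicate-free lists. Order plays no part
    in it, so sums over pairs, integers or [Idx] can be reindexed along any injection whose image
    carries the family. *)
Definition has_sum {I : Type} (g : I -> C) (S : C) : Prop :=
  forall eps, 0 < eps -> exists l0, NoDup l0 /\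
    forall l, NoDup l -> incl l0 l -> Cmod (lsum g l - S) < eps.

(** An arbitrary complex number when [g] has no sum; the value has meaning only beside a [csummable]
    or [has_sum] fact. *)
Definition CSum {I : Type} (g : I -> C) : C :=
  epsilon (inhabits (RtoC 0) : inhabited C) (has_sum g).

Definition dec {I : Type} (x y : I) : {x = y} + {x <> y} :=
  excluded_middle_informative (x = y).

Lemma lsum_app {I} (g : I -> C) l l' : lsum g (l ++ l') = (lsum g l + lsum g l')%C.
Proof. induction l as [|i l IH]; simpl; [fin | rewrite IH; fin]. Qed.

Lemma rsum_app {I} (a : I -> R) l l' : rsum a (l ++ l') = rsum a l + rsum a l'.
Proof. induction l as [|i l IH]; simpl; lra. Qed.

Lemma lsum_perm {I} (g : I -> C) l l' : Permutation l l' -> lsum g l = lsum g l'.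
Proof. induction 1; simpl; try congruence; fin. Qed.

Lemma rsum_perm {I} (a : I -> R) l l' : Permutation l l' -> rsum a l = rsum a l'.
Proof. induction 1; simpl; lra. Qed.

Lemma lsum_ext_in {I} (g h : I -> C) l :
  (forall i, In i l -> g i = h i) -> lsum g l = lsum h l.
Proof.
induction l as [|i l IH]; simpl; intros H; auto.
rewrite H, IH; fin.
Qed.

Lemma rsum_le_in {I} (a b : I -> R) l :
  (forall i, In i l -> a i <= b i) -> rsum a l <= rsum b l.
Proof.
induction l as [|i l IH]; simpl; intros H; [lra|].
apply Rplus_le_compat; fin.
Qed.

Lemma rsum_nonneg {I} (a : I -> R) l : (forall i, 0 <= a i) -> 0 <= rsum a l.
Proof. intros H; induction l as [|i l IH]; simpl; [lra|]. specialize (H i); lra. Qed.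

Lemma lsum_plus {I} (g h : I -> C) l :
  lsum (fun i => (g i + h i)%C) l = (lsum g l + lsum h l)%C.
Proof. induction l as [|i l IH]; simpl; [fin | rewrite IH; fin]. Qed.

Lemma lsum_scal {I} (c : C) (g : I -> C) l :
  lsum (fun i => (c * g i)%C) l = (c * lsum g l)%C.
Proof. induction l as [|i l IH]; simpl; [fin | rewrite IH; fin]. Qed.

Lemma rsum_scal {I} (c : R) (a : I -> R) l :
  rsum (fun i => c * a i) l = c * rsum a l.
Proof. induction l as [|i l IH]; simpl; lra. Qed.

Lemma rsum_plus {I} (a b : I -> R) l :
  rsum (fun i => a i + b i) l = rsum a l + rsum b l.
Proof. induction l as [|i l IH]; simpl; lra. Qed.

Lemma lsum_RtoC {I} (a : I -> R) l : lsum (fun i => RtoC (a i)) l = RtoC (rsum a l).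
Proof. induction l as [|i l IH]; simpl; [fin | rewrite IH, RtoC_plus; fin]. Qed.

Lemma Cmod_lsum {I} (g : I -> C) l : Cmod (lsum g l) <= rsum (fun i => Cmod (g i)) l.
Proof.
induction l as [|i l IH]; simpl; [rewrite Cmod_0; lra|].
Ctri; lra.
Qed.

Lemma NoDup_incl_split {I} (l0 l : list I) : NoDup l0 -> NoDup l -> incl l0 l ->
  exists l', Permutation l (l0 ++ l') /\ NoDup l' /\ forall i, In i l' -> ~ In i l0.
Proof.
revert l; induction l0 as [|i l0 IH]; intros l H0 Hl Hi.
- exists l; fin.
- inversion H0.
  destruct (in_split i l (Hi i (or_introl eq_refl))) as (u & v & ->).
  assert (Hn : NoDup (u ++ v)) by (eapply NoDup_remove_1; eauto).
  assert (Hni : ~ In i (u ++ v)) by (eapply NoDup_remove_2; fin).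
  destruct (IH (u ++ v)) as (l' & P & N & D); auto.
  + intros j Hj. pose proof (Hi j (or_intror Hj)) as K.
    apply in_app_or in K. apply in_or_app.
    destruct K as [K | [K | K]]; auto. subst; tauto.
  + exists l'; split; [|split; auto].
    * rewrite <- Permutation_middle. now constructor.
    * intros j Hj [-> | K]; [|now apply (D j)].
      apply Hni, (Permutation_in j (Permutation_sym P)).
      apply in_or_app; fin.
Qed.

Lemma rsum_incl {I} (a : I -> R) l0 l : (forall i, 0 <= a i) ->
  NoDup l0 -> NoDup l -> incl l0 l -> rsum a l0 <= rsum a l.
Proof.
intros Ha H0 Hl Hi; destruct (NoDup_incl_split l0 l H0 Hl Hi) as (l' & P & _ & _).
rewrite (rsum_perm a l _ P), rsum_app.
pose proof (rsum_nonneg a l' Ha); lra.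
Qed.

Lemma nodup_union {I} (l l' : list I) :
  exists m, NoDup m /\ incl l m /\ incl l' m /\ forall i, In i m -> In i l \/ In i l'.
Proof.
exists (nodup dec (l ++ l')); split; [apply NoDup_nodup|].
repeat split; intros i Hi.
- apply nodup_In, in_or_app; fin.
- apply nodup_In, in_or_app; fin.
- apply nodup_In, in_app_or in Hi; fin.
Qed.

Lemma rsummable_lub {I} (a : I -> R) : rsummable a ->
  exists S, rbounded a S /\
    forall eps, 0 < eps -> exists l0, NoDup l0 /\ S - eps < rsum a l0.
Proof.
intros [Ha [M HM]].
destruct (completeness (fun x => exists l, NoDup l /\ x = rsum a l)) as [S [H1 H2]].
- exists M; intros x (l & Hl & ->); fin.
- exists 0, nil; split; [constructor | fin].
- exists S; split.
  + intros l Hl; apply H1; exists l; fin.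
  + intros eps He; apply NNPP; intros Hn.
    assert (S <= S - eps); [|lra].
    apply H2; intros x (l & Hl & ->).
    apply Rnot_lt_le; intros K; apply Hn; exists l; fin.
Qed.

Lemma rsummable_tail {I} (a : I -> R) : rsummable a -> forall eps, 0 < eps ->
  exists l0, NoDup l0 /\
    forall l, NoDup l -> (forall i, In i l -> ~ In i l0) -> rsum a l < eps.
Proof.
intros Hs eps He; destruct (rsummable_lub a Hs) as (S & HS & Hl).
destruct (Hl eps He) as (l0 & N0 & H0).
exists l0; split; auto; intros l Nl D.
assert (K : rsum a (l0 ++ l) <= S) by (apply HS, NoDup_app; auto; intros i h1 h2; exact (D i h2 h1)).
rewrite rsum_app in K; lra.
Qed.

Lemma has_sum_nonneg {I} (a : I -> R) : rsummable a ->
  exists S, has_sum (fun i => RtoC (a i)) S.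
Proof.
intros Hs; destruct (rsummable_lub a Hs) as (S & HS & Hl).
exists (RtoC S); intros eps He; destruct (Hl eps He) as (l0 & N0 & H0).
exists l0; split; auto; intros l Nl Hi.
rewrite lsum_RtoC, <- RtoC_minus, Cmod_R.
assert (rsum a l0 <= rsum a l) by (apply rsum_incl; auto; apply Hs).
pose proof (HS l Nl). apply Rabs_def1; lra.
Qed.

Lemma has_sum_ext {I} (g h : I -> C) S :
  (forall i, g i = h i) -> has_sum g S -> has_sum h S.
Proof. intros E; replace h with g; auto; now apply functional_extensionality. Qed.

Lemma has_sum_val {I} (g : I -> C) S T : has_sum g S -> S = T -> has_sum g T.
Proof. now intros H <-. Qed.

Lemma has_sum_plus {I} (g h : I -> C) S T :
  has_sum g S -> has_sum h T -> has_sum (fun i => (g i + h i)%C) (S + T)%C.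
Proof.
intros Hg Hh eps He.
destruct (Hg (eps / 2)) as (l1 & N1 & H1); [lra|].
destruct (Hh (eps / 2)) as (l2 & N2 & H2); [lra|].
destruct (nodup_union l1 l2) as (m & Nm & I1 & I2 & _).
exists m; split; auto; intros l Nl Hi.
rewrite lsum_plus.
replace (lsum g l + lsum h l - (S + T))%C
  with ((lsum g l - S) + (lsum h l - T))%C by ring.
eapply Rle_lt_trans; [apply Cmod_triangle|].
assert (Cmod (lsum g l - S) < eps / 2) by (apply H1; auto; eapply incl_tran; eauto).
assert (Cmod (lsum h l - T) < eps / 2) by (apply H2; auto; eapply incl_tran; eauto).
lra.
Qed.

Lemma has_sum_scal {I} (c : C) (g : I -> C) S :
  has_sum g S -> has_sum (fun i => (c * g i)%C) (c * S)%C.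
Proof.
intros Hg eps He.
pose proof (Cmod_ge_0 c).
destruct (Hg (eps / (Cmod c + 1))) as (l1 & N1 & H1); [pos|].
exists l1; split; auto; intros l Nl Hi.
rewrite lsum_scal. replace (c * lsum g l - c * S)%C with (c * (lsum g l - S))%C by ring.
rewrite Cmod_mult.
pose proof (H1 l Nl Hi) as K. pose proof (Cmod_ge_0 (lsum g l - S)%C).
replace eps with ((Cmod c + 1) * (eps / (Cmod c + 1))) by fin.
nra.
Qed.

Lemma has_sum_unique {I} (g : I -> C) S T : has_sum g S -> has_sum g T -> S = T.
Proof.
intros HS HT.
assert (K : Cmod (S - T)%C = 0).
{ apply Rle_antisym; [|pos].
  apply Rnot_lt_le; intros K. set (e := Cmod (S - T)%C) in *.
  destruct (HS (e / 2)) as (l1 & N1 & H1); [lra|].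
  destruct (HT (e / 2)) as (l2 & N2 & H2); [lra|].
  destruct (nodup_union l1 l2) as (m & Nm & I1 & I2 & _).
  pose proof (H1 m Nm I1) as A. pose proof (H2 m Nm I2) as B.
  assert (e <= Cmod (lsum g m - S)%C + Cmod (lsum g m - T)%C); [|lra].
  unfold e. replace (S - T)%C with (- (lsum g m - S) + (lsum g m - T))%C by ring.
  Ctri. rewrite Cmod_opp; lra. }
apply Cmod_eq_0 in K. replace S with ((S - T) + T)%C by ring. rewrite K; fin.
Qed.

Lemma rsummable_le {I} (a b : I -> R) :
  (forall i, 0 <= a i <= b i) -> rsummable b -> rsummable a.
Proof.
intros H [Hb [M HM]]; split; [apply H|].
exists M; intros l Nl; eapply Rle_trans; [|apply (HM l Nl)].
apply rsum_le_in; intros; apply H.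
Qed.

Lemma rsummable_scal {I} (c : R) (a : I -> R) : 0 <= c -> rsummable a ->
  rsummable (fun i => c * a i).
Proof.
intros Hc [Ha [M HM]]; split.
- intros i; apply Rmult_le_pos; fin.
- exists (c * M); intros l Nl; rewrite rsum_scal; apply Rmult_le_compat_l; fin.
Qed.

Lemma rsummable_plus {I} (a b : I -> R) : rsummable a -> rsummable b ->
  rsummable (fun i => a i + b i).
Proof.
intros [Ha [M HM]] [Hb [M' HM']]; split.
- intros i; specialize (Ha i); specialize (Hb i); lra.
- exists (M + M'); intros l Nl; rewrite rsum_plus; apply Rplus_le_compat; fin.
Qed.

Lemma csummable_le {I} (g : I -> C) (b : I -> R) :
  (forall i, Cmod (g i) <= b i) -> rsummable b -> csummable g.
Proof. intros H Hb; eapply rsummable_le; [|exact Hb]; split; fin. Qed.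

Lemma csummable_plus {I} (g h : I -> C) : csummable g -> csummable h ->
  csummable (fun i => (g i + h i)%C).
Proof.
intros Hg Hh; apply csummable_le with (fun i => Cmod (g i) + Cmod (h i)).
- intros; apply Cmod_triangle.
- now apply rsummable_plus.
Qed.

Lemma csummable_scal {I} (c : C) (g : I -> C) : csummable g ->
  csummable (fun i => (c * g i)%C).
Proof.
intros Hg; apply csummable_le with (fun i => Cmod c * Cmod (g i)).
- intros; rewrite Cmod_mult; lra.
- apply rsummable_scal; fin.
Qed.

(** For a real part [u] of the family, [Cmod + u] and [Cmod] are nonnegative summable families,
    whose sums exist as suprema. Their difference sums [u]; real and imaginary parts are then
    recombined. *)
Lemma csummable_has_sum {I} (g : I -> C) : csummable g -> has_sum g (CSum g).
Proof.
intros Hg; unfold CSum; apply epsilon_spec.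
assert (P : forall u : C -> R, (forall z, Rabs (u z) <= Cmod z) ->
  exists S, has_sum (fun i => RtoC (u (g i))) S).
{ intros u Hu.
  destruct (has_sum_nonneg (fun i => Cmod (g i) + u (g i))) as [S1 H1].
  { apply rsummable_le with (fun i => 2 * Cmod (g i)).
    - intros i; pose proof (Hu (g i)) as K; apply Rabs_le_between in K; lra.
    - apply rsummable_scal; fin. }
  destruct (has_sum_nonneg (fun i => Cmod (g i))) as [S2 H2]; auto.
  exists (S1 + (-1) * S2)%C.
  eapply has_sum_ext; [|apply has_sum_plus; [exact H1 | apply has_sum_scal; exact H2]].
  intros i; cbv beta. rewrite RtoC_plus; fin. }
destruct (P Re) as [S1 H1]; [apply re_le_Cmod|].
destruct (P Im) as [S2 H2].
{ intros z; eapply Rle_trans; [|apply Rmax_Cmod]; apply Rmax_r. }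
exists (Cplus S1 (Cmult Ci S2)).
eapply has_sum_ext; [|apply has_sum_plus; [exact H1 | apply has_sum_scal; exact H2]].
intros i; cbv beta. destruct (g i) as [x y].
unfold Cplus; simpl; fin.
Qed.

Lemma has_sum_bound {I} (g : I -> C) S M :
  has_sum g S -> rbounded (fun i => Cmod (g i)) M -> Cmod S <= M.
Proof.
intros H HM; apply Rnot_lt_le; intros K.
destruct (H (Cmod S - M)) as (l & Nl & Hl); [lra|].
specialize (Hl l Nl (incl_refl l)).
assert (Cmod S <= Cmod (lsum g l) + Cmod (lsum g l - S)%C) by (replace S with (lsum g l + - (lsum g l - S))%C at 1 by ring; Ctri; rewrite Cmod_opp; lra).
pose proof (Cmod_lsum g l). pose proof (HM l Nl). lra.
Qed.

(** The list [l0] depends on the majorant [a] alone. This uniformity in [g] is what later permits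
    integrating a series term by term. *)
Lemma csummable_tail_uniform {I} (a : I -> R) : rsummable a -> forall eps, 0 < eps ->
  exists l0, NoDup l0 /\ forall g, (forall i, Cmod (g i) <= a i) ->
    forall l, NoDup l -> incl l0 l -> Cmod (lsum g l - CSum g) <= eps.
Proof.
intros Ha eps He.
destruct (rsummable_tail a Ha eps He) as (l0 & N0 & H0).
exists l0; split; auto; intros g Hg l Nl Hl.
assert (Hc : csummable g) by (eapply csummable_le; fin).
apply Rnot_lt_le; intros K.
destruct (csummable_has_sum g Hc (Cmod (lsum g l - CSum g)%C - eps)) as (l1 & N1 & H1); [lra|].
destruct (nodup_union l l1) as (m & Nm & I1 & I2 & _),
(NoDup_incl_split l m Nl Nm I1) as (l' & P & N' & D).
specialize (H1 m Nm I2).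
assert (E : lsum g m = (lsum g l + lsum g l')%C) by (rewrite (lsum_perm g _ _ P), lsum_app; fin).
assert (Cmod (lsum g l') < eps).
{ eapply Rle_lt_trans; [apply Cmod_lsum|].
  eapply Rle_lt_trans; [apply rsum_le_in; fin|].
  apply H0; auto. intros i Hi Hi0; apply (D i Hi); fin. }
assert (Cmod (lsum g l - CSum g)%C <= Cmod (lsum g m - CSum g)%C + Cmod (lsum g l')) by (replace (lsum g l - CSum g)%C with ((lsum g m - CSum g) + - lsum g l')%C by (rewrite E; fin); Ctri; rewrite Cmod_opp; lra).
lra.
Qed.

Lemma csummable_tail {I} (g : I -> C) (a : I -> R) :
  (forall i, Cmod (g i) <= a i) -> rsummable a -> forall eps, 0 < eps ->
  exists l0, NoDup l0 /\ forall l, NoDup l -> incl l0 l -> Cmod (lsum g l - CSum g) <= eps.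
Proof.
intros Hg Ha eps He. destruct (csummable_tail_uniform a Ha eps He) as (l0 & N0 & H0).
eauto.
Qed.

Lemma CSum_unique {I} (g : I -> C) S : has_sum g S -> CSum g = S.
Proof.
intros H; apply (has_sum_unique g); auto.
unfold CSum; apply epsilon_spec; eauto.
Qed.

(** * Change of index and double sums *)

(** Finite form of a change of index: a finite subset of [I] is pulled back along the injection, and
    a family that vanishes off the image loses nothing in the sum. *)
Lemma preimage_list {I J} (f : J -> I) (Hf : forall x y, f x = f y -> x = y) (l : list I) :
  NoDup l -> exists m, NoDup m /\ (forall j, In j m <-> In (f j) l) /\
    (forall g : I -> C, (forall i, (forall j, f j <> i) -> g i = 0%C) ->
        lsum (fun j => g (f j)) m = lsum g l) /\
    (forall a : I -> R, (forall i, (forall j, f j <> i) -> a i = 0) ->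
        rsum (fun j => a (f j)) m = rsum a l).
Proof.
induction l as [|i l IH]; intros N.
- exists nil; split; [constructor|]; split; fin.
- inversion N. destruct IH as (m & Nm & Em & Gm & Am); auto.
  destruct (classic (exists j, f j = i)) as [[j <-] | Hn].
  + exists (j :: m); split; [constructor; auto; rewrite Em; fin|].
    split; [|split].
    * intros j'; simpl; rewrite Em; split; intros [K | K]; subst; fin.
    * intros g Hg; simpl; rewrite Gm; fin.
    * intros a Ha; simpl; rewrite Am; fin.
  + exists m; split; auto. split; [|split].
    * intros j'; simpl; rewrite Em; split; auto. intros [K | K]; auto.
      exfalso; eauto.
    * intros g Hg; simpl. rewrite (Hg i), Gm; auto; [fin|]. eauto.
    * intros a Ha; simpl. rewrite (Ha i), Am; auto; [lra|]. eauto.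
Qed.

Lemma has_sum_reindex {I J} (f : J -> I) (g : I -> C) S :
  (forall x y, f x = f y -> x = y) -> (forall i, (forall j, f j <> i) -> g i = 0%C) ->
  has_sum (fun j => g (f j)) S -> has_sum g S.
Proof.
intros Hf Hg HS eps He; destruct (HS eps He) as (m0 & N0 & H0).
exists (map f m0); split.
- apply FinFun.Injective_map_NoDup; fin.
- intros l Nl Hi. destruct (preimage_list f Hf l Nl) as (m & Nm & Em & Gm & _).
  rewrite <- Gm by auto. apply H0; auto.
  intros j Hj; apply Em, Hi, in_map, Hj.
Qed.

Lemma rsum_map {I J} (f : J -> I) (a : I -> R) m :
  rsum a (map f m) = rsum (fun j => a (f j)) m.
Proof. induction m as [|j m IH]; simpl; lra. Qed.

Lemma lsum_map {I J} (f : J -> I) (g : I -> C) m :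
  lsum g (map f m) = lsum (fun j => g (f j)) m.
Proof. induction m as [|j m IH]; simpl; [fin | rewrite IH; fin]. Qed.

Lemma rsummable_comp {I J} (f : J -> I) (a : I -> R) :
  (forall x y, f x = f y -> x = y) -> rsummable a -> rsummable (fun j => a (f j)).
Proof.
intros Hf [Ha [M HM]]; split; auto; exists M; intros m Nm.
rewrite <- rsum_map; apply HM, FinFun.Injective_map_NoDup; fin.
Qed.

Lemma rsummable_reindex {I J} (f : J -> I) (a : I -> R) :
  (forall x y, f x = f y -> x = y) -> (forall i, (forall j, f j <> i) -> a i = 0) ->
  rsummable (fun j => a (f j)) -> rsummable a.
Proof.
intros Hf Hz [Ha [M HM]]; split.
- intros i; destruct (classic (exists j, f j = i)) as [[j <-] | Hn]; auto.
  rewrite Hz; [lra|]. eauto.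
- exists M; intros l Nl. destruct (preimage_list f Hf l Nl) as (m & Nm & _ & _ & Am).
  rewrite <- Am; fin.
Qed.

Lemma has_sum_comp {I J} (f : J -> I) (g : I -> C) :
  (forall x y, f x = f y -> x = y) -> (forall i, (forall j, f j <> i) -> g i = 0%C) ->
  csummable g -> has_sum (fun j => g (f j)) (CSum g).
Proof.
intros Hf Hz Hg.
assert (K : has_sum (fun j => g (f j)) (CSum (fun j => g (f j)))) by (apply csummable_has_sum; apply (rsummable_comp f (fun i => Cmod (g i))); fin).
replace (CSum g) with (CSum (fun j => g (f j))); auto.
symmetry; apply CSum_unique, (has_sum_reindex f); fin.
Qed.

Lemma has_sum_zero {I} : has_sum (fun _ : I => 0%C) 0%C.
Proof.
exists nil; split; [constructor|]; intros l _ _.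
replace (lsum (fun _ : I => 0%C) l) with (RtoC 0).
- rewrite Cmod_diag; lra.
- induction l; simpl; auto. rewrite <- IHl; fin.
Qed.

Lemma has_sum_finite {I} (g : I -> C) l :
  NoDup l -> (forall i, ~ In i l -> g i = 0%C) -> has_sum g (lsum g l).
Proof.
intros Nl Hz eps He; exists l; split; auto; intros m Nm Hi.
destruct (NoDup_incl_split l m Nl Nm Hi) as (l' & P & N' & D).
rewrite (lsum_perm g _ _ P), lsum_app.
replace (lsum g l') with (RtoC 0).
- replace (lsum g l + 0 - lsum g l)%C with (RtoC 0) by ring. rewrite Cmod_0; lra.
- symmetry. rewrite (lsum_ext_in g (fun _ => 0%C)).
  + clear; induction l'; simpl; auto. rewrite IHl'; fin.
  + fin.
Qed.

Lemma has_sum_sum {I J} (g : I + J -> C) S T :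
  has_sum (fun i => g (inl i)) S -> has_sum (fun j => g (inr j)) T -> has_sum g (S + T)%C.
Proof.
intros H1 H2.
apply has_sum_ext with (fun x =>
  (match x with inl i => g (inl i) | inr _ => 0%C end
   + match x with inl i => 0%C | inr j => g (inr j) end)%C).
- intros [i | j]; fin.
- apply has_sum_plus.
  + apply (has_sum_reindex (@inl I J)); auto; [congruence|].
    intros [i | j] K; auto. now destruct (K i).
  + apply (has_sum_reindex (@inr I J)); auto; [congruence|].
    intros [i | j] K; auto. now destruct (K j).
Qed.

Lemma rsummable_sum {I J} (a : I + J -> R) :
  rsummable (fun i => a (inl i)) -> rsummable (fun j => a (inr j)) -> rsummable a.
Proof.
intros H1 H2.
apply rsummable_le with (fun x =>
  match x with inl i => a (inl i) | inr _ => 0 end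
   + match x with inl i => 0 | inr j => a (inr j) end).
- intros [i | j]; split; try lra; [apply H1 | apply H2].
- apply rsummable_plus.
  + apply (rsummable_reindex (@inl I J)); auto; [congruence|].
    intros [i | j] K; auto. now destruct (K i).
  + apply (rsummable_reindex (@inr I J)); auto; [congruence|].
    intros [i | j] K; auto. now destruct (K j).
Qed.

(** Tonelli for finite lists: entries are grouped by first coordinate, and induction on the list [L]
    of those coordinates strips off one row at a time, each bounded by its own [B i]. *)
Lemma rbounded_pair {I J} (a : I * J -> R) (B : I -> R) M :
  (forall p, 0 <= a p) -> (forall i, rbounded (fun j => a (i, j)) (B i)) ->
  rbounded B M -> rbounded a M.
Proof.
intros Ha HB HM l Nl.
assert (K : forall L l, NoDup L -> NoDup l -> (forall p, In p l -> In (fst p) L) ->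
   rsum a l <= rsum B L).
{ induction L as [|i L IH]; intros m NL Nm Hm.
  - destruct m as [|p m]; simpl; [lra|]. destruct (Hm p); simpl; fin.
  - inversion NL.
    destruct (preimage_list (fun j : J => (i, j))) with (l := m) as (n & Nn & En & _ & _);
      [congruence | fin |].
    assert (Nin : NoDup (map (fun j => (i, j)) n))
      by (apply FinFun.Injective_map_NoDup; congruence).
    destruct (NoDup_incl_split (map (fun j => (i, j)) n) m) as (l' & P & N' & D); auto.
    { intros p Hp; apply in_map_iff in Hp; destruct Hp as (j & <- & Hj); now apply En. }
    rewrite (rsum_perm a _ _ P), rsum_app, rsum_map.
    apply Rplus_le_compat; [apply (HB i); fin|].
    apply IH; auto. intros [i' j'] Hp.
    assert (Hpm : In (i', j') m)
      by (apply (Permutation_in _ (Permutation_sym P)), in_or_app; fin).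
    destruct (Hm _ Hpm) as [K | K]; auto. simpl in K; subst i'.
    exfalso; apply (D _ Hp). apply (in_map (fun j => (i, j))), En, Hpm. }
eapply Rle_trans; [|apply (HM (nodup dec (map fst l)) (NoDup_nodup _ _))].
apply K; auto; [apply NoDup_nodup|].
intros p Hp; now apply nodup_In, in_map.
Qed.

Lemma rsummable_pair {I J} (a : I * J -> R) (B : I -> R) :
  (forall p, 0 <= a p) -> (forall i, rbounded (fun j => a (i, j)) (B i)) ->
  rsummable B -> rsummable a.
Proof. intros Ha HB [_ [M HM]]; split; auto; exists M; eapply rbounded_pair; fin. Qed.

Lemma rsummable_prod {I J} (a : I -> R) (b : J -> R) : rsummable a -> rsummable b ->
  rsummable (fun p : I * J => a (fst p) * b (snd p)).
Proof.
intros Ha [Hb [M HM]].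
apply rsummable_pair with (fun i => M * a i).
- intros p; apply Rmult_le_pos; [apply Ha | fin].
- intros i l Nl; simpl. rewrite rsum_scal, Rmult_comm.
  apply Rmult_le_compat_r; [apply Ha | fin].
- apply rsummable_scal; auto. apply (HM nil); constructor.
Qed.

(** The finite approximation behind Fubini. Each row in [L] is replaced by finitely many of its
    entries with error at most [eta], and the entries of [l0] in those rows are included, so that
    [l] contains [l0] once [L] covers its rows. *)
Lemma rows_approx {I J} (g : I * J -> C) (l0 : list (I * J)) (eta : R) (L : list I) :
  csummable g -> 0 < eta -> NoDup L ->
  exists l, NoDup l /\ (forall p, In p l -> In (fst p) L) /\
    (forall p, In p l0 -> In (fst p) L -> In p l) /\
    Cmod (lsum g l - lsum (fun i => CSum (fun j => g (i, j))) L) <= eta * INR (length L) /\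
    rsum (fun i => Cmod (CSum (fun j => g (i, j)))) L
      <= rsum (fun p => Cmod (g p)) l + eta * INR (length L).
Proof.
intros Hg Heta; induction L as [|i L IH]; intros NL.
- exists nil; split; [constructor|]. split; auto. split; auto. simpl.
  rewrite Cmod_diag; lra.
- inversion NL; subst. destruct IH as (l & Nl & Fl & Cl & Bl & Ml); auto.
  assert (Hr : has_sum (fun j => g (i, j)) (CSum (fun j => g (i, j)))) by (apply csummable_has_sum; apply (rsummable_comp (fun j => (i, j)) (fun p => Cmod (g p))); auto; congruence).
  destruct (Hr eta Heta) as (m1 & N1 & H1''),
  (nodup_union m1 (map snd l0)) as (m & Nm & I1 & I2 & _).
  specialize (H1'' m Nm I1). set (c := CSum (fun j => g (i, j))) in *.
  exists (map (fun j => (i, j)) m ++ l). split; [|split; [|split; [|split]]].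
  + apply NoDup_app; auto.
    * apply FinFun.Injective_map_NoDup; auto. congruence.
    * intros p Hp Hpl. apply in_map_iff in Hp; destruct Hp as (j & <- & Hj).
      apply Fl in Hpl; fin.
  + intros p Hp; apply in_app_or in Hp; destruct Hp as [Hp | Hp]; [|right; fin].
    apply in_map_iff in Hp; destruct Hp as (j & <- & Hj); left; fin.
  + intros [i' j'] Hp [K | K]; apply in_or_app; [left | fin].
    simpl in K; subst i'. apply (in_map (fun j => (i, j))), I2.
    apply (in_map snd) in Hp; fin.
  + rewrite lsum_app, lsum_map.
    change (length (i :: L)) with (S (length L)); rewrite S_INR; simpl.
    fold c. match goal with |- Cmod ?z <= _ => replace z with
     ((lsum (fun j => g (i, j)) m - c)
       + (lsum g l - lsum (fun i => CSum (fun j => g (i, j))) L))%C by ring end.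
    Ctri. lra.
  + rewrite rsum_app, rsum_map.
    change (length (i :: L)) with (S (length L)); rewrite S_INR; simpl. fold c.
    assert (Cmod c <= rsum (fun j => Cmod (g (i, j))) m + eta); [|lra].
    replace c with (lsum (fun j => g (i, j)) m + - (lsum (fun j => g (i, j)) m - c))%C at 1 by ring.
    Ctri. rewrite Cmod_opp.
    pose proof (Cmod_lsum (fun j => g (i, j)) m). lra.
Qed.

Lemma has_sum_rows {I J} (g : I * J -> C) : csummable g ->
  has_sum (fun i => CSum (fun j => g (i, j))) (CSum g).
Proof.
intros Hg eps He.
destruct (csummable_has_sum g Hg (eps / 2)) as (l0 & N0 & H0); [lra|].
exists (nodup dec (map fst l0)); split; [apply NoDup_nodup|].
intros L NL HL. pose proof (pos_INR (length L)).
(* The error per row is divided by the number of rows plus one, so that all rows together cost at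
   most [eps / 2], also when [L] is empty. *)
destruct (rows_approx g l0 (eps / 2 / (INR (length L) + 1)) L Hg)
  as (l & Nl & Fl & Cl & Bl & _); auto.
{ pos. }
specialize (H0 l Nl).
match goal with |- Cmod ?z < _ => replace z with
  (- (lsum g l - lsum (fun i => CSum (fun j => g (i, j))) L) + (lsum g l - CSum g))%C by ring end.
eapply Rle_lt_trans; [apply Cmod_triangle|]. rewrite Cmod_opp.
assert (Cmod (lsum g l - CSum g)%C < eps / 2) by (apply H0; intros p Hp; apply Cl; auto; apply HL, nodup_In, in_map, Hp).
assert (eps / 2 / (INR (length L) + 1) * INR (length L) <= eps / 2); [|lra].
apply Rle_trans with (eps / 2 / (INR (length L) + 1) * (INR (length L) + 1)).
- apply Rmult_le_compat_l; [|lra]. pos.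
- right; fin.
Qed.

Lemma lsum_seq (g : nat -> C) n : lsum g (seq 0 (S n)) = sum_n g n.
Proof.
induction n as [|n IH].
- fin.
- rewrite seq_S, lsum_app, IH, sum_Sn. unfold plus; simpl. fin.
Qed.

Lemma rsum_seq (a : nat -> R) n : rsum a (seq 0 (S n)) = sum_n a n.
Proof.
induction n as [|n IH].
- fin.
- rewrite seq_S, rsum_app, IH, sum_Sn. unfold plus; simpl. lra.
Qed.

Lemma ex_series_rsummable (a : nat -> R) : rsummable a -> ex_series a.
Proof.
intros [Ha [M HM]].
assert (Hi : forall n, sum_n a n <= sum_n a (S n)) by (intros n; rewrite sum_Sn; unfold plus; simpl; specialize (Ha (S n)); lra).
destruct (ex_finite_lim_seq_incr (sum_n a) M Hi) as [l Hl].
- intros n; rewrite <- rsum_seq; apply HM, seq_NoDup.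
- exists l; fin.
Qed.

Lemma rsummable_ex_series (a : nat -> R) : (forall n, 0 <= a n) -> ex_series a -> rsummable a.
Proof.
intros Ha [S HS]; split; auto; exists S; intros l Nl.
assert (B : exists n, forall i, In i l -> (i < n)%nat) by (clear; induction l as [|i l [n Hn]]; [exists 0%nat; easy|]; exists (Nat.max n (i + 1)); intros j [<- | Hj]; [lia|]; specialize (Hn j Hj); lia).
destruct B as [n Hn].
apply Rle_trans with (rsum a (seq 0 (1 + n))).
- apply rsum_incl; auto; [apply seq_NoDup|]. intros i Hi; apply in_seq.
  specialize (Hn i Hi); lia.
- rewrite rsum_seq.
  assert (HS' : is_lim_seq (sum_n a) S) by exact HS.
  apply (is_lim_seq_incr_compare (sum_n a) S HS').
  intros m; rewrite sum_Sn; unfold plus; simpl. specialize (Ha (Datatypes.S m)); lra.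
Qed.

Lemma is_series_has_sum (g : nat -> C) S : csummable g -> has_sum g S ->
  is_series (K := C_AbsRing) (V := C_NormedModule) g S.
Proof.
intros Hc Hg. rewrite <- (CSum_unique g S Hg).
apply (filterlim_locally_ball_norm (K := C_AbsRing) (U := C_NormedModule)).
intros eps.
destruct (csummable_tail g (fun i => Cmod (g i)) (fun i => Rle_refl _) Hc (eps / 2)) as (l0 & N0 & H0).
{ pose proof (cond_pos eps); lra. }
assert (B : exists n, forall i, In i l0 -> (i < n)%nat) by (clear; induction l0 as [|i l [n Hn]]; [exists 0%nat; easy|]; exists (Nat.max n (i + 1)); intros j [<- | Hj]; [lia|]; specialize (Hn j Hj); lia).
destruct B as [n Hn]. exists n; intros m Hm.
rewrite <- lsum_seq.
eapply Rle_lt_trans; [apply (H0 (seq 0 (Datatypes.S m)))|].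
- apply seq_NoDup.
- intros i Hi; apply in_seq; specialize (Hn i Hi); lia.
- pose proof (cond_pos eps); lra.
Qed.

(** * Complex derivatives *)

Lemma Ceq (z w : C) : Re z = Re w -> Im z = Im w -> z = w.
Proof. destruct z, w; simpl; intros -> ->; fin. Qed.

Lemma im_le_Cmod (z : C) : Rabs (Im z) <= Cmod z.
Proof. eapply Rle_trans; [|apply Rmax_Cmod]; apply Rmax_r. Qed.

Lemma Cmod_le_Re_Im (z : C) : Cmod z <= Rabs (Re z) + Rabs (Im z).
Proof.
destruct z as [x y]; simpl.
replace (x, y) with (RtoC x + Ci * RtoC y)%C.
- Ctri.
  rewrite Cmod_mult, !Cmod_R, Cmod_Ci; lra.
- unfold Cplus; simpl; fin.
Qed.

Lemma Re_pair x y : Re (x, y) = x. Proof. fin. Qed.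
Lemma Im_pair x y : Im (x, y) = y. Proof. fin. Qed.
Lemma im_plus (a b : C) : Im (a + b) = Im a + Im b. Proof. fin. Qed.
Lemma im_opp (a : C) : Im (- a) = - Im a. Proof. fin. Qed.
Lemma im_RtoC (x : R) : Im x = 0. Proof. fin. Qed.
Lemma re_minus (a b : C) : Re (a - b) = Re a - Re b. Proof. fin. Qed.
Lemma im_minus (a b : C) : Im (a - b) = Im a - Im b. Proof. fin. Qed.

Ltac Creim := repeat progress rewrite ?re_minus, ?im_minus, ?re_plus, ?im_plus, ?re_mult,
  ?im_mult, ?re_opp, ?im_opp, ?re_RtoC, ?im_RtoC, ?Re_pair, ?Im_pair.

Ltac Cring := apply Ceq; Creim; simpl; ring.

Ltac Cfield := apply Ceq; Creim; simpl; field.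

Lemma Re_conj_self (u : C) : Re (Cconj u * u) = Cmod u ^ 2.
Proof. rewrite Cmod2_alt; destruct u; simpl; lra. Qed.

Lemma Re_conj_le (u w : C) : Re (Cconj u * w) <= Cmod u * Cmod w.
Proof.
eapply Rle_trans; [apply Rle_abs|]. eapply Rle_trans; [apply re_le_Cmod|].
rewrite Cmod_mult, Cmod_conj; lra.
Qed.

Definition rderiv (h : R -> C) (t : R) (l : C) : Prop :=
  is_derive (fun t => Re (h t)) t (Re l) /\ is_derive (fun t => Im (h t)) t (Im l).

(** The increment form admits [h = 0] and contains no quotient, which suits chain rules and termwise
    estimates; [cderiv_is_derive] translates it into the derivative of [holomorphic_at]. *)
Definition cderiv (f : C -> C) (s l : C) : Prop :=
  forall eps, 0 < eps -> exists d, 0 < d /\ forall h, Cmod h < d ->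
    Cmod (f (s + h) - f s - l * h)%C <= eps * Cmod h.

Lemma is_derive_eps (h : R -> R) t l :
  is_derive h t l <-> forall eps, 0 < eps -> exists d, 0 < d /\
    forall k, Rabs k < d -> Rabs (h (t + k) - h t - l * k) <= eps * Rabs k.
Proof.
rewrite is_derive_Reals; split.
- intros H eps He; destruct (H eps He) as [d Hd]; exists d; split; [apply cond_pos|].
  intros k Hk; destruct (Req_dec k 0) as [-> | K].
  + rewrite Rplus_0_r. replace (h t - h t - l * 0) with 0 by ring. rewrite Rabs_R0; lra.
  + specialize (Hd k K Hk).
    replace (h (t + k) - h t - l * k) with (((h (t + k) - h t) / k - l) * k) by fin.
    rewrite Rabs_mult; apply Rmult_le_compat_r; fin.
- intros H eps He; destruct (H (eps / 2)) as (d & Hd & H'); [lra|].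
  exists (mkposreal d Hd); intros k K Hk.
  replace ((h (t + k) - h t) / k - l) with ((h (t + k) - h t - l * k) / k) by fin.
  unfold Rdiv; rewrite Rabs_mult, Rabs_inv.
  pose proof (Rabs_pos_lt k K).
  apply Rle_lt_trans with (eps / 2 * Rabs k * / Rabs k).
  + apply Rmult_le_compat_r; fin.
  + replace (eps / 2 * Rabs k * / Rabs k) with (eps / 2) by fin. lra.
Qed.

Lemma rderiv_eps h t l :
  rderiv h t l <-> forall eps, 0 < eps -> exists d, 0 < d /\
    forall k : R, Rabs k < d -> Cmod (h (t + k)%R - h t - l * k)%C <= eps * Rabs k.
Proof.
split.
- intros [H1 H2] eps He; rewrite is_derive_eps in H1, H2.
  destruct (H1 (eps / 2)) as (d1 & D1 & K1); [lra|].
  destruct (H2 (eps / 2)) as (d2 & D2 & K2); [lra|].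
  exists (Rmin d1 d2); split; [now apply Rmin_pos|]. intros k Hk.
  specialize (K1 k (Rlt_le_trans _ _ _ Hk (Rmin_l _ _))).
  specialize (K2 k (Rlt_le_trans _ _ _ Hk (Rmin_r _ _))).
  eapply Rle_trans; [apply Cmod_le_Re_Im|]. Creim.
  replace (Re (h (t + k)%R) - Re (h t) - (Re l * k - Im l * 0))
    with (Re (h (t + k)%R) - Re (h t) - Re l * k) by ring.
  replace (Im (h (t + k)%R) - Im (h t) - (Re l * 0 + Im l * k))
    with (Im (h (t + k)%R) - Im (h t) - Im l * k) by ring. lra.
- split; apply is_derive_eps; intros eps He;
    destruct (H eps He) as (d & D & K); exists d; split; auto; intros k Hk;
    specialize (K k Hk); eapply Rle_trans; [|exact K| |exact K].
  + eapply Rle_trans; [|apply re_le_Cmod]. Creim. right; fin.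
  + eapply Rle_trans; [|apply im_le_Cmod]. Creim. right; fin.
Qed.

Lemma rderiv_ext h g t l : (forall t, h t = g t) -> rderiv h t l -> rderiv g t l.
Proof. intros E H; replace g with h; auto; now apply functional_extensionality. Qed.

Lemma rderiv_val h t l l' : rderiv h t l -> l = l' -> rderiv h t l'.
Proof. now intros H <-. Qed.

Lemma rderiv_const c t : rderiv (fun _ => c) t 0.
Proof. split; apply @is_derive_const. Qed.

Lemma rderiv_id t : rderiv (fun t => RtoC t) t 1.
Proof. split; simpl; [apply @is_derive_id | apply @is_derive_const]. Qed.

Lemma rderiv_RtoC (h : R -> R) t l : is_derive h t l -> rderiv (fun t => RtoC (h t)) t l.
Proof. split; simpl; auto; apply @is_derive_const. Qed.

Lemma rderiv_plus h g t l m :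
  rderiv h t l -> rderiv g t m -> rderiv (fun t => (h t + g t)%C) t (l + m)%C.
Proof.
intros [H1 H2] [G1 G2]; split; apply @is_derive_plus; fin.
Qed.

Lemma is_derive_Rmult (f g : R -> R) t l m : is_derive f t l -> is_derive g t m ->
  is_derive (fun t => f t * g t) t (l * g t + f t * m).
Proof. intros H G; apply (is_derive_mult f g t l m H G); apply Rmult_comm. Qed.

Lemma is_derive_Rcomp (f g : R -> R) t l m : is_derive g t m -> is_derive f (g t) l ->
  is_derive (fun t => f (g t)) t (m * l).
Proof. intros G F; apply (is_derive_comp f g t l m F G). Qed.

Lemma rderiv_mult h g t l m : rderiv h t l -> rderiv g t m ->
  rderiv (fun t => (h t * g t)%C) t (l * g t + h t * m)%C.
Proof.
intros [H1 H2] [G1 G2]; split; Creim.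
- eapply is_derive_ext; [symmetry; apply re_mult|].
  evar_last; [apply @is_derive_minus; apply is_derive_Rmult; eassumption|].
  unfold minus, plus, opp; simpl; lra.
- eapply is_derive_ext; [symmetry; apply im_mult|].
  evar_last; [apply @is_derive_plus; apply is_derive_Rmult; eassumption|].
  unfold plus; simpl; lra.
Qed.

Lemma rderiv_scal (c : C) h t l : rderiv h t l -> rderiv (fun t => (c * h t)%C) t (c * l)%C.
Proof.
intros H; eapply rderiv_val; [apply rderiv_mult; [apply rderiv_const | exact H]|]. cbv beta; fin.
Qed.

Lemma rderiv_opp h t l : rderiv h t l -> rderiv (fun t => (- h t)%C) t (- l)%C.
Proof.
intros H; apply (rderiv_ext (fun t => (-1 * h t)%C)); [intros; fin|].
eapply rderiv_val; [apply rderiv_scal, H|]; fin.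
Qed.

Lemma rderiv_minus h g t l m :
  rderiv h t l -> rderiv g t m -> rderiv (fun t => (h t - g t)%C) t (l - m)%C.
Proof. intros H G; apply rderiv_plus; auto; now apply rderiv_opp. Qed.

Lemma rderiv_comp_R (h : R -> C) (u : R -> R) t l du :
  rderiv h (u t) l -> is_derive u t du -> rderiv (fun t => h (u t)) t (du * l)%C.
Proof.
intros [H1 H2] Hu; split; Creim.
- evar_last; [apply (is_derive_Rcomp (fun t => Re (h t))); eassumption | lra].
- evar_last; [apply (is_derive_Rcomp (fun t => Im (h t))); eassumption | lra].
Qed.

Lemma rderiv_cexp h t l : rderiv h t l -> rderiv (fun t => Cexp (h t)) t (l * Cexp (h t))%C.
Proof.
intros [H1 H2]; unfold Cexp; split; Creim.
- evar_last; [apply is_derive_Rmult; apply is_derive_Rcomp|]; [exact H1| |exact H2| |].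
  + apply is_derive_Reals, derivable_pt_lim_exp.
  + apply is_derive_Reals, derivable_pt_lim_cos.
  + lra.
- evar_last; [apply is_derive_Rmult; apply is_derive_Rcomp|]; [exact H1| |exact H2| |].
  + apply is_derive_Reals, derivable_pt_lim_exp.
  + apply is_derive_Reals, derivable_pt_lim_sin.
  + lra.
Qed.

(** The real mean value theorem is applied to the component of [h] in the direction of the total
    increment [u]; the component of [u] itself in that direction is $|u|^2$. *)
Lemma rderiv_MVT (h h' : R -> C) a b M : a <= b ->
  (forall t, a <= t <= b -> rderiv h t (h' t)) ->
  (forall t, a <= t <= b -> Cmod (h' t) <= M) -> Cmod (h b - h a)%C <= M * (b - a).
Proof.
intros Hab Hd HM.
set (u := (h b - h a)%C).
destruct (MVT_gen (fun t => Re (Cconj u * h t)) a b (fun t => Re (Cconj u * h' t)%C))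
  as (c & Hc & E).
- rewrite Rmin_left, Rmax_right by auto. intros t Ht.
  apply (rderiv_scal (Cconj u) h t (h' t)), Hd; lra.
- rewrite Rmin_left, Rmax_right by auto. intros t Ht.
  apply continuity_pt_filterlim, @ex_derive_continuous.
  exists (Re (Cconj u * h' t)).
  exact (proj1 (rderiv_scal (Cconj u) h t (h' t) (Hd t ltac:(lra)))).
- rewrite Rmin_left, Rmax_right in Hc by auto.
  assert (E2 : Cmod u ^ 2 = Re (Cconj u * h' c) * (b - a)) by (rewrite <- E, <- Re_conj_self; unfold u at 2; Creim; lra).
  pose proof (Re_conj_le u (h' c)). pose proof (HM c Hc). pose proof (Cmod_ge_0 u).
  destruct (Req_dec (Cmod u) 0) as [-> | K].
  + pose proof (Cmod_ge_0 (h' c)). pos.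
  + assert (Cmod u * Cmod u <= Cmod u * (M * (b - a))); [|nra].
    replace (Cmod u * Cmod u) with (Cmod u ^ 2) by ring. rewrite E2.
    replace (Cmod u * (M * (b - a))) with ((Cmod u * M) * (b - a)) by ring.
    apply Rmult_le_compat_r; [lra|]. nra.
Qed.

(** The uniform tool for all remainder estimates: [H] is a chain of successive derivatives whose
    first [n] members vanish at 0, and the mean value inequality is iterated. The factor $1/n!$ is
    given away. *)
Lemma rderiv_taylor n : forall (H : nat -> R -> C) a M, 0 <= a ->
  (forall k t, (k < n)%nat -> 0 <= t <= a -> rderiv (H k) t (H (S k) t)) ->
  (forall k, (k < n)%nat -> H k 0 = 0%C) ->
  (forall t, 0 <= t <= a -> Cmod (H n t) <= M) -> Cmod (H 0%nat a) <= M * a ^ n.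
Proof.
induction n as [|n IH]; intros H a M Ha Hd H0 HM.
- rewrite Rmult_1_r; apply HM; lra.
- assert (K : forall t, 0 <= t <= a -> Cmod (H 1%nat t) <= M * a ^ n).
  { intros t Ht. apply Rle_trans with (M * t ^ n).
    - apply (IH (fun k => H (S k))); try lra; intros.
      + apply Hd; fin.
      + apply H0; lia.
      + apply HM; lra.
    - apply Rmult_le_compat_l.
      + eapply Rle_trans; [apply Cmod_ge_0 | apply (HM 0); lra].
      + apply pow_incr; lra. }
  replace (H 0%nat a) with (H 0%nat a - H 0%nat 0)%C by (rewrite (H0 0%nat) by lia; fin).
  replace (M * a ^ S n) with (M * a ^ n * (a - 0)) by (simpl; lra).
  apply (rderiv_MVT _ (H 1%nat)); auto. intros t Ht; apply Hd; fin.
Qed.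

Lemma Cexp_plus a b : Cexp (a + b) = (Cexp a * Cexp b)%C.
Proof.
unfold Cexp; apply Ceq; Creim; rewrite exp_plus, ?cos_plus, ?sin_plus; lra.
Qed.

Lemma Cexp_0 : Cexp 0 = 1%C.
Proof. apply Ceq; simpl; rewrite exp_0, ?cos_0, ?sin_0; lra. Qed.

Lemma Cmod_Cexp s : Cmod (Cexp s) = exp (Re s).
Proof.
unfold Cmod; simpl.
replace (_ + _) with (exp (Re s) ^ 2).
- replace (exp (Re s) ^ 2) with (Rsqr (exp (Re s))) by (unfold Rsqr; lra).
  apply sqrt_Rsqr, Rlt_le, exp_pos.
- pose proof (sin2_cos2 (Im s)) as E; unfold Rsqr in E.
  nra.
Qed.

Lemma Cexp_neq0 s : Cexp s <> 0%C.
Proof.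
intros E; pose proof (Cmod_Cexp s) as K; rewrite E, Cmod_0 in K.
pose proof (exp_pos (Re s)); lra.
Qed.

Lemma Cexp_RtoC (x : R) : Cexp x = RtoC (exp x).
Proof. apply Ceq; simpl; rewrite ?cos_0, ?sin_0; lra. Qed.

Lemma cderiv_ext f g s l : (forall s, f s = g s) -> cderiv f s l -> cderiv g s l.
Proof. intros E H; replace g with f; auto; now apply functional_extensionality. Qed.

Lemma cderiv_ext_loc f g s l d : 0 < d -> (forall s', Cmod (s' - s) < d -> f s' = g s') ->
  cderiv f s l -> cderiv g s l.
Proof.
intros Hd E H eps He; destruct (H eps He) as (d' & D' & K).
exists (Rmin d d'); split; [now apply Rmin_pos|]; intros h Hh.
rewrite <- !E.
- apply K; eapply Rlt_le_trans; [exact Hh | apply Rmin_r].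
- replace (s - s)%C with (RtoC 0) by ring; rewrite Cmod_0; lra.
- replace (s + h - s)%C with h by ring. eapply Rlt_le_trans; [exact Hh | apply Rmin_l].
Qed.

Lemma cderiv_val f s l l' : cderiv f s l -> l = l' -> cderiv f s l'.
Proof. now intros H <-. Qed.

Lemma cderiv_cont f s l : cderiv f s l -> forall eps, 0 < eps -> exists d, 0 < d /\
  forall h, Cmod h < d -> Cmod (f (s + h) - f s)%C < eps.
Proof.
intros H eps He; destruct (H 1) as (d & D & K); [lra|].
pose proof (Cmod_ge_0 l) as Hl.
exists (Rmin d (eps / (Cmod l + 2))); split.
{ apply Rmin_pos; fin. }
intros h Hh. specialize (K h (Rlt_le_trans _ _ _ Hh (Rmin_l _ _))).
assert (Hh2 : Cmod h < eps / (Cmod l + 2)) by (eapply Rlt_le_trans; [exact Hh | apply Rmin_r]).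
replace (f (s + h) - f s)%C with ((f (s + h) - f s - l * h) + l * h)%C by ring.
eapply Rle_lt_trans; [apply Cmod_triangle|]. rewrite Cmod_mult.
pose proof (Cmod_ge_0 h).
replace eps with ((Cmod l + 2) * (eps / (Cmod l + 2))) by fin.
nra.
Qed.

Lemma cderiv_const c s : cderiv (fun _ => c) s 0.
Proof.
exists 1; split; [lra|]; intros h _.
replace (c - c - 0 * h)%C with (RtoC 0) by ring. rewrite Cmod_0.
pos.
Qed.

Lemma cderiv_id s : cderiv (fun s => s) s 1.
Proof.
exists 1; split; [lra|]; intros h _.
replace (s + h - s - 1 * h)%C with (RtoC 0) by ring. rewrite Cmod_0.
pos.
Qed.

Lemma cderiv_plus f g s l m :
  cderiv f s l -> cderiv g s m -> cderiv (fun s => (f s + g s)%C) s (l + m)%C.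
Proof.
intros H G eps He.
destruct (H (eps / 2)) as (d1 & D1 & K1); [lra|].
destruct (G (eps / 2)) as (d2 & D2 & K2); [lra|].
exists (Rmin d1 d2); split; [now apply Rmin_pos|]; intros h Hh.
specialize (K1 h (Rlt_le_trans _ _ _ Hh (Rmin_l _ _))).
specialize (K2 h (Rlt_le_trans _ _ _ Hh (Rmin_r _ _))).
match goal with |- Cmod ?z <= _ => replace z with
  ((f (s + h) - f s - l * h) + (g (s + h) - g s - m * h))%C by ring end.
Ctri. lra.
Qed.

(** Common core of the chain rules with complex and with real inner variable: [k] stands for the
    increment of the inner function and [m * h] for its linear part. *)
Lemma cderiv_chain_bound f w l m eps : cderiv f w l -> 0 < eps ->
  exists e d, 0 < e /\ 0 < d /\ forall (k h : C), Cmod h < d -> Cmod (k - m * h)%C <= e * Cmod h ->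
    Cmod (f (w + k) - f w - l * m * h)%C <= eps * Cmod h.
Proof.
intros F He. pose proof (Cmod_ge_0 l) as Hl. pose proof (Cmod_ge_0 m) as Hm.
set (e1 := eps / (2 * (Cmod m + 1))). assert (He1 : 0 < e1) by pos.
destruct (F e1 He1) as (d1 & D1 & K1).
set (e2 := Rmin 1 (eps / (2 * (Cmod l + 1)))).
assert (He2 : 0 < e2) by (apply Rmin_pos; fin).
exists e2, (d1 / (Cmod m + 1)); split; auto. split; [fin|].
intros k h Hh K2. pose proof (Cmod_ge_0 h) as Hh0.
assert (Hk : Cmod k <= (Cmod m + 1) * Cmod h).
{ replace k with ((k - m * h) + m * h)%C by ring. Ctri. rewrite Cmod_mult.
  assert (e2 <= 1) by apply Rmin_l. nra. }
assert (Hk2 : Cmod k < d1) by (eapply Rle_lt_trans; [fin|]; replace d1 with ((Cmod m + 1) * (d1 / (Cmod m + 1))) by fin; nra).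
specialize (K1 k Hk2).
replace (f (w + k) - f w - l * m * h)%C with ((f (w + k) - f w - l * k) + l * (k - m * h))%C by ring.
Ctri. rewrite Cmod_mult.
assert (A : e1 * Cmod k <= eps / 2 * Cmod h) by (apply Rle_trans with (e1 * ((Cmod m + 1) * Cmod h)); [fin|]; right; unfold e1; fin).
assert (B : Cmod l * (e2 * Cmod h) <= eps / 2 * Cmod h).
{ rewrite <- Rmult_assoc; apply Rmult_le_compat_r; auto.
  apply Rle_trans with ((Cmod l + 1) * (eps / (2 * (Cmod l + 1)))).
  - apply Rmult_le_compat; try lra. apply Rmin_r.
  - right; fin. }
nra.
Qed.

Lemma cderiv_comp f g s l m :
  cderiv g s m -> cderiv f (g s) l -> cderiv (fun s => f (g s)) s (l * m)%C.
Proof.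
intros G F eps He. destruct (cderiv_chain_bound f _ l m eps F He) as (e & d & E & D & K),
(G e E) as (d2 & D2 & K2). exists (Rmin d2 d); split; [now apply Rmin_pos|].
intros h Hh. specialize (K (g (s + h) - g s)%C h (Rlt_le_trans _ _ _ Hh (Rmin_r _ _))
  (K2 h (Rlt_le_trans _ _ _ Hh (Rmin_l _ _)))).
now replace (g s + (g (s + h) - g s))%C with (g (s + h)%C) in K by ring.
Qed.

Lemma cderiv_sq s : cderiv (fun s => (s * s)%C) s (2 * s)%C.
Proof.
intros eps He; exists eps; split; auto; intros h Hh.
replace ((s + h) * (s + h) - s * s - 2 * s * h)%C with (h * h)%C by ring.
rewrite Cmod_mult. pose proof (Cmod_ge_0 h). nra.
Qed.

Lemma cderiv_scal (c : C) f s l : cderiv f s l -> cderiv (fun s => (c * f s)%C) s (c * l)%C.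
Proof.
intros H; apply (cderiv_comp (fun z => (c * z)%C) f s c l); auto.
exists 1; split; [lra|]; intros h _.
replace (c * (f s + h) - c * f s - c * h)%C with (RtoC 0) by ring. rewrite Cmod_0.
pos.
Qed.

(* Polarization: a product is a combination of squares, and squaring is a composition. *)
Lemma cderiv_mult f g s l m : cderiv f s l -> cderiv g s m ->
  cderiv (fun s => (f s * g s)%C) s (l * g s + f s * m)%C.
Proof.
intros H G.
assert (HP : cderiv (fun s => (f s + g s)%C) s (l + m)%C) by now apply cderiv_plus.
assert (HM : cderiv (fun s => (f s + -1 * g s)%C) s (l + -1 * m)%C)
  by (apply cderiv_plus, cderiv_scal; fin).
pose proof (cderiv_comp _ _ s _ _ HP (cderiv_sq _)) as A.
pose proof (cderiv_comp _ _ s _ _ HM (cderiv_sq _)) as B.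
pose proof (cderiv_plus _ _ s _ _ (cderiv_scal (1 / 4) _ _ _ A) (cderiv_scal (- (1 / 4)) _ _ _ B)) as K.
eapply cderiv_val; [eapply cderiv_ext; [|exact K]|]; intros; cbv beta; fin.
Qed.

Lemma cderiv_inv f s l : cderiv f s l -> f s <> 0%C ->
  cderiv (fun s => (/ f s)%C) s (- l / (f s * f s))%C.
Proof.
intros H N.
apply cderiv_val with ((- / (f s * f s)) * l)%C; [|field; fin].
apply (cderiv_comp (fun z => (/ z)%C) f s (- / (f s * f s))%C l); auto.
set (z := f s) in *. assert (Hz : 0 < Cmod z) by now apply Cmod_gt_0.
intros eps He.
exists (Rmin (Cmod z / 2) (eps * Cmod z ^ 3 / 2)); split.
{ apply Rmin_pos; [lra|]. pos. }
intros h Hh.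
assert (H1 : Cmod h < Cmod z / 2) by (eapply Rlt_le_trans; [exact Hh | apply Rmin_l]).
assert (H2 : Cmod h < eps * Cmod z ^ 3 / 2) by (eapply Rlt_le_trans; [exact Hh | apply Rmin_r]).
assert (Hzh : Cmod z / 2 <= Cmod (z + h)%C).
{ assert (Cmod z <= Cmod (z + h)%C + Cmod h); [|lra].
  replace z with ((z + h) + - h)%C at 1 by ring.
  Ctri. rewrite Cmod_opp; lra. }
assert (N2 : (z + h)%C <> 0%C) by (apply Cmod_gt_0; lra).
replace (/ (z + h) - / z - - / (z * z) * h)%C with (h * h / (z * z * (z + h)))%C
  by (field; fin).
rewrite Cmod_div, !Cmod_mult; [|repeat apply Cmult_neq_0; fin].
pose proof (Cmod_ge_0 h).
assert (P : 0 < Cmod z * Cmod z * Cmod (z + h)%C) by pos.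
apply Rmult_le_reg_r with (Cmod z * Cmod z * Cmod (z + h)%C); auto.
unfold Rdiv; rewrite Rmult_assoc, Rinv_l by lra.
apply Rle_trans with (Cmod h * (eps * Cmod z ^ 3 / 2)); [fin|].
replace (Cmod h * (eps * Cmod z ^ 3 / 2)) with (eps * Cmod h * (Cmod z * Cmod z * (Cmod z / 2)))
  by lra.
apply Rmult_le_compat_l; [nra|]. nra.
Qed.

Lemma rderiv_comp_C (f : C -> C) (h : R -> C) t l m :
  cderiv f (h t) l -> rderiv h t m -> rderiv (fun t => f (h t)) t (l * m)%C.
Proof.
intros F H; rewrite rderiv_eps in H |- *; intros eps He.
destruct (cderiv_chain_bound f _ l m eps F He) as (e & d & E & D & K),
(H e E) as (d2 & D2 & K2). exists (Rmin d2 d); split; [now apply Rmin_pos|].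
intros x Hx. specialize (K (h (t + x)%R - h t)%C x). rewrite Cmod_R in K.
specialize (K (Rlt_le_trans _ _ _ Hx (Rmin_r _ _)) (K2 x (Rlt_le_trans _ _ _ Hx (Rmin_l _ _)))).
now replace (h t + (h (t + x)%R - h t))%C with (h (t + x)%R) in K by ring.
Qed.

Lemma cderiv_cexp s : cderiv Cexp s (Cexp s).
Proof.
intros eps He.
pose proof (exp_pos (Re s)) as Es. pose proof (exp_pos 1) as E1.
exists (Rmin 1 (eps / (exp (Re s) * exp 1))); split.
{ apply Rmin_pos; [lra|]. pos. }
intros h Hh.
assert (H1 : Cmod h < 1) by (eapply Rlt_le_trans; [exact Hh | apply Rmin_l]).
assert (H2 : Cmod h < eps / (exp (Re s) * exp 1)) by (eapply Rlt_le_trans; [exact Hh | apply Rmin_r]).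
rewrite Cexp_plus.
replace (Cexp s * Cexp h - Cexp s - Cexp s * h)%C with (Cexp s * (Cexp h - 1 - h))%C by ring.
rewrite Cmod_mult, Cmod_Cexp.
assert (K : Cmod (Cexp h - 1 - h)%C <= Cmod h * Cmod h * exp 1 * 1 ^ 2).
(* Taylor expansion of second order along the segment from 0 to [h]: the remainder and its first two
   derivatives in [t]. *)
{ set (H := fun (k : nat) (t : R) => match k with
     | O => (Cexp (t * h) - 1 - t * h)%C
     | 1%nat => (h * Cexp (t * h) - h)%C
     | _ => (h * (h * Cexp (t * h)))%C end).
  replace (Cexp h - 1 - h)%C with (H 0%nat 1) by (unfold H; rewrite Cmult_1_l; fin).
  assert (D : forall t, rderiv (fun t : R => (t * h)%C) t h) by (intros t; eapply rderiv_val; [apply rderiv_mult; [apply rderiv_id | apply rderiv_const]|]; cbv beta; fin).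
  apply rderiv_taylor; [lra| | |].
  - intros k t Hk Ht. destruct k as [|[|k]]; [| |lia]; unfold H.
    + eapply rderiv_val; [apply rderiv_minus; [apply rderiv_minus|]|].
      * apply rderiv_cexp, D.
      * apply rderiv_const.
      * fin.
      * cbv beta; fin.
    + eapply rderiv_val; [apply rderiv_minus; [apply rderiv_scal|]|].
      * apply rderiv_cexp, D.
      * apply rderiv_const.
      * cbv beta; fin.
  - intros k Hk. destruct k as [|[|k]]; [| |lia]; unfold H.
    + replace (0 * h)%C with (RtoC 0) by ring. rewrite Cexp_0; fin.
    + replace (0 * h)%C with (RtoC 0) by ring. rewrite Cexp_0; fin.
  - intros t Ht; unfold H. rewrite !Cmod_mult, Cmod_Cexp. pose proof (Cmod_ge_0 h).
    rewrite Rmult_assoc. apply Rmult_le_compat_l; auto. apply Rmult_le_compat_l; auto.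
    apply Rlt_le. apply Rle_lt_trans with (exp (Cmod h)); [|apply exp_increasing; lra].
    assert (Re (t * h) <= Cmod h).
    { rewrite re_scal_l. pose proof (re_le_Cmod h) as Q. apply Rabs_le_between in Q. nra. }
    destruct (Rle_lt_or_eq_dec _ _ H3) as [K | ->]; [apply Rlt_le, exp_increasing; lra| lra]. }
pose proof (Cmod_ge_0 h).
apply Rle_trans with (exp (Re s) * (Cmod h * Cmod h * exp 1 * 1 ^ 2)).
{ nra. }
replace (exp (Re s) * (Cmod h * Cmod h * exp 1 * 1 ^ 2))
  with ((exp (Re s) * exp 1 * Cmod h) * Cmod h) by ring.
apply Rmult_le_compat_r; auto.
replace eps with (exp (Re s) * exp 1 * (eps / (exp (Re s) * exp 1))) by fin.
apply Rmult_le_compat_l; [|lra]. pos.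
Qed.

Lemma cderiv_is_derive f s l : cderiv f s l ->
  is_derive (K := C_AbsRing) (V := C_NormedModule) f s l.
Proof.
split.
- apply (is_linear_scal_l (K := C_AbsRing) (V := C_NormedModule)).
- intros x Hx. apply (is_filter_lim_locally_unique (K := C_AbsRing) (V := AbsRing_NormedModule C_AbsRing)) in Hx. subst x.
  intros eps. destruct (H eps (cond_pos eps)) as (d & D & K).
  exists (mkposreal d D). intros y Hy.
  specialize (K _ Hy).
  assert (E : forall a b : C, (a + (b - a))%C = b) by (intros; fin). rewrite E in K.
  rewrite (Cmult_comm _ l). fin.
Qed.

Lemma cderiv_unique f s l m : cderiv f s l -> cderiv f s m -> l = m.
Proof.
intros H K. apply NNPP; intros N. set (e := Cmod (l - m)%C).
assert (He : 0 < e).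
{ apply Cmod_gt_0. intros E; apply N. replace l with ((l - m) + m)%C by ring. rewrite E; fin. }
destruct (H (e / 4)) as (d & D & A1); [lra|]. destruct (K (e / 4)) as (d' & D' & A2); [lra|].
set (x := Rmin d d' / 2). assert (Hx : 0 < x) by (unfold x; pose proof (Rmin_pos d d' D D'); lra).
assert (X : Cmod x = x) by (rewrite Cmod_R, Rabs_pos_eq; lra).
specialize (A1 x). specialize (A2 x). rewrite X in A1, A2.
specialize (A1 ltac:(pose proof (Rmin_l d d'); unfold x in *; lra)).
specialize (A2 ltac:(pose proof (Rmin_r d d'); unfold x in *; lra)).
assert (Q : Cmod ((l - m) * x)%C <= e / 4 * x + e / 4 * x) by (replace ((l - m) * x)%C with (- (f (s + x) - f s - l * x) + (f (s + x) - f s - m * x))%C by ring; Ctri; rewrite Cmod_opp; lra).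
rewrite Cmod_mult in Q. fold e in Q. nra.
Qed.

(** * Contour integrals, entire functions and sums of them *)

Definition ccont (h : R -> C) (t : R) : Prop :=
  continuous (fun t => Re (h t)) t /\ continuous (fun t => Im (h t)) t.

Definition ccont2 (u : R -> R -> C) (x y : R) : Prop :=
  continuity_2d_pt (fun a b => Re (u a b)) x y /\ continuity_2d_pt (fun a b => Im (u a b)) x y.

Lemma rderiv_ccont h t l : rderiv h t l -> ccont h t.
Proof. intros [H1 H2]; split; apply @ex_derive_continuous; eexists; eauto. Qed.

Lemma ccont2_const c x y : ccont2 (fun _ _ => c) x y.
Proof. split; apply continuity_2d_pt_const. Qed.

Lemma ccont2_id1 x y : ccont2 (fun a _ => RtoC a) x y.
Proof. split; [apply continuity_2d_pt_id1 | apply (continuity_2d_pt_const x y 0)]. Qed.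

Lemma ccont2_id2 x y : ccont2 (fun _ b => RtoC b) x y.
Proof. split; [apply continuity_2d_pt_id2 | apply (continuity_2d_pt_const x y 0)]. Qed.

Lemma ccont2_plus u v x y : ccont2 u x y -> ccont2 v x y ->
  ccont2 (fun a b => (u a b + v a b)%C) x y.
Proof. intros [U1 U2] [V1 V2]; split; apply continuity_2d_pt_plus; fin. Qed.

Lemma ccont2_mult u v x y : ccont2 u x y -> ccont2 v x y ->
  ccont2 (fun a b => (u a b * v a b)%C) x y.
Proof.
intros [U1 U2] [V1 V2]; split.
- apply continuity_2d_pt_minus; apply continuity_2d_pt_mult; fin.
- apply continuity_2d_pt_plus; apply continuity_2d_pt_mult; fin.
Qed.

Lemma ccont2_eps u x y : ccont2 u x y <-> forall eps, 0 < eps -> exists d, 0 < d /\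
  forall a b, Rabs (a - x) < d -> Rabs (b - y) < d -> Cmod (u a b - u x y)%C < eps.
Proof.
split.
- intros [U1 U2] eps He.
  destruct (U1 (mkposreal (eps / 2) ltac:(lra))) as [d1 H1],
  (U2 (mkposreal (eps / 2) ltac:(lra))) as [d2 H2].
  exists (Rmin d1 d2); split; [apply Rmin_pos; apply cond_pos|]. intros a b Ha Hb.
  assert (A : Rabs (Re (u a b) - Re (u x y)) < eps / 2) by (apply H1; eapply Rlt_le_trans; eauto; apply Rmin_l).
  assert (B : Rabs (Im (u a b) - Im (u x y)) < eps / 2) by (apply H2; eapply Rlt_le_trans; eauto; apply Rmin_r).
  eapply Rle_lt_trans; [apply Cmod_le_Re_Im|]. Creim. lra.
- split; intros eps; destruct (H eps (cond_pos eps)) as (d & D & K);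
    exists (mkposreal d D); intros a b Ha Hb; specialize (K a b Ha Hb);
    eapply Rle_lt_trans; [|exact K| |exact K]; rewrite <- ?re_minus, <- ?im_minus.
  + apply re_le_Cmod.
  + apply im_le_Cmod.
Qed.

Lemma ccont2_comp_C (f : C -> C) u x y l : cderiv f (u x y) l -> ccont2 u x y ->
  ccont2 (fun a b => f (u a b)) x y.
Proof.
intros F U; rewrite ccont2_eps in U |- *; intros eps He.
destruct (cderiv_cont f _ _ F eps He) as (d1 & D1 & K1),
(U d1 D1) as (d2 & D2 & K2).
exists d2; split; auto; intros a b Ha Hb. specialize (K1 _ (K2 a b Ha Hb)).
replace (u x y + (u a b - u x y))%C with (u a b) in K1 by ring. lra.
Qed.

Lemma continuity_2d_pt_snd (f : R -> R -> R) x y : continuity_2d_pt f x y -> continuous (f x) y.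
Proof.
intros H; apply continuity_pt_filterlim.
intros eps He; destruct (H (mkposreal eps He)) as [d Hd].
exists d; split; [apply cond_pos|]. intros z [_ Hz].
apply Hd; auto. rewrite Rminus_diag, Rabs_R0; apply cond_pos.
Qed.

Lemma ccont2_snd u x y : ccont2 u x y -> ccont (u x) y.
Proof.
intros [U1 U2]; split.
- apply (continuity_2d_pt_snd (fun a b => Re (u a b)) x y U1).
- apply (continuity_2d_pt_snd (fun a b => Im (u a b)) x y U2).
Qed.

Definition CI (h : R -> C) (a b : R) : C :=
  (RInt (fun t => Re (h t)) a b, RInt (fun t => Im (h t)) a b).

Lemma CI_ext h g a b : (forall t, h t = g t) -> CI h a b = CI g a b.
Proof. intros E; replace g with h; auto; now apply functional_extensionality. Qed.

Lemma ccont_ex_RInt h a b : (forall t, ccont h t) ->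
  ex_RInt (fun t => Re (h t)) a b /\ ex_RInt (fun t => Im (h t)) a b.
Proof. 
split; apply (ex_RInt_continuous (V := R_CompleteNormedModule)); intros t _.
- exact (proj1 (H t)).
- exact (proj2 (H t)).
Qed.

Lemma CI_plus h g a b : (forall t, ccont h t) -> (forall t, ccont g t) ->
  CI (fun t => (h t + g t)%C) a b = (CI h a b + CI g a b)%C.
Proof.
intros H G; destruct (ccont_ex_RInt h a b H), (ccont_ex_RInt g a b G).
apply Ceq; apply (RInt_plus (V := R_CompleteNormedModule)); fin.
Qed.

Lemma CI_scal (c : C) h a b : (forall t, ccont h t) ->
  CI (fun t => (c * h t)%C) a b = (c * CI h a b)%C.
Proof.
intros H; destruct (ccont_ex_RInt h a b H) as [H1 H2].
apply Ceq; apply is_RInt_unique.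
-
  apply (is_RInt_minus (V := R_NormedModule) (fun t => Re c * Re (h t)) (fun t => Im c * Im (h t)));
    apply (is_RInt_scal (V := R_NormedModule)); now apply (RInt_correct (V := R_CompleteNormedModule)).
-
  apply (is_RInt_plus (V := R_NormedModule) (fun t => Re c * Im (h t)) (fun t => Im c * Re (h t)));
    apply (is_RInt_scal (V := R_NormedModule)); now apply (RInt_correct (V := R_CompleteNormedModule)).
Qed.

Lemma ccont_const c t : ccont (fun _ => c) t.
Proof. apply rderiv_ccont with (RtoC 0), rderiv_const. Qed.

Lemma ccont_plus h g t : ccont h t -> ccont g t -> ccont (fun t => (h t + g t)%C) t.
Proof. intros [H1 H2] [G1 G2]; split; apply @continuous_plus; fin. Qed.

Lemma ccont_mult h g t : ccont h t -> ccont g t -> ccont (fun t => (h t * g t)%C) t.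
Proof.
intros [H1 H2] [G1 G2]; split.
- apply @continuous_minus; apply @continuous_mult; fin.
- apply @continuous_plus; apply @continuous_mult; fin.
Qed.

Lemma CI_const (c : C) a b : CI (fun _ => c) a b = ((b - a)%R * c)%C.
Proof.
unfold CI; rewrite !RInt_const. unfold scal; simpl; unfold mult; simpl.
apply Ceq; Creim; lra.
Qed.

(** Multiplication by the conjugate of the integral makes it real and nonnegative, so the real
    estimate applies without loss of a factor. *)
Lemma CI_bound h a b M : a <= b -> (forall t, ccont h t) ->
  (forall t, a <= t <= b -> Cmod (h t) <= M) -> Cmod (CI h a b) <= M * (b - a).
Proof.
intros Hab Hc HM. set (u := CI h a b).
assert (E : Cmod u ^ 2 = Re (CI (fun t => (Cconj u * h t)%C) a b)) by (rewrite CI_scal by auto; now rewrite Re_conj_self).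
assert (B : Re (CI (fun t => (Cconj u * h t)%C) a b) <= (b - a) * (Cmod u * M)).
{ eapply Rle_trans; [apply Rle_abs|].
  apply (abs_RInt_le_const (fun t => Re (Cconj u * h t)%C)); auto.
  - apply (ccont_ex_RInt (fun t => (Cconj u * h t)%C)); intros; apply ccont_mult; auto; apply ccont_const.
  - intros t Ht. eapply Rle_trans; [apply re_le_Cmod|]. rewrite Cmod_mult, Cmod_conj.
    apply Rmult_le_compat_l; fin. }
pose proof (Cmod_ge_0 u).
destruct (Req_dec (Cmod u) 0) as [-> | K].
- pose proof (Cmod_ge_0 (h a)). pose proof (HM a). nra.
- nra.
Qed.

Lemma CI_FTC h h' a b : (forall t, rderiv h t (h' t)) -> (forall t, ccont h' t) ->
  CI h' a b = (h b - h a)%C.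
Proof.
intros H H'; apply Ceq; apply is_RInt_unique.
- apply (is_RInt_derive (V := R_CompleteNormedModule) (fun t => Re (h t))); intros t _;
    [exact (proj1 (H t)) | exact (proj1 (H' t))].
- apply (is_RInt_derive (V := R_CompleteNormedModule) (fun t => Im (h t))); intros t _;
    [exact (proj2 (H t)) | exact (proj2 (H' t))].
Qed.

Lemma CI_param (h h' : R -> R -> C) a b x :
  (forall x t, rderiv (fun x => h x t) x (h' x t)) -> (forall x t, ccont2 h' x t) ->
  (forall x t, ccont (h x) t) ->
  rderiv (fun x => CI (h x) a b) x (CI (h' x) a b).
Proof.
intros H H' Hc; split.
- evar_last; [apply (is_derive_RInt_param (fun x t => Re (h x t)))|].
  + apply filter_forall; intros y t _; exists (Re (h' y t)). exact (proj1 (H y t)).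
  + intros t _. eapply continuity_2d_pt_ext; [|exact (proj1 (H' x t))].
    intros y s; symmetry; apply is_derive_unique. exact (proj1 (H y s)).
  + apply filter_forall; intros y. exact (proj1 (ccont_ex_RInt (h y) a b (Hc y))).
  + apply RInt_ext; intros t _; apply is_derive_unique. exact (proj1 (H x t)).
- evar_last; [apply (is_derive_RInt_param (fun x t => Im (h x t)))|].
  + apply filter_forall; intros y t _; exists (Im (h' y t)). exact (proj2 (H y t)).
  + intros t _. eapply continuity_2d_pt_ext; [|exact (proj2 (H' x t))].
    intros y s; symmetry; apply is_derive_unique. exact (proj2 (H y s)).
  + apply filter_forall; intros y. exact (proj2 (ccont_ex_RInt (h y) a b (Hc y))).
  + apply RInt_ext; intros t _; apply is_derive_unique. exact (proj2 (H x t)).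
Qed.

(** Every term of the series summed below lies in this class. It is closed under differentiation and
    its members are bounded on discs, so derivatives of all orders are available for Cauchy's
    estimate. *)
Inductive Ent : (C -> C) -> Prop :=
| Ent_const c : Ent (fun _ => c)
| Ent_id : Ent (fun s => s)
| Ent_exp c : Ent (fun s => Cexp (c * s)%C)
| Ent_plus f g : Ent f -> Ent g -> Ent (fun s => (f s + g s)%C)
| Ent_mult f g : Ent f -> Ent g -> Ent (fun s => (f s * g s)%C).

Lemma Ent_ext f g : (forall s, f s = g s) -> Ent f -> Ent g.
Proof. intros E H; replace g with f; auto; now apply functional_extensionality. Qed.

Lemma Ent_opp f : Ent f -> Ent (fun s => (- f s)%C).
Proof.
intros H; apply (Ent_ext (fun s => (-1 * f s)%C)); [intros; fin|].
apply Ent_mult; auto; apply Ent_const.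
Qed.

Lemma Ent_minus f g : Ent f -> Ent g -> Ent (fun s => (f s - g s)%C).
Proof. intros; apply Ent_plus; auto; now apply Ent_opp. Qed.

Lemma Ent_deriv f : Ent f -> exists f', Ent f' /\ forall s, cderiv f s (f' s).
Proof.
induction 1 as [c | | c | f g Hf [f' [F1 F2]] Hg [g' [G1 G2]] | f g Hf [f' [F1 F2]] Hg [g' [G1 G2]]].
- exists (fun _ => 0%C); split; [apply Ent_const |apply cderiv_const].
- exists (fun _ => 1%C); split; [apply Ent_const |apply cderiv_id].
- exists (fun s => (Cexp (c * s) * (c * 1))%C); split.
  + apply Ent_mult; [apply Ent_exp | apply Ent_const].
  + intros s. apply (cderiv_comp Cexp (fun s => (c * s)%C)); [|apply cderiv_cexp].
    apply cderiv_scal, cderiv_id.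
- exists (fun s => (f' s + g' s)%C); split; [now apply Ent_plus|].
  intros; now apply cderiv_plus.
- exists (fun s => (f' s * g s + f s * g' s)%C); split.
  + apply Ent_plus; apply Ent_mult; fin.
  + intros; now apply cderiv_mult.
Qed.

Lemma Ent_bounded f p d : Ent f -> exists B, forall s, Cmod (s - p)%C <= d -> Cmod (f s) <= B.
Proof.
assert (T : forall s, Cmod (s - p)%C <= d -> Cmod s <= Cmod p + d) by (intros s Hs; replace s with (p + (s - p))%C by ring; Ctri; lra).
induction 1 as [c | | c | f g Hf [B1 F] Hg [B2 G] | f g Hf [B1 F] Hg [B2 G]].
- exists (Cmod c); fin.
- eauto.
- exists (exp (Cmod c * (Cmod p + d))); intros s Hs. rewrite Cmod_Cexp.
  assert (K : Re (c * s) <= Cmod c * (Cmod p + d)) by (eapply Rle_trans; [apply Rle_abs|]; eapply Rle_trans; [apply re_le_Cmod|]; rewrite Cmod_mult; apply Rmult_le_compat_l; fin).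
  destruct (Rle_lt_or_eq_dec _ _ K) as [K' | ->]; [apply Rlt_le, exp_increasing; lra| lra].
- exists (B1 + B2); intros s Hs. specialize (F s Hs); specialize (G s Hs).
  Ctri; lra.
- exists (B1 * B2); intros s Hs.
  rewrite Cmod_mult; apply Rmult_le_compat; fin.
Qed.

Definition Eit (t : R) : C := Cexp (Ci * t)%C.

Lemma Cmod_Eit t : Cmod (Eit t) = 1.
Proof.
unfold Eit; rewrite Cmod_Cexp. replace (Re (Ci * t)) with 0; [apply exp_0|].
simpl; lra.
Qed.

Lemma Eit_eq t : Eit t = (cos t, sin t).
Proof.
unfold Eit, Cexp; simpl. replace (0 * t - 1 * 0) with 0 by ring.
replace (0 * 0 + 1 * t) with t by ring. rewrite exp_0; fin.
Qed.

Lemma Eit_0 : Eit 0 = 1%C.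
Proof. rewrite Eit_eq, cos_0, sin_0; fin. Qed.

Lemma Eit_plus a b : Eit (a + b) = (Eit a * Eit b)%C.
Proof. unfold Eit; rewrite <- Cexp_plus. rewrite RtoC_plus; fin. Qed.

Lemma Eit_2PI : Eit (2 * PI) = 1%C.
Proof. rewrite Eit_eq, cos_2PI, sin_2PI; fin. Qed.

Lemma Eit_opp t : (Eit (- t) * Eit t)%C = 1%C.
Proof. rewrite <- Eit_plus. replace (- t + t) with 0 by ring. apply Eit_0. Qed.

Lemma rderiv_Eit t : rderiv Eit t (Ci * Eit t)%C.
Proof.
apply rderiv_cexp. eapply rderiv_val; [apply rderiv_scal, rderiv_id|]. fin.
Qed.

Lemma ccont2_Eit x y : ccont2 (fun _ b => Eit b) x y.
Proof.
eapply ccont2_comp_C; [apply cderiv_cexp|].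
apply ccont2_mult; [apply ccont2_const | apply ccont2_id2].
Qed.

Lemma Ci_neq0 : Ci <> 0%C.
Proof. intros E; injection E; lra. Qed.

Lemma RtoC_neq0 (x : R) : x <> 0 -> RtoC x <> 0%C.
Proof. intros N E; apply RtoC_inj in E; lra. Qed.

Section Circle.
Variables (F F' F'' : C -> C) (p : C).
Hypothesis (HF : forall s, cderiv F s (F' s)) (HF' : forall s, cderiv F' s (F'' s)).

Lemma circle_deriv (r t : R) : rderiv (fun r : R => F (p + r * Eit t)%C) r (F' (p + r * Eit t) * Eit t)%C.
Proof.
apply (rderiv_comp_C F (fun r : R => (p + r * Eit t)%C)); auto.
eapply rderiv_val; [apply rderiv_plus; [apply rderiv_const | apply rderiv_mult;
  [apply rderiv_id | apply rderiv_const]]|]. cbv beta; fin.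
Qed.

Lemma circle_deriv_t (r t : R) :
  rderiv (fun t : R => F (p + r * Eit t)%C) t (r * Ci * (F' (p + r * Eit t) * Eit t))%C.
Proof.
eapply rderiv_val.
- apply (rderiv_comp_C F (fun t : R => (p + r * Eit t)%C)); auto.
  apply rderiv_plus; [apply rderiv_const | apply rderiv_scal, rderiv_Eit].
- fin.
Qed.

Lemma circle_cont2 (r t : R) : ccont2 (fun r t : R => F (p + r * Eit t)%C) r t.
Proof.
eapply ccont2_comp_C; auto.
apply ccont2_plus; [apply ccont2_const|].
apply ccont2_mult; [apply ccont2_id1 | apply ccont2_Eit].
Qed.
End Circle.

Lemma rderiv_zero_const h a b : a <= b -> (forall t, a <= t <= b -> rderiv h t 0) -> h b = h a.
Proof.
intros Hab H.
assert (K : Cmod (h b - h a)%C <= 0 * (b - a)) by (apply (rderiv_MVT h (fun _ => 0%C)); auto; intros; rewrite Cmod_0; lra).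
pose proof (Cmod_ge_0 (h b - h a)%C).
assert (E : (h b - h a)%C = 0%C) by (apply Cmod_eq_0; lra).
replace (h b) with ((h b - h a) + h a)%C by ring. rewrite E; fin.
Qed.

Lemma CI_Eit_period : CI Eit 0 (2 * PI) = 0%C.
Proof.
rewrite (CI_FTC (fun t => (/ Ci * Eit t)%C)).
- rewrite Eit_2PI, Eit_0; fin.
- intros t. eapply rderiv_val; [apply rderiv_scal, rderiv_Eit|]. field. apply Ci_neq0.
- intros t; eapply rderiv_ccont, rderiv_Eit.
Qed.

(** The derivative of the circle integral in the radius is the integral of $F'(p+xe^{it})e^{it}$.
    For $x\ne0$ this is a total derivative in $t$ of a periodic function, and for $x=0$ a multiple
    of $\int e^{it}$; so the integral keeps its value at radius 0. *)
Lemma mean_value (F F' F'' : C -> C) p (r : R) :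
  (forall s, cderiv F s (F' s)) -> (forall s, cderiv F' s (F'' s)) -> 0 <= r ->
  CI (fun t => F (p + r * Eit t)%C) 0 (2 * PI) = ((2 * PI)%R * F p)%C.
Proof.
intros HF HF' Hr.
assert (D : forall x, rderiv (fun x : R => CI (fun t => F (p + x * Eit t)%C) 0 (2 * PI)) x
   (CI (fun t => (F' (p + x * Eit t) * Eit t)%C) 0 (2 * PI))).
{ intros x. apply (CI_param (fun (x t : R) => F (p + x * Eit t)%C)
    (fun (x t : R) => (F' (p + x * Eit t) * Eit t)%C)).
  - now apply circle_deriv.
  - intros; apply ccont2_mult; [eapply circle_cont2; fin| apply ccont2_Eit].
  - intros y t. apply (ccont2_snd (fun (x t : R) => F (p + x * Eit t)%C)).
    eapply circle_cont2; fin. }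
assert (Z : forall x : R, CI (fun t => (F' (p + x * Eit t) * Eit t)%C) 0 (2 * PI) = 0%C).
{ intros x. destruct (Req_dec x 0) as [-> | N].
  - rewrite (CI_ext _ (fun t => (F' p * Eit t)%C)).
    + rewrite CI_scal; [rewrite CI_Eit_period; fin|].
      intros t; eapply rderiv_ccont, rderiv_Eit.
    + intros t. do 2 f_equal; fin.
  - rewrite (CI_FTC (fun t => (/ (x * Ci) * F (p + x * Eit t))%C)).
    + rewrite Eit_2PI, Eit_0; fin.
    + intros t. eapply rderiv_val; [apply rderiv_scal, circle_deriv_t; fin|].
      field; split; [apply Ci_neq0 | now apply RtoC_neq0].
    + intros t. apply (ccont2_snd (fun (x t : R) => (F' (p + x * Eit t) * Eit t)%C)).
      apply ccont2_mult; [eapply circle_cont2; fin| apply ccont2_Eit]. }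
rewrite (rderiv_zero_const (fun x : R => CI (fun t => F (p + x * Eit t)%C) 0 (2 * PI)) 0 r Hr).
- rewrite (CI_ext _ (fun t => F p)).
  + rewrite CI_const. do 2 f_equal; lra.
  + intros t; fin.
- intros t _. eapply rderiv_val; fin.
Qed.

(** The integral [K] of $F(p+xe^{it})e^{-it}$ vanishes at $x=0$ and has constant derivative $2\pi
    F'(p)$, by the mean value property of [F']. Hence $K(r)=2\pi rF'(p)$, and [K] is bounded through
    [M]. *)
Lemma cauchy_estimate (F F' F'' F3 : C -> C) p (r M : R) :
  (forall s, cderiv F s (F' s)) -> (forall s, cderiv F' s (F'' s)) ->
  (forall s, cderiv F'' s (F3 s)) -> 0 < r ->
  (forall s, Cmod (s - p)%C <= r -> Cmod (F s) <= M) -> Cmod (F' p) <= M / r.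
Proof.
intros HF HF' HF'' Hr HM.
set (K := fun x : R => CI (fun t => (F (p + x * Eit t) * Eit (- t))%C) 0 (2 * PI)).
assert (Dopp : forall t, rderiv (fun t => Eit (- t)) t (-1 * (Ci * Eit (- t)))%C) by (intros t; apply (rderiv_comp_R Eit Ropp); [apply rderiv_Eit|]; auto_derive; lra).
assert (C2opp : forall x y, ccont2 (fun _ b => Eit (- b)) x y).
{ intros x y. eapply ccont2_comp_C; [apply cderiv_cexp|].
  apply ccont2_mult; [apply ccont2_const|].
  split; [apply continuity_2d_pt_opp, continuity_2d_pt_id2 | apply (continuity_2d_pt_const x y 0)]. }
assert (D : forall x, 0 <= x -> rderiv K x ((2 * PI)%R * F' p)%C).
{ intros x Hx. eapply rderiv_val.
  - apply (CI_param (fun (x t : R) => (F (p + x * Eit t) * Eit (- t))%C)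
      (fun (x t : R) => F' (p + x * Eit t)%C)).
    + intros y t. eapply rderiv_val; [apply rderiv_mult; [eapply circle_deriv; fin| apply rderiv_const]|].
      pose proof (Eit_opp t) as E.
      transitivity (F' (p + y * Eit t) * (Eit (- t) * Eit t))%C; [fin|]. rewrite E; fin.
    + eapply circle_cont2; fin.
    + intros y t. apply (ccont2_snd (fun (x t : R) => (F (p + x * Eit t) * Eit (- t))%C)).
      apply ccont2_mult; auto; eapply circle_cont2; fin.
  - eapply mean_value; fin. }
assert (E : K r = (r * ((2 * PI)%R * F' p))%C).
{ assert (E0 : (K r - r * ((2 * PI)%R * F' p))%C = (K 0 - 0 * ((2 * PI)%R * F' p))%C).
  { apply (rderiv_zero_const (fun x : R => (K x - x * ((2 * PI)%R * F' p))%C) 0 r); [lra|].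
    intros t Ht. eapply rderiv_val; [apply rderiv_minus; [apply D; lra| apply rderiv_mult;
      [apply rderiv_id | apply rderiv_const]]|]. cbv beta; fin. }
  assert (K0 : K 0 = 0%C).
  { unfold K. rewrite (CI_ext _ (fun t => (F p * Eit (- t))%C)) by (intros; do 2 f_equal; fin).
    rewrite CI_scal by (intros; eapply rderiv_ccont, Dopp).
    rewrite (CI_FTC (fun t => (Ci * Eit (- t))%C)).
    - replace (- (2 * PI)) with (0 - 2 * PI) by ring.
      assert (Q : Eit (0 - 2 * PI) = 1%C).
      { transitivity (Eit (0 - 2 * PI) * Eit (2 * PI))%C; [rewrite Eit_2PI; fin|].
        rewrite <- Eit_plus. replace (0 - 2 * PI + 2 * PI) with 0 by ring. apply Eit_0. }
      rewrite Q, Ropp_0, Eit_0; fin.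
    - intros t. eapply rderiv_val; [apply rderiv_scal, Dopp|].
      apply Ceq; simpl; lra.
    - intros t; eapply rderiv_ccont, Dopp. }
  rewrite K0 in E0. replace (K r) with ((K r - r * ((2 * PI)%R * F' p)) + r * ((2 * PI)%R * F' p))%C by ring.
  rewrite E0; fin. }
pose proof PI_RGT_0 as HPI.
assert (B : Cmod (K r) <= M * (2 * PI - 0)).
{ apply CI_bound; [lra| |].
  - intros t. apply (ccont2_snd (fun (x t : R) => (F (p + x * Eit t) * Eit (- t))%C)).
    apply ccont2_mult; auto; eapply circle_cont2; fin.
  - intros t _. rewrite Cmod_mult, Cmod_Eit, Rmult_1_r. apply HM.
    replace (p + r * Eit t - p)%C with (r * Eit t)%C by ring.
    rewrite Cmod_mult, Cmod_Eit, Cmod_R, Rabs_pos_eq; lra. }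
rewrite E, !Cmod_mult, !Cmod_R, !Rabs_pos_eq in B by lra.
apply Rmult_le_reg_r with (r * (2 * PI)); [nra|].
replace (M / r * (r * (2 * PI))) with (M * (2 * PI - 0)) by fin. lra.
Qed.

Lemma taylor2_bound (F F' F'' : C -> C) s h M :
  (forall s, cderiv F s (F' s)) -> (forall s, cderiv F' s (F'' s)) ->
  (forall t : R, 0 <= t <= 1 -> Cmod (F'' (s + t * h)%C) <= M) ->
  Cmod (F (s + h) - F s - F' s * h)%C <= M * Cmod h * Cmod h.
Proof.
intros HF HF' HM.
set (H := fun (k : nat) (t : R) => match k with
     | O => (F (s + t * h) - F s - F' s * h * t)%C
     | 1%nat => (F' (s + t * h) * h - F' s * h)%C
     | _ => (F'' (s + t * h) * h * h)%C end).
assert (D : forall t, rderiv (fun t : R => (s + t * h)%C) t h) by (intros t; eapply rderiv_val; [apply rderiv_plus; [apply rderiv_const|apply rderiv_mult;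
   [apply rderiv_id | apply rderiv_const]]|]; cbv beta; fin).
replace (F (s + h) - F s - F' s * h)%C with (H 0%nat 1).
2:{ unfold H. replace (s + 1 * h)%C with (s + h)%C by ring. fin. }
replace (M * Cmod h * Cmod h) with (M * Cmod h * Cmod h * 1 ^ 2) by ring.
apply rderiv_taylor; [lra| | |].
- intros k t Hk Ht. destruct k as [|[|k]]; [| |lia]; unfold H.
  + eapply rderiv_val; [apply rderiv_minus; [apply rderiv_minus|]|].
    * apply (rderiv_comp_C F _ t _ _ (HF _) (D t)).
    * apply rderiv_const.
    * apply rderiv_scal, rderiv_id.
    * fin.
  + eapply rderiv_val; [apply rderiv_minus; [apply rderiv_mult|]|].
    * apply (rderiv_comp_C F' _ t _ _ (HF' _) (D t)).
    * apply rderiv_const.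
    * apply rderiv_const.
    * cbv beta; fin.
- intros k Hk. destruct k as [|[|k]]; [| |lia]; unfold H.
  + replace (s + 0 * h)%C with s by ring. fin.
  + replace (s + 0 * h)%C with s by ring. fin.
- intros t Ht; unfold H. rewrite !Cmod_mult.
  apply Rmult_le_compat_r; [pos|]. apply Rmult_le_compat_r; auto. fin.
Qed.

Definition cdiffble (f : C -> C) (s : C) : Prop := exists l, cderiv f s l.

(* Cauchy's estimate bounds the second derivatives on a smaller disc by the [M i],
   so the remainders of the first-order expansions can be summed. *)
Lemma holo_sum_deriv {I} (f : I -> C -> C) (M : I -> R) p d : 0 < d ->
  (forall i, Ent (f i)) -> rsummable M ->
  (forall i s, Cmod (s - p)%C < d -> Cmod (f i s) <= M i) ->
  forall s f', Cmod (s - p)%C < d -> (forall i, cderiv (f i) s (f' i)) ->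
  cderiv (fun s => CSum (fun i => f i s)) s (CSum f').
Proof.
intros Hd HE HM Hb s f' Hs Hf'.
(* A derivative operator obtained by description; it can be iterated because derivatives stay in
   [Ent]. Off [Ent] it is the identity. *)
set (D := fun g : C -> C => match excluded_middle_informative (Ent g) with
   | left H => proj1_sig (constructive_indefinite_description _ (Ent_deriv g H))
   | right _ => g end).
assert (HD : forall g, Ent g -> Ent (D g) /\ forall s, cderiv g s (D g s)) by (intros g Hg; unfold D; destruct (excluded_middle_informative (Ent g)); [|tauto]; destruct (constructive_indefinite_description _ _); fin).
(* A quarter of the distance to the boundary: circles of radius [r] bound the first derivatives on
   the disc of radius [2 * r] about [s], then the second derivatives on the disc of radius [r], all
   inside the given disc. *)
set (r := (d - Cmod (s - p)%C) / 4). assert (Hr : 0 < r) by pos.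
assert (T : forall a b q : C, Cmod (b - q)%C <= Cmod (b - a)%C + Cmod (a - q)%C) by (intros a b q; replace (b - q)%C with ((b - a) + (a - q))%C by ring; apply Cmod_triangle).
assert (E1 : forall i, Ent (D (f i))) by (intros; now apply HD).
assert (E2 : forall i, Ent (D (D (f i)))) by (intros; now apply HD).
assert (E3 : forall i, Ent (D (D (D (f i))))) by (intros; now apply HD).
assert (B1 : forall i z, Cmod (z - s)%C <= 2 * r -> Cmod (D (f i) z) <= M i / r).
{ intros i z Hz. eapply (cauchy_estimate (f i) (D (f i)) (D (D (f i))) (D (D (D (f i)))));
    try (intros; now apply HD); auto.
  intros w Hw. apply Hb. pose proof (T z w s). pose proof (T s w p). unfold r in *; lra. }
assert (B2 : forall i z, Cmod (z - s)%C <= r -> Cmod (D (D (f i)) z) <= M i / r / r).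
{ intros i z Hz. eapply (cauchy_estimate (D (f i)) (D (D (f i))) (D (D (D (f i)))) (D (D (D (D (f i))))));
    try (intros; now apply HD); auto.
  intros w Hw. apply B1. pose proof (T z w s). lra. }
assert (S0 : forall z, Cmod (z - p)%C < d -> csummable (fun i => f i z)) by (intros z Hz; apply csummable_le with M; fin).
assert (S1 : csummable (fun i => D (f i) s)).
{ apply csummable_le with (fun i => / r * M i).
  - intros i. eapply Rle_trans; [apply B1|].
    + rewrite Cmod_diag; lra.
    + lra.
  - apply rsummable_scal; auto. pos. }
destruct HM as [HM0 [MM HMM]].
assert (Ef : f' = fun i => D (f i) s) by (funext i; apply (cderiv_unique (f i) s); auto; now apply HD).
subst f'. intros eps He.
assert (HMMp : 0 <= MM) by (apply (HMM nil); constructor).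
exists (Rmin r (eps / (MM / r / r + 1))). 
assert (P : 0 < MM / r / r + 1) by nra.
split; [apply Rmin_pos; fin|].
intros h Hh. pose proof (Cmod_ge_0 h) as Hh0.
assert (Hh1 : Cmod h < r) by (eapply Rlt_le_trans; [exact Hh | apply Rmin_l]).
assert (Hh2 : Cmod h < eps / (MM / r / r + 1)) by (eapply Rlt_le_trans; [exact Hh | apply Rmin_r]).
assert (Hsh : Cmod (s + h - p)%C < d).
{ pose proof (T s (s + h)%C p). replace (s + h - s)%C with h in H by ring. unfold r in *; lra. }
assert (HS : has_sum (fun i => (f i (s + h) + -1 * f i s + - h * D (f i) s)%C)
   (CSum (fun i => f i (s + h)%C) + -1 * CSum (fun i => f i s) + - h * CSum (fun i => D (f i) s))%C).
{ apply has_sum_plus; [apply has_sum_plus|].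
  - apply csummable_has_sum; fin.
  - apply has_sum_scal, csummable_has_sum; fin.
  - apply has_sum_scal, csummable_has_sum; fin. }
apply Rle_trans with (MM / r / r * Cmod h * Cmod h).
- replace (CSum (fun i => f i (s + h)%C) - CSum (fun i => f i s) - CSum (fun i => D (f i) s) * h)%C
   with (CSum (fun i => f i (s + h)%C) + -1 * CSum (fun i => f i s) + - h * CSum (fun i => D (f i) s))%C by ring.
  eapply has_sum_bound; [exact HS|].
  intros l Nl. apply Rle_trans with (rsum (fun i => (/ r * / r * Cmod h * Cmod h) * M i) l).
  + apply rsum_le_in. intros i _.
    replace (f i (s + h) + -1 * f i s + - h * D (f i) s)%C
      with (f i (s + h) - f i s - D (f i) s * h)%C by ring.
    eapply Rle_trans; [eapply (taylor2_bound (f i) (D (f i)) (D (D (f i)))); try (intros; now apply HD)|].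
    * intros t Ht. apply B2. replace (s + t * h - s)%C with (t * h)%C by ring.
      rewrite Cmod_mult, Cmod_R, Rabs_pos_eq by lra. nra.
    * lra.
  + rewrite rsum_scal.
    replace (MM / r / r * Cmod h * Cmod h) with ((/ r * / r * Cmod h * Cmod h) * MM) by lra.
    apply Rmult_le_compat_l; auto. pos.
- apply Rmult_le_compat_r; auto.
  apply Rle_trans with ((MM / r / r + 1) * (eps / (MM / r / r + 1)));
    [|right; revert P; generalize (MM / r / r + 1); intros; fin].
  nra.
Qed.

Lemma holo_sum {I} (f : I -> C -> C) (M : I -> R) p d : 0 < d ->
  (forall i, Ent (f i)) -> rsummable M ->
  (forall i s, Cmod (s - p)%C < d -> Cmod (f i s) <= M i) ->
  forall s, Cmod (s - p)%C < d -> cdiffble (fun s => CSum (fun i => f i s)) s.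
Proof.
intros Hd HE HM Hb s Hs.
destruct (choice (fun i l => cderiv (f i) s l)) as [f' Hf'].
{ intros i. destruct (Ent_deriv (f i) (HE i)) as (g & _ & G). eauto. }
exists (CSum f'). now apply (holo_sum_deriv f M p d).
Qed.

(** A majorant may fail at finitely many indices: each exceptional summand is bounded on the disc by
    itself, and this bound is added to the majorant at its single index. It covers the finitely many
    small eigenvalues, where asymptotic estimates are false. *)
Lemma holo_sum_almost {I} (f : I -> C -> C) (M : I -> R) (l : list I) p d : 0 < d ->
  (forall i, Ent (f i)) -> rsummable M ->
  (forall i s, ~ In i l -> Cmod (s - p)%C < d -> Cmod (f i s) <= M i) ->
  exists M', rsummable M' /\ (forall i s, Cmod (s - p)%C < d -> Cmod (f i s) <= M' i).
Proof.
intros Hd HE HM; revert f HE; induction l as [|j l IH]; intros f HE Hb.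
- eauto.
- destruct (IH (fun i => if dec i j then fun _ => 0%C else f i)) as (M' & S' & H').
  + intros i; destruct (dec i j); auto; apply Ent_const.
  + intros i s Hi Hs; destruct (dec i j).
    * rewrite Cmod_0; apply HM.
    * apply Hb; auto. intros [K | K]; fin.
  + destruct (Ent_bounded (f j) p d (HE j)) as [B HB].
    exists (fun i => M' i + if dec i j then Rabs B else 0); split.
    * apply rsummable_plus; auto. split.
      -- intros i; destruct (dec i j); fin.
      -- exists (Rabs B). intros m Nm.
         assert (K : forall m, NoDup m -> rsum (fun i => if dec i j then Rabs B else 0) m <= Rabs B /\
             (~ In j m -> rsum (fun i => if dec i j then Rabs B else 0) m = 0)).
         { clear; induction m as [|i m IH]; intros N; simpl.
           - split; fin.
           - inversion N. destruct (IH H2) as [A1 A2], (dec i j) as [-> | Nij].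
             + split; [rewrite A2; fin| tauto].
             + split; [lra|]. intros K. rewrite A2; fin. }
         now apply K.
    * intros i s Hs. specialize (H' i s Hs). destruct (dec i j) as [-> | N].
      -- rewrite Cmod_0 in H'. assert (Cmod (f j s) <= B) by (apply HB; lra).
         pose proof (Rle_abs B); lra.
      -- lra.
Qed.

Definition cholo (f : C -> C) (p : C) : Prop :=
  exists d, 0 < d /\ forall s, Cmod (s - p)%C < d -> cdiffble f s.

Lemma cholo_holomorphic f p : cholo f p -> holomorphic_at f p.
Proof.
intros (d & D & H); exists d; split; auto; intros s Hs.
destruct (H s Hs) as [l Hl]; exists l; now apply cderiv_is_derive.
Qed.

Lemma cholo_plus f g p : cholo f p -> cholo g p -> cholo (fun s => (f s + g s)%C) p.
Proof.
intros (d & D & H) (d' & D' & H'); exists (Rmin d d'); split; [now apply Rmin_pos|].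
intros s Hs. destruct (H s (Rlt_le_trans _ _ _ Hs (Rmin_l _ _))) as [l Hl],
(H' s (Rlt_le_trans _ _ _ Hs (Rmin_r _ _))) as [m Hm].
eexists; apply cderiv_plus; eauto.
Qed.

Lemma cholo_mult f g p : cholo f p -> cholo g p -> cholo (fun s => (f s * g s)%C) p.
Proof.
intros (d & D & H) (d' & D' & H'); exists (Rmin d d'); split; [now apply Rmin_pos|].
intros s Hs. destruct (H s (Rlt_le_trans _ _ _ Hs (Rmin_l _ _))) as [l Hl],
(H' s (Rlt_le_trans _ _ _ Hs (Rmin_r _ _))) as [m Hm].
eexists; apply cderiv_mult; eauto.
Qed.

Lemma cholo_ext f g p : (forall s, f s = g s) -> cholo f p -> cholo g p.
Proof. intros E H; replace g with f; auto; now apply functional_extensionality. Qed.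

Lemma cholo_Ent f p : Ent f -> cholo f p.
Proof.
intros H; destruct (Ent_deriv f H) as (f' & _ & H').
exists 1; split; [lra|]; eexists; fin.
Qed.

Lemma cholo_inv f p : cholo f p -> f p <> 0%C -> cholo (fun s => (/ f s)%C) p.
Proof.
intros (d & D & H) N.
destruct (H p) as [l Hl].
{ rewrite Cmod_diag; lra. }
destruct (cderiv_cont f p l Hl (Cmod (f p))) as (d' & D' & K); [now apply Cmod_gt_0|].
exists (Rmin d d'); split; [now apply Rmin_pos|]. intros s Hs.
destruct (H s (Rlt_le_trans _ _ _ Hs (Rmin_l _ _))) as [m Hm].
eexists; apply cderiv_inv; [exact Hm|].
intros E. specialize (K (s - p)%C (Rlt_le_trans _ _ _ Hs (Rmin_r _ _))).
replace (p + (s - p))%C with s in K by ring. rewrite E in K.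
replace (0 - f p)%C with (- f p)%C in K by ring. rewrite Cmod_opp in K; lra.
Qed.

Lemma cholo_shift f (c p : C) : cholo f (p + c)%C -> cholo (fun s => f (s + c)%C) p.
Proof.
intros (d & D & H); exists d; split; auto; intros s Hs.
destruct (H (s + c)%C) as [l Hl].
{ replace (s + c - (p + c))%C with (s - p)%C by ring; lra. }
exists (l * 1)%C. apply (cderiv_comp f (fun s => (s + c)%C)); auto.
eapply cderiv_val; [apply cderiv_plus; [apply cderiv_id | apply cderiv_const]|]; fin.
Qed.

Definition cmero (f : C -> C) (p : C) : Prop :=
  exists n g, cholo g p /\ exists d, 0 < d /\
    forall s, s <> p -> Cmod (s - p)%C < d -> ((s - p) ^ n * f s)%C = g s.

Lemma cmero_meromorphic f p : cmero f p -> meromorphic_at f p.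
Proof.
intros (n & g & G & d & D & H); exists n, g, d; split; auto. now apply cholo_holomorphic.
Qed.

Lemma cmero_cholo f p : cholo f p -> cmero f p.
Proof.
exists 0%nat, f; split; auto; exists 1; split; intros; fin.
Qed.

Lemma cholo_pow p n q : cholo (fun s => ((s - p) ^ n)%C) q.
Proof.
induction n as [|n IH]; simpl.
- apply cholo_Ent, Ent_const.
- apply cholo_mult; auto. apply cholo_Ent, Ent_minus; [apply Ent_id | apply Ent_const].
Qed.

Lemma cmero_plus f g p : cmero f p -> cmero g p -> cmero (fun s => (f s + g s)%C) p.
Proof.
intros (n & u & U & d & D & H) (m & v & V & d' & D' & H').
exists (n + m)%nat, (fun s => ((s - p) ^ m * u s + (s - p) ^ n * v s)%C); split.
- apply cholo_plus; apply cholo_mult; auto; apply cholo_pow.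
- exists (Rmin d d'); split; [now apply Rmin_pos|]. intros s Ns Hs.
  rewrite <- H, <- H'; auto.
  + rewrite Cpow_add_r; fin.
  + eapply Rlt_le_trans; [exact Hs | apply Rmin_r].
  + eapply Rlt_le_trans; [exact Hs | apply Rmin_l].
Qed.

Lemma cmero_mult f g p : cmero f p -> cmero g p -> cmero (fun s => (f s * g s)%C) p.
Proof.
intros (n & u & U & d & D & H) (m & v & V & d' & D' & H').
exists (n + m)%nat, (fun s => (u s * v s)%C); split.
- now apply cholo_mult.
- exists (Rmin d d'); split; [now apply Rmin_pos|]. intros s Ns Hs.
  rewrite <- H, <- H'; auto.
  + rewrite Cpow_add_r; fin.
  + eapply Rlt_le_trans; [exact Hs | apply Rmin_r].
  + eapply Rlt_le_trans; [exact Hs | apply Rmin_l].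
Qed.

Lemma cmero_inv_linear q p : cmero (fun s => (/ (s - q))%C) p.
Proof.
destruct (classic (p = q)) as [-> | N].
- exists 1%nat, (fun _ => 1%C); split; [apply cholo_Ent, Ent_const|].
  exists 1; split; [lra|]; intros s Ns _. field.
  intros E; apply Ns. replace s with ((s - q) + q)%C by ring. rewrite E; fin.
- apply cmero_cholo, (cholo_inv (fun s => (s - q)%C)).
  + apply cholo_Ent, Ent_minus; [apply Ent_id | apply Ent_const].
  + intros E; apply N. replace p with ((p - q) + q)%C by ring. rewrite E; fin.
Qed.

(** * Removable singularities and complex powers *)

Lemma taylor3_bound (F F' F'' F3 : C -> C) s h M :
  (forall s, cderiv F s (F' s)) -> (forall s, cderiv F' s (F'' s)) ->
  (forall s, cderiv F'' s (F3 s)) ->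
  (forall t : R, 0 <= t <= 1 -> Cmod (F3 (s + t * h)%C) <= M) ->
  Cmod (F (s + h) - F s - F' s * h - F'' s * h * h / 2)%C <= M * Cmod h * Cmod h * Cmod h.
Proof.
intros HF HF' HF'' HM.
set (H := fun (k : nat) (t : R) => match k with
     | O => (F (s + t * h) - F s - F' s * h * t - F'' s * h * h / 2 * (t * t))%C
     | 1%nat => (F' (s + t * h) * h - F' s * h - F'' s * h * h * t)%C
     | 2%nat => (F'' (s + t * h) * h * h - F'' s * h * h)%C
     | _ => (F3 (s + t * h) * h * h * h)%C end).
assert (D : forall t, rderiv (fun t : R => (s + t * h)%C) t h) by (intros t; eapply rderiv_val; [apply rderiv_plus; [apply rderiv_const|apply rderiv_mult;
   [apply rderiv_id | apply rderiv_const]]|]; cbv beta; fin).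
replace (F (s + h) - F s - F' s * h - F'' s * h * h / 2)%C with (H 0%nat 1).
2:{ unfold H. replace (s + 1 * h)%C with (s + h)%C by ring. fin. }
replace (M * Cmod h * Cmod h * Cmod h) with (M * Cmod h * Cmod h * Cmod h * 1 ^ 3) by ring.
apply rderiv_taylor; [lra| | |].
- intros k t Hk Ht. destruct k as [|[|[|k]]]; [| | |lia]; unfold H.
  + eapply rderiv_val; [apply rderiv_minus; [apply rderiv_minus; [apply rderiv_minus|]|]|].
    * apply (rderiv_comp_C F _ t _ _ (HF _) (D t)).
    * apply rderiv_const.
    * apply rderiv_scal, rderiv_id.
    * apply rderiv_scal, rderiv_mult; apply rderiv_id.
    * fin.
  + eapply rderiv_val; [apply rderiv_minus; [apply rderiv_minus; [apply rderiv_mult|]|]|].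
    * apply (rderiv_comp_C F' _ t _ _ (HF' _) (D t)).
    * apply rderiv_const.
    * apply rderiv_const.
    * apply rderiv_scal, rderiv_id.
    * cbv beta; fin.
  + eapply rderiv_val; [apply rderiv_minus; [apply rderiv_mult; [apply rderiv_mult|]|]|].
    * apply (rderiv_comp_C F'' _ t _ _ (HF'' _) (D t)).
    * apply rderiv_const.
    * apply rderiv_const.
    * apply rderiv_const.
    * cbv beta; fin.
- assert (E : (s + 0 * h)%C = s) by ring.
  intros k Hk. destruct k as [|[|[|k]]]; unfold H; rewrite E; fin.
- intros t Ht; unfold H. rewrite !Cmod_mult.
  repeat (apply Rmult_le_compat_r; [apply Cmod_ge_0|]). fin.
Qed.

(** Removable singularity: Taylor expansion to third order at the zero [p] shows that the quotient,
    extended by $f'(p)$, has derivative $f''(p)/2$ there. *)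
Lemma cderiv_quotient_at (f : C -> C) p : Ent f -> f p = 0%C -> forall f' : C -> C,
  (forall s, cderiv f s (f' s)) ->
  cdiffble (fun s => if dec s p then f' p else (f s / (s - p))%C) p.
Proof.
intros Hf Hp f' Hf'.
destruct (Ent_deriv f Hf) as (g1 & G1 & K1), (Ent_deriv g1 G1) as (g2 & G2 & K2),
(Ent_deriv g2 G2) as (g3 & G3 & K3).
assert (E1 : f' p = g1 p) by exact (cderiv_unique _ _ _ _ (Hf' p) (K1 p)).
destruct (Ent_bounded g3 p 1 G3) as [B HB].
assert (HB0 : 0 <= B) by (eapply Rle_trans; [apply Cmod_ge_0 | apply (HB p)]; rewrite Cmod_diag; lra).
exists (g2 p / 2)%C. intros eps He. exists (Rmin 1 (eps / (B + 1))).
split; [apply Rmin_pos; fin|].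
intros h Hh.
assert (H1 : Cmod h < 1) by (eapply Rlt_le_trans; [exact Hh | apply Rmin_l]).
assert (H2 : Cmod h < eps / (B + 1)) by (eapply Rlt_le_trans; [exact Hh | apply Rmin_r]).
destruct (dec p p) as [_ | N]; [|tauto].
destruct (dec (p + h)%C p) as [E | N].
- assert (E0 : h = 0%C) by (replace h with ((p + h) - p)%C by ring; rewrite E; fin).
  rewrite E0. replace (f' p - f' p - g2 p / 2 * 0)%C with (RtoC 0) by ring. rewrite Cmod_0; lra.
- assert (Nh : h <> 0%C) by (intros E; apply N; rewrite E; fin).
  assert (Hh0 : 0 < Cmod h) by now apply Cmod_gt_0.
  replace (f (p + h) / (p + h - p) - f' p - g2 p / 2 * h)%C
    with ((f (p + h) - f p - g1 p * h - g2 p * h * h / 2) / h)%C.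
  2:{ rewrite Hp, E1. field. intros K; apply Nh.
      replace h with (p + h - p)%C by ring. fin. }
  rewrite Cmod_div by auto.
  apply Rmult_le_reg_r with (Cmod h); auto. unfold Rdiv; rewrite Rmult_assoc, Rinv_l, Rmult_1_r by lra.
  eapply Rle_trans; [apply (taylor3_bound f g1 g2 g3 p h B); auto|].
  + intros t Ht. apply HB. replace (p + t * h - p)%C with (t * h)%C by ring.
    rewrite Cmod_mult, Cmod_R, Rabs_pos_eq by lra. nra.
  + apply Rmult_le_compat_r; [lra|]. apply Rmult_le_compat_r; [lra|].
    apply Rle_trans with ((B + 1) * (eps / (B + 1))); [|right; fin].
    nra.
Qed.

(** At a simple zero, $f(s)=(s-p)g(s)$ with $g$ holomorphic and $g(p)\ne0$, so the reciprocal has a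
    pole of order one. *)
Lemma cmero_inv_Ent f p : Ent f -> (forall f', (forall s, cderiv f s (f' s)) ->
  f p = 0%C -> f' p <> 0%C) -> cmero (fun s => (/ f s)%C) p.
Proof.
intros Hf Hs.
destruct (classic (f p = 0%C)) as [E | N].
2:{ apply cmero_cholo, cholo_inv; auto. now apply cholo_Ent. }
destruct (Ent_deriv f Hf) as (f' & _ & Hf').
set (g := fun s => if dec s p then f' p else (f s / (s - p))%C).
assert (Hg : cholo g p).
{ exists 1; split; [lra|]. intros s _. destruct (classic (s = p)) as [-> | N].
  - now apply cderiv_quotient_at.
  - assert (Hsp : (s - p)%C <> 0%C) by (intros K; apply N; replace s with ((s - p) + p)%C by ring; rewrite K; fin).
    eexists. apply (cderiv_ext_loc (fun s => (f s * / (s - p))%C) g s _ (Cmod (s - p)%C)).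
    + now apply Cmod_gt_0.
    + intros s' H'. unfold g. destruct (dec s' p) as [-> | _]; auto.
      replace (p - s)%C with (- (s - p))%C in H' by ring. rewrite Cmod_opp in H'; lra.
    + apply cderiv_mult; auto. apply cderiv_inv; auto.
      apply cderiv_plus; [apply cderiv_id | apply cderiv_const]. }
exists 1%nat, (fun s => (/ g s)%C); split.
- apply cholo_inv; auto. unfold g. destruct (dec p p); fin.
- destruct Hg as (d & D & _). exists d; split; auto. intros s Ns _.
  unfold g. destruct (dec s p) as [K | _]; [tauto|].
  assert (Hsp : (s - p)%C <> 0%C) by (intros K; apply Ns; replace s with ((s - p) + p)%C by ring; rewrite K; fin).
  (* The identity is required at every [s] other than [p] in the disc. At another zero of [f] both
     sides are 0, since [/ 0] evaluates to 0. *)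
  destruct (classic (f s = 0%C)) as [F0 | F0].
  + rewrite F0. unfold Cdiv. rewrite Cmult_0_l.
    assert (I0 : (/ 0)%C = 0%C) by (apply Ceq; simpl; lra).
    rewrite I0; fin.
  + field; fin.
Qed.

(** The power $x^{-s}$, with the sign convention of Dirichlet series and of [eta_term]. *)
Definition cpow (x : R) (s : C) : C := Cexp (- s * RtoC (ln x))%C.

Lemma Cmod_cpow x s : Cmod (cpow x s) = Rpower x (- Re s).
Proof. unfold cpow; rewrite Cmod_Cexp; unfold Rpower; f_equal; Creim; lra. Qed.

Lemma cpow_plus x s t : cpow x (s + t) = (cpow x s * cpow x t)%C.
Proof. unfold cpow; rewrite <- Cexp_plus; fin. Qed.

Lemma cpow_mult x y s : 0 < x -> 0 < y -> cpow (x * y) s = (cpow x s * cpow y s)%C.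
Proof.
intros; unfold cpow; rewrite ln_mult, RtoC_plus, <- Cexp_plus by auto; fin.
Qed.

Lemma cpow_1 x : 0 < x -> cpow x 1 = (/ x)%C.
Proof.
intros; unfold cpow. replace (- (1) * ln x)%C with (- RtoC (ln x))%C by ring.
rewrite <- RtoC_opp, Cexp_RtoC, exp_Ropp, exp_ln by auto. now rewrite RtoC_inv by lra.
Qed.

Lemma cpow_S x s : 0 < x -> cpow x (s + 1) = (cpow x s * / x)%C.
Proof. intros; rewrite cpow_plus, cpow_1; fin. Qed.

Lemma cpow_m1 x s : 0 < x -> cpow x (s - 1) = (cpow x s * x)%C.
Proof.
intros H; replace s with (s - 1 + 1)%C at 2 by ring. rewrite cpow_S by auto.
field. apply RtoC_neq0; lra.
Qed.

Lemma Ent_cpow x (f : C -> C) (c d : C) : (forall s, f s = (c * s + d)%C) ->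
  Ent (fun s => cpow x (f s)).
Proof.
intros E. apply (Ent_ext (fun s => (Cexp ((- c * ln x) * s) * Cexp (- d * ln x))%C)).
- intros s; rewrite E; unfold cpow; rewrite <- Cexp_plus; fin.
- apply Ent_mult; [apply Ent_exp | apply Ent_const].
Qed.

Lemma Ent_affine (f : C -> C) (c d : C) : (forall s, f s = (c * s + d)%C) -> Ent f.
Proof.
intros E; apply (Ent_ext (fun s => (c * s + d)%C)); auto.
apply Ent_plus; [apply Ent_mult; [apply Ent_const | apply Ent_id] | apply Ent_const].
Qed.

Lemma rderiv_cpow s x : 0 < x -> rderiv (fun x => cpow x s) x (- s * cpow x (s + 1))%C.
Proof.
intros H; eapply rderiv_val.
- apply rderiv_cexp, rderiv_scal, rderiv_RtoC. apply is_derive_Reals, derivable_pt_lim_ln; lra.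
- rewrite cpow_S, RtoC_inv by lra. unfold cpow; fin.
Qed.

Lemma rderiv_cpow_shift s x t : 0 < x + t ->
  rderiv (fun t => cpow (x + t) s) t (- s * cpow (x + t) (s + 1))%C.
Proof.
intros H. eapply rderiv_val.
- apply (rderiv_comp_R (fun x => cpow x s) (fun t => x + t) t (- s * cpow (x + t) (s + 1))%C 1).
  + apply rderiv_cpow; lra.
  + auto_derive; lra.
- fin.
Qed.

Lemma Rpower_decr x y e : 0 < x <= y -> 0 <= e -> Rpower y (- e) <= Rpower x (- e).
Proof.
intros [Hx Hy] He. rewrite !Rpower_Ropp.
apply Rinv_le_contravar; [pos|]. apply Rle_Rpower_l; lra.
Qed.

(** A majorant valid on a whole vertical strip: the extreme exponents dominate for [x] above 1 and
    below 1 respectively, and their sum covers both. *)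
Lemma Rpower_box x u v e : u <= e <= v -> Rpower x (- e) <= Rpower x (- u) + Rpower x (- v).
Proof.
intros H. unfold Rpower.
pose proof (exp_pos (- u * ln x)). pose proof (exp_pos (- v * ln x)).
destruct (Rle_dec 0 (ln x)).
- assert (exp (- e * ln x) <= exp (- u * ln x)); [|lra].
  destruct (Rle_lt_or_eq_dec (- e * ln x) (- u * ln x)) as [K | ->]; [nra| |lra].
  now apply Rlt_le, exp_increasing.
- assert (exp (- e * ln x) <= exp (- v * ln x)); [|lra].
  destruct (Rle_lt_or_eq_dec (- e * ln x) (- v * ln x)) as [K | ->]; [nra| |lra].
  now apply Rlt_le, exp_increasing.
Qed.

Lemma Rpower_pos x e : 0 < Rpower x e. Proof. pos. Qed.

Lemma rsummable_telescope (a V : nat -> R) : (forall n, 0 <= a n) -> (forall n, 0 <= V n) ->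
  (forall n, a n <= V n - V (S n)) -> rsummable a.
Proof.
intros Ha HV H; apply rsummable_ex_series; auto.
assert (Hi : forall n, sum_n a n <= sum_n a (S n)) by (intros n; rewrite sum_Sn; unfold plus; simpl; specialize (Ha (S n)); lra).
destruct (ex_finite_lim_seq_incr (sum_n a) (V 0%nat) Hi) as [l Hl].
- intros n. assert (K : sum_n a n <= V 0%nat - V (S n)) by (induction n as [|n IH]; [rewrite sum_O; fin|]; rewrite sum_Sn; unfold plus; simpl; specialize (H (S n)); lra).
  specialize (HV (S n)); lra.
- exists l; fin.
Qed.

Lemma rsummable_shift (a : nat -> R) : (forall n, 0 <= a n) ->
  rsummable (fun n => a (S n)) -> rsummable a.
Proof.
intros Ha H; apply rsummable_ex_series; auto.
apply (ex_series_incr_1 a). now apply ex_series_rsummable.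
Qed.

(** Integral comparison by telescoping: the antiderivative $x^{1-e}/(e-1)$ drops by at least the
    next term over each unit step. The first term is split off by a shift. *)
Lemma pseries_summable q e : 0 < q -> 1 < e -> rsummable (fun n => Rpower (INR n + q) (- e)).
Proof.
intros Hq He. apply rsummable_shift; [intros; fin|].
apply rsummable_telescope with (fun n => / (e - 1) * Rpower (INR n + q) (- (e - 1))).
- intros; fin.
- intros; fin.
- intros n. pose proof (pos_INR n). rewrite S_INR.
  set (x := INR n + q). replace (INR n + 1 + q) with (x + 1) by (unfold x; lra).
  assert (Hx : 0 < x) by (unfold x; lra).
  destruct (MVT_gen (fun x => Rpower x (- (e - 1))) x (x + 1)
     (fun x => - (e - 1) * Rpower x (- (e - 1) - 1))) as (c & Hc & E).
  + intros y Hy. rewrite Rmin_left in Hy by lra.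
    apply is_derive_Reals, derivable_pt_lim_power; lra.
  + intros y Hy. rewrite Rmin_left in Hy by lra. apply continuity_pt_filterlim,
    (@ex_derive_continuous R_AbsRing R_NormedModule (fun x => Rpower x (- (e - 1)))).
    eexists; apply is_derive_Reals, derivable_pt_lim_power; lra.
  + rewrite Rmin_left, Rmax_right in Hc by lra.
    replace (- (e - 1) - 1) with (- e) in E by ring.
    assert (Rpower (x + 1) (- e) <= Rpower c (- e)) by (apply Rpower_decr; lra).
    replace (/ (e - 1) * Rpower x (- (e - 1)) - / (e - 1) * Rpower (x + 1) (- (e - 1)))
      with (- / (e - 1) * (Rpower (x + 1) (- (e - 1)) - Rpower x (- (e - 1)))) by ring.
    rewrite E. replace (- / (e - 1) * (- (e - 1) * Rpower c (- e) * (x + 1 - x)))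
      with (Rpower c (- e)) by fin. lra.
Qed.

(* [w - 1] times the error of the trapezoidal rule with derivative correction
   for [x ^ (- w)] on [[x, x + 1]]. *)
Definition em_err (x : R) (w : C) : C :=
  (cpow x (w - 1) - cpow (x + 1) (w - 1) - (w - 1) / 2 * (cpow x w + cpow (x + 1) w)
   - (w - 1) * w / 12 * (cpow (x + 1) (w + 1) - cpow x (w + 1)))%C.

Definition em_coef (w : C) : C := ((w - 1) * w * (w + 1) * (w + 2) * (w + 3) / 12)%C.
Lemma RtoC_2 : RtoC 2 <> 0%C. Proof. apply RtoC_neq0; lra. Qed.

(** Let the interval have length [t]. The error, as a function of [t], vanishes at 0 with its first
    two derivatives, and its third derivative is $\mathrm{em\_coef}(w)\,t^2(x+t)^{-w-4}$. The gain
    of four powers of [x] carries the Hurwitz continuation down to $\mathrm{Re}\,w>-3$. *)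
Lemma em_err_bound x w : 0 < x -> 0 <= Re w + 4 ->
  Cmod (em_err x w) <= Cmod (em_coef w) * Rpower x (- (Re w + 4)).
Proof.
intros Hx Hw.
set (P := fun (k : R) (t : R) => cpow (x + t) (w + k)%C).
assert (DP : forall k t, 0 <= t -> rderiv (P k) t (- (w + k) * P (k + 1)%R t)%C).
{ intros k t Ht. eapply rderiv_val; [apply rderiv_cpow_shift; lra|].
  unfold P. replace (w + (k + 1)%R)%C with (w + k + 1)%C by (rewrite RtoC_plus; fin).
  auto. }
set (H := fun (k : nat) (t : R) => match k with
  | O => (P (-1) 0 - P (-1) t - (w - 1) / 2 * t * (P 0 0 + P 0 t)
          - (w - 1) * w / 12 * (t * t) * (P 1 t - P 1 0))%C
  | 1%nat => ((w - 1) / 2 * (P 0 t - P 0 0) + (w - 1) * w / 2 * t * P 1 t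
          - (w - 1) * w / 6 * t * (P 1 t - P 1 0) + (w - 1) * w * (w + 1) / 12 * (t * t) * P 2 t)%C
  | 2%nat => (- (w - 1) * w / 6 * (P 1 t - P 1 0) - (w - 1) * w * (w + 1) / 6 * t * P 2 t
          - (w - 1) * w * (w + 1) * (w + 2) / 12 * (t * t) * P 3 t)%C
  | _ => (em_coef w * (t * t) * P 4 t)%C end).
assert (E : em_err x w = H 0%nat 1).
{ unfold H, em_err, P. rewrite !Rplus_0_r.
  replace (w + (-1)%R)%C with (w - 1)%C by ring.
  replace (w + 0)%C with w by ring. fin. }
assert (Tt : forall t, rderiv (fun t : R => (t * t)%C) t (2 * t)%C).
{ intros t; eapply rderiv_val; [apply rderiv_mult; apply rderiv_id|]. fin. }
rewrite E. replace (Cmod (em_coef w) * Rpower x (- (Re w + 4)))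
  with (Cmod (em_coef w) * Rpower x (- (Re w + 4)) * 1 ^ 3) by ring.
apply rderiv_taylor; [lra| | |].
- intros k t Hk Ht.
  pose proof (DP (-1) t ltac:(lra)) as D0. pose proof (DP 0 t ltac:(lra)) as D1.
  pose proof (DP 1 t ltac:(lra)) as D2. pose proof (DP 2 t ltac:(lra)) as D3.
  pose proof (DP 3 t ltac:(lra)) as D4.
  replace (-1 + 1) with 0 in D0 by ring. replace (0 + 1) with 1 in D1 by ring.
  replace (1 + 1) with 2 in D2 by ring. replace (2 + 1) with 3 in D3 by ring.
  replace (3 + 1) with 4 in D4 by ring.
  destruct k as [|[|[|k]]]; [| | |lia]; unfold H.
  + eapply rderiv_val; [apply rderiv_minus; [apply rderiv_minus; [apply rderiv_minus;
      [apply rderiv_const | exact D0]|]|]|].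
    * apply rderiv_mult; [apply rderiv_scal, rderiv_id | apply rderiv_plus; [apply rderiv_const | exact D1]].
    * apply rderiv_mult; [apply rderiv_scal, Tt | apply rderiv_minus; [exact D2 | apply rderiv_const]].
    * replace (w + (-1)%R)%C with (w - 1)%C by ring. fin.
  + eapply rderiv_val; [apply rderiv_plus; [apply rderiv_minus; [apply rderiv_plus|]|]|].
    * apply rderiv_scal, rderiv_minus; [exact D1 | apply rderiv_const].
    * apply rderiv_mult; [apply rderiv_scal, rderiv_id | exact D2].
    * apply rderiv_mult; [apply rderiv_scal, rderiv_id | apply rderiv_minus; [exact D2 | apply rderiv_const]].
    * apply rderiv_mult; [apply rderiv_scal, Tt | exact D3].
    * cbv beta. fin.
  + eapply rderiv_val; [apply rderiv_minus; [apply rderiv_minus|]|].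
    * apply rderiv_scal, rderiv_minus; [exact D2 | apply rderiv_const].
    * apply rderiv_mult; [apply rderiv_scal, rderiv_id | exact D3].
    * apply rderiv_mult; [apply rderiv_scal, Tt | exact D4].
    * unfold em_coef. fin.
- intros k Hk. destruct k as [|[|[|k]]]; unfold H; fin.
- intros t Ht. unfold H, P. rewrite !Cmod_mult, Cmod_cpow, !Cmod_R.
  rewrite Rmult_assoc. apply Rmult_le_compat_l; [pos|].
  rewrite Rabs_pos_eq by lra.
  assert (Rpower (x + t) (- (Re w + 4)) <= Rpower x (- (Re w + 4))) by (apply Rpower_decr; lra).
  pose proof (Rpower_pos (x + t) (- (Re w + 4))).
  apply Rle_trans with (1 * Rpower (x + t) (- (Re w + 4))); [|lra].
  apply Rmult_le_compat_r; [lra|]. nra.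
Qed.

(** * Hurwitz-type sums *)

Lemma has_sum_telescope (U : nat -> C) : csummable (fun n => (U n - U (S n))%C) ->
  (forall eps, 0 < eps -> exists N, forall n, (N <= n)%nat -> Cmod (U n) < eps) ->
  has_sum (fun n => (U n - U (S n))%C) (U 0%nat).
Proof.
intros Hs Hl. set (S0 := CSum (fun n => (U n - U (S n))%C)).
assert (E : forall n, lsum (fun n => (U n - U (S n))%C) (seq 0 (S n)) = (U 0%nat - U (S n))%C) by (induction n as [|n IH]; [simpl; fin|]; rewrite seq_S, lsum_app, IH; simpl; fin).
replace (U 0%nat) with S0; [now apply csummable_has_sum|].
apply NNPP; intros N. set (e := Cmod (S0 - U 0%nat)%C).
assert (He : 0 < e).
{ apply Cmod_gt_0. intros K; apply N. replace S0 with ((S0 - U 0%nat) + U 0%nat)%C by ring.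
  rewrite K; fin. }
destruct (csummable_tail _ _ (fun n => Rle_refl _) Hs (e / 4)) as (l0 & N0 & H0); [lra|].
destruct (Hl (e / 4)) as [n1 Hn1]; [lra|].
assert (B : exists n, forall i, In i l0 -> (i < n)%nat) by (clear; induction l0 as [|i l [n Hn]]; [exists 0%nat; easy|]; exists (Nat.max n (i + 1)); intros j [<- | Hj]; [lia|]; specialize (Hn j Hj); lia).
destruct B as [n2 Hn2]. set (n := Nat.max n1 n2).
specialize (H0 (seq 0 (S n)) (seq_NoDup _ _)). rewrite E in H0.
assert (A : Cmod (U 0%nat - U (S n) - S0)%C <= e / 4) by (apply H0; intros i Hi; apply in_seq; specialize (Hn2 i Hi); fin).
assert (A2 : Cmod (U (S n)) < e / 4) by (apply Hn1; fin).
assert (e <= Cmod (U 0%nat - U (S n) - S0)%C + Cmod (U (S n))); [|lra].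
unfold e. replace (S0 - U 0%nat)%C with (- (U 0%nat - U (S n) - S0) + - U (S n))%C by ring.
Ctri. rewrite !Cmod_opp; lra.
Qed.

Lemma Rpower_tends_0 q e eps : 0 < q -> 0 < e -> 0 < eps ->
  exists N, forall n, (N <= n)%nat -> Rpower (INR n + q) (- e) < eps.
Proof.
destruct (INR_unbounded (exp (- ln eps / e))) as [N HN].
exists N; intros n Hn. apply le_INR in Hn.
rewrite <- (exp_ln eps) by auto. apply exp_increasing.
assert (K : - ln eps / e < ln (INR n + q)) by (rewrite <- (ln_exp (- ln eps / e)); apply ln_increasing; fin).
apply Rmult_lt_compat_r with (r := e) in K; auto.
replace (- ln eps / e * e) with (- ln eps) in K by fin. lra.
Qed.

Definition hz (q : R) (w : C) : C := CSum (fun n => cpow (INR n + q) w).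

(** The Euler-Maclaurin expression for $(w-1)\zeta(w,q)$: the factor $w-1$ removes the pole, and the
    error series converges for $\mathrm{Re}\,w>-3$. *)
Definition Kz (q : R) (w : C) : C :=
  (cpow q (w - 1) + (w - 1) / 2 * cpow q w + (w - 1) * w / 12 * cpow q (w + 1)
   - CSum (fun n => em_err (INR n + q) w))%C.

Lemma csummable_hz q w : 0 < q -> 1 < Re w -> csummable (fun n => cpow (INR n + q) w).
Proof.
intros Hq Hw. apply csummable_le with (fun n => Rpower (INR n + q) (- Re w)).
- intros; rewrite Cmod_cpow; lra.
- now apply pseries_summable.
Qed.

Lemma csummable_em q w : 0 < q -> -3 < Re w -> csummable (fun n => em_err (INR n + q) w).
Proof.
intros Hq Hw. apply csummable_le with
  (fun n => Cmod (em_coef w) * Rpower (INR n + q) (- (Re w + 4))).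
- intros n; apply em_err_bound; [|lra]. pose proof (pos_INR n); lra.
- apply rsummable_scal; [pos | apply pseries_summable; lra].
Qed.

Lemma has_sum_shift (g : nat -> C) S : has_sum g S -> csummable g ->
  has_sum (fun n => g (Datatypes.S n)) (S - g 0%nat)%C.
Proof.
intros Hg Hc.
assert (Hc' : csummable (fun n => g (Datatypes.S n))) by (apply (rsummable_comp Datatypes.S (fun n => Cmod (g n))); fin).
pose proof (csummable_has_sum _ Hc') as H. set (T := CSum _) in H.
assert (K : has_sum (fun n => ((if dec n 0%nat then g 0%nat else 0%C)
   + (if dec n 0%nat then 0%C else g n))%C) (g 0%nat + T)%C).
{ apply has_sum_plus.
  - eapply has_sum_val; [apply has_sum_finite with (l := 0%nat :: nil)|].
    + repeat constructor; fin.
    + intros i Hi. destruct (dec i 0%nat) as [-> |]; auto. elim Hi; left; fin.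
    + simpl. destruct (dec 0%nat 0%nat); fin.
  - apply (has_sum_reindex Datatypes.S); auto.
    + intros i Hi; destruct (dec i 0%nat) as [|N]; auto. destruct i as [|i]; [lia|].
      now elim (Hi i).
    + eapply has_sum_ext; [|exact H]. intros n. destruct (dec (Datatypes.S n) 0%nat); fin. }
assert (E : S = (g 0%nat + T)%C).
{ eapply has_sum_unique; [exact Hg|]. eapply has_sum_ext; [|exact K].
  intros n. cbv beta. destruct (dec n 0%nat) as [-> |]; fin. }
rewrite E. replace (g 0%nat + T - g 0%nat)%C with T by ring. fin.
Qed.

(** The boundary terms [U n] telescope, and each difference is the error plus a trapezoid. Summing
    the trapezoids counts every term of the series twice, except the first, which is counted
    once. *)
Lemma hz_Kz q w : 0 < q -> 1 < Re w -> ((w - 1) * hz q w)%C = Kz q w.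
Proof.
intros Hq Hw.
set (U := fun n => (cpow (INR n + q) (w - 1) + (w - 1) * w / 12 * cpow (INR n + q) (w + 1))%C).
set (c := fun n => cpow (INR n + q) w).
assert (Hc : csummable c) by now apply csummable_hz.
assert (Hc' : csummable (fun n => c (S n))) by (apply (rsummable_comp S (fun n => Cmod (c n))); fin).
assert (EU : forall n, (U n - U (S n))%C
   = (em_err (INR n + q) w + (w - 1) / 2 * (c n + c (S n)))%C).
{ intros n; unfold U, c, em_err. rewrite S_INR.
  replace (INR n + 1 + q) with (INR n + q + 1) by ring. fin. }
assert (HU : has_sum (fun n => (U n - U (S n))%C) (U 0%nat)).
{ apply has_sum_telescope.
  - replace (fun n => (U n - U (S n))%C)
      with (fun n => (em_err (INR n + q) w + (w - 1) / 2 * (c n + c (S n)))%C)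
      by (funext p; fin).
    apply csummable_plus; [apply csummable_em; lra|].
    apply csummable_scal, csummable_plus; fin.
  - intros eps He. set (C0 := Cmod ((w - 1) * w / 12)%C).
    assert (HC0 : 0 <= C0) by apply Cmod_ge_0.
    destruct (Rpower_tends_0 q (Re w - 1) (eps / 2)) as [N1 H1]; [lra | lra | lra |].
    destruct (Rpower_tends_0 q (Re w + 1) (eps / 2 / (C0 + 1))) as [N2 H2];
      [lra | lra | pos |].
    exists (Nat.max N1 N2). intros n Hn.
    specialize (H1 n ltac:(lia)). specialize (H2 n ltac:(lia)).
    eapply Rle_lt_trans; [apply Cmod_triangle|]. rewrite Cmod_mult, !Cmod_cpow.
    fold C0. rewrite re_minus, re_plus, re_RtoC.
    assert (C0 * Rpower (INR n + q) (- (Re w + 1)) <= eps / 2); [|lra].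
    apply Rle_trans with ((C0 + 1) * (eps / 2 / (C0 + 1))); [|right; fin].
    apply Rmult_le_compat; try lra. pos. }
pose proof (csummable_has_sum _ Hc) as Sc.
pose proof (has_sum_shift c _ Sc Hc) as Sc'.
pose proof (csummable_has_sum _ (csummable_em q w Hq ltac:(lra))) as Se.
set (E := CSum _) in Se.
assert (K : U 0%nat = (E + (w - 1) / 2 * (hz q w + (hz q w - c 0%nat)))%C).
{ eapply has_sum_unique; [exact HU|].
  eapply has_sum_ext; [symmetry; apply EU|].
  apply has_sum_plus; auto. apply has_sum_scal, has_sum_plus; fin. }
unfold Kz. fold E. unfold U, c in K. rewrite !Rplus_0_l in K.
transitivity ((E + (w - 1) / 2 * (hz q w + (hz q w - cpow q w))) - E + (w - 1) / 2 * cpow q w)%C;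
  [fin|]. rewrite <- K. fin.
Qed.

Lemma Ent_em_err x (f : C -> C) (c d : C) : (forall s, f s = (c * s + d)%C) ->
  Ent (fun s => em_err x (f s)).
Proof.
intros E. assert (Ef : Ent f) by (eapply Ent_affine; fin).
assert (E1 : Ent (fun s => (f s - 1)%C)) by (apply Ent_minus; [fin | apply Ent_const]).
assert (Em : forall y, Ent (fun s => cpow y (f s - 1)%C)) by (intros y; apply (Ent_cpow y (fun s => (f s - 1)%C) c (d - 1)%C); intros; rewrite E; fin).
assert (Ep : forall y, Ent (fun s => cpow y (f s + 1)%C)) by (intros y; apply (Ent_cpow y (fun s => (f s + 1)%C) c (d + 1)%C); intros; rewrite E; fin).
assert (E0 : forall y, Ent (fun s => cpow y (f s))) by (intros; eapply Ent_cpow; fin).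
apply Ent_minus; [apply Ent_minus; [apply Ent_minus|]|]; auto.
- apply Ent_mult; [apply Ent_mult; [fin | apply Ent_const]| apply Ent_plus; fin].
- apply Ent_mult; [apply Ent_mult; [apply Ent_mult; fin| apply Ent_const]| apply Ent_minus; fin].
Qed.

Lemma Ent_em_coef (f : C -> C) (c d : C) : (forall s, f s = (c * s + d)%C) ->
  Ent (fun s => em_coef (f s)).
Proof.
intros E. assert (Ef : Ent f) by (eapply Ent_affine; fin).
repeat (apply Ent_mult || apply Ent_plus || apply Ent_minus || apply Ent_const); fin.
Qed.

Lemma disc_Re (s p : C) d : Cmod (s - p)%C < d -> Re p - d < Re s < Re p + d.
Proof.
pose proof (re_le_Cmod (s - p)%C) as K. rewrite re_minus in K.
apply Rabs_le_between in K. lra.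
Qed.

Lemma cholo_Kz q w : 0 < q -> -3 < Re w -> cholo (Kz q) w.
Proof.
intros Hq Hw.
assert (H : cholo (fun w => CSum (fun n => em_err (INR n + q) w)) w).
{ set (d := (Re w + 3) / 2). exists d; split; [pos|].
  destruct (Ent_bounded em_coef w d) as [B HB].
  { apply (Ent_em_coef (fun s => s) 1 0). intros; fin. }
  assert (HB0 : 0 <= B) by (eapply Rle_trans; [apply Cmod_ge_0 | apply (HB w)]; rewrite Cmod_diag; fin).
  apply (holo_sum (fun n w => em_err (INR n + q) w)
    (fun n => B * (Rpower (INR n + q) (- (Re w - d + 4)) + Rpower (INR n + q) (- (Re w + d + 4)))));
    [pos| | |].
  - intros n. apply (Ent_em_err _ (fun s => s) 1 0). intros; fin.
  - apply rsummable_scal; auto.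
    apply rsummable_plus; apply pseries_summable; unfold d; lra.
  - intros n s Hs. pose proof (disc_Re _ _ _ Hs). pose proof (pos_INR n).
    eapply Rle_trans; [apply em_err_bound; [lra | unfold d in *; lra]|].
    apply Rmult_le_compat.
    + pos.
    + pos.
    + apply HB; lra.
    + apply Rpower_box. lra. }
assert (Em : forall k, cholo (fun w => cpow q (w + k)%C) w) by (intros k; apply cholo_Ent, (Ent_cpow q (fun w => (w + k)%C) 1 k); intros; fin).
assert (E0 : Ent (cpow q)) by (apply (Ent_cpow q (fun w => w) 1 0); intros; fin).
assert (Hs : Ent (fun w => (w - 1)%C)) by (apply (Ent_affine _ 1 (-1)%C); intros; fin).
apply cholo_plus; [apply cholo_plus; [apply cholo_plus|]|].
- eauto.
- apply cholo_mult; [|apply cholo_Ent, E0].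
  apply cholo_Ent, Ent_mult; [fin | apply Ent_const].
- apply cholo_mult; auto.
  apply cholo_Ent; repeat apply Ent_mult; auto; [apply Ent_id | apply Ent_const].
- apply (cholo_ext (fun w => (-1 * CSum (fun n => em_err (INR n + q) w))%C)); [intros; fin|].
  apply cholo_mult; auto. apply cholo_Ent, Ent_const.
Qed.

(** * The zeta function of the excited oscillator modes *)

Section Nil.
Variables (al be q0 m : R).
Hypothesis (Hal : 0 < al) (Hbe : 0 < be) (Hq0 : 0 < q0) (Hm : 0 < m).

Let tau (p : nat) : R := INR p + q0.

(** With $al=4\pi/A$ and $be=\pi A$ this is $\sqrt{c^2+2(n+1)c/A}$ for the central frequency
    $c=2\pi(p+q_0)$, that is, the excited level at $r=1$. The factored form makes the sum over [n] a
    Hurwitz sum. *)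
Definition nil_mu (x : nat * nat) : R :=
  sqrt (al * (INR (fst x) + q0) * (INR (snd x) + 1 + be * (INR (fst x) + q0))).

(** The multiplicity of the level: [m * (p + q0)] theta series, doubled by complex conjugation. *)
Definition nil_W (x : nat * nat) : R := 2 * m * (INR (fst x) + q0).

Lemma tau_pos p : 0 < tau p.
Proof. unfold tau; pose proof (pos_INR p); lra. Qed.

Lemma nil_mu_arg x : 0 < al * tau (fst x) /\ 0 < INR (snd x) + 1 + be * tau (fst x).
Proof.
pose proof (tau_pos (fst x)). pose proof (pos_INR (snd x)). nra.
Qed.

Lemma nil_mu_pos x : 0 < nil_mu x.
Proof.
destruct (nil_mu_arg x) as [A B]. apply sqrt_lt_R0, Rmult_lt_0_compat; fin.
Qed.

Lemma ln_sqrt x : 0 < x -> ln (sqrt x) = ln x / 2.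
Proof.
intros H. rewrite <- (sqrt_sqrt x) at 2 by lra.
rewrite ln_mult by now apply sqrt_lt_R0. lra.
Qed.

Lemma cpow_nil_mu x s : cpow (nil_mu x) s =
  (cpow (al * tau (fst x)) (s / 2) * cpow (INR (snd x) + 1 + be * tau (fst x)) (s / 2))%C.
Proof.
destruct (nil_mu_arg x) as [A B]. rewrite <- cpow_mult by auto.
unfold cpow, nil_mu. f_equal. fold (tau (fst x)).
rewrite ln_sqrt by now apply Rmult_lt_0_compat.
unfold Rdiv. rewrite RtoC_mult, RtoC_inv by lra. fin.
Qed.

(** One power of the second factor of the squared level is estimated by $be\,\tau$ and cancels the
    weight. What remains is a product of two p-series with exponents $e/2$ and $e/2-1$; the second
    one forces $e>4$. *)
Lemma nil_summable e : 4 < e -> rsummable (fun x => nil_W x * Rpower (nil_mu x) (- e)).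
Proof.
intros He. set (a := e / 2).
apply rsummable_le with (fun x => (2 * m * Rpower al (- a) * / be)
   * (Rpower (INR (fst x) + q0) (- a) * Rpower (INR (snd x) + 1) (- (a - 1)))).
- intros x. destruct (nil_mu_arg x) as [A B]. pose proof (tau_pos (fst x)) as T.
  unfold tau in *. set (t := INR (fst x) + q0) in *. pose proof (pos_INR (snd x)) as Hn.
  set (n := INR (snd x)) in *.
  split; [pos|].
  assert (E : Rpower (nil_mu x) (- e) = Rpower al (- a) * Rpower t (- a) * Rpower (n + 1 + be * t) (- a)).
  { unfold nil_mu. fold t n. unfold Rpower. rewrite ln_sqrt by now apply Rmult_lt_0_compat.
    rewrite !ln_mult by auto. rewrite <- !exp_plus. f_equal. unfold a; lra. }
  assert (F : Rpower (n + 1 + be * t) (- a) <= / (be * t) * Rpower (n + 1) (- (a - 1))).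
  { replace (- a) with (-(1) + - (a - 1)) by ring. rewrite Rpower_plus.
    assert (0 < be * t) by now apply Rmult_lt_0_compat.
    apply Rmult_le_compat; try (apply Rlt_le, Rpower_pos).
    - rewrite Rpower_Ropp, Rpower_1 by lra. apply Rinv_le_contravar; lra.
    - apply Rpower_decr; [lra | unfold a; lra]. }
  rewrite E.
  apply Rle_trans with (2 * m * t * (Rpower al (- a) * Rpower t (- a) * (/ (be * t) * Rpower (n + 1) (- (a - 1))))).
  + apply Rmult_le_compat_l; [nra|]. apply Rmult_le_compat_l; auto.
    pos.
  + right. fin.
- apply rsummable_scal.
  + pos.
  + apply (rsummable_prod (fun p => Rpower (INR p + q0) (- a)) (fun n => Rpower (INR n + 1) (- (a - 1))));
      apply pseries_summable; unfold a; lra.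
Qed.

Definition nil_Z (s : C) : C := CSum (fun x => (nil_W x * cpow (nil_mu x) s)%C).

Lemma nil_csummable s : 4 < Re s -> csummable (fun x => (nil_W x * cpow (nil_mu x) s)%C).
Proof.
intros H. apply csummable_le with (fun x => nil_W x * Rpower (nil_mu x) (- Re s)).
- intros x. rewrite Cmod_mult, Cmod_R, Cmod_cpow, Rabs_pos_eq; fin.
- now apply nil_summable.
Qed.

(** The total of the Euler-Maclaurin errors in [n] over all [p], the part of the double series that
    is not a Hurwitz sum; it converges absolutely for $\mathrm{Re}\,s>0$. *)
Definition E2 (s : C) : C := CSum (fun x : nat * nat =>
  (tau (fst x) * cpow (tau (fst x)) (s / 2) * em_err (INR (snd x) + be * tau (fst x)) (s / 2))%C).

Definition E2_bound (u v : R) (x : nat * nat) : R :=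
  (Rpower be (- (u / 2 + 2)) + Rpower be (- (v / 2 + 2)))
   * ((Rpower (tau (fst x)) (- (u + 1)) + Rpower (tau (fst x)) (- (v + 1)))
      * Rpower (INR (snd x) + be * q0) (-(2))).

Lemma E2_bound_summable u v : 0 < u -> 0 < v -> rsummable (E2_bound u v).
Proof.
intros Hu Hv. apply rsummable_scal.
- pos.
- apply (rsummable_prod (fun p => Rpower (tau p) (- (u + 1)) + Rpower (tau p) (- (v + 1)))
    (fun n => Rpower (INR n + be * q0) (-(2)))).
  + apply rsummable_plus; apply pseries_summable; lra.
  + apply pseries_summable; fin.
Qed.

(** The exponent $g+4$ with $g=\mathrm{Re}(s)/2$ is split as $(g+2)+2$. The first part goes to
    $be\,\tau$ and leaves $\tau^{-(\mathrm{Re}\,s+1)}$ after the weight, the second makes the sum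
    over [n] converge; [Rpower_box] then covers the strip. *)
Lemma E2_term_bound s u v x : 0 < u -> u <= Re s <= v ->
  Cmod (tau (fst x) * cpow (tau (fst x)) (s / 2) * em_err (INR (snd x) + be * tau (fst x)) (s / 2))%C
   <= Cmod (em_coef (s / 2)) * E2_bound u v x.
Proof.
intros Hu Hs. pose proof (tau_pos (fst x)) as T.
assert (Tq : q0 <= tau (fst x)) by (unfold tau; pose proof (pos_INR (fst x)); lra).
set (t := tau (fst x)) in *. pose proof (pos_INR (snd x)) as Hn. set (n := INR (snd x)) in *.
assert (Hbq : 0 < be * q0) by now apply Rmult_lt_0_compat.
assert (Hbtq : be * q0 <= be * t) by nra.
assert (Er : Re (s / 2) = Re s / 2).
{ unfold Cdiv. rewrite <- RtoC_inv by lra. rewrite re_scal_r. lra. }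
set (g := Re s / 2) in *.
rewrite !Cmod_mult, Cmod_R, Cmod_cpow, Er, Rabs_pos_eq by lra.
apply Rle_trans with (t * Rpower t (- g) * (Cmod (em_coef (s / 2)) * Rpower (n + be * t) (- (g + 4)))).
{ apply Rmult_le_compat_l.
  - pos.
  - rewrite <- Er. apply em_err_bound; [lra | rewrite Er; fin]. }
replace (t * Rpower t (- g) * (Cmod (em_coef (s / 2)) * Rpower (n + be * t) (- (g + 4))))
  with (Cmod (em_coef (s / 2)) * (t * Rpower t (- g) * Rpower (n + be * t) (- (g + 4)))) by ring.
apply Rmult_le_compat_l; [pos|].
assert (F : Rpower (n + be * t) (- (g + 4)) <= Rpower (be * t) (- (g + 2)) * Rpower (n + be * q0) (-(2))) by (replace (- (g + 4)) with (- (g + 2) + -(2)) by ring; rewrite Rpower_plus; apply Rmult_le_compat; try (apply Rlt_le, Rpower_pos); apply Rpower_decr; fin).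
apply Rle_trans with (t * Rpower t (- g) * (Rpower (be * t) (- (g + 2)) * Rpower (n + be * q0) (-(2)))).
{ apply Rmult_le_compat_l; auto. pos. }
assert (G : t * Rpower t (- g) * (Rpower (be * t) (- (g + 2)) * Rpower (n + be * q0) (-(2)))
  = Rpower be (- (g + 2)) * (Rpower t (- (Re s + 1)) * Rpower (n + be * q0) (-(2)))).
{ rewrite <- Rpower_mult_distr by auto.
  replace (Rpower t (- (Re s + 1))) with (t * Rpower t (- g) * Rpower t (- (g + 2))); [lra|].
  rewrite <- (Rpower_1 t) at 1 by auto. rewrite <- !Rpower_plus. f_equal. unfold g; lra. }
rewrite G. unfold E2_bound. fold t n.
pose proof (Rpower_pos be (- (g + 2))).
pose proof (Rpower_pos (n + be * q0) (-(2))).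
apply Rmult_le_compat; [lra | pos | apply Rpower_box; unfold g; lra|].
apply Rmult_le_compat_r; [lra|]. apply Rpower_box; lra.
Qed.

Lemma E2_csummable s : 0 < Re s -> csummable (fun x : nat * nat =>
  (tau (fst x) * cpow (tau (fst x)) (s / 2) * em_err (INR (snd x) + be * tau (fst x)) (s / 2))%C).
Proof.
intros Hs. apply csummable_le with (fun x => Cmod (em_coef (s / 2)) * E2_bound (Re s) (Re s) x).
- intros x; apply E2_term_bound; lra.
- apply rsummable_scal; [pos | now apply E2_bound_summable].
Qed.

Lemma cholo_E2 s : 0 < Re s -> cholo E2 s.
Proof.
set (d := Re s / 2). exists d; split; [pos|].
assert (Eh : forall s : C, (s / 2)%C = (/ 2 * s + 0)%C) by (intros; fin).
destruct (Ent_bounded (fun s => em_coef (s / 2)%C) s d) as [B HB].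
{ apply (Ent_em_coef (fun s => (s / 2)%C) (/ 2) 0); fin. }
assert (HB0 : 0 <= B) by (eapply Rle_trans; [apply Cmod_ge_0 | apply (HB s)]; rewrite Cmod_diag; fin).
apply (holo_sum (fun (x : nat * nat) s => (tau (fst x) * cpow (tau (fst x)) (s / 2)
   * em_err (INR (snd x) + be * tau (fst x)) (s / 2))%C)
   (fun x => B * E2_bound (Re s - d) (Re s + d) x)); [pos| | |].
- intros x. apply Ent_mult; [apply Ent_mult; [apply Ent_const|]|].
  + apply (Ent_cpow _ (fun s => (s / 2)%C) (/ 2) 0); fin.
  + apply (Ent_em_err _ (fun s => (s / 2)%C) (/ 2) 0); fin.
- apply rsummable_scal; auto. apply E2_bound_summable; unfold d; lra.
- intros x z Hz. pose proof (disc_Re _ _ _ Hz).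
  eapply Rle_trans; [apply (E2_term_bound z (Re s - d) (Re s + d)); unfold d in *; lra|].
  apply Rmult_le_compat_r; [|apply HB; lra].
  pos.
Qed.

Lemma cpow_tau_combine t (w : C) : 0 < t ->
  (t * cpow t w * cpow t (w - 1))%C = cpow t (2 * w - 2)
  /\ (t * cpow t w * cpow t w)%C = cpow t (2 * w - 1)
  /\ (t * cpow t w * cpow t (w + 1))%C = cpow t (2 * w).
Proof.
intros Ht.
assert (N : RtoC t <> 0%C) by (apply RtoC_neq0; lra).
assert (E : cpow t (2 * w) = (cpow t w * cpow t w)%C) by (rewrite <- cpow_plus; fin).
split; [|split].
- replace (2 * w - 2)%C with (2 * w - 1 - 1)%C by ring. rewrite !cpow_m1, E by auto. fin.
- rewrite !cpow_m1, E by auto. fin.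
- rewrite cpow_S, E by auto. field; fin.
Qed.

(** For fixed [p] the sum over [n] is a Hurwitz sum at $be\,\tau$ without its first term. Expanding
    it by [hz_Kz] and collecting powers of $\tau$ turns the three main terms into Hurwitz sums over
    [p] at $s-2$, $s-1$ and $s$. The missing first term flips the sign of the middle coefficient. *)
Lemma nil_Z_eq s : 4 < Re s -> ((s / 2 - 1) * nil_Z s)%C =
  (2 * m * cpow al (s / 2) * (cpow be (s / 2 - 1) * hz q0 (s - 2)
     + - ((s / 2 - 1) / 2) * cpow be (s / 2) * hz q0 (s - 1)
     + (s / 2 - 1) * (s / 2) / 12 * cpow be (s / 2 + 1) * hz q0 s + - E2 s))%C.
Proof.
intros Hs. set (w := (s / 2)%C).
assert (Es : s = (2 * w)%C) by (unfold w; fin).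
assert (Hw : 2 < Re w) by (rewrite Es, re_scal_l in Hs; lra).
pose proof (has_sum_rows _ (nil_csummable s Hs)) as HZ.
eapply has_sum_unique; [apply has_sum_scal, HZ|].
assert (HE : csummable (fun x : nat * nat => (tau (fst x) * cpow (tau (fst x)) (s / 2)
   * em_err (INR (snd x) + be * tau (fst x)) (s / 2))%C)) by (apply E2_csummable; lra).
pose proof (has_sum_rows _ HE) as HE'.
assert (R2 : Re (s - 2) = Re s - 2) by auto.
assert (R1 : Re (s - 1) = Re s - 1) by auto.
pose proof (csummable_has_sum _ (csummable_hz q0 (s - 2)%C Hq0 ltac:(lra))) as H2.
pose proof (csummable_has_sum _ (csummable_hz q0 (s - 1)%C Hq0 ltac:(lra))) as H1.
pose proof (csummable_has_sum _ (csummable_hz q0 s Hq0 ltac:(lra))) as H0.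
eapply has_sum_ext; [|apply has_sum_scal, has_sum_plus; [apply has_sum_plus; [apply has_sum_plus|]|];
  [apply has_sum_scal, H2 | apply has_sum_scal, H1 | apply has_sum_scal, H0 |
   apply has_sum_ext with (g := fun i => (-1 * CSum (fun j => (tau i * cpow (tau i) w
       * em_err (INR j + be * tau i) w)%C))%C); [fin|]]].
2:{ replace (- E2 s)%C with (-1 * E2 s)%C by ring. apply has_sum_scal. fin. }
intros p. cbv beta. fold (tau p). set (t := tau p).
assert (Ht : 0 < t) by apply tau_pos.
assert (Hbt : 0 < be * t) by now apply Rmult_lt_0_compat.
assert (Sh : has_sum (fun n => cpow (INR (S n) + be * t) w) (hz (be * t) w - cpow (be * t) w)%C).
{ replace (cpow (be * t) w) with (cpow (INR 0 + be * t) w) by (simpl; fin).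
  apply (has_sum_shift (fun n => cpow (INR n + be * t) w)).
  - apply csummable_has_sum, csummable_hz; lra.
  - apply csummable_hz; lra. }
assert (A : CSum (fun j => (nil_W (p, j) * cpow (nil_mu (p, j)) s)%C)
   = (2 * m * t * cpow (al * t) w * (hz (be * t) w - cpow (be * t) w))%C).
{ apply CSum_unique. eapply has_sum_ext; [|apply has_sum_scal, Sh].
  intros n. rewrite cpow_nil_mu. unfold nil_W. simpl fst; simpl snd. fold (tau p). fold t w.
  rewrite S_INR, !RtoC_mult. fin. }
assert (B : CSum (fun j => (t * cpow t w * em_err (INR j + be * t) w)%C)
   = (t * cpow t w * CSum (fun j => em_err (INR j + be * t) w))%C) by (apply CSum_unique, has_sum_scal, csummable_has_sum, csummable_em; lra).
rewrite A, B.
pose proof (hz_Kz (be * t) w Hbt ltac:(lra)) as K. unfold Kz in K.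
destruct (cpow_tau_combine t w Ht) as (T1 & T2 & T3).
rewrite !(cpow_mult be t) in K by auto. rewrite (cpow_mult al t), (cpow_mult be t) by auto.
replace (cpow t (s - 2)) with (cpow t (2 * w - 2)) by now rewrite Es.
replace (cpow t (s - 1)) with (cpow t (2 * w - 1)) by now rewrite Es.
replace (cpow t s) with (cpow t (2 * w)) by now rewrite Es.
rewrite <- T1, <- T2, <- T3.
symmetry. transitivity (2 * m * t * cpow al w * cpow t w * ((w - 1) * hz (be * t) w - (w - 1) * (cpow be w * cpow t w)))%C;
  [fin|]. rewrite K. fin.
Qed.

(** The zeta function [nil_Z] multiplied by all its denominators: $s/2-1$ from the sum over [n], and
    $s-3$, $s-2$, $s-1$ from the poles of the three Hurwitz sums over [p]. *)
Definition nil_P (s : C) : C :=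
  (2 * m * cpow al (s / 2) *
    (cpow be (s / 2 - 1) * Kz q0 (s - 2) * ((s - 2) * (s - 1))
     + - ((s / 2 - 1) / 2) * cpow be (s / 2) * Kz q0 (s - 1) * ((s - 3) * (s - 1))
     + (s / 2 - 1) * (s / 2) / 12 * cpow be (s / 2 + 1) * Kz q0 s * ((s - 3) * (s - 2))
     + - E2 s * ((s - 3) * (s - 2) * (s - 1))))%C.

Lemma nil_Z_P s : 4 < Re s ->
  ((s / 2 - 1) * ((s - 3) * (s - 2) * (s - 1)) * nil_Z s)%C = nil_P s.
Proof.
transitivity (((s / 2 - 1) * nil_Z s) * ((s - 3) * (s - 2) * (s - 1)))%C; [fin|].
rewrite nil_Z_eq by auto. unfold nil_P.
assert (R2 : Re (s - 2) = Re s - 2) by auto.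
assert (R1 : Re (s - 1) = Re s - 1) by auto.
rewrite <- (hz_Kz q0 (s - 2)), <- (hz_Kz q0 (s - 1)), <- (hz_Kz q0 s) by lra.
fin.
Qed.

Lemma cholo_nil_P s : 0 < Re s -> cholo nil_P s.
Proof.
intros Hs.
assert (Ea : forall (c d : C), Ent (fun s => (c * s + d)%C)) by (intros c d; apply (Ent_affine _ c d); fin).
assert (Ep : forall x (f : C -> C) (c d : C), (forall s, f s = (c * s + d)%C) -> cholo (fun s => cpow x (f s)) s) by (intros; eapply cholo_Ent, Ent_cpow; fin).
assert (Af : forall (f : C -> C) (c d : C), (forall s, f s = (c * s + d)%C) -> cholo f s) by (intros; eapply cholo_Ent, Ent_affine; fin).
assert (KK : forall k : R, -3 < Re s - k -> cholo (fun s => Kz q0 (s - k)%C) s) by (intros k Hk; apply (cholo_shift (Kz q0)), cholo_Kz; fin).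
assert (Sub : forall k : R, cholo (fun s => (s - k)%C) s) by (intros k; apply (Af _ 1 (- k)%C); intros; fin).
apply cholo_mult.
- apply cholo_mult; [apply cholo_Ent, Ent_const|]. apply (Ep al _ (/ 2) 0)%C; intros; fin.
- apply cholo_plus; [apply cholo_plus; [apply cholo_plus|]|].
  + apply cholo_mult; [apply cholo_mult|].
    * apply (Ep be _ (/ 2) (- (1)))%C; intros; fin.
    * apply KK; lra.
    * apply cholo_mult; fin.
  + apply cholo_mult; [apply cholo_mult; [apply cholo_mult|]|].
    * apply (Af _ (- (/ 4)) (/ 2))%C; intros; fin.
    * apply (Ep be _ (/ 2) 0)%C; intros; fin.
    * apply KK; lra.
    * apply cholo_mult; fin.
  + apply cholo_mult; [apply cholo_mult; [apply cholo_mult|]|].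
    * apply (cholo_ext (fun s => ((/ 2 * s + - (1)) * (/ 24 * s + 0))%C)); [intros; fin|].
      apply cholo_mult; apply cholo_Ent, Ea.
    * apply (Ep be _ (/ 2) 1)%C; intros; fin.
    * apply cholo_Kz; lra.
    * apply cholo_mult; fin.
  + apply cholo_mult; [|apply cholo_mult; [apply cholo_mult|]; fin].
    apply (cholo_ext (fun s => (-1 * E2 s)%C)); [intros; fin|].
    apply cholo_mult; [apply cholo_Ent, Ent_const | now apply cholo_E2].
Qed.

End Nil.

(** * Pairs of eigenvalues *)

(** The torus may have a mode with [mu = 0], which must contribute nothing to a zeta function; the
    cutoff removes it without changing the index set. *)
Definition pwc (mu : R) (s : C) : C := if Rlt_dec 0 mu then cpow mu s else 0%C.

Definition rpw (mu e : R) : R := if Rlt_dec 0 mu then Rpower mu (- e) else 0.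

Lemma Cmod_pwc mu s : Cmod (pwc mu s) = rpw mu (Re s).
Proof. unfold pwc, rpw; destruct (Rlt_dec 0 mu); [apply Cmod_cpow | apply Cmod_0]. Qed.

Lemma rpw_nonneg mu e : 0 <= rpw mu e.
Proof. unfold rpw; destruct (Rlt_dec 0 mu); fin. Qed.

Lemma eta_term_pos x s : 0 < x -> eta_term x s = cpow x s.
Proof.
intros H; unfold eta_term. rewrite sign_eq_1, Rabs_pos_eq by lra. unfold cpow; fin.
Qed.

Lemma eta_term_neg x s : x < 0 -> eta_term x s = (- cpow (- x) s)%C.
Proof.
intros H; unfold eta_term. rewrite sign_eq_m1, Rabs_left by lra.
Cring.
Qed.

Lemma eta_term_0 s : eta_term 0 s = 0%C.
Proof. unfold eta_term. rewrite sign_0. fin. Qed.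

Lemma Cmod_eta_term x s : x <> 0 -> Cmod (eta_term x s) = Rpower (Rabs x) (- Re s).
Proof.
intros H. destruct (Rdichotomy _ _ H) as [N | P].
- rewrite eta_term_neg, Cmod_opp, Cmod_cpow, Rabs_left; lra.
- rewrite eta_term_pos, Cmod_cpow, Rabs_pos_eq by lra; lra.
Qed.

Lemma Ent_eta_term x : Ent (eta_term x).
Proof.
apply Ent_mult; [apply Ent_const|].
apply (Ent_ext (fun s => Cexp (- ln (Rabs x) * s)%C)); [intros; fin| apply Ent_exp].
Qed.

Definition eta_pair (a mu : R) (s : C) : C := (eta_term (- a + mu) s + eta_term (- a - mu) s)%C.

(** For $\mu>a$ the pair is $(\mu-a)^{-s}-(\mu+a)^{-s}$. The even powers of $a$ cancel, and the two
    subtracted terms are those of order $a$ and $a^3$. *)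
Definition eta_rem (a mu : R) (s : C) : C :=
  (eta_pair a mu s - (2 * a * s * pwc mu (s + 1)
     + a * a * a / 3 * (s * (s + 1) * (s + 2)) * pwc mu (s + 3)))%C.

Lemma Ent_eta_rem a mu : Ent (eta_rem a mu).
Proof.
assert (E : forall k : C, Ent (fun s => pwc mu (s + k)%C)) by (intros k; unfold pwc; destruct (Rlt_dec 0 mu); [|apply Ent_const]; apply (Ent_cpow mu (fun s => (s + k)%C) 1 k); intros; fin).
repeat first [apply Ent_eta_term | apply E | apply Ent_id | apply Ent_const | apply Ent_minus
  | apply Ent_plus | apply Ent_mult].
Qed.

Definition rem_coef (s : C) : C := (s * (s + 1) * (s + 2) * (s + 3) * (s + 4))%C.

Lemma Ent_rem_coef : Ent rem_coef.
Proof.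
repeat first [apply Ent_plus | apply Ent_mult | apply Ent_id | apply Ent_const].
Qed.

Lemma rderiv_cpow_reflect s x t : 0 < x - t ->
  rderiv (fun t => cpow (x - t) s) t (s * cpow (x - t) (s + 1))%C.
Proof.
intros H. eapply rderiv_val.
- apply (rderiv_comp_R (fun x => cpow x s) (fun t => x - t) t (- s * cpow (x - t) (s + 1))%C (-1)).
  + apply rderiv_cpow; lra.
  + auto_derive; lra.
- fin.
Qed.

(** Taylor expansion in the shift [t] from 0 to [a]: the remainder and its first four derivatives
    vanish at 0, and the fifth consists of two powers with exponent $-(s+5)$. As $\mu\ge2a$, the
    bases stay above $\mu/2$, whence the factor $2^{\mathrm{Re}\,s+5}$. *)
Lemma eta_rem_bound a mu s : 0 < a -> 2 * a <= mu -> 0 <= Re s + 5 ->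
  Cmod (eta_rem a mu s)
   <= Cmod (rem_coef s) * 2 * a ^ 5 * (Rpower 2 (Re s + 5) * rpw mu (Re s + 5)).
Proof.
intros Ha Hmu Hs.
set (P := fun (k : R) (t : R) => cpow (mu + t) (s + k)%C).
set (N := fun (k : R) (t : R) => cpow (mu - t) (s + k)%C).
assert (DP : forall k k' t, k' = k + 1 -> 0 <= t <= a -> rderiv (P k) t (- (s + k) * P k' t)%C).
{ intros k k' t -> Ht. eapply rderiv_val; [apply rderiv_cpow_shift; lra|].
  unfold P. replace (s + (k + 1)%R)%C with (s + k + 1)%C by (rewrite RtoC_plus; fin).
  fin. }
assert (DN : forall k k' t, k' = k + 1 -> 0 <= t <= a -> rderiv (N k) t ((s + k) * N k' t)%C).
{ intros k k' t -> Ht. eapply rderiv_val; [apply rderiv_cpow_reflect; lra|].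
  unfold N. replace (s + (k + 1)%R)%C with (s + k + 1)%C by (rewrite RtoC_plus; fin).
  fin. }
set (p1 := cpow mu (s + 1)%C). set (p3 := cpow mu (s + 3)%C).
set (H := fun (k : nat) (t : R) => match k with
  | O => (N 0 t - P 0 t - 2 * s * p1 * t - s * (s + 1) * (s + 2) * p3 / 3 * (t * t * t))%C
  | 1%nat => (s * (N 1 t + P 1 t) - 2 * s * p1 - s * (s + 1) * (s + 2) * p3 * (t * t))%C
  | 2%nat => (s * (s + 1) * (N 2 t - P 2 t) - 2 * (s * (s + 1) * (s + 2)) * p3 * t)%C
  | 3%nat => (s * (s + 1) * (s + 2) * (N 3 t + P 3 t) - 2 * (s * (s + 1) * (s + 2)) * p3)%C
  | 4%nat => (s * (s + 1) * (s + 2) * (s + 3) * (N 4 t - P 4 t))%C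
  | _ => (rem_coef s * (N 5 t + P 5 t))%C end).
assert (E : eta_rem a mu s = H 0%nat a).
{ unfold eta_rem, eta_pair, H, N, P, pwc. destruct (Rlt_dec 0 mu); [|lra].
  rewrite eta_term_pos, eta_term_neg by lra.
  replace (- a + mu) with (mu - a) by ring. replace (- (- a - mu)) with (mu + a) by ring.
  replace (s + 0)%C with s by ring. unfold p1, p3. fin. }
rewrite E.
assert (Tt : forall t, rderiv (fun t : R => (t * t)%C) t (2 * t)%C) by (intros t; eapply rderiv_val; [apply rderiv_mult; apply rderiv_id|]; fin).
assert (Ttt : forall t, rderiv (fun t : R => (t * t * t)%C) t (3 * (t * t))%C) by (intros t; eapply rderiv_val; [apply rderiv_mult; [fin | apply rderiv_id]|]; cbv beta; fin).
replace (Cmod (rem_coef s) * 2 * a ^ 5 * (Rpower 2 (Re s + 5) * rpw mu (Re s + 5)))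
  with (Cmod (rem_coef s) * (2 * (Rpower 2 (Re s + 5) * rpw mu (Re s + 5))) * a ^ 5) by ring.
apply rderiv_taylor; [lra| | |].
- intros k t Hk Ht. destruct k as [|[|[|[|[|k]]]]]; [| | | | |lia]; unfold H.
  + eapply rderiv_val; [apply rderiv_minus; [apply rderiv_minus; [apply rderiv_minus;
      [apply (DN 0 1); lra| apply (DP 0 1); lra]|]|]|].
    * apply rderiv_scal, rderiv_id.
    * apply rderiv_scal, Ttt.
    * fin.
  + eapply rderiv_val; [apply rderiv_minus; [apply rderiv_minus; [apply rderiv_scal, rderiv_plus;
      [apply (DN 1 2); lra| apply (DP 1 2); lra]|]|]|].
    * apply rderiv_const.
    * apply rderiv_scal, Tt.
    * fin.
  + eapply rderiv_val; [apply rderiv_minus; [apply rderiv_scal, rderiv_minus;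
      [apply (DN 2 3); lra| apply (DP 2 3); lra]|apply rderiv_scal, rderiv_id]|].
    fin.
  + eapply rderiv_val; [apply rderiv_minus; [apply rderiv_scal, rderiv_plus;
      [apply (DN 3 4); lra| apply (DP 3 4); lra]|apply rderiv_const]|].
    fin.
  + eapply rderiv_val; [apply rderiv_scal, rderiv_minus;
      [apply (DN 4 5); lra| apply (DP 4 5); lra]|].
    unfold rem_coef. fin.
- assert (E0 : forall k, N k 0 = P k 0) by (intros; unfold N, P; fin).
  assert (E1 : P 1 0 = p1) by (unfold P, p1; fin).
  assert (E3 : P 3 0 = p3) by (unfold P, p3; fin).
  intros k Hk. destruct k as [|[|[|[|[|k]]]]]; unfold H;
    rewrite !E0, ?E1, ?E3; fin.
- intros t Ht. unfold H. rewrite Cmod_mult. apply Rmult_le_compat_l; [pos|].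
  assert (G : forall x, mu / 2 <= x -> Cmod (cpow x (s + 5)) <= Rpower 2 (Re s + 5) * rpw mu (Re s + 5)).
  { intros x Hx. rewrite Cmod_cpow.
    apply Rle_trans with (Rpower (mu / 2) (- (Re s + 5))); [apply Rpower_decr; lra|].
    unfold rpw. destruct (Rlt_dec 0 mu); [|lra].
    replace (Rpower 2 (Re s + 5)) with (Rpower (/ 2) (- (Re s + 5))).
    - rewrite Rpower_mult_distr by lra. right; fin.
    - unfold Rpower. rewrite ln_Rinv by lra. fin. }
  Ctri.
  pose proof (G (mu - t) ltac:(lra)). pose proof (G (mu + t) ltac:(lra)).
  unfold N, P. lra.
Qed.

Lemma rsummable_almost {I} (a b : I -> R) (l : list I) : (forall i, 0 <= a i) ->
  rsummable b -> (forall i, ~ In i l -> a i <= b i) -> rsummable a.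
Proof.
intros Ha Hb H.
destruct (holo_sum_almost (fun i _ => RtoC (a i)) b l 0%C 1) as (M & SM & HM); auto; try lra.
- intros; apply Ent_const.
- intros i s Hi _. rewrite Cmod_R, Rabs_pos_eq; fin.
- apply rsummable_le with M; auto. split; auto.
  specialize (HM i 0%C). rewrite Cmod_R, Rabs_pos_eq in HM by auto. apply HM.
  rewrite Cmod_diag; lra.
Qed.

(** Discreteness from summability: an index with weight at least [w0] and level below [R0]
    contributes more than a small tail of the series can hold. *)
Lemma finite_below {I} (W mu : I -> R) e w0 R0 : rsummable (fun i => W i * rpw (mu i) e) ->
  0 <= e -> 0 < w0 -> 0 < R0 ->
  exists l, forall i, ~ In i l -> w0 <= W i -> 0 < mu i -> R0 <= mu i.
Proof.
intros HS He Hw HR.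
destruct (rsummable_tail _ HS (w0 * Rpower R0 (- e))) as (l & _ & H).
{ pos. }
exists l; intros i Hi HW Hmu. apply Rnot_lt_le; intros K.
specialize (H (i :: nil)).
assert (Q : W i * rpw (mu i) e + 0 < w0 * Rpower R0 (- e)) by (apply H; [repeat constructor; fin|]; intros j [<- | []]; fin).
unfold rpw in Q. destruct (Rlt_dec 0 (mu i)); auto.
assert (Rpower R0 (- e) <= Rpower (mu i) (- e)) by (apply Rpower_decr; lra).
pose proof (Rpower_pos R0 (- e)).
nra.
Qed.

Section Pairs.
Context {I : Type} (W mu : I -> R) (a w0 : R) (l0 : list I).
Hypothesis (Ha : 0 < a) (Hw0 : 0 < w0) (HW : forall i, W i = 0 \/ w0 <= W i)
  (Hsum : forall e, 4 < e -> rsummable (fun i => W i * rpw (mu i) e))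
  (Hl0 : forall i, mu i <= 0 -> In i l0).

Lemma pairs_W_nonneg i : 0 <= W i.
Proof. destruct (HW i); lra. Qed.

Lemma pairs_list : exists l, forall i, ~ In i l -> W i = 0 \/ 2 * a <= mu i.
Proof.
destruct (finite_below W mu 5 w0 (2 * a) (Hsum 5 ltac:(lra))) as (l & H); try lra.
exists (l0 ++ l). intros i Hi. destruct (HW i) as [K | K]; auto. right. apply H; auto.
- intros K'; apply Hi, in_or_app; fin.
- apply Rnot_le_lt; intros K'. apply Hi, in_or_app; fin.
Qed.

Definition pairs_Z (s : C) : C := CSum (fun i => (W i * pwc (mu i) s)%C).
Definition pairs_R (s : C) : C := CSum (fun i => (W i * eta_rem a (mu i) s)%C).

Lemma pairs_Z_csummable s : 4 < Re s -> csummable (fun i => (W i * pwc (mu i) s)%C).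
Proof.
intros Hs. apply csummable_le with (fun i => W i * rpw (mu i) (Re s)).
- intros i. rewrite Cmod_mult, Cmod_R, Cmod_pwc, Rabs_pos_eq; [lra | apply pairs_W_nonneg].
- fin.
Qed.

(** The remainder bound needs $\mu\ge2a$, which fails for finitely many indices of nonzero weight;
    [holo_sum_almost] absorbs them. The condition $\mathrm{Re}\,p>-1$ keeps the exponent
    $\mathrm{Re}\,s+5$ above 4. *)
Lemma pairs_R_majorant p : -1 < Re p -> exists d, 0 < d /\ exists M, rsummable M /\
  forall i s, Cmod (s - p)%C < d -> Cmod (W i * eta_rem a (mu i) s)%C <= M i.
Proof.
intros Hp. set (d := (Re p + 1) / 2). assert (Hd : 0 < d) by pos.
exists d; split; auto.
destruct pairs_list as [l Hl],
(Ent_bounded rem_coef p d Ent_rem_coef) as [B HB].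
(* The extreme values of $\mathrm{Re}\,s+5$ on the disc; the radius [d] is half the distance to the
   line $\mathrm{Re}=-1$, so [u] still exceeds 4. *)
set (u := Re p - d + 5). set (v := Re p + d + 5).
assert (HB0 : 0 <= B) by (eapply Rle_trans; [apply Cmod_ge_0 | apply (HB p)]; rewrite Cmod_diag; lra).
assert (Ha5 : 0 <= a ^ 5) by pos.
apply (holo_sum_almost (fun i s => (W i * eta_rem a (mu i) s)%C)
  (fun i => B * 2 * a ^ 5 * (Rpower 2 u + Rpower 2 v)
     * (W i * rpw (mu i) u + W i * rpw (mu i) v)) l p d Hd).
- intros i. apply Ent_mult; [apply Ent_const | apply Ent_eta_rem].
- apply rsummable_scal.
  + pos.
  + apply rsummable_plus; apply Hsum; unfold u, v, d; lra.
- intros i s Hi Hs. pose proof (disc_Re _ _ _ Hs). pose proof (pairs_W_nonneg i) as Wi.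
  rewrite Cmod_mult, Cmod_R, Rabs_pos_eq by auto.
  destruct (Hl i Hi) as [K | K].
  + nra.
  + assert (Q : Cmod (eta_rem a (mu i) s) <= B * 2 * a ^ 5 * ((Rpower 2 u + Rpower 2 v)
      * (rpw (mu i) u + rpw (mu i) v))).
    { eapply Rle_trans; [apply eta_rem_bound; unfold d in *; lra|].
      assert (R1 : Rpower 2 (Re s + 5) <= Rpower 2 u + Rpower 2 v).
      { pose proof (Rpower_box 2 (- v) (- u) (- (Re s + 5))) as X. rewrite !Ropp_involutive in X.
        assert (Y := X ltac:(unfold u, v; lra)). lra. }
      assert (R2 : rpw (mu i) (Re s + 5) <= rpw (mu i) u + rpw (mu i) v) by (unfold rpw; destruct (Rlt_dec 0 (mu i)); [apply Rpower_box; unfold u, v; lra| lra]).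
      pose proof (Rpower_pos 2 (Re s + 5)). pose proof (rpw_nonneg (mu i) (Re s + 5)).
      apply Rmult_le_compat.
      - pos.
      - pos.
      - apply Rmult_le_compat_r; auto. apply Rmult_le_compat_r; [lra|]. apply HB; lra.
      - nra. }
    nra.
Qed.

Lemma pairs_R_cholo p : -1 < Re p -> cholo pairs_R p.
Proof.
intros Hp. destruct (pairs_R_majorant p Hp) as (d & Hd & M & SM & HM).
exists d; split; auto. apply (holo_sum (fun i s => (W i * eta_rem a (mu i) s)%C) M); auto.
intros i. apply Ent_mult; [apply Ent_const | apply Ent_eta_rem].
Qed.

Lemma pairs_R_csummable s : -1 < Re s -> csummable (fun i => (W i * eta_rem a (mu i) s)%C).
Proof.
intros Hp. destruct (pairs_R_majorant s Hp) as (d & Hd & M & SM & HM).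
apply csummable_le with M; auto. intros i. apply HM.
rewrite Cmod_diag; lra.
Qed.

Lemma pairs_has_sum s : 4 < Re s -> has_sum (fun i => (W i * eta_pair a (mu i) s)%C)
  (2 * a * s * pairs_Z (s + 1) + a * a * a / 3 * (s * (s + 1) * (s + 2)) * pairs_Z (s + 3)
    + pairs_R s)%C.
Proof.
intros Hs.
assert (H1 : has_sum (fun i => (W i * pwc (mu i) (s + 1))%C) (pairs_Z (s + 1)%C)) by (apply csummable_has_sum, pairs_Z_csummable; rewrite re_plus, re_RtoC; lra).
assert (H3 : has_sum (fun i => (W i * pwc (mu i) (s + 3))%C) (pairs_Z (s + 3)%C)) by (apply csummable_has_sum, pairs_Z_csummable; rewrite re_plus, re_RtoC; lra).
eapply has_sum_ext; [|apply has_sum_plus; [apply has_sum_plus; apply has_sum_scal; [exact H1 | exact H3]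
  | apply csummable_has_sum, pairs_R_csummable; lra]].
intros i. unfold eta_rem. fin.
Qed.

Lemma pairs_abs_summable s : 4 < Re s -> rsummable (fun i =>
  W i * (Cmod (eta_term (- a + mu i) s) + Cmod (eta_term (- a - mu i) s))).
Proof.
intros Hs. destruct pairs_list as [l Hl].
apply (rsummable_almost _ (fun i => 2 * Rpower 2 (Re s) * (W i * rpw (mu i) (Re s))) l).
- intros i. pose proof (pairs_W_nonneg i). pos.
- apply rsummable_scal; fin.
- intros i Hi. pose proof (pairs_W_nonneg i).
  destruct (Hl i Hi) as [-> | K]; [lra|].
  assert (G : forall x, mu i / 2 <= Rabs x -> Cmod (eta_term x s) <= Rpower 2 (Re s) * rpw (mu i) (Re s)).
  { intros x Hx. assert (x <> 0) by (intros ->; rewrite Rabs_R0 in Hx; lra).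
    rewrite Cmod_eta_term by auto.
    apply Rle_trans with (Rpower (mu i / 2) (- Re s)); [apply Rpower_decr; lra|].
    unfold rpw. destruct (Rlt_dec 0 (mu i)); [|lra].
    replace (Rpower 2 (Re s)) with (Rpower (/ 2) (- Re s)).
    - rewrite Rpower_mult_distr by lra. right; fin.
    - unfold Rpower. rewrite ln_Rinv by lra. fin. }
  assert (G1 := G (- a + mu i)). assert (G2 := G (- a - mu i)).
  rewrite Rabs_pos_eq in G1 by lra. rewrite Rabs_left in G2 by lra.
  nra.
Qed.

End Pairs.

(** * Epstein sums *)

Definition Z_code (x : Z) : nat + nat :=
  if Z_le_dec 0 x then inl (Z.to_nat x) else inr (Z.to_nat (- x)).

Lemma Z_code_inj x y : Z_code x = Z_code y -> x = y.
Proof.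
unfold Z_code; destruct (Z_le_dec 0 x), (Z_le_dec 0 y); intros E; inversion E; lia.
Qed.

Lemma Z_pseries e : 1 < e -> rsummable (fun x : Z => Rpower (1 + Rabs (IZR x)) (- e)).
Proof.
intros He.
set (a := fun c : nat + nat => match c with
   | inl n => Rpower (INR n + 1) (- e) | inr n => Rpower (INR n + 1) (- e) end).
assert (Ha : rsummable a) by (apply rsummable_sum; apply pseries_summable; lra).
apply (rsummable_le _ (fun x => a (Z_code x))).
- intros x; split; [pos|].
  unfold a, Z_code. destruct (Z_le_dec 0 x) as [H | H]; right; f_equal;
    rewrite INR_IZR_INZ, Z2Nat.id by lia.
  + apply IZR_le in H. rewrite Rabs_pos_eq by lra. lra.
  + assert (IZR x < 0) by (apply IZR_lt; lia). rewrite Rabs_left, opp_IZR by lra. lra.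
- apply rsummable_comp; auto. apply Z_code_inj.
Qed.

Section Epstein.
Variables (A B D : R).
Hypothesis (HA : 0 < A) (HB : 0 < B).

(** A positive definite binary form in triangular coordinates, the shape in which the squared length
    of a dual lattice vector appears. *)
Definition qf (x y : R) : R := (A * x) ^ 2 + (B * y - D * x) ^ 2.

Definition qn (xi : Z * Z) : R := sqrt (qf (IZR (fst xi)) (IZR (snd xi))).

Definition qf_const : R := / (8 * (/ A ^ 2 + (1 + D ^ 2 / A ^ 2) / B ^ 2)).

Lemma qf_lower x y : x ^ 2 + y ^ 2 <= 2 * (/ A ^ 2 + (1 + D ^ 2 / A ^ 2) / B ^ 2) * qf x y.
Proof.
set (u := A * x). set (v := B * y - D * x).
assert (Ex : x = u / A) by (unfold u; fin).
assert (Ey : y = (v + D / A * u) / B) by (unfold u, v; fin).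
unfold qf. fold u v. rewrite Ex, Ey.
assert (K : (v + D / A * u) ^ 2 <= 2 * (v ^ 2 + D ^ 2 / A ^ 2 * u ^ 2)) by (replace (D ^ 2 / A ^ 2 * u ^ 2) with ((D / A * u) ^ 2) by fin; pose proof (pow2_ge_0 (v - D / A * u)); nra).
assert (HA2 : 0 < / A ^ 2) by pos.
assert (HB2 : 0 < / B ^ 2) by pos.
replace ((u / A) ^ 2) with (/ A ^ 2 * u ^ 2) by fin.
replace (((v + D / A * u) / B) ^ 2) with (/ B ^ 2 * (v + D / A * u) ^ 2) by fin.
pose proof (pow2_ge_0 v). pose proof (pow2_ge_0 D).
assert (K2 : / B ^ 2 * (v + D / A * u) ^ 2 <= / B ^ 2 * (2 * (v ^ 2 + D ^ 2 / A ^ 2 * u ^ 2)))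
  by nra.
apply Rle_trans with (/ A ^ 2 * u ^ 2 + / B ^ 2 * (2 * (v ^ 2 + D ^ 2 / A ^ 2 * u ^ 2))); [lra|].
set (p := / A ^ 2) in *. set (q := / B ^ 2) in *.
replace (D ^ 2 / A ^ 2) with (D ^ 2 * p) by auto.
replace ((1 + D ^ 2 * p) / B ^ 2) with ((1 + D ^ 2 * p) * q) by reflexivity.
assert (0 <= q * (D ^ 2 * p * v ^ 2))
  by pos.
nra.
Qed.

Lemma qf_nonneg x y : 0 <= qf x y.
Proof. unfold qf; pose proof (pow2_ge_0 (A * x)); pose proof (pow2_ge_0 (B * y - D * x)); lra. Qed.

Lemma qf_const_pos : 0 < qf_const.
Proof.
apply Rinv_0_lt_compat.
assert (0 < / A ^ 2) by pos.
assert (0 < / B ^ 2) by pos.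
assert (0 <= (D ^ 2 / A ^ 2)) by nra.
nra.
Qed.

(** Comparison with a product decouples the two coordinates, so that the double series is dominated
    by a product of p-series. It uses that a nonzero integer point has $x^2+y^2\ge1$. *)
Lemma qf_product (x y : Z) : (x, y) <> (0, 0)%Z ->
  qf_const * ((1 + Rabs (IZR x)) * (1 + Rabs (IZR y))) <= qf (IZR x) (IZR y).
Proof.
intros N. pose proof (qf_lower (IZR x) (IZR y)) as L. pose proof qf_const_pos as P.
set (K := 2 * (/ A ^ 2 + (1 + D ^ 2 / A ^ 2) / B ^ 2)) in *.
assert (EK : qf_const = / (4 * K)) by (unfold qf_const, K; fin).
assert (HK : 0 < K).
{ rewrite EK in P. apply Rnot_le_lt; intros Hn.
  destruct (Req_dec K 0) as [E | E]; [rewrite E, Rmult_0_r, Rinv_0 in P; lra|].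
  assert (/ (4 * K) < 0) by (apply Rinv_lt_0_compat; lra). lra. }
assert (M : (1 + Rabs (IZR x)) * (1 + Rabs (IZR y)) <= 4 * (IZR x ^ 2 + IZR y ^ 2)).
{ rewrite <- (pow2_abs (IZR x)), <- (pow2_abs (IZR y)), <- !abs_IZR.
  assert (Hxy : (1 <= Z.abs x \/ 1 <= Z.abs y)%Z) by (destruct (Z.eq_dec x 0) as [-> |]; [|lia]; destruct (Z.eq_dec y 0) as [-> |]; [tauto | lia]).
  set (a := IZR (Z.abs x)) in *. set (b := IZR (Z.abs y)) in *.
  assert (H1 : 1 <= a ^ 2 + b ^ 2) by (destruct Hxy as [H | H]; apply IZR_le in H; fold a in H || fold b in H; nra).
  pose proof (pow2_ge_0 (b - 1)). nra. }
apply Rle_trans with (/ (4 * K) * (4 * (IZR x ^ 2 + IZR y ^ 2))).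
- nra.
- apply Rmult_le_reg_l with K; auto.
  replace (K * (/ (4 * K) * (4 * (IZR x ^ 2 + IZR y ^ 2)))) with (IZR x ^ 2 + IZR y ^ 2) by fin.
  lra.
Qed.

Lemma qn_pos xi : xi <> (0, 0)%Z -> 0 < qn xi.
Proof.
intros N. apply sqrt_lt_R0.
destruct xi as [x y]; simpl. pose proof (qf_product x y N). pose proof qf_const_pos.
pose proof (Rabs_pos (IZR x)). pose proof (Rabs_pos (IZR y)).
assert (0 < qf_const * ((1 + Rabs (IZR x)) * (1 + Rabs (IZR y)))); [|lra].
pos.
Qed.

Lemma qn_0 : qn (0, 0)%Z = 0.
Proof. unfold qn, qf; simpl. rewrite !Rmult_0_r, Rminus_0_r, Rmult_0_l, Rplus_0_r. apply sqrt_0. Qed.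

Lemma qn_summable e : 2 < e -> rsummable (fun xi => rpw (qn xi) e).
Proof.
intros He. pose proof qf_const_pos as Hc.
apply rsummable_le with (fun xi => Rpower qf_const (- (e / 2)) *
   (Rpower (1 + Rabs (IZR (fst xi))) (- (e / 2)) * Rpower (1 + Rabs (IZR (snd xi))) (- (e / 2)))).
- intros [x y]; split; [apply rpw_nonneg|].
  pose proof (Rabs_pos (IZR x)). pose proof (Rabs_pos (IZR y)).
  assert (0 < (1 + Rabs (IZR x)) * (1 + Rabs (IZR y))) by nra.
  simpl. rewrite !Rpower_mult_distr by lra.
  unfold rpw. destruct (Rlt_dec 0 (qn (x, y))) as [Hq | Hq]; [|pos].
  assert (N : (x, y) <> (0, 0)%Z) by (intros E; rewrite E, qn_0 in Hq; lra).
  pose proof (qf_product x y N) as L.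
  assert (0 < qf_const * ((1 + Rabs (IZR x)) * (1 + Rabs (IZR y)))) by now apply Rmult_lt_0_compat.
  replace (Rpower (qn (x, y)) (- e)) with (Rpower (qf (IZR x) (IZR y)) (- (e / 2))).
  + apply Rpower_decr; lra.
  + unfold qn, Rpower; simpl. rewrite ln_sqrt by lra. fin.
- apply rsummable_scal; [pos|].
  apply (rsummable_prod (fun x => Rpower (1 + Rabs (IZR x)) (- (e / 2)))
    (fun x => Rpower (1 + Rabs (IZR x)) (- (e / 2)))); apply Z_pseries; lra.
Qed.

(** * Sign characters and second differences *)

Definition par (b : bool) (x : Z) : R := if b then (if Z.even x then 1 else -1) else 1.

Definition chi2 (b c : bool) (xi : Z * Z) : R := par b (fst xi) * par c (snd xi).

Lemma par_cases b x : par b x = 1 \/ par b x = -1.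
Proof. unfold par; destruct b, (Z.even x); lra. Qed.

Lemma Cmod_chi2 b c xi : Cmod (chi2 b c xi) = 1.
Proof.
unfold chi2. rewrite Cmod_R, Rabs_mult.
destruct (par_cases b (fst xi)) as [-> | ->], (par_cases c (snd xi)) as [-> | ->];
  rewrite ?Rabs_R1, ?Rabs_m1; lra.
Qed.

Definition eps_S (b c : bool) (s : C) : C := CSum (fun xi => (chi2 b c xi * pwc (qn xi) s)%C).

Lemma eps_S_csummable b c s : 2 < Re s -> csummable (fun xi => (chi2 b c xi * pwc (qn xi) s)%C).
Proof.
intros Hs. apply csummable_le with (fun xi => rpw (qn xi) (Re s)); [|now apply qn_summable].
intros xi. rewrite Cmod_mult, Cmod_chi2, Cmod_pwc; lra.
Qed.

Definition zadd (xi e : Z * Z) : Z * Z := (fst xi + fst e, snd xi + snd e)%Z.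
Definition zopp (e : Z * Z) : Z * Z := (- fst e, - snd e)%Z.

Definition diff2 (e xi : Z * Z) (s : C) : C :=
  (2 * pwc (qn xi) s - pwc (qn (zadd xi e)) s - pwc (qn (zadd xi (zopp e))) s)%C.

Lemma has_sum_translate (e : Z * Z) (g : Z * Z -> C) S : has_sum g S ->
  has_sum (fun xi => g (zadd xi e)) S.
Proof.
intros H. apply (has_sum_reindex (fun xi => zadd xi (zopp e))).
- intros [x y] [x' y'] E. injection E; intros. f_equal; lia.
- intros [x y] K. elim (K (zadd (x, y) e)). unfold zadd; simpl. fin.
- eapply has_sum_ext; [|exact H]. intros [x y]; f_equal. unfold zadd; simpl. fin.
Qed.

Definition diff_coef (e : Z * Z) (z : C) : R :=
  8 * qf (IZR (fst e)) (IZR (snd e)) * (Cmod z * Cmod (z + 1)%C + Cmod z).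

(** On the line through [xi] in the direction [e] the form is a quadratic [Q]. The combination
    $2g(0)-g(t)-g(-t)$ of $g=Q^{-s/2}$ vanishes to second order at 0, and $g''$ decays by two powers
    of the norm more than $g$. *)
Lemma diff2_bound e xi s : 0 < qn e -> 2 * qn e <= qn xi -> 0 <= Re s ->
  Cmod (diff2 e xi s) <= diff_coef e (s / 2) * (Rpower (/ 4) (- (Re s / 2 + 1)) * rpw (qn xi) (Re s + 2)).
Proof.
intros He Hx Hs.
set (x := IZR (fst xi)). set (y := IZR (snd xi)). set (u := IZR (fst e)). set (v := IZR (snd e)).
set (q0 := qf x y). set (q2 := qf u v).
set (q1 := 2 * (A * x * (A * u) + (B * y - D * x) * (B * v - D * u))).
set (Q := fun t : R => q0 + q1 * t + q2 * t ^ 2).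
assert (EQ : forall t, qf (x + t * u) (y + t * v) = Q t) by (intros t; unfold Q, q0, q1, q2, qf; lra).
assert (Hq0 : 0 <= q0) by apply qf_nonneg. assert (Hq2 : 0 <= q2) by apply qf_nonneg.
(* Cauchy-Schwarz for the form; the added square is that of the determinant of the two vectors. *)
assert (Disc : q1 ^ 2 <= 4 * q0 * q2) by (unfold q1, q0, q2, qf; pose proof (pow2_ge_0 (A * x * (B * v - D * u) - A * u * (B * y - D * x))); nra).
assert (Ea : qn xi ^ 2 = q0) by (unfold qn; rewrite pow2_sqrt; fin).
assert (Eb : qn e ^ 2 = q2) by (unfold qn; rewrite pow2_sqrt; fin).
(* Since [e] has at most half the length of [xi], the segment stays at distance at least half of
   [qn xi] from the origin. *)
assert (HQ : forall t, -1 <= t <= 1 -> qn xi ^ 2 / 4 <= Q t).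
{ intros t Ht. unfold Q.
  assert (K : Rabs q1 <= 2 * qn xi * qn e) by (apply Rsqr_le_abs_0_alt || apply Rabs_le_between; assert (0 <= 2 * qn xi * qn e) by nra; nra).
  apply Rabs_le_between in K.
  set (a := qn xi) in *. set (b := qn e) in *.
  assert (q1 * t >= - (2 * a * b * Rabs t)) by (destruct (Rle_dec 0 t); [rewrite Rabs_pos_eq by auto | rewrite Rabs_left by lra]; nra).
  assert (b ^ 2 * t ^ 2 = (b * Rabs t) ^ 2) by (rewrite Rpow_mult_distr, pow2_abs; lra).
  assert (b * Rabs t <= a / 2) by (assert (Rabs t <= 1) by (apply Rabs_le; lra); nra).
  nra. }
assert (Hc : 0 < qn xi ^ 2 / 4) by nra.
set (z := (s / 2)%C).
assert (Ez : Re z = Re s / 2).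
{ unfold z, Cdiv. rewrite <- RtoC_inv by lra. rewrite re_scal_r. lra. }
assert (Pw : forall a, 0 < qf (fst a) (snd a) ->
   pwc (sqrt (qf (fst a) (snd a))) s = cpow (qf (fst a) (snd a)) z).
{ intros [a b] H; simpl in *. unfold pwc. pose proof (sqrt_lt_R0 _ H).
  destruct (Rlt_dec 0 (sqrt (qf a b))); [|lra]. unfold cpow. f_equal.
  rewrite ln_sqrt by auto. unfold Rdiv, z. rewrite RtoC_mult, RtoC_inv by lra. fin. }
set (g := fun t : R => cpow (Q t) z).
set (g1 := fun t : R => ((q1 + 2 * q2 * t)%R * (- z * cpow (Q t) (z + 1)))%C).
set (g2 := fun t : R => ((2 * q2)%R * (- z * cpow (Q t) (z + 1))
   + ((q1 + 2 * q2 * t) ^ 2)%R * (z * (z + 1) * cpow (Q t) (z + 2)))%C).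
assert (DQ : forall t, is_derive Q t (q1 + 2 * q2 * t)) by (intros t; unfold Q; auto_derive; lra).
assert (Dc : forall t w, -1 <= t <= 1 -> rderiv (fun t => cpow (Q t) w) t
    ((q1 + 2 * q2 * t)%R * (- w * cpow (Q t) (w + 1)))%C).
{ intros t w Ht. apply (rderiv_comp_R (fun x => cpow x w) Q); auto.
  apply rderiv_cpow. specialize (HQ t Ht); lra. }
assert (D1 : forall t, -1 <= t <= 1 -> rderiv g t (g1 t)) by eauto.
assert (D2 : forall t, -1 <= t <= 1 -> rderiv g1 t (g2 t)).
{ intros t Ht. eapply rderiv_val.
  - apply rderiv_mult; [apply rderiv_RtoC | apply rderiv_scal, Dc, Ht].
    instantiate (1 := 2 * q2). auto_derive; lra.
  - unfold g2. replace (z + 1 + 1)%C with (z + 2)%C by ring.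
    rewrite RtoC_pow. fin. }
set (H := fun (k : nat) (t : R) => match k with
  | O => (2 * g 0 - g t - g (- t)%R)%C
  | 1%nat => (g1 (- t)%R - g1 t)%C
  | _ => (- g2 (- t)%R - g2 t)%C end).
assert (Dneg : forall (f f' : R -> C) t, rderiv f (- t) (f' (- t)) ->
   rderiv (fun t => f (- t)) t (- f' (- t)%R)%C).
{ intros f f' t Hf. eapply rderiv_val.
  - apply (rderiv_comp_R f Ropp t _ (-1) Hf). auto_derive; lra.
  - fin. }
assert (E : diff2 e xi s = H 0%nat 1).
{ unfold diff2, H, g. rewrite <- !EQ.
  assert (X0 := HQ 0 ltac:(lra)). assert (X1 := HQ 1 ltac:(lra)). assert (X2 := HQ (-(1)) ltac:(lra)).
  rewrite <- EQ in X0, X1, X2.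
  f_equal; [f_equal; [f_equal |]|].
  - replace (x + 0 * u) with x in * by ring. replace (y + 0 * v) with y in * by ring.
    apply (Pw (x, y)); simpl; lra.
  - unfold qn; simpl. rewrite !plus_IZR.
    replace (x + 1 * u) with (x + u) in * by ring. replace (y + 1 * v) with (y + v) in * by ring.
    apply (Pw (x + u, y + v)); simpl; lra.
  - unfold qn; simpl. rewrite !plus_IZR, !opp_IZR.
    replace (x + -(1) * u) with (x + - u) in * by ring.
    replace (y + -(1) * v) with (y + - v) in * by ring.
    apply (Pw (x + - u, y + - v)); simpl; lra. }
rewrite E.
match goal with |- _ <= ?M => replace M with (M * 1 ^ 2) by ring end.
apply rderiv_taylor; [lra| | |].
- intros k t Hk Ht. destruct k as [|[|k]]; [| |lia]; unfold H.
  + eapply rderiv_val; [apply rderiv_minus; [apply rderiv_minus; [apply rderiv_const | apply D1; lra]|]|].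
    * apply (Dneg g g1), D1; lra.
    * fin.
  + eapply rderiv_val; [apply rderiv_minus; [apply (Dneg g1 g2), D2; lra| apply D2; lra]|]. fin.
- intros k Hk. destruct k as [|[|k]]; unfold H; rewrite Ropp_0; fin.
- assert (G : forall t, -1 <= t <= 1 -> Cmod (g2 t) <=
    4 * q2 * (Cmod z * Cmod (z + 1)%C + Cmod z) * (Rpower (/ 4) (- (Re s / 2 + 1)) * rpw (qn xi) (Re s + 2))).
  { intros t Ht. pose proof (HQ t Ht) as HQt.
    (* The bound $(Q')^2\le4q_2Q$ is the discriminant inequality again; it trades the square of the
       first derivative for one factor [Q]. *)
    assert (Disc2 : (q1 + 2 * q2 * t) ^ 2 <= 4 * q2 * Q t) by (unfold Q; nra).
    assert (P1 : Rpower (Q t) (- (Re s / 2 + 1)) <= Rpower (/ 4) (- (Re s / 2 + 1)) * rpw (qn xi) (Re s + 2)).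
    { apply Rle_trans with (Rpower (qn xi ^ 2 / 4) (- (Re s / 2 + 1))); [apply Rpower_decr; lra|].
      right. unfold rpw. destruct (Rlt_dec 0 (qn xi)); [|lra].
      replace (Rpower (qn xi) (- (Re s + 2))) with (Rpower (qn xi ^ 2) (- (Re s / 2 + 1))).
      - rewrite Rpower_mult_distr by nra. fin.
      - unfold Rpower. f_equal. replace (qn xi ^ 2) with (qn xi * qn xi) by ring.
        rewrite ln_mult by lra. lra. }
    Ctri.
    rewrite !Cmod_mult, Cmod_opp, !Cmod_cpow, !Cmod_R.
    replace (Re (z + 1)) with (Re s / 2 + 1) by (rewrite re_plus, re_RtoC; lra).
    replace (Re (z + 2)) with (1 + (Re s / 2 + 1)) by (rewrite re_plus, re_RtoC; lra).
    assert (P2 : Rpower (Q t) (- (1 + (Re s / 2 + 1))) = / Q t * Rpower (Q t) (- (Re s / 2 + 1))) by (replace (- (1 + (Re s / 2 + 1))) with (-(1) + - (Re s / 2 + 1)) by ring; rewrite Rpower_plus, (Rpower_Ropp _ 1), Rpower_1 by lra; lra).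
    set (X := Rpower (Q t) (- (Re s / 2 + 1))) in *.
    rewrite !Rabs_pos_eq by (try apply pow2_ge_0; lra).
    pose proof (Cmod_ge_0 z) as Z0. pose proof (Cmod_ge_0 (z + 1)%C) as Z1.
    assert (0 <= Cmod z * Cmod (z + 1)%C) by now apply Rmult_le_pos.
    assert (T2 : (q1 + 2 * q2 * t) ^ 2 * (/ Q t * X) <= 4 * q2 * X).
    { apply Rle_trans with (4 * q2 * Q t * (/ Q t * X)).
      - apply Rmult_le_compat_r; auto. pos.
      - right; fin. }
    apply Rle_trans with (4 * q2 * (Cmod z * Cmod (z + 1)%C + Cmod z) * X).
    -
      assert (0 <= q2 * (Cmod z * X)) by pos.
      nra.
    - apply Rmult_le_compat_l; auto. pos. }
  intros t Ht. Ctri. rewrite !Cmod_opp.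
  pose proof (G t ltac:(lra)). pose proof (G (- t) ltac:(lra)).
  unfold diff_coef. fold u v q2 z. lra.
Qed.

Lemma Ent_pwc mu (f : C -> C) (c d : C) : (forall s, f s = (c * s + d)%C) -> Ent (fun s => pwc mu (f s)).
Proof.
intros E; unfold pwc; destruct (Rlt_dec 0 mu); [eapply Ent_cpow; fin| apply Ent_const].
Qed.

Lemma Cmod_half_le (s : C) : Cmod (s / 2)%C <= Cmod s.
Proof.
rewrite Cmod_div by apply RtoC_2. rewrite Cmod_R, Rabs_pos_eq by lra.
pose proof (Cmod_ge_0 s). lra.
Qed.

Lemma diff2_majorant b c e p : e <> (0, 0)%Z -> 0 < Re p ->
  exists d, 0 < d /\ exists M, rsummable M /\
  forall xi s, Cmod (s - p)%C < d -> Cmod (chi2 b c xi * diff2 e xi s)%C <= M xi.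
Proof.
intros He Hp. set (d := Re p / 2). assert (Hd : 0 < d) by pos.
exists d; split; auto. pose proof (qn_pos e He) as Hqe.
destruct (finite_below (fun _ => 1) qn 3 1 (2 * qn e)) as (l & Hl); try lra.
{ apply rsummable_le with (fun xi => rpw (qn xi) 3); [|apply qn_summable; lra].
  intros xi; pose proof (rpw_nonneg (qn xi) 3); lra. }
set (u := Re p - d + 2). set (v := Re p + d + 2).
set (m := Cmod p + d).
pose proof (qf_nonneg (IZR (fst e)) (IZR (snd e))) as Hq.
set (K := 8 * qf (IZR (fst e)) (IZR (snd e)) * (m * (m + 1) + m)).
assert (HK : 0 <= K) by pos.
set (L := Rpower (/ 4) (- (u / 2)) + Rpower (/ 4) (- (v / 2))).
assert (HL : 0 < L) by (unfold L; pose proof (Rpower_pos (/ 4) (- (u / 2)));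
  pose proof (Rpower_pos (/ 4) (- (v / 2))); lra).
apply (holo_sum_almost (fun xi s => (chi2 b c xi * diff2 e xi s)%C)
  (fun xi => K * L * (rpw (qn xi) u + rpw (qn xi) v)) ((0, 0)%Z :: l) p d Hd).
- intros xi. apply Ent_mult; [apply Ent_const|].
  assert (E : forall mu, Ent (pwc mu)) by (intros; apply (Ent_pwc mu (fun s => s) 1 0); intros; fin).
  apply Ent_minus; [apply Ent_minus; [apply Ent_mult; [apply Ent_const|]|]|]; fin.
- apply rsummable_scal; [nra|]. apply rsummable_plus; apply qn_summable; unfold u, v, d; lra.
- intros xi s Hi Hs. pose proof (disc_Re _ _ _ Hs).
  assert (Nxi : xi <> (0, 0)%Z) by (intros ->; apply Hi; left; fin).
  assert (Hx : 2 * qn e <= qn xi) by (apply Hl; [intros Q; apply Hi; right; fin| lra | now apply qn_pos]).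
  rewrite Cmod_mult, Cmod_chi2, Rmult_1_l.
  eapply Rle_trans; [apply diff2_bound; unfold d in *; lra|].
  rewrite Rmult_assoc.
  assert (Hsm : Cmod s <= m).
  { unfold m. replace s with (p + (s - p))%C by ring. Ctri. lra. }
  pose proof (Cmod_half_le s) as Hh. pose proof (Cmod_ge_0 (s / 2)%C) as Hh0.
  assert (Hh1 : Cmod (s / 2 + 1)%C <= m + 1) by (Ctri; rewrite Cmod_1; lra).
  apply Rmult_le_compat.
  + pos.
  + apply Rmult_le_pos; [pos | apply rpw_nonneg].
  + apply Rmult_le_compat_l; [lra|].
    nra.
  + apply Rmult_le_compat; [pos | apply rpw_nonneg | |].
    *
      apply Rpower_box. unfold u, v; lra.
    * unfold rpw. destruct (Rlt_dec 0 (qn xi)); [apply Rpower_box; unfold u, v; lra| lra].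
Qed.

Definition eps_T (b c : bool) (e : Z * Z) (s : C) : C := CSum (fun xi => (chi2 b c xi * diff2 e xi s)%C).

Lemma eps_T_cholo b c e p : e <> (0, 0)%Z -> 0 < Re p -> cholo (eps_T b c e) p.
Proof.
intros He Hp. destruct (diff2_majorant b c e p He Hp) as (d & Hd & M & SM & HM).
exists d; split; auto. apply (holo_sum (fun xi s => (chi2 b c xi * diff2 e xi s)%C) M); auto.
intros xi. apply Ent_mult; [apply Ent_const|].
assert (E : forall mu, Ent (pwc mu)) by (intros; apply (Ent_pwc mu (fun s => s) 1 0); intros; fin).
apply Ent_minus; [apply Ent_minus; [apply Ent_mult; [apply Ent_const|]|]|]; fin.
Qed.

(** Reindexing moves the translations from the norm to the character, which changes sign under each,
    so the coefficients add up as $2+1+1=4$. The differenced series converges for $\mathrm{Re}\,s>0$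
    and thus continues the twisted sum. *)
Lemma eps_S_T b c e s : 2 < Re s ->
  (forall xi, chi2 b c (zadd xi e) = - chi2 b c xi) ->
  (forall xi, chi2 b c (zadd xi (zopp e)) = - chi2 b c xi) ->
  eps_T b c e s = (4 * eps_S b c s)%C.
Proof.
intros Hs H1 H2. apply CSum_unique.
pose proof (csummable_has_sum _ (eps_S_csummable b c s Hs)) as HS.
replace (4 * eps_S b c s)%C with (2 * eps_S b c s + eps_S b c s + eps_S b c s)%C by ring.
eapply has_sum_ext; [|apply has_sum_plus; [apply has_sum_plus; [apply has_sum_scal, HS|]|];
  [apply (has_sum_translate e), HS | apply (has_sum_translate (zopp e)), HS]].
intros xi; cbv beta. rewrite H1, H2. unfold diff2. rewrite RtoC_opp. fin.
Qed.

(** A unit step on which the character [chi2 b c] equals -1, provided [b] or [c] is true. *)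
Definition dir (b : bool) : Z * Z := if b then (1, 0)%Z else (0, 1)%Z.

Lemma eps_S_dir b c s : orb b c = true -> 2 < Re s ->
  eps_T b c (dir b) s = (4 * eps_S b c s)%C.
Proof.
intros Hbc Hs. apply eps_S_T; auto; intros [x y]; unfold chi2, zadd, par;
  destruct b, c; cbn [fst snd]; rewrite ?Z.even_add;
  destruct (Z.even x), (Z.even y); simpl; lra.
Qed.

Lemma dir_neq0 b : dir b <> (0, 0)%Z.
Proof. destruct b; discriminate. Qed.

(* The class of [(i, j)] modulo 2 is detected by the four sign characters. *)
Lemma class_sum (i j : Z) s : 2 < Re s -> 
  has_sum (fun xi => pwc (qn (2 * fst xi + i, 2 * snd xi + j)%Z) s)
   (/ 4 * (eps_S false false s + par true i * eps_S true false s
      + par true j * eps_S false true s + (par true i * par true j)%R * eps_S true true s))%C.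
Proof.
intros Hs.
assert (SS : forall b c, has_sum (fun xi => (chi2 b c xi * pwc (qn xi) s)%C) (eps_S b c s)) by (intros; now apply csummable_has_sum, eps_S_csummable).
set (g := fun xi => (/ 4 * (chi2 false false xi * pwc (qn xi) s
      + par true i * (chi2 true false xi * pwc (qn xi) s)
      + par true j * (chi2 false true xi * pwc (qn xi) s)
      + (par true i * par true j)%R * (chi2 true true xi * pwc (qn xi) s)))%C).
assert (Hg : has_sum g (/ 4 * (eps_S false false s + par true i * eps_S true false s
      + par true j * eps_S false true s + (par true i * par true j)%R * eps_S true true s))%C) by (apply has_sum_scal, has_sum_plus; [apply has_sum_plus; [apply has_sum_plus|]|];
    try apply has_sum_scal; fin).
assert (Eg : forall xi, g xi = if andb (Z.even (fst xi - i)) (Z.even (snd xi - j)) then pwc (qn xi) s else 0%C) by (intros [x y]; unfold g, chi2; simpl; rewrite !Z.even_sub; destruct (Z.even x), (Z.even i), (Z.even y), (Z.even j); simpl;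
    rewrite ?RtoC_mult; fin).
assert (Sg : csummable g) by (apply csummable_le with (fun xi => rpw (qn xi) (Re s)); [|now apply qn_summable]; intros xi; rewrite Eg; destruct (andb _ _); [rewrite Cmod_pwc; lra| rewrite Cmod_0; apply rpw_nonneg]).
rewrite <- (CSum_unique g _ Hg).
eapply has_sum_ext; [|apply (has_sum_comp (fun xi : Z * Z => (2 * fst xi + i, 2 * snd xi + j)%Z) g)]; auto.
- intros [x y]. rewrite Eg; cbn [fst snd].
  replace (2 * x + i - i)%Z with (2 * x)%Z by ring. replace (2 * y + j - j)%Z with (2 * y)%Z by ring.
  rewrite !Z.even_mul; fin.
- intros [x y] [x' y'] E. pose proof (f_equal fst E) as E1. pose proof (f_equal snd E) as E2.
    cbn [fst snd] in E1, E2. f_equal; lia.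
- intros [x y] K. rewrite Eg; cbn [fst snd].
  destruct (Z.even (x - i)) eqn:E1, (Z.even (y - j)) eqn:E2; auto.
  exfalso. apply Z.even_spec in E1, E2. destruct E1 as [k1 E1], E2 as [k2 E2].
  apply (K (k1, k2)); cbn [fst snd]. f_equal; lia.
Qed.

Lemma qn_double x y : qn (2 * x, 2 * y)%Z = 2 * qn (x, y).
Proof.
unfold qn; cbn [fst snd]. rewrite !mult_IZR.
replace (qf (2 * IZR x) (2 * IZR y)) with (2 * 2 * qf (IZR x) (IZR y)) by (unfold qf; lra).
rewrite sqrt_mult by (try apply qf_nonneg; lra). now rewrite sqrt_square by lra.
Qed.

Lemma pwc_scale k mu s : 0 < k -> pwc (k * mu) s = (cpow k s * pwc mu s)%C.
Proof.
intros Hk. unfold pwc. destruct (Rlt_dec 0 mu), (Rlt_dec 0 (k * mu)); try nra.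
- now apply cpow_mult.
- fin.
Qed.

(** The points of the sublattice $2\mathbb{Z}^2$ contribute $2^{-s}$ times the full sum by
    homogeneity, and a quarter of the four character sums by orthogonality. This expresses the
    untwisted sum through the twisted ones; its pole sits in the factor on the left. *)
Lemma eps_S_trivial s : 2 < Re s -> ((4 * cpow 2 s - 1) * eps_S false false s)%C =
  (eps_S true false s + eps_S false true s + eps_S true true s)%C.
Proof.
intros Hs.
assert (E : (cpow 2 s * eps_S false false s)%C =
  (/ 4 * (eps_S false false s + eps_S true false s + eps_S false true s + eps_S true true s))%C).
{ eapply has_sum_unique.
  - apply has_sum_scal, csummable_has_sum, (eps_S_csummable false false s Hs).
  - pose proof (class_sum 0 0 s Hs) as K.
    rewrite Rmult_1_l, !Cmult_1_l in K.
    eapply has_sum_ext; [|exact K]. intros [x y].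
    rewrite !Z.add_0_r, qn_double, pwc_scale by lra. unfold chi2; simpl. rewrite Rmult_1_l. fin. }
transitivity (4 * (cpow 2 s * eps_S false false s) - eps_S false false s)%C; [fin|].
rewrite E. fin.
Qed.

(** The sum over the shifted lattice times [4 * cpow 2 s - 1], with the untwisted sum eliminated by
    [eps_S_trivial]. The factor 1/16 is 1/4 from [class_sum] times 1/4 from [eps_S_dir], and
    [cpow 2 (- s)] accounts for the halving in [half_n]. *)
Definition eps_P (i j : Z) (s : C) : C :=
  (cpow 2 (- s) * / 16 * (eps_T true false (dir true) s + eps_T false true (dir false) s + eps_T true true (dir true) s
     + (4 * cpow 2 s - 1) * (par true i * eps_T true false (dir true) s
      + par true j * eps_T false true (dir false) s + (par true i * par true j)%R * eps_T true true (dir true) s)))%C.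

(** The norm at the point shifted by $(i/2,j/2)$; the parities of [i] and [j] will encode the spin
    signs along [v] and [w]. *)
Definition half_n (i j : Z) (xi : Z * Z) : R := qn (2 * fst xi + i, 2 * snd xi + j)%Z / 2.

Lemma eps_P_eq i j s : 2 < Re s -> 
  ((4 * cpow 2 s - 1) * CSum (fun xi => (1 * pwc (half_n i j xi) s)%C))%C = eps_P i j s.
Proof.
intros Hs.
assert (E : CSum (fun xi => (1 * pwc (half_n i j xi) s)%C) = (cpow 2 (- s) *
  (/ 4 * (eps_S false false s + par true i * eps_S true false s
      + par true j * eps_S false true s + (par true i * par true j)%R * eps_S true true s)))%C).
{ apply CSum_unique. eapply has_sum_ext; [|apply has_sum_scal, (class_sum i j s Hs)].
  intros xi. unfold half_n. rewrite Cmult_1_l.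
  replace (qn (2 * fst xi + i, 2 * snd xi + j)%Z / 2) with (/ 2 * qn (2 * fst xi + i, 2 * snd xi + j)%Z)
    by field.
  rewrite pwc_scale by lra. unfold cpow. rewrite ln_Rinv by lra. f_equal.
  rewrite RtoC_opp; fin. }
rewrite E. unfold eps_P. rewrite !eps_S_dir by auto.
pose proof (eps_S_trivial s Hs) as K.
transitivity (cpow 2 (- s) * / 4 * ((4 * cpow 2 s - 1) * eps_S false false s
   + (4 * cpow 2 s - 1) * (par true i * eps_S true false s
      + par true j * eps_S false true s + (par true i * par true j)%R * eps_S true true s)))%C; [fin|].
rewrite K. fin.
Qed.

Lemma cholo_eps_P i j p : 0 < Re p -> cholo (eps_P i j) p.
Proof.
intros Hp.
assert (E2 : cholo (fun s => (4 * cpow 2 s - 1)%C) p) by (apply cholo_Ent, Ent_minus; [|apply Ent_const]; apply Ent_mult; [apply Ent_const|]; apply (Ent_cpow 2 (fun s => s) 1 0); intros; fin).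
assert (E1 : cholo (fun s => (cpow 2 (- s) * / 16)%C) p) by (apply cholo_Ent, Ent_mult; [|apply Ent_const]; apply (Ent_cpow 2 (fun s => (- s)%C) (-1) 0); intros; fin).
assert (TT : forall b c d, cholo (eps_T b c (dir d)) p) by (intros; apply eps_T_cholo; auto; apply dir_neq0).
assert (SC : forall (k : C) f, cholo f p -> cholo (fun s => (k * f s)%C) p) by (intros; apply cholo_mult; auto; apply cholo_Ent, Ent_const).
apply cholo_mult; auto.
apply cholo_plus; [apply cholo_plus; [apply cholo_plus|]; fin|].
apply cholo_mult; auto.
apply cholo_plus; [apply cholo_plus|]; fin.
Qed.

Lemma half_n_summable i j e : 2 < e -> rsummable (fun xi => rpw (half_n i j xi) e).
Proof.
intros He. apply rsummable_le with (fun xi => Rpower 2 e * rpw (qn (2 * fst xi + i, 2 * snd xi + j)%Z) e).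
- split; [apply rpw_nonneg|]. unfold half_n, rpw.
  set (m := qn _). destruct (Rlt_dec 0 (m / 2)), (Rlt_dec 0 m); try lra.
  right. replace (m / 2) with (/ 2 * m) by field. rewrite <- Rpower_mult_distr by lra. f_equal.
  unfold Rpower. rewrite ln_Rinv by lra. fin.
- apply rsummable_scal; [pos|].
  apply (rsummable_comp (fun xi : Z * Z => (2 * fst xi + i, 2 * snd xi + j)%Z) (fun xi => rpw (qn xi) e)).
  + intros [x y] [x' y'] E. pose proof (f_equal fst E) as E1. pose proof (f_equal snd E) as E2.
    cbn [fst snd] in E1, E2. f_equal; lia.
  + now apply qn_summable.
Qed.

Lemma half_n_zero_list i j : exists l, forall xi, half_n i j xi <= 0 -> In xi l.
Proof.
exists (((- i) / 2, (- j) / 2)%Z :: nil). intros [x y] H. left.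
destruct (classic ((2 * x + i, 2 * y + j)%Z = (0, 0)%Z)) as [E | N].
- pose proof (f_equal fst E) as E1. pose proof (f_equal snd E) as E2. cbn [fst snd] in E1, E2.
  f_equal; [replace (- i)%Z with (x * 2)%Z by lia | replace (- j)%Z with (y * 2)%Z by lia];
    apply Z.div_mul; lia.
- pose proof (qn_pos _ N). unfold half_n in H; cbn [fst snd] in H. lra.
Qed.

End Epstein.

(** * Continuation of the eta function *)

(* Indices of the eigenspinor basis: excited states ((p, n), (j, sign, conjugate))
   of oscillator level n + 1, ground states (p, (j, conjugate)), and torus modes. *)
Definition Idx : Type :=
  ((nat * nat) * (nat * bool * bool) + nat * (nat * bool)) + (Z * Z) * bool.

Definition bsgn (b : bool) : R := if b then 1 else -1.

Definition freq (r q0 : R) (p : nat) : R := 2 * PI * (INR p + q0) / r.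

Definition nil_level (A c : R) (n : nat) : R := sqrt (c ^ 2 + 2 * INR n * c / A).

(** [Idx] is a fixed type that ignores multiplicities; [dom] selects the indices that occur. [Nm p]
    counts the theta series of a frequency, and torus modes occur only for the trivial central
    sign. *)
Definition dom (Nm : nat -> nat) (tor : bool) (i : Idx) : Prop :=
  match i with
  | inl (inl ((p, n), (j, b, cj))) => (j < Nm p)%nat
  | inl (inr (p, (j, cj))) => (j < Nm p)%nat
  | inr _ => tor = true
  end.

Definition lamI (A r q0 : R) (nq : Z * Z -> R) (i : Idx) : R :=
  match i with
  | inl (inl ((p, n), (j, b, cj))) =>
      - (1 / (4 * A)) + bsgn b * nil_level A (freq r q0 p) (S n)
  | inl (inr (p, (j, cj))) => - (1 / (4 * A)) - freq r q0 p
  | inr (xi, b) => - (1 / (4 * A)) + bsgn b * nq xi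
  end.

Definition eta_fam (Nm : nat -> nat) (tor : bool) (lam : Idx -> R) (s : C) (i : Idx) : C :=
  if excluded_middle_informative (dom Nm tor i) then eta_term (lam i) s else 0%C.

Lemma has_sum_prod_finite {I J} (g : I * J -> C) (L : I -> list J) (h : I -> C) (B : I -> R) S :
  (forall i, NoDup (L i)) -> (forall i j, ~ In j (L i) -> g (i, j) = 0%C) ->
  (forall i, lsum (fun j => g (i, j)) (L i) = h i) ->
  (forall i, rsum (fun j => Cmod (g (i, j))) (L i) <= B i) -> rsummable B ->
  has_sum h S -> csummable g /\ has_sum g S.
Proof.
intros HL Hz Hh HB SB HS.
assert (Hc : csummable g).
{ apply rsummable_pair with B; auto; [intros; fin|].
  intros i l Nl. eapply Rle_trans; auto.
  destruct (nodup_union l (L i)) as (m & Nm & I1 & I2 & I3).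
  apply Rle_trans with (rsum (fun j => Cmod (g (i, j))) m).
  - apply rsum_incl; auto. intros; fin.
  - destruct (NoDup_incl_split (L i) m (HL i) Nm I2) as (l' & P & N' & D').
    rewrite (rsum_perm _ _ _ P), rsum_app.
    assert (E : rsum (fun j => Cmod (g (i, j))) l' = 0); [|lra].
    clear - D' Hz. induction l' as [|j l' IH]; simpl; auto.
    rewrite IH, Hz, Cmod_0; [lra | apply D'; left; fin| intros k Hk; apply D'; right; fin]. }
split; auto.
assert (E : CSum g = S); [|rewrite <- E; now apply csummable_has_sum].
eapply has_sum_unique; [apply has_sum_rows, Hc|].
eapply has_sum_ext; [|exact HS]. symmetry. apply CSum_unique.
eapply has_sum_val; [apply has_sum_finite; [fin | apply Hz]|]. fin.
Qed.

Definition jbb (n : nat) : list (nat * bool * bool) :=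
  list_prod (list_prod (seq 0 n) (true :: false :: nil)) (true :: false :: nil).

Definition jb (n : nat) : list (nat * bool) := list_prod (seq 0 n) (true :: false :: nil).

Lemma NoDup_prod {I J} (l : list I) (m : list J) : NoDup l -> NoDup m -> NoDup (list_prod l m).
Proof.
intros Hl Hm. induction l as [|i l IH]; [constructor|].
inversion Hl. apply NoDup_app; auto.
- apply FinFun.Injective_map_NoDup; auto. congruence.
- intros [i' j'] K1 K2. apply in_map_iff in K1. destruct K1 as (j & E & _).
  apply in_prod_iff in K2. destruct K2 as [K2 _]. congruence.
Qed.

Lemma NoDup_bb : NoDup (true :: false :: nil).
Proof. repeat constructor; simpl; lra. Qed.

Lemma In_bb b : In b (true :: false :: nil). Proof. destruct b; simpl; lra. Qed.

Lemma In_jbb n j b c : In (j, b, c) (jbb n) <-> (j < n)%nat.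
Proof.
unfold jbb. rewrite !in_prod_iff, in_seq. pose proof (In_bb b). pose proof (In_bb c). intuition lia.
Qed.

Lemma In_jb n j b : In (j, b) (jb n) <-> (j < n)%nat.
Proof. unfold jb. rewrite in_prod_iff, in_seq. pose proof (In_bb b). intuition lia. Qed.

Lemma lsum_prod_bb {I} (g : I * bool -> C) (l : list I) :
  lsum g (list_prod l (true :: false :: nil)) = lsum (fun i => (g (i, true) + g (i, false))%C) l.
Proof. induction l as [|i l IH]; simpl; auto. rewrite IH; fin. Qed.

Lemma rsum_prod_bb {I} (g : I * bool -> R) (l : list I) :
  rsum g (list_prod l (true :: false :: nil)) = rsum (fun i => g (i, true) + g (i, false)) l.
Proof. induction l as [|i l IH]; simpl; auto. lra. Qed.

Lemma lsum_const_seq (c : C) a n : lsum (fun _ : nat => c) (seq a n) = (INR n * c)%C.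
Proof.
revert a; induction n as [|n IH]; intros a; [simpl; fin|].
rewrite S_INR, RtoC_plus. simpl. rewrite IH. fin.
Qed.

Lemma rsum_const_seq (c : R) a n : rsum (fun _ : nat => c) (seq a n) = INR n * c.
Proof.
revert a; induction n as [|n IH]; intros a; [simpl; lra|].
rewrite S_INR. simpl. rewrite IH. lra.
Qed.

Section Continuation.
Variables (A m q0 : R) (Nm : nat -> nat) (tor : bool) (Aq Bq Dq : R) (i0 j0 : Z).
Hypothesis (HA : 0 < A) (Hm : 0 < m) (Hq0 : 0 < q0).
Hypothesis (HN : forall p, INR (Nm p) = m * (INR p + q0)).
Hypothesis (HAq : 0 < Aq) (HBq : 0 < Bq).

Let a : R := 1 / (4 * A).
Let al : R := 4 * PI / A.
Let be : R := PI * A.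
Let nq : Z * Z -> R := half_n Aq Bq Dq i0 j0.
Let lam : Idx -> R := lamI A 1 q0 nq.

Lemma cont_pos : 0 < a /\ 0 < al /\ 0 < be.
Proof.
pose proof PI_RGT_0.
repeat split; try (apply Rdiv_lt_0_compat; lra). pos.
Qed.

Lemma level_nil_mu p n : nil_level A (freq 1 q0 p) (S n) = nil_mu al be q0 (p, n).
Proof.
unfold nil_level, nil_mu, freq, al, be. f_equal. rewrite S_INR. simpl. fin.
Qed.

Lemma nil_pairs_hyp :
  0 < 2 * m * q0 /\ (forall x, nil_W q0 m x = 0 \/ 2 * m * q0 <= nil_W q0 m x) /\
  (forall e, 4 < e -> rsummable (fun x => nil_W q0 m x * rpw (nil_mu al be q0 x) e)) /\
  (forall x, nil_mu al be q0 x <= 0 -> In x nil).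
Proof.
destruct cont_pos as (_ & Hal & Hbe).
split; [|split; [|split]].
- pos.
- intros x. unfold nil_W. pose proof (pos_INR (fst x)). nra.
- intros e He. eapply rsummable_le; [|apply (nil_summable al be q0 m Hal Hbe Hq0 Hm e He)].
  intros x. unfold rpw. pose proof (nil_mu_pos al be q0 Hal Hbe Hq0 x).
  destruct (Rlt_dec 0 (nil_mu al be q0 x)); [|lra]. split; fin.
- intros x K. pose proof (nil_mu_pos al be q0 Hal Hbe Hq0 x). lra.
Qed.

Lemma nil_pairs_Z s : pairs_Z (nil_W q0 m) (nil_mu al be q0) s = nil_Z al be q0 m s.
Proof.
destruct cont_pos as (_ & Hal & Hbe).
unfold pairs_Z, nil_Z. f_equal. funext x.
unfold pwc. pose proof (nil_mu_pos al be q0 Hal Hbe Hq0 x).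
destruct (Rlt_dec 0 (nil_mu al be q0 x)); fin.
Qed.

(** In [nil_P] at $s+1$ and $s+3$ the cleared denominators contain $s$ and $s(s+1)(s+2)$, exactly
    the factors in front of the two zeta functions. After cancellation the remaining poles lie at 1,
    2 and -1. *)
Definition F_nil (s : C) : C :=
  (4 * a * nil_P al be q0 m (s + 1) * / (s - 1) * / (s - 1) * / (s - 2)
   + 2 * a * a * a / 3 * nil_P al be q0 m (s + 3) * / (s - RtoC (-1))
   + pairs_R (nil_W q0 m) (nil_mu al be q0) a s)%C.

(** Chosen so that the ground eigenvalue $-a-2\pi(p+q_0)$ equals $-2\pi(p+gq)$. *)
Definition gq : R := q0 + a / (2 * PI).

(** The multiplicity $2m(p+q_0)$ is rewritten with $p+q_0=(p+gq)-a/(2\pi)$, which splits the series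
    into Hurwitz sums at $s-1$ and $s$. The overall minus sign is that of the eigenvalues. *)
Definition F_gr (s : C) : C :=
  (- (2) * m * cpow (2 * PI) s * (Kz gq (s - 1) * / (s - 2) + - (a / (2 * PI))%R * Kz gq s * / (s - 1)))%C.

Definition F_tor (s : C) : C :=
  (2 * a * s * eps_P Aq Bq Dq i0 j0 (s + 1) * / (4 * cpow 2 (s + 1) - 1)
   + a * a * a / 3 * (s * (s + 1) * (s + 2)) * eps_P Aq Bq Dq i0 j0 (s + 3) * / (4 * cpow 2 (s + 3) - 1)
   + pairs_R (fun _ => 1) nq a s)%C.

Definition F_eta (s : C) : C := (F_nil s + F_gr s + (if tor then F_tor s else 0))%C.

Lemma sub_neq0 (s : C) (k : R) : k < Re s -> (s - k)%C <> 0%C.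
Proof.
intros H E. assert (K : Re (s - k) = 0) by now rewrite E. rewrite re_minus, re_RtoC in K. lra.
Qed.

Lemma nil_excited_sum s : 4 < Re s ->
  csummable (fun x => eta_fam Nm tor lam s (inl (inl x))) /\
  has_sum (fun x => eta_fam Nm tor lam s (inl (inl x))) (F_nil s).
Proof.
intros Hs. destruct cont_pos as (Ha & Hal & Hbe), nil_pairs_hyp as (H1 & H2 & H3 & H4).
pose proof (pairs_has_sum (nil_W q0 m) (nil_mu al be q0) a _ nil Ha H1 H2 H3 H4 s Hs) as HS.
assert (EF : F_nil s = (2 * a * s * pairs_Z (nil_W q0 m) (nil_mu al be q0) (s + 1)
   + a * a * a / 3 * (s * (s + 1) * (s + 2)) * pairs_Z (nil_W q0 m) (nil_mu al be q0) (s + 3)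
   + pairs_R (nil_W q0 m) (nil_mu al be q0) a s)%C).
{ rewrite !nil_pairs_Z. unfold F_nil.
  assert (R1 : Re (s + 1) = Re s + 1) by reflexivity. assert (R3 : Re (s + 3) = Re s + 3) by reflexivity.
  rewrite <- (nil_Z_P al be q0 m Hal Hbe Hq0 Hm (s + 1)) by lra.
  rewrite <- (nil_Z_P al be q0 m Hal Hbe Hq0 Hm (s + 3)) by lra.
  pose proof (sub_neq0 s 1 ltac:(lra)). pose proof (sub_neq0 s 2 ltac:(lra)).
  pose proof (sub_neq0 s (-1) ltac:(lra)) as N3.
  field; fin. }
rewrite EF.
apply (has_sum_prod_finite _ (fun x => jbb (Nm (fst x))) (fun x => (nil_W q0 m x * eta_pair a (nil_mu al be q0 x) s)%C)
  (fun x => nil_W q0 m x * (Cmod (eta_term (- a + nil_mu al be q0 x) s) + Cmod (eta_term (- a - nil_mu al be q0 x) s)))).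
- intros i. repeat apply NoDup_prod; try apply NoDup_bb. apply seq_NoDup.
- intros [p n] [[j b] c] Hj. unfold eta_fam. destruct (excluded_middle_informative _) as [K | K]; auto.
  elim Hj. apply In_jbb. fin.
- intros [p n]. rewrite (lsum_ext_in _ (fun x => eta_term (- a + bsgn (snd (fst x)) * nil_mu al be q0 (p, n)) s)).
  + unfold jbb. rewrite !lsum_prod_bb. simpl. rewrite lsum_const_seq, HN.
    unfold nil_W, eta_pair; simpl. rewrite !RtoC_mult.
    replace (- a + 1 * nil_mu al be q0 (p, n)) with (- a + nil_mu al be q0 (p, n)) by ring.
    replace (- a + -1 * nil_mu al be q0 (p, n)) with (- a - nil_mu al be q0 (p, n)) by ring. fin.
  + intros [[j b] c] Hj. apply In_jbb in Hj. unfold eta_fam.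
    destruct (excluded_middle_informative _) as [K | K]; [|elim K; fin].
    unfold lam, lamI. now rewrite level_nil_mu.
- intros [p n].
  apply Rle_trans with (rsum (fun x => Cmod (eta_term (- a + bsgn (snd (fst x)) * nil_mu al be q0 (p, n)) s)) (jbb (Nm p))).
  + apply rsum_le_in. intros [[j b] c] Hj. apply In_jbb in Hj. unfold eta_fam.
    destruct (excluded_middle_informative _) as [K | K]; [|elim K; fin].
    unfold lam, lamI. rewrite level_nil_mu. fin.
  + unfold jbb. rewrite !rsum_prod_bb. simpl. rewrite rsum_const_seq, HN.
    unfold nil_W; simpl.
    replace (- a + 1 * nil_mu al be q0 (p, n)) with (- a + nil_mu al be q0 (p, n)) by ring.
    replace (- a + -1 * nil_mu al be q0 (p, n)) with (- a - nil_mu al be q0 (p, n)) by ring.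
    lra.
- exact (pairs_abs_summable (nil_W q0 m) (nil_mu al be q0) a _ nil Ha H1 H2 H3 H4 s Hs).
- fin.
Qed.

Lemma nil_ground_sum s : 4 < Re s ->
  csummable (fun x => eta_fam Nm tor lam s (inl (inr x))) /\
  has_sum (fun x => eta_fam Nm tor lam s (inl (inr x))) (F_gr s).
Proof.
intros Hs. pose proof PI_RGT_0 as HPI.
assert (Hap : 0 < a / (2 * PI)) by pos.
assert (Hg : 0 < gq) by (unfold gq; lra).
assert (R1 : Re (s - 1) = Re s - 1) by reflexivity.
pose proof (csummable_has_sum _ (csummable_hz gq (s - 1)%C Hg ltac:(lra))) as S1. fold (hz gq (s - 1)%C) in S1.
pose proof (csummable_has_sum _ (csummable_hz gq s Hg ltac:(lra))) as S0. fold (hz gq s) in S0.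
assert (ET : forall p, eta_term (- a - freq 1 q0 p) s = (- (cpow (2 * PI) s * cpow (INR p + gq) s))%C).
{ intros p. pose proof (pos_INR p).
  assert (E : - (- a - freq 1 q0 p) = 2 * PI * (INR p + gq)) by (unfold freq, gq; fin).
  rewrite eta_term_neg.
  - rewrite E, cpow_mult by lra. fin.
  - nra. }
assert (HS : has_sum (fun p => (2 * m * (INR p + q0) * eta_term (- a - freq 1 q0 p) s)%C) (F_gr s)).
{ unfold F_gr. rewrite <- (hz_Kz gq (s - 1)), <- (hz_Kz gq s) by lra.
  pose proof (sub_neq0 s 1 ltac:(lra)). pose proof (sub_neq0 s 2 ltac:(lra)).
  eapply has_sum_val; [eapply has_sum_ext; [|apply (has_sum_scal (- (2) * m * cpow (2 * PI) s)%C),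
    has_sum_plus; [exact S1 | apply (has_sum_scal (- (a / (2 * PI))%R)%C), S0]]|].
  - intros p. rewrite ET. pose proof (pos_INR p). rewrite cpow_m1 by lra.
    unfold gq. rewrite RtoC_plus, (RtoC_plus q0). fin.
  - field; fin. }
apply (has_sum_prod_finite _ (fun p => jb (Nm p)) (fun p => (2 * m * (INR p + q0) * eta_term (- a - freq 1 q0 p) s)%C)
  (fun p => 2 * m * Rpower (2 * PI) (- Re s) * Rpower (INR p + q0) (- (Re s - 1)))).
- intros i. apply NoDup_prod; [apply seq_NoDup | apply NoDup_bb].
- intros p [j c] Hj. unfold eta_fam. destruct (excluded_middle_informative _) as [K | K]; auto.
  elim Hj. apply In_jb. fin.
- intros p. rewrite (lsum_ext_in _ (fun x => eta_term (- a - freq 1 q0 p) s)).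
  + unfold jb. rewrite !lsum_prod_bb, lsum_const_seq, HN, RtoC_mult, RtoC_plus. fin.
  + intros [j c] Hj. apply In_jb in Hj. unfold eta_fam.
    destruct (excluded_middle_informative _) as [K | K]; [|elim K; fin]. fin.
- intros p.
  apply Rle_trans with (rsum (fun x => Cmod (eta_term (- a - freq 1 q0 p) s)) (jb (Nm p))).
  + apply rsum_le_in. intros [j c] Hj. apply In_jb in Hj. unfold eta_fam.
    destruct (excluded_middle_informative _) as [K | K]; [|elim K; fin]. fin.
  + unfold jb. rewrite !rsum_prod_bb, rsum_const_seq, HN, ET, Cmod_opp, Cmod_mult, !Cmod_cpow.
    pose proof (pos_INR p).
    assert (E : Rpower (INR p + q0) (- (Re s - 1)) = (INR p + q0) * Rpower (INR p + q0) (- Re s)) by (rewrite <- (Rpower_1 (INR p + q0)) at 2 by lra; rewrite <- Rpower_plus; fin).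
    rewrite E.
    assert (L : Rpower (INR p + gq) (- Re s) <= Rpower (INR p + q0) (- Re s)) by (apply Rpower_decr; unfold gq; lra).
    apply Rle_trans with (2 * m * (INR p + q0) * Rpower (2 * PI) (- Re s) * Rpower (INR p + gq) (- Re s)); [lra|].
    apply Rle_trans with (2 * m * (INR p + q0) * Rpower (2 * PI) (- Re s) * Rpower (INR p + q0) (- Re s)); [|lra].
    apply Rmult_le_compat_l; fin.
- apply rsummable_scal; [pos|].
  apply pseries_summable; lra.
- fin.
Qed.

Lemma tor_pairs_hyp : (forall x : Z * Z, 1 = 0 \/ 1 <= 1) /\
  (forall e, 4 < e -> rsummable (fun x => 1 * rpw (nq x) e)).
Proof.
split; [intros; lra|]. intros e He.
apply rsummable_scal; [lra|]. apply half_n_summable; lra.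
Qed.

Lemma tor_factor_neq0 s : 2 < Re s -> (4 * cpow 2 s - 1)%C <> 0%C.
Proof.
intros Hs E.
assert (K : Cmod (4 * cpow 2 s)%C = 1) by (replace (4 * cpow 2 s)%C with (4 * cpow 2 s - 1 + 1)%C by ring; rewrite E, Cplus_0_l; apply Cmod_1).
rewrite Cmod_mult, Cmod_cpow, Cmod_R, Rabs_pos_eq in K by lra.
assert (L : Rpower 2 (- Re s) < Rpower 2 (-(1) + -(1))) by (apply Rpower_lt; lra).
rewrite Rpower_plus, (Rpower_Ropp 2 1), Rpower_1 in L by lra. lra.
Qed.

Lemma torus_sum s : 4 < Re s ->
  csummable (fun x => eta_fam Nm tor lam s (inr x)) /\
  has_sum (fun x => eta_fam Nm tor lam s (inr x)) (if tor then F_tor s else 0)%C.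
Proof.
intros Hs. destruct cont_pos as (Ha & Hal & Hbe), tor_pairs_hyp as (H2 & H3),
(half_n_zero_list Aq Bq Dq HAq HBq i0 j0) as (l0 & H4).
pose proof (pairs_has_sum (fun _ => 1) nq a 1 l0 Ha Rlt_0_1 H2 H3 H4 s Hs) as HS.
destruct tor eqn:Etor.
2:{ assert (E : forall x, eta_fam Nm false lam s (inr x) = 0%C) by (intros x; unfold eta_fam; destruct (excluded_middle_informative _) as [K | K]; easy).
    split.
    - apply csummable_le with (fun _ => 0).
      + intros x; rewrite E, Cmod_0; lra.
      + split; [fin|]. exists 0. intros l _. induction l; simpl; lra.
    - eapply has_sum_ext; [symmetry; apply E | apply has_sum_zero]. }
assert (EF : F_tor s = (2 * a * s * pairs_Z (fun _ => 1) nq (s + 1)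
   + a * a * a / 3 * (s * (s + 1) * (s + 2)) * pairs_Z (fun _ => 1) nq (s + 3)
   + pairs_R (fun _ => 1) nq a s)%C).
{ unfold F_tor.
  assert (R1 : Re (s + 1) = Re s + 1) by reflexivity. assert (R3 : Re (s + 3) = Re s + 3) by reflexivity.
  rewrite <- (eps_P_eq Aq Bq Dq HAq HBq i0 j0 (s + 1)) by lra.
  rewrite <- (eps_P_eq Aq Bq Dq HAq HBq i0 j0 (s + 3)) by lra.
  pose proof (tor_factor_neq0 (s + 1)%C ltac:(lra)). pose proof (tor_factor_neq0 (s + 3)%C ltac:(lra)).
  unfold pairs_Z. fold nq. field; fin. }
rewrite EF.
apply (has_sum_prod_finite _ (fun _ => true :: false :: nil) (fun x => (1 * eta_pair a (nq x) s)%C)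
  (fun x => 1 * (Cmod (eta_term (- a + nq x) s) + Cmod (eta_term (- a - nq x) s)))).
- intros; apply NoDup_bb.
- intros x b Hb. elim Hb. apply In_bb.
- intros x. unfold eta_fam; simpl.
  destruct (excluded_middle_informative _) as [K | K]; [|lra].
  fold a. unfold eta_pair.
  replace (- a + 1 * nq x) with (- a + nq x) by ring. replace (- a + -1 * nq x) with (- a - nq x) by ring. fin.
- intros x. unfold eta_fam; simpl.
  destruct (excluded_middle_informative _) as [K | K]; [|lra].
  fold a.
  replace (- a + 1 * nq x) with (- a + nq x) by ring. replace (- a + -1 * nq x) with (- a - nq x) by ring.
  lra.
- exact (pairs_abs_summable (fun _ => 1) nq a 1 l0 Ha Rlt_0_1 H2 H3 H4 s Hs).
- fin.
Qed.

Lemma cholo_scal (k : C) f p : cholo f p -> cholo (fun s => (k * f s)%C) p.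
Proof. apply cholo_mult, cholo_Ent, Ent_const. Qed.

Lemma cholo_inv_sub (k : C) p : (p - k)%C <> 0%C -> cholo (fun s => (/ (s - k))%C) p.
Proof.
apply (cholo_inv (fun s => (s - k)%C)).
apply cholo_Ent, Ent_minus; [apply Ent_id | apply Ent_const].
Qed.

Lemma Re_plus_R (p : C) (k : R) : Re (p + k) = Re p + k.
Proof. fin. Qed.

Lemma cholo_poly_s p : cholo (fun s => (s * (s + 1) * (s + 2))%C) p.
Proof.
apply cholo_Ent. repeat first [apply Ent_id | apply Ent_const | apply Ent_mult | apply Ent_plus].
Qed.

Lemma F_nil_parts p : -1 < Re p ->
  cholo (fun s => (4 * a * nil_P al be q0 m (s + 1))%C) p /\
  cholo (fun s => (2 * a * a * a / 3 * nil_P al be q0 m (s + 3))%C) p /\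
  cholo (pairs_R (nil_W q0 m) (nil_mu al be q0) a) p.
Proof.
destruct cont_pos as (Ha & Hal & Hbe), nil_pairs_hyp as (H1 & H2 & H3 & H4).
split; [|split].
- apply cholo_scal. apply (cholo_shift (nil_P al be q0 m)), cholo_nil_P; auto. rewrite Re_plus_R; lra.
- apply cholo_scal. apply (cholo_shift (nil_P al be q0 m)), cholo_nil_P; auto. rewrite Re_plus_R; lra.
- eapply pairs_R_cholo; eauto.
Qed.

Lemma F_gr_parts p : -1 < Re p ->
  cholo (fun s => (- (2) * m * cpow (2 * PI) s)%C) p /\ cholo (fun s => Kz gq (s - 1)%C) p /\
  cholo (fun s => (- (a / (2 * PI))%R * Kz gq s)%C) p.
Proof.
pose proof PI_RGT_0 as HPI.
assert (Hap : 0 < a / (2 * PI)) by pos.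
assert (Hg : 0 < gq) by (unfold gq; lra).
split; [|split].
- apply cholo_scal, cholo_Ent. apply (Ent_cpow (2 * PI) (fun s => s) 1 0); intros; fin.
- apply (cholo_shift (Kz gq) (- (1))%C), cholo_Kz; auto. rewrite re_plus, re_opp, re_RtoC; lra.
- apply cholo_scal, cholo_Kz; lra.
Qed.

Lemma F_tor_parts p : -1 < Re p ->
  cholo (fun s => (2 * a * s * eps_P Aq Bq Dq i0 j0 (s + 1))%C) p /\
  cholo (fun s => (a * a * a / 3 * (s * (s + 1) * (s + 2)) * eps_P Aq Bq Dq i0 j0 (s + 3))%C) p /\
  cholo (pairs_R (fun _ => 1) nq a) p.
Proof.
intros Hp. destruct cont_pos as (Ha & Hal & Hbe), tor_pairs_hyp as (H2 & H3),
(half_n_zero_list Aq Bq Dq HAq HBq i0 j0) as (l0 & H4).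
split; [|split].
- apply cholo_mult; [apply cholo_scal, cholo_Ent, Ent_id|].
  apply (cholo_shift (eps_P Aq Bq Dq i0 j0)), cholo_eps_P; auto. rewrite Re_plus_R; lra.
- apply cholo_mult; [apply cholo_scal, cholo_poly_s|].
  apply (cholo_shift (eps_P Aq Bq Dq i0 j0)), cholo_eps_P; auto. rewrite Re_plus_R; lra.
- exact (pairs_R_cholo (fun _ => 1) nq a 1 l0 Ha Rlt_0_1 H2 H3 H4 p Hp).
Qed.

Lemma Ent_tor_factor (k : C) : Ent (fun s => (4 * cpow 2 (s + k) - 1)%C).
Proof.
apply Ent_minus; [|apply Ent_const]. apply Ent_mult; [apply Ent_const|].
apply (Ent_cpow 2 (fun s => (s + k)%C) 1 k); intros; fin.
Qed.

(** All zeros of the denominator are simple, its derivative being a nonzero multiple of an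
    exponential. *)
Lemma cmero_tor_factor (k : C) p : cmero (fun s => (/ (4 * cpow 2 (s + k) - 1))%C) p.
Proof.
apply (cmero_inv_Ent (fun s => (4 * cpow 2 (s + k) - 1)%C)); [apply Ent_tor_factor|].
intros f' Hf' _ E.
assert (K : cderiv (fun s => (4 * cpow 2 (s + k) - 1)%C) p (4 * (Cexp (- (p + k) * ln 2) * (- ln 2 * 1)))%C).
{ eapply cderiv_val; [apply cderiv_plus; [apply cderiv_scal|apply cderiv_const]|].
  - apply (cderiv_comp Cexp (fun s => (- (s + k) * ln 2)%C)); [|apply cderiv_cexp].
    apply (cderiv_ext (fun s => (- ln 2 * s + - k * ln 2)%C)); [intros; fin|].
    apply cderiv_plus; [apply cderiv_scal, cderiv_id | apply cderiv_const].
  - fin. }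
pose proof (cderiv_unique _ _ _ _ (Hf' p) K) as Q. rewrite E in Q.
assert (L : 0 < ln 2) by (rewrite <- ln_1; apply ln_increasing; lra).
symmetry in Q. revert Q. apply Cmult_neq_0; [apply RtoC_neq0; lra|].
apply Cmult_neq_0; [apply Cexp_neq0|]. rewrite Cmult_1_r, <- RtoC_opp. apply RtoC_neq0; lra.
Qed.

Lemma F_eta_cmero p : -1 < Re p -> cmero F_eta p.
Proof.
intros Hp. destruct (F_nil_parts p Hp) as (N1 & N2 & N3), (F_gr_parts p Hp) as (G1 & G2 & G3),
(F_tor_parts p Hp) as (T1 & T2 & T3).
apply cmero_cholo in N1, N2, N3, G1, G2, G3, T1, T2, T3.
apply cmero_plus; [apply cmero_plus|].
- apply cmero_plus; [apply cmero_plus|]; auto.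
  + apply cmero_mult; [apply cmero_mult; [apply cmero_mult|]|]; auto; apply cmero_inv_linear.
  + apply cmero_mult; auto; apply cmero_inv_linear.
- apply cmero_mult; auto. apply cmero_plus; apply cmero_mult; auto; apply cmero_inv_linear.
- destruct tor; [|apply cmero_cholo, cholo_Ent, Ent_const].
  apply cmero_plus; [apply cmero_plus|]; auto; apply cmero_mult; auto; apply cmero_tor_factor.
Qed.

Lemma F_eta_cholo_0 : cholo F_eta 0%C.
Proof.
assert (Hp : -1 < Re 0) by (simpl; lra).
destruct (F_nil_parts _ Hp) as (N1 & N2 & N3), (F_gr_parts _ Hp) as (G1 & G2 & G3),
(F_tor_parts _ Hp) as (T1 & T2 & T3).
assert (I1 : cholo (fun s => (/ (s - 1))%C) 0%C) by (apply cholo_inv_sub; replace (0 - 1)%C with (RtoC (-1)) by ring; apply RtoC_neq0; lra).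
assert (I2 : cholo (fun s => (/ (s - 2))%C) 0%C) by (apply cholo_inv_sub; replace (0 - 2)%C with (RtoC (-2)) by ring; apply RtoC_neq0; lra).
assert (I3 : cholo (fun s => (/ (s - RtoC (-1)))%C) 0%C) by (apply cholo_inv_sub; replace (0 - RtoC (-1))%C with (RtoC 1) by ring; apply RtoC_neq0; lra).
assert (C1 : cpow 2 1 = RtoC (/ 2)) by (rewrite cpow_1 by lra; now rewrite RtoC_inv by lra).
assert (J1 : cholo (fun s => (/ (4 * cpow 2 (s + 1) - 1))%C) 0%C) by (apply (cholo_inv (fun s => (4 * cpow 2 (s + 1) - 1)%C)); [apply cholo_Ent, Ent_tor_factor|]; rewrite Cplus_0_l, C1, <- RtoC_mult, <- RtoC_minus; apply RtoC_neq0; lra).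
assert (J3 : cholo (fun s => (/ (4 * cpow 2 (s + 3) - 1))%C) 0%C).
{ apply (cholo_inv (fun s => (4 * cpow 2 (s + 3) - 1)%C)); [apply cholo_Ent, Ent_tor_factor|].
  rewrite Cplus_0_l. replace (RtoC 3) with (1 + 1 + 1)%C by ring.
  rewrite !cpow_plus, C1, <- !RtoC_mult, <- RtoC_minus. apply RtoC_neq0; lra. }
apply cholo_plus; [apply cholo_plus|].
- apply cholo_plus; [apply cholo_plus|]; auto.
  + apply cholo_mult; [apply cholo_mult; [apply cholo_mult|]|]; fin.
  + apply cholo_mult; fin.
- apply cholo_mult; auto. apply cholo_plus; apply cholo_mult; fin.
- destruct tor; [|apply cholo_Ent, Ent_const].
  apply cholo_plus; [apply cholo_plus|]; auto; apply cholo_mult; fin.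
Qed.

Lemma eta_continuation : exists F : C -> C,
  (forall s, 4 < Re s -> csummable (eta_fam Nm tor lam s) /\ has_sum (eta_fam Nm tor lam s) (F s)) /\
  (forall p, -1 < Re p -> cmero F p) /\ cholo F 0%C.
Proof.
exists F_eta. split; [|split; [apply F_eta_cmero | apply F_eta_cholo_0]].
intros s Hs. destruct (nil_excited_sum s Hs) as [E1 E2'], (nil_ground_sum s Hs) as [G1 G2],
(torus_sum s Hs) as [T1 T2]. split.
- apply (rsummable_sum (fun i => Cmod (eta_fam Nm tor lam s i))); auto.
  apply (rsummable_sum (fun i => Cmod (eta_fam Nm tor lam s (inl i)))); fin.
- apply has_sum_sum; auto.
  apply (has_sum_sum (fun i => eta_fam Nm tor lam s (inl i))); fin.
Qed.

End Continuation.

(** * Smooth functions on the Heisenberg group *)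

Definition hcont (f : heis -> C) : Prop :=
  forall x y z eps, 0 < eps -> exists d, 0 < d /\ forall x' y' z',
    Rabs (x' - x) < d -> Rabs (y' - y) < d -> Rabs (z' - z) < d ->
    Cmod (f (x', y', z') - f (x, y, z))%C < eps.

Lemma continuous_heis_eps (u : heis -> R) x y z : continuous u (x, y, z) <->
  forall eps, 0 < eps -> exists d, 0 < d /\ forall x' y' z',
    Rabs (x' - x) < d -> Rabs (y' - y) < d -> Rabs (z' - z) < d ->
    Rabs (u (x', y', z') - u (x, y, z)) < eps.
Proof.
split.
- intros H eps He.
  assert (L : locally (u (x, y, z)) (fun w => Rabs (w - u (x, y, z)) < eps)) by (exists (mkposreal eps He); fin).
  destruct (H _ L) as [d Hd]. exists d; split; [apply cond_pos|].
  intros x' y' z' Hx Hy Hz. apply (Hd (x', y', z')). easy.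
- intros H Q [eps HQ]. destruct (H eps (cond_pos eps)) as (d & D & K).
  exists (mkposreal d D). intros [[x' y'] z'] [[Hx Hy] Hz]. apply HQ. apply K; fin.
Qed.

Lemma hcont_iff (f : heis -> C) : hcont f <->
  (forall p, continuous (fun p => Re (f p)) p) /\ (forall p, continuous (fun p => Im (f p)) p).
Proof.
split.
- split; intros [[x y] z]; apply continuous_heis_eps; intros eps He;
    destruct (H x y z eps He) as (d & D & K); exists d; split; auto; intros x' y' z' Hx Hy Hz;
    specialize (K x' y' z' Hx Hy Hz); eapply Rle_lt_trans; [|exact K| |exact K];
    rewrite <- ?re_minus, <- ?im_minus; first [apply re_le_Cmod | apply im_le_Cmod].
- intros [H1 H2] x y z eps He.
  specialize (H1 (x, y, z)). specialize (H2 (x, y, z)). rewrite continuous_heis_eps in H1, H2.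
  destruct (H1 (eps / 2)) as (d1 & D1 & K1); [lra|].
  destruct (H2 (eps / 2)) as (d2 & D2 & K2); [lra|].
  exists (Rmin d1 d2); split; [now apply Rmin_pos|]. intros x' y' z' Hx Hy Hz.
  pose proof (Rmin_l d1 d2). pose proof (Rmin_r d1 d2).
  specialize (K1 x' y' z' ltac:(lra) ltac:(lra) ltac:(lra)).
  specialize (K2 x' y' z' ltac:(lra) ltac:(lra) ltac:(lra)).
  eapply Rle_lt_trans; [apply Cmod_le_Re_Im|].
  replace eps with (eps / 2 + eps / 2) by field. apply Rplus_lt_compat; fin.
Qed.

Definition partials (f fx fy fz : heis -> C) : Prop := forall x y z,
  rderiv (fun t => f (t, y, z)) x (fx (x, y, z)) /\
  rderiv (fun t => f (x, t, z)) y (fy (x, y, z)) /\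
  rderiv (fun t => f (x, y, t)) z (fz (x, y, z)).

Definition csmooth (f : heis -> C) : Prop :=
  forall n, Ck n (fun p => Re (f p)) /\ Ck n (fun p => Im (f p)).

(** Coinduction for smoothness: a class of continuous functions whose partial derivatives exist and
    lie in the class again satisfies [Ck n] for every [n], by induction on the order. *)
Lemma csmooth_coind (P : (heis -> C) -> Prop) :
  (forall f, P f -> hcont f /\ exists fx fy fz, P fx /\ P fy /\ P fz /\ partials f fx fy fz) ->
  forall f, P f -> csmooth f.
Proof.
intros HP f Hf n; revert f Hf; induction n as [|n IH]; intros f Hf;
  destruct (HP f Hf) as (Hc & fx & fy & fz & Px & Py & Pz & Hd); apply hcont_iff in Hc;
  destruct Hc as [C1 C2'].
- easy.
- destruct (IH fx Px) as [X1 X2], (IH fy Py) as [Y1 Y2], (IH fz Pz) as [Z1 Z2].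
  assert (E : forall (g : heis -> C) (h : C -> R) (d : (heis -> R) -> heis -> R),
    (forall p, d (fun p => h (f p)) p = h (g p)) -> d (fun p => h (f p)) = (fun p => h (g p)))
    by (intros; now apply functional_extensionality).
  split; (split; [assumption | split; [intros x y z; destruct (Hd x y z) as (A & B & D)|]]).
  + split; [|split]; [exists (Re (fx (x, y, z))); exact (proj1 A) | exists (Re (fy (x, y, z))); exact (proj1 B)
      | exists (Re (fz (x, y, z))); exact (proj1 D)].
  + rewrite (E fx Re d_x), (E fy Re d_y), (E fz Re d_z); [fin| | |]; intros [[x y] z];
      destruct (Hd x y z) as (A & B & D); apply is_derive_unique;
      [exact (proj1 D) | exact (proj1 B) | exact (proj1 A)].
  + split; [|split]; [exists (Im (fx (x, y, z))); exact (proj2 A) | exists (Im (fy (x, y, z))); exact (proj2 B)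
      | exists (Im (fz (x, y, z))); exact (proj2 D)].
  + rewrite (E fx Im d_x), (E fy Im d_y), (E fz Im d_z); [fin| | |]; intros [[x y] z];
      destruct (Hd x y z) as (A & B & D); apply is_derive_unique;
      [exact (proj2 D) | exact (proj2 B) | exact (proj2 A)].
Qed.

Lemma csmooth_inv f : csmooth f -> hcont f /\ exists fx fy fz,
  csmooth fx /\ csmooth fy /\ csmooth fz /\ partials f fx fy fz.
Proof.
split.
- apply hcont_iff. destruct (H 0%nat) as [[H1 _] [H2 _]]; fin.
- exists (fun p => (d_x (fun p => Re (f p)) p, d_x (fun p => Im (f p)) p)),
    (fun p => (d_y (fun p => Re (f p)) p, d_y (fun p => Im (f p)) p)),
    (fun p => (d_z (fun p => Re (f p)) p, d_z (fun p => Im (f p)) p)).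
  split; [|split; [|split]].
  + intros n; destruct (H (S n)) as [(_ & _ & A & _ & _) (_ & _ & B & _ & _)]; fin.
  + intros n; destruct (H (S n)) as [(_ & _ & _ & A & _) (_ & _ & _ & B & _)]; fin.
  + intros n; destruct (H (S n)) as [(_ & _ & _ & _ & A) (_ & _ & _ & _ & B)]; fin.
  + intros x y z. destruct (H 1%nat) as [(_ & A & _) (_ & B & _)],
    (A x y z) as (A1 & A2 & A3), (B x y z) as (B1 & B2 & B3).
    split; [|split]; split.
    * exact (Derive_correct _ _ A1).
    * exact (Derive_correct _ _ B1).
    * exact (Derive_correct _ _ A2).
    * exact (Derive_correct _ _ B2).
    * exact (Derive_correct _ _ A3).
    * exact (Derive_correct _ _ B3).
Qed.

(* The closure of a family of entire functions, composed with [q], and of the smooth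
   functions under sums and products. *)
Inductive EAlg (P : (C -> C) -> Prop) (q : heis -> C) : (heis -> C) -> Prop :=
| EAlg_base f : csmooth f -> EAlg P q f
| EAlg_comp g : P g -> EAlg P q (fun p => g (q p))
| EAlg_plus f g : EAlg P q f -> EAlg P q g -> EAlg P q (fun p => (f p + g p)%C)
| EAlg_mult f g : EAlg P q f -> EAlg P q g -> EAlg P q (fun p => (f p * g p)%C).

Lemma hcont_plus f g : hcont f -> hcont g -> hcont (fun p => (f p + g p)%C).
Proof.
intros F G; rewrite hcont_iff in *; destruct F as [F1 F2], G as [G1 G2].
split; intros p; apply @continuous_plus; fin.
Qed.

Lemma hcont_mult f g : hcont f -> hcont g -> hcont (fun p => (f p * g p)%C).
Proof.
intros F G; rewrite hcont_iff in *; destruct F as [F1 F2], G as [G1 G2].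
split; intros p.
- apply @continuous_minus; apply @continuous_mult; fin.
- apply @continuous_plus; apply @continuous_mult; fin.
Qed.

(** The closure contains its own partial derivatives by the chain and product rules, so the
    coinduction principle applies to it as a whole. *)
Lemma EAlg_smooth (P : (C -> C) -> Prop) (q : heis -> C) :
  (forall g, P g -> exists g', P g' /\ forall s, cderiv g s (g' s)) -> csmooth q ->
  forall f, EAlg P q f -> csmooth f.
Proof.
intros HP Hq. destruct (csmooth_inv q Hq) as (Qc & qx & qy & qz & QX & QY & QZ & QD).
apply csmooth_coind. induction 1 as [f H | g Hg | f g Hf IHf Hg IHg | f g Hf IHf Hg IHg].
- destruct (csmooth_inv f H) as (Hc & fx & fy & fz & X & Y & Z & D). split; auto.
  exists fx, fy, fz. split; [|split; [|split]]; try (now apply EAlg_base). fin.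
- destruct (HP g Hg) as (g' & Hg' & D). split.
  + intros x y z eps He. destruct (cderiv_cont g (q (x, y, z)) _ (D _) eps He) as (d & Hd & K),
    (Qc x y z d Hd) as (d' & Hd' & K'). exists d'; split; auto; intros.
    replace (q (x', y', z')) with (q (x, y, z) + (q (x', y', z') - q (x, y, z)))%C by ring. fin.
  + exists (fun p => (g' (q p) * qx p)%C), (fun p => (g' (q p) * qy p)%C), (fun p => (g' (q p) * qz p)%C).
    split; [|split; [|split]];
      try (apply EAlg_mult; [exact (EAlg_comp P q g' Hg') | now apply EAlg_base]).
    intros x y z. destruct (QD x y z) as (A & B & E).
    split; [|split].
    * exact (rderiv_comp_C g (fun t => q (t, y, z)) x _ _ (D _) A).
    * exact (rderiv_comp_C g (fun t => q (x, t, z)) y _ _ (D _) B).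
    * exact (rderiv_comp_C g (fun t => q (x, y, t)) z _ _ (D _) E).
- destruct IHf as (Fc & fx & fy & fz & FX & FY & FZ & FD),
  IHg as (Gc & gx & gy & gz & GX & GY & GZ & GD).
  split; [now apply hcont_plus|].
  exists (fun p => (fx p + gx p)%C), (fun p => (fy p + gy p)%C), (fun p => (fz p + gz p)%C).
  split; [|split; [|split]]; try (now apply EAlg_plus).
  intros x y z. destruct (FD x y z) as (A & B & D), (GD x y z) as (A' & B' & D').
  split; [|split].
  + exact (rderiv_plus _ _ _ _ _ A A').
  + exact (rderiv_plus _ _ _ _ _ B B').
  + exact (rderiv_plus _ _ _ _ _ D D').
- destruct IHf as (Fc & fx & fy & fz & FX & FY & FZ & FD),
  IHg as (Gc & gx & gy & gz & GX & GY & GZ & GD).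
  split; [now apply hcont_mult|].
  exists (fun p => (fx p * g p + f p * gx p)%C), (fun p => (fy p * g p + f p * gy p)%C),
    (fun p => (fz p * g p + f p * gz p)%C).
  split; [|split; [|split]]; try (apply EAlg_plus; now apply EAlg_mult).
  intros x y z. destruct (FD x y z) as (A & B & D), (GD x y z) as (A' & B' & D').
  split; [|split].
  + exact (rderiv_mult _ _ _ _ _ A A').
  + exact (rderiv_mult _ _ _ _ _ B B').
  + exact (rderiv_mult _ _ _ _ _ D D').
Qed.

Lemma csmooth_plus f g : csmooth f -> csmooth g -> csmooth (fun p => (f p + g p)%C).
Proof. intros F G. apply (EAlg_smooth (fun _ => False) f); [lia | fin|].
apply EAlg_plus; now apply EAlg_base. Qed.

Lemma csmooth_mult f g : csmooth f -> csmooth g -> csmooth (fun p => (f p * g p)%C).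
Proof. intros F G. apply (EAlg_smooth (fun _ => False) f); [lia | fin|].
apply EAlg_mult; now apply EAlg_base. Qed.

Lemma csmooth_const c : csmooth (fun _ => c).
Proof.
apply (csmooth_coind (fun f => exists c, f = fun _ => c)); [|eauto].
intros f [k ->]; split.
- exists 1; split; [lra|].
  rewrite Cmod_diag; fin.
- exists (fun _ => 0%C), (fun _ => 0%C), (fun _ => 0%C).
  split; [eauto|]. split; [eauto|]. split; [eauto|].
  split; [|split]; apply rderiv_const.
Qed.

Lemma csmooth_scal (c : C) f : csmooth f -> csmooth (fun p => (c * f p)%C).
Proof. apply csmooth_mult; apply csmooth_const. Qed.

Lemma csmooth_ext f g : (forall p, f p = g p) -> csmooth f -> csmooth g.
Proof. intros E; replace g with f; auto; now apply functional_extensionality. Qed.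

Definition hX (p : heis) : R := fst (fst p).

Definition hY (p : heis) : R := snd (fst p).

Definition hZ (p : heis) : R := snd p.

Lemma csmooth_coord (h : heis -> R) : h = hX \/ h = hY \/ h = hZ -> csmooth (fun p => RtoC (h p)).
Proof.
intros Hh. apply (csmooth_coind (fun f =>
  (exists h, (h = hX \/ h = hY \/ h = hZ) /\ f = (fun p => RtoC (h p))) \/ exists c, f = fun _ => c)); [|eauto].
clear h Hh. intros f [(h & Hh & ->) | [k ->]]; split.
- intros x y z eps He; exists eps; split; auto; intros.
  rewrite <- RtoC_minus, Cmod_R. destruct Hh as [-> | [-> | ->]]; fin.
- exists (fun _ => RtoC (h (1, 0, 0))), (fun _ => RtoC (h (0, 1, 0))), (fun _ => RtoC (h (0, 0, 1))).
  split; [eauto|]. split; [eauto|]. split; [eauto|].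
  intros x y z. destruct Hh as [-> | [-> | ->]]; unfold hX, hY; simpl;
    (split; [|split]); first [apply rderiv_id | apply rderiv_const].
- exists 1; split; [lra|].
  rewrite Cmod_diag; fin.
- exists (fun _ => 0%C), (fun _ => 0%C), (fun _ => 0%C).
  split; [eauto|]. split; [eauto|]. split; [eauto|].
  split; [|split]; apply rderiv_const.
Qed.

Lemma csmooth_Cexp q : csmooth q -> csmooth (fun p => Cexp (q p)).
Proof.
intros Hq. apply (EAlg_smooth (fun g => g = Cexp) q); auto.
- intros g ->. exists Cexp. split; auto. apply cderiv_cexp.
- now apply (EAlg_comp (fun g => g = Cexp)).
Qed.

Lemma rderiv_conj h t l : rderiv h t l -> rderiv (fun t => Cconj (h t)) t (Cconj l).
Proof.
intros [H1 H2]; split; auto. now apply @is_derive_opp.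
Qed.

Lemma csmooth_conj f : csmooth f -> csmooth (fun p => Cconj (f p)).
Proof.
intros Hf. apply (csmooth_coind (fun g => exists f, csmooth f /\ g = fun p => Cconj (f p))); [|eauto].
clear. intros g (f & Hf & ->). destruct (csmooth_inv f Hf) as (Hc & fx & fy & fz & X & Y & Z & D).
split.
- intros x y z eps He. destruct (Hc x y z eps He) as (d & Hd & K). exists d; split; auto; intros.
  rewrite <- Cminus_conj, Cmod_conj. fin.
- exists (fun p => Cconj (fx p)), (fun p => Cconj (fy p)), (fun p => Cconj (fz p)).
  split; [|split; [|split]]; [now exists fx | now exists fy | now exists fz|].
  intros x y z. destruct (D x y z) as (A & B & E). split; [|split]; now apply rderiv_conj.
Qed.

(** * Left-invariant fields on complex functions *)

Definition Derive_C (u : R -> C) (t : R) : C :=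
  (Derive (fun s => Re (u s)) t, Derive (fun s => Im (u s)) t).

Lemma Derive_C_unique u t l : rderiv u t l -> Derive_C u t = l.
Proof.
intros [H1 H2]. apply Ceq; [exact (is_derive_unique _ _ _ H1) | exact (is_derive_unique _ _ _ H2)].
Qed.

Definition CX (f : heis -> C) (p : heis) : C := Derive_C (fun t => f (hmul p (t, 0, 0))) 0.
Definition CY (f : heis -> C) (p : heis) : C := Derive_C (fun t => f (hmul p (0, t, 0))) 0.
Definition CZ (f : heis -> C) (p : heis) : C := Derive_C (fun t => f (hmul p (0, 0, t))) 0.

Lemma hcont_ccont2_yz f x y z : hcont f -> ccont2 (fun b c => f (x, b, c)) y z.
Proof.
intros H; apply ccont2_eps; intros eps He. destruct (H x y z eps He) as (d & D & K).
exists d; split; auto; intros b c Hb Hc. apply K; auto. rewrite Rminus_diag, Rabs_R0; lra.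
Qed.

(** The field Y follows curves on which [y] and [z] move together, so its relation to the partial
    derivatives is a chain rule in two variables; continuity of one partial suffices for
    differentiability. *)
Lemma chain2 (u u1 u2 : R -> R -> R) (f1 f2 : R -> R) t l1 l2 :
  (forall x y, is_derive (fun x => u x y) x (u1 x y)) ->
  (forall x y, is_derive (fun y => u x y) y (u2 x y)) ->
  continuity_2d_pt u1 (f1 t) (f2 t) -> is_derive f1 t l1 -> is_derive f2 t l2 ->
  is_derive (fun t => u (f1 t) (f2 t)) t (u1 (f1 t) (f2 t) * l1 + u2 (f1 t) (f2 t) * l2).
Proof.
intros H1 H2 Hc D1 D2. apply is_derive_Reals. apply is_derive_Reals in D1, D2.
apply derivable_pt_lim_comp_2d; auto.
apply filterdiff_differentiable_pt_lim, (is_derive_filterdiff u (f1 t) (f2 t) u1).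
- apply filter_forall; fin.
- fin.
- apply continuity_2d_pt_filterlim in Hc. fin.
Qed.

Lemma rderiv_path_y f fx fy fz x y z (s : R) : hcont fy -> partials f fx fy fz ->
  rderiv (fun t => f (x, t, z + s * t)) y (fy (x, y, z + s * y)%R + s * fz (x, y, z + s * y)%R)%C.
Proof.
intros Hc D.
assert (Dl : forall y, is_derive (fun t => z + s * t) y s) by (intros; auto_derive; lra).
pose proof (hcont_ccont2_yz fy x y (z + s * y) Hc) as [Q1 Q2].
split; Creim.
- evar_last; [apply (chain2 (fun b c => Re (f (x, b, c))) (fun b c => Re (fy (x, b, c)))
    (fun b c => Re (fz (x, b, c))) (fun t => t) (fun t => z + s * t) y 1 s)|]; auto.
  + intros a b; exact (proj1 (proj1 (proj2 (D x a b)))).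
  + intros a b; exact (proj1 (proj2 (proj2 (D x a b)))).
  + apply @is_derive_id.
  + lra.
- evar_last; [apply (chain2 (fun b c => Im (f (x, b, c))) (fun b c => Im (fy (x, b, c)))
    (fun b c => Im (fz (x, b, c))) (fun t => t) (fun t => z + s * t) y 1 s)|]; auto.
  + intros a b; exact (proj2 (proj1 (proj2 (D x a b)))).
  + intros a b; exact (proj2 (proj2 (proj2 (D x a b)))).
  + apply @is_derive_id.
  + lra.
Qed.

Lemma rderiv_translate h t l : rderiv h t l -> rderiv (fun s => h (t + s)) 0 l.
Proof.
intros H. eapply rderiv_val.
- apply (rderiv_comp_R h (fun s => t + s) 0 l 1); [now rewrite Rplus_0_r|].
  auto_derive; lra.
- fin.
Qed.

Lemma fields_partials f fx fy fz : hcont fy -> partials f fx fy fz ->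
  CX f = fx /\ CY f = (fun p => (fy p + hX p * fz p)%C) /\ CZ f = fz.
Proof.
intros Hc D; split; [|split]; funext [[x y] z];
  apply Derive_C_unique; unfold hmul.
- apply (rderiv_ext (fun t => f (x + t, y, z))); [intros; f_equal; f_equal; fin|].
  exact (rderiv_translate (fun t => f (t, y, z)) x _ (proj1 (D x y z))).
(* The third coordinate $z+xt$ is written as an affine function of $y+t$, to match the path of
   [rderiv_path_y]. *)
- apply (rderiv_ext (fun t => f (x, y + t, z - x * y + x * (y + t)))).
  { intros; f_equal; f_equal; fin. }
  apply (rderiv_translate (fun t => f (x, t, z - x * y + x * t))).
  pose proof (rderiv_path_y f fx fy fz x y (z - x * y) x Hc D) as K.
  replace (z - x * y + x * y) with z in K by ring. fin.
- apply (rderiv_ext (fun t => f (x, y, z + t))); [intros; f_equal; f_equal; fin|].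
  exact (rderiv_translate (fun t => f (x, y, t)) z _ (proj2 (proj2 (D x y z)))).
Qed.

Lemma csmooth_fields f : csmooth f -> csmooth (CX f) /\ csmooth (CY f) /\ csmooth (CZ f).
Proof.
intros H; destruct (csmooth_inv f H) as (Hc & fx & fy & fz & X & Y & Z & D).
destruct (fields_partials f fx fy fz) as (-> & -> & ->); auto; [apply csmooth_inv, Y|].
split; [|split]; auto. apply csmooth_plus; auto. apply csmooth_mult; auto. apply csmooth_coord; fin.
Qed.

Lemma hmul_assoc p q s : hmul (hmul p q) s = hmul p (hmul q s).
Proof.
destruct p as [[x y] z], q as [[x' y'] z'], s as [[a b] c]; unfold hmul.
f_equal; fin.
Qed.

Lemma Derive_C_scal (k : C) u t l : rderiv u t l -> Derive_C (fun s => (k * u s)%C) t = (k * Derive_C u t)%C.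
Proof. intros H. rewrite (Derive_C_unique u t l H). now apply Derive_C_unique, rderiv_scal. Qed.

Lemma field_curves f : csmooth f -> forall p,
  rderiv (fun t => f (hmul p (t, 0, 0))) 0 (CX f p) /\
  rderiv (fun t => f (hmul p (0, t, 0))) 0 (CY f p) /\
  rderiv (fun t => f (hmul p (0, 0, t))) 0 (CZ f p).
Proof.
intros H [[x y] z]; destruct (csmooth_inv f H) as (Hc & fx & fy & fz & X & Y & Z & D).
destruct (fields_partials f fx fy fz) as (-> & -> & ->); auto; [apply csmooth_inv, Y|].
unfold hmul; split; [|split].
- apply (rderiv_ext (fun t => f (x + t, y, z))); [intros; f_equal; f_equal; fin|].
  exact (rderiv_translate (fun t => f (t, y, z)) x _ (proj1 (D x y z))).
- apply (rderiv_ext (fun t => f (x, y + t, z - x * y + x * (y + t)))).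
  { intros; f_equal; f_equal; fin. }
  apply (rderiv_translate (fun t => f (x, t, z - x * y + x * t))).
  pose proof (rderiv_path_y f fx fy fz x y (z - x * y) x (proj1 (csmooth_inv fy Y)) D) as K.
  replace (z - x * y + x * y) with z in K by ring. fin.
- apply (rderiv_ext (fun t => f (x, y, z + t))); [intros; f_equal; f_equal; fin|].
  exact (rderiv_translate (fun t => f (x, y, t)) z _ (proj2 (proj2 (D x y z)))).
Qed.

(** The fields differentiate along right translations, which commute with left translations by
    associativity. *)
Lemma fields_equivariant f (g : heis) (k : C) : csmooth f -> (forall p, f (hmul g p) = (k * f p)%C) ->
  (forall p, CX f (hmul g p) = (k * CX f p)%C) /\ (forall p, CY f (hmul g p) = (k * CY f p)%C) /\
  (forall p, CZ f (hmul g p) = (k * CZ f p)%C).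
Proof.
split; [|split]; intros p; destruct (field_curves f H p) as (A & B & D).
- unfold CX at 1. replace (fun t => f (hmul (hmul g p) (t, 0, 0))) with (fun t => (k * f (hmul p (t, 0, 0)))%C)
    by (funext p0; now rewrite hmul_assoc).
  eapply Derive_C_scal, A.
- unfold CY at 1. replace (fun t => f (hmul (hmul g p) (0, t, 0))) with (fun t => (k * f (hmul p (0, t, 0)))%C)
    by (funext p0; now rewrite hmul_assoc).
  eapply Derive_C_scal, B.
- unfold CZ at 1. replace (fun t => f (hmul (hmul g p) (0, 0, t))) with (fun t => (k * f (hmul p (0, 0, t)))%C)
    by (funext p0; now rewrite hmul_assoc).
  eapply Derive_C_scal, D.
Qed.

Lemma fields_plus f g : csmooth f -> csmooth g ->
  (forall p, CX (fun p => (f p + g p)%C) p = (CX f p + CX g p)%C) /\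
  (forall p, CY (fun p => (f p + g p)%C) p = (CY f p + CY g p)%C) /\
  (forall p, CZ (fun p => (f p + g p)%C) p = (CZ f p + CZ g p)%C).
Proof.
intros F G; split; [|split]; intros p; apply Derive_C_unique;
  destruct (field_curves f F p) as (A & B & D), (field_curves g G p) as (A' & B' & D');
  now apply rderiv_plus.
Qed.

Lemma fields_scal (k : C) f : csmooth f ->
  (forall p, CX (fun p => (k * f p)%C) p = (k * CX f p)%C) /\
  (forall p, CY (fun p => (k * f p)%C) p = (k * CY f p)%C) /\
  (forall p, CZ (fun p => (k * f p)%C) p = (k * CZ f p)%C).
Proof.
intros F; split; [|split]; intros p; apply Derive_C_unique;
  destruct (field_curves f F p) as (A & B & D); now apply rderiv_scal.
Qed.

Lemma fields_conj f : csmooth f ->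
  (forall p, CX (fun p => Cconj (f p)) p = Cconj (CX f p)) /\
  (forall p, CY (fun p => Cconj (f p)) p = Cconj (CY f p)) /\
  (forall p, CZ (fun p => Cconj (f p)) p = Cconj (CZ f p)).
Proof.
intros F; split; [|split]; intros p; apply Derive_C_unique;
  destruct (field_curves f F p) as (A & B & D); now apply rderiv_conj.
Qed.

(** * Fourier coefficients of periodic functions *)

Lemma hcont_unif_z (g : heis -> C) x y a b eps : hcont g -> 0 < eps -> exists d, 0 < d /\
  forall x' y' z, a <= z <= b -> Rabs (x' - x) < d -> Rabs (y' - y) < d ->
    Cmod (g (x', y', z) - g (x, y, z))%C < eps.
Proof.
intros Hg He.
assert (HD : forall z, exists d : posreal, forall x' y' z', Rabs (x' - x) < d -> Rabs (y' - y) < d ->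
   Rabs (z' - z) < d -> Cmod (g (x', y', z') - g (x, y, z))%C < eps / 2) by (intros z; destruct (Hg x y z (eps / 2)) as (d & D & K); [lra|]; exists (mkposreal d D); fin).
set (delta := fun z => proj1_sig (constructive_indefinite_description _ (HD z))).
assert (Hd : forall z x' y' z', Rabs (x' - x) < delta z -> Rabs (y' - y) < delta z ->
   Rabs (z' - z) < delta z -> Cmod (g (x', y', z') - g (x, y, z))%C < eps / 2) by (intros z; exact (proj2_sig (constructive_indefinite_description _ (HD z)))).
destruct (compactness_value 1 (a, tt) (b, tt) (fun t => delta (fst t))) as [d Hdd].
exists d; split; [apply cond_pos|]. intros x' y' z Hz Hx Hy.
apply NNPP; intros N. apply (Hdd (z, tt)); [simpl; lra|].
intros ([t []] & Ht & Hc & Hle). simpl in Ht, Hc, Hle. apply N.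
replace (g (x', y', z) - g (x, y, z))%C
  with ((g (x', y', z) - g (x, y, t)) + - (g (x, y, z) - g (x, y, t)))%C by ring.
eapply Rle_lt_trans; [apply Cmod_triangle|]. rewrite Cmod_opp.
replace eps with (eps / 2 + eps / 2) by field. apply Rplus_lt_compat.
- apply Hd; lra.
- apply Hd; [rewrite Rminus_diag, Rabs_R0; apply cond_pos | rewrite Rminus_diag, Rabs_R0; apply cond_pos | lra].
Qed.

Lemma hcont_ccont_z g x y z : hcont g -> ccont (fun z => g (x, y, z)) z.
Proof. intros H; apply (ccont2_snd (fun b c => g (x, b, c)) y z). now apply hcont_ccont2_yz. Qed.

Lemma CI_minus h g a b : (forall t, ccont h t) -> (forall t, ccont g t) ->
  CI (fun t => (h t - g t)%C) a b = (CI h a b - CI g a b)%C.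
Proof.
transitivity (CI (fun t => (h t + -1 * g t)%C) a b); [apply CI_ext; intros; fin|].
rewrite CI_plus, CI_scal; auto; [fin|]. intros t; apply ccont_mult; auto; apply ccont_const.
Qed.

Lemma CI_cont2 (g : heis -> C) a b x y : hcont g -> a <= b ->
  ccont2 (fun x y => CI (fun z => g (x, y, z)) a b) x y.
Proof.
intros Hg Hab. apply ccont2_eps; intros eps He.
destruct (hcont_unif_z g x y a b (eps / (b - a + 1)) Hg) as (d & D & K).
{ pos. }
exists d; split; auto. intros x' y' Hx Hy.
rewrite <- CI_minus by (intros; now apply hcont_ccont_z).
apply Rle_lt_trans with (eps / (b - a + 1) * (b - a)).
- apply CI_bound; auto.
  + intros t. apply ccont_plus; [now apply hcont_ccont_z|].
    apply (ccont2_snd (fun b c => (- g (x, b, c))%C) y t).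
    apply ccont2_eps; intros e' He'. destruct (Hg x y t e' He') as (d' & D' & K').
    exists d'; split; auto. intros b' c' Hb' Hc'.
    replace (- g (x, b', c') - - g (x, y, t))%C with (- (g (x, b', c') - g (x, y, t)))%C by ring.
    rewrite Cmod_opp. apply K'; auto. rewrite Rminus_diag, Rabs_R0; lra.
  + intros t Ht. apply Rlt_le, K; lra.
- apply Rmult_lt_reg_r with (b - a + 1); [lra|].
  replace (eps / (b - a + 1) * (b - a) * (b - a + 1)) with (eps * (b - a)) by fin. nra.
Qed.

Lemma hcont_shear f : hcont f -> hcont (fun p => let '(x, y, z) := p in f (x, y, z + x * y)).
Proof.
intros Hf x y z eps He. destruct (Hf x y (z + x * y) eps He) as (d & D & K).
pose proof (Rabs_pos x). pose proof (Rabs_pos y).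
set (m := Rmin (Rmin 1 d) (d / (2 + Rabs x + Rabs y))).
assert (M1 : m <= 1) by (eapply Rle_trans; [apply Rmin_l | apply Rmin_l]).
assert (M2 : m <= d) by (eapply Rle_trans; [apply Rmin_l | apply Rmin_r]).
assert (M3 : m <= d / (2 + Rabs x + Rabs y)) by apply Rmin_r.
exists m; split.
{ apply Rmin_pos; [apply Rmin_pos; lra| pos]. }
intros x' y' z' Hx Hy Hz. apply K; [lra | lra |].
replace (z' + x' * y' - (z + x * y)) with ((z' - z) + ((x' - x) * y + (x' - x) * (y' - y)) + x * (y' - y)) by ring.
assert (B1 : Rabs ((x' - x) * y) <= m * Rabs y) by (rewrite Rabs_mult; fin).
assert (B2 : Rabs ((x' - x) * (y' - y)) <= m) by (rewrite Rabs_mult; pose proof (Rabs_pos (y' - y)); nra).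
assert (B3 : Rabs (x * (y' - y)) <= Rabs x * m) by (rewrite Rabs_mult; fin).
assert (B4 : m * (2 + Rabs x + Rabs y) <= d).
{ apply Rle_trans with (d / (2 + Rabs x + Rabs y) * (2 + Rabs x + Rabs y)).
  - nra.
  - right; fin. }
eapply Rle_lt_trans; [apply Rabs_triang|]. eapply Rle_lt_trans; [apply Rplus_le_compat_r, Rabs_triang|].
pose proof (Rabs_triang ((x' - x) * y) ((x' - x) * (y' - y))). nra.
Qed.

Lemma ccont2_swap u x y : ccont2 u x y -> ccont2 (fun a b => u b a) y x.
Proof.
intros H; rewrite ccont2_eps in H |- *; intros eps He; destruct (H eps He) as (d & D & K).
eauto.
Qed.

Lemma ccont2_fst u x y : ccont2 u x y -> ccont (fun a => u a y) x.
Proof. intros H. apply ccont2_swap in H. exact (ccont2_snd _ _ _ H). Qed.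

Lemma ccont_opp h t : ccont h t -> ccont (fun t => (- h t)%C) t.
Proof.
intros H. pose proof (ccont_mult (fun _ => (-1)%C) h t (ccont_const _ _) H) as K.
replace (fun t => (- h t)%C) with (fun t => (-1 * h t)%C); auto.
funext p; fin.
Qed.

Lemma rderiv_Eit_lin k t : rderiv (fun t => Eit (k * t)) t (k * (Ci * Eit (k * t)))%C.
Proof. apply (rderiv_comp_R Eit (fun t => k * t)); [apply rderiv_Eit | auto_derive; lra]. Qed.

Lemma ccont_Eit_lin k t : ccont (fun t => Eit (k * t)) t.
Proof. eapply rderiv_ccont, rderiv_Eit_lin. Qed.

Lemma ccont2_Eit_lin2 k x y : ccont2 (fun _ b => Eit (k * b)) x y.
Proof.
eapply ccont2_comp_C; [apply cderiv_cexp|].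
apply ccont2_mult; [apply ccont2_const|]. split.
- apply continuity_2d_pt_mult; [apply (continuity_2d_pt_const x y k) | apply continuity_2d_pt_id2].
- apply (continuity_2d_pt_const x y 0).
Qed.

Lemma CI_shift_periodic h L s : (forall t, ccont h t) -> (forall t, h (t + L) = h t) ->
  CI (fun t => h (t + s)) 0 L = CI h 0 L.
Proof.
intros Hc Hp.
assert (P : forall u : R -> R, (forall t, continuous u t) -> (forall t, u (t + L) = u t) ->
  RInt (fun t => u (t + s)) 0 L = RInt u 0 L).
{ intros u Cu Pu.
  assert (EX : forall a b, ex_RInt u a b)
    by (intros; apply (ex_RInt_continuous (V := R_CompleteNormedModule)); fin).
  assert (E1 : forall c a b, RInt (fun t => u (t + c)) a b = RInt u (a + c) (b + c)).
  { intros c a b. pose proof (RInt_comp_lin u 1 c a b) as Q.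
    rewrite !Rmult_1_l in Q. rewrite <- (Q (EX _ _)).
    apply RInt_ext; intros t _. change (u (t + c) = 1 * u (1 * t + c)).
    replace (1 * t + c) with (t + c) by ring. lra. }
  rewrite E1.
  pose proof (RInt_Chasles u (0 + s) L (L + s) (EX _ _) (EX _ _)) as Q1.
  pose proof (RInt_Chasles u 0 (0 + s) L (EX _ _) (EX _ _)) as Q2.
  assert (E2 : RInt u L (L + s) = RInt u 0 (0 + s)).
  { rewrite (Rplus_comm L s). replace L with (0 + L) at 1 by ring.
    replace (s + L) with ((0 + s) + L) by ring.
    rewrite <- (E1 L 0 (0 + s)). apply RInt_ext; fin. }
  rewrite <- Q1, <- Q2. unfold plus; simpl. lra. }
unfold CI; f_equal.
- apply (P (fun t => Re (h t))); [intros t; exact (proj1 (Hc t)) | intros; now rewrite Hp].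
- apply (P (fun t => Im (h t))); [intros t; exact (proj2 (Hc t)) | intros; now rewrite Hp].
Qed.

Lemma Eit_INR_2PI n : Eit (INR n * (2 * PI)) = 1%C.
Proof.
induction n as [|n IH]; [rewrite Rmult_0_l; apply Eit_0|].
rewrite S_INR. replace ((INR n + 1) * (2 * PI)) with (INR n * (2 * PI) + 2 * PI) by ring.
rewrite Eit_plus, IH, Eit_2PI. fin.
Qed.

Lemma Eit_IZR_2PI n : Eit (IZR n * (2 * PI)) = 1%C.
Proof.
destruct (Z_le_dec 0 n) as [H | H].
- rewrite <- (Z2Nat.id n H), <- INR_IZR_INZ. apply Eit_INR_2PI.
- pose proof (Eit_opp (IZR (- n) * (2 * PI))) as K.
  rewrite <- (Z2Nat.id (- n)), <- INR_IZR_INZ, Eit_INR_2PI, Cmult_1_r, INR_IZR_INZ, Z2Nat.id in K by lia.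
  rewrite opp_IZR in K. rewrite <- K. fin.
Qed.

(** * Uniqueness of Fourier coefficients *)

Section FourierUnique.
Variables (L : R) (G : R -> C).
Hypothesis (HL : 0 < L) (Gc : forall t, ccont G t) (Gp : forall t, G (t + L) = G t).
Let om : R := 2 * PI / L.
Hypothesis (G0 : forall n : Z, CI (fun t => (G t * Eit (- (IZR n * om) * t))%C) 0 L = 0%C).

(** The classical peak kernel: on a period it is at least 1 where [om * |t - t0| <= de] and has
    absolute value at most 1 elsewhere, so its powers concentrate at [t0]. *)
Definition kern (t0 de t : R) : R := 1 + cos (om * (t - t0)) - cos de.

Lemma kern_Eit t0 de t : RtoC (kern t0 de t) = ((1 - cos de)%R
  + (/ 2 * Eit (- (om * t0))) * Eit (om * t) + (/ 2 * Eit (om * t0)) * Eit (- om * t))%C.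
Proof.
unfold kern. rewrite !Eit_eq. replace (om * (t - t0)) with (om * t - om * t0) by ring.
replace (- om * t) with (- (om * t)) by ring. rewrite cos_minus, !cos_neg, !sin_neg.
apply Ceq; simpl; lra.
Qed.

(** The kernel is a trigonometric polynomial of degree one, so a factor of it moves the frequency by
    at most one step; the quantifier over [m] carries the induction on the power. *)
Lemma kern_orthogonal t0 de n : forall m : Z,
  CI (fun t => (G t * kern t0 de t ^ n * Eit (- (IZR m * om) * t))%C) 0 L = 0%C.
Proof.
induction n as [|n IH]; intros m.
- rewrite <- (G0 m). apply CI_ext; intros t. fin.
- assert (Ck : forall k t, ccont (fun t => (G t * kern t0 de t ^ n * Eit (k * t))%C) t).
  { intros k t. apply ccont_mult; [apply ccont_mult|]; auto; [|apply ccont_Eit_lin].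
    clear IH. induction n as [|n IH]; [apply ccont_const|]. apply ccont_mult; auto.
    eapply rderiv_ccont, rderiv_RtoC. unfold kern. auto_derive; fin. }
  assert (E : forall t, (G t * kern t0 de t ^ S n * Eit (- (IZR m * om) * t))%C =
     ((1 - cos de)%R * (G t * kern t0 de t ^ n * Eit (- (IZR m * om) * t))
       + (/ 2 * Eit (- (om * t0))) * (G t * kern t0 de t ^ n * Eit (- (IZR (m - 1) * om) * t))
       + (/ 2 * Eit (om * t0)) * (G t * kern t0 de t ^ n * Eit (- (IZR (m + 1) * om) * t)))%C).
  { intros t.
    replace (- (IZR (m - 1) * om) * t) with (- (IZR m * om) * t + om * t) by (rewrite minus_IZR; lra).
    replace (- (IZR (m + 1) * om) * t) with (- (IZR m * om) * t + - om * t) by (rewrite plus_IZR; lra).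
    rewrite !Eit_plus. change (RtoC (kern t0 de t) ^ S n)%C with (RtoC (kern t0 de t) * RtoC (kern t0 de t) ^ n)%C.
    generalize (RtoC (kern t0 de t) ^ n)%C. intros X. rewrite kern_Eit. fin. }
  rewrite (CI_ext _ _ 0 L E).
  rewrite CI_plus, CI_plus, !CI_scal, !IH; auto; try ring.
  + intros; apply ccont_mult; auto; apply ccont_const.
  + intros; apply ccont_mult; auto; apply ccont_const.
  + intros; apply ccont_plus; apply ccont_mult; auto; apply ccont_const.
  + intros; apply ccont_mult; auto; apply ccont_const.
Qed.

Lemma ccont_eps h t : ccont h t -> forall eps, 0 < eps -> exists d, 0 < d /\
  forall s, Rabs (s - t) < d -> Cmod (h s - h t)%C < eps.
Proof.
intros [H1 H2] eps He.
assert (P : forall u : R -> R, continuous u t -> exists d : posreal, forall s, Rabs (s - t) < d -> Rabs (u s - u t) < eps / 2).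
{ intros u Hu. assert (L0 : locally (u t) (fun w => Rabs (w - u t) < eps / 2)) by (exists (mkposreal (eps / 2) ltac:(lra)); fin).
  destruct (Hu _ L0) as [d Hd]. exists d. fin. }
destruct (P _ H1) as [d1 K1], (P _ H2) as [d2 K2].
exists (Rmin d1 d2); split; [apply Rmin_pos; apply cond_pos|]. intros s Hs.
eapply Rle_lt_trans; [apply Cmod_le_Re_Im|].
replace eps with (eps / 2 + eps / 2) by field. apply Rplus_lt_compat.
- apply K1. eapply Rlt_le_trans; [exact Hs | apply Rmin_l].
- apply K2. eapply Rlt_le_trans; [exact Hs | apply Rmin_r].
Qed.

Lemma cos_outside de s : 0 < de <= PI -> de <= Rabs s <= 2 * PI - de -> cos s <= cos de.
Proof.
intros Hd Hs.
assert (E : cos s = cos (Rabs s)) by (unfold Rabs; destruct (Rcase_abs s); [now rewrite cos_neg | lra]).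
rewrite E. set (a := Rabs s) in *. destruct (Rle_dec a PI) as [H | H].
- apply cos_decr_1; lra.
- replace (cos a) with (cos (2 * PI - a)).
  + apply cos_decr_1; lra.
  + rewrite cos_minus, cos_2PI, sin_2PI. lra.
Qed.

Lemma cos_inside de s : 0 < de <= PI -> Rabs s <= de / 2 -> cos (de / 2) <= cos s.
Proof.
intros Hd Hs.
assert (E : cos s = cos (Rabs s)) by (unfold Rabs; destruct (Rcase_abs s); [now rewrite cos_neg | lra]).
rewrite E. pose proof (Rabs_pos s). apply cos_decr_1; lra.
Qed.

(** If [G t0] were nonzero, the component [u] of [G] along it would stay above [u0 / 2] near [t0],
    and the integrals of [u] against powers of the kernel would grow geometrically, whereas all of
    them vanish. *)
Lemma fourier_zero_interior t0 : 0 < t0 < L -> G t0 = 0%C.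
Proof.
intros Ht0. apply NNPP; intros N.
pose proof PI_RGT_0 as HPI.
set (u0 := Cmod (G t0) ^ 2).
assert (Hu0 : 0 < u0) by (unfold u0; pose proof (proj1 (Cmod_gt_0 _) N); nra).
set (u := fun t => Re (Cconj (G t0) * G t)).
destruct (ccont_eps (fun t => (Cconj (G t0) * G t)%C) t0
  (ccont_mult _ _ _ (ccont_const _ _) (Gc t0)) (u0 / 2)) as (d & D & K); [lra|].
(* The bound [d / 2] keeps [u] large on the window; those by [t0 / 2] and [(L - t0) / 2] keep the
   window inside the period and give $|t-t_0|\le L-r$, which the periodic kernel needs at its other
   peak. *)
set (r := Rmin (Rmin (d / 2) (L / 4)) (Rmin (t0 / 2) ((L - t0) / 2))).
assert (R0 : 0 < r) by (repeat apply Rmin_pos; lra).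
assert (R1 : r <= d / 2) by (eapply Rle_trans; [apply Rmin_l | apply Rmin_l]).
assert (R3 : r <= t0 / 2) by (eapply Rle_trans; [apply Rmin_r | apply Rmin_l]).
assert (R4 : r <= (L - t0) / 2) by (eapply Rle_trans; [apply Rmin_r | apply Rmin_r]).
assert (Hom : 0 < om) by pos.
assert (EomL : om * L = 2 * PI) by (unfold om; fin).
set (de := om * r).
assert (Hde : 0 < de <= PI) by (unfold de; nra).
assert (Hu : forall t, Rabs (t - t0) <= r -> u0 / 2 <= u t).
{ intros t Ht. specialize (K t ltac:(lra)).
  pose proof (re_le_Cmod (Cconj (G t0) * G t - Cconj (G t0) * G t0)%C) as Q.
  rewrite re_minus, Re_conj_self in Q. apply Rabs_le_between in Q. fold u0 in Q.
  unfold u. lra. }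
assert (HB : exists U, 0 <= U /\ forall t, 0 <= t <= L -> Rabs (u t) <= U).
{ assert (Cu : forall t, 0 <= t <= L -> continuity_pt u t) by (intros t _; apply continuity_pt_filterlim; exact (proj1 (ccont_mult _ _ _ (ccont_const (Cconj (G t0)) t) (Gc t)))).
  destruct (continuity_ab_maj u 0 L ltac:(lra) Cu) as (tM & HM & _),
  (continuity_ab_min u 0 L ltac:(lra) Cu) as (tm & Hm & _).
  exists (Rabs (u tM) + Rabs (u tm)). split; [pos|].
  intros t Ht. specialize (HM t Ht). specialize (Hm t Ht).
  pose proof (Rabs_pos (u tM)). pose proof (Rabs_pos (u tm)).
  pose proof (Rle_abs (u tM)). pose proof (Rle_abs (- u tm)). rewrite Rabs_Ropp in *.
  apply Rabs_le; lra. }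
destruct HB as (U & HU0 & HU).
set (eta := cos (de / 2) - cos de).
assert (Heta : 0 < eta) by (unfold eta; assert (cos de < cos (de / 2)) by (apply cos_decreasing_1; lra); lra).
assert (QO : forall t, 0 <= t <= L -> r <= Rabs (t - t0) -> -1 <= kern t0 de t <= 1).
{ intros t Ht Hr. unfold kern.
  assert (cos (om * (t - t0)) <= cos de).
  { apply cos_outside; auto. rewrite Rabs_mult, (Rabs_pos_eq om) by lra.
    assert (Rabs (t - t0) <= L - r) by (apply Rabs_le; lra).
    unfold de. nra. }
  pose proof (COS_bound (om * (t - t0))). pose proof (COS_bound de). lra. }
assert (QI : forall t, Rabs (t - t0) <= r -> 1 <= kern t0 de t).
{ intros t Hr. unfold kern.
  assert (cos de <= cos (om * (t - t0))); [|lra].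
  assert (E : cos (om * (t - t0)) = cos (Rabs (om * (t - t0)))) by (unfold Rabs; destruct (Rcase_abs (om * (t - t0))); [now rewrite cos_neg | lra]).
  rewrite E, Rabs_mult, (Rabs_pos_eq om) by lra.
  assert (om * Rabs (t - t0) <= de) by (unfold de; fin).
  assert (0 <= om * Rabs (t - t0)) by pos.
  apply cos_decr_1; lra. }
assert (QII : forall t, Rabs (t - t0) <= r / 2 -> 1 + eta <= kern t0 de t).
{ intros t Hr. unfold kern, eta.
  assert (cos (de / 2) <= cos (om * (t - t0))); [|lra].
  apply cos_inside; auto. rewrite Rabs_mult, (Rabs_pos_eq om) by lra.
  unfold de. nra. }
set (h := fun (n : nat) t => u t * kern t0 de t ^ n).
assert (Hint : forall n, RInt (h n) 0 L = 0).
{ intros n. pose proof (kern_orthogonal t0 de n 0) as Q.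
  assert (Q2 : CI (fun t => (Cconj (G t0) * (G t * kern t0 de t ^ n * Eit (- (IZR 0 * om) * t)))%C) 0 L = 0%C).
  { rewrite CI_scal; [rewrite Q; fin|]. intros t. apply ccont_mult; [apply ccont_mult|]; auto; [|apply ccont_Eit_lin].
    clear Q. induction n as [|n IH]; [apply ccont_const|]. apply ccont_mult; auto.
    eapply rderiv_ccont, rderiv_RtoC. unfold kern. auto_derive; fin. }
  apply (f_equal Re) in Q2.
  refine (eq_trans _ Q2).
  apply RInt_ext. intros t _.
  rewrite <- RtoC_pow. replace (- (0 * om) * t) with 0 by ring. rewrite Eit_0.
  change (Re (Cconj (G t0) * G t) * kern t0 de t ^ n = Re (Cconj (G t0) * (G t * (kern t0 de t ^ n)%R * 1))%C).
  Creim. lra. }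
assert (Hc : forall n t, continuous (h n) t).
{ intros n t. apply (@continuous_mult R_UniformSpace R_AbsRing).
  - exact (proj1 (ccont_mult _ _ _ (ccont_const (Cconj (G t0)) t) (Gc t))).
  - apply (@ex_derive_continuous R_AbsRing R_NormedModule). unfold kern. auto_derive. lra. }
assert (EX : forall n a b, ex_RInt (h n) a b)
  by (intros; apply (ex_RInt_continuous (V := R_CompleteNormedModule)); fin).
assert (Hlow : forall n t, 0 <= t <= L -> - U <= h n t).
{ intros n t Ht. unfold h. specialize (HU t Ht). apply Rabs_le_between in HU.
  destruct (Rle_dec r (Rabs (t - t0))) as [H | H].
  - specialize (QO t Ht H). assert (Rabs (kern t0 de t ^ n) <= 1).
    { rewrite <- RPow_abs, <- (pow1 n). apply pow_incr. split; [pos | apply Rabs_le; lra]. }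
    apply Rabs_le_between in H0. nra.
  - specialize (QI t ltac:(lra)). specialize (Hu t ltac:(lra)).
    assert (0 < kern t0 de t ^ n) by pos. nra. }
assert (Hhigh : forall n t, Rabs (t - t0) <= r / 2 -> u0 / 2 * (1 + eta) ^ n <= h n t).
{ intros n t Ht. specialize (QII t Ht). specialize (Hu t ltac:(lra)).
  assert ((1 + eta) ^ n <= kern t0 de t ^ n) by (apply pow_incr; lra).
  assert (0 < (1 + eta) ^ n) by pos.
  apply Rmult_le_compat; lra. }
(* The integrand is at least [u0 / 2 * (1 + eta) ^ n] on an inner window of width [r] and at least
   [- U] everywhere, so for such [n] the integral is positive. *)
assert (Hgrow : exists n, U * L < r * (u0 / 2) * (1 + eta) ^ n).
{ destruct (Pow_x_infinity (1 + eta) ltac:(rewrite Rabs_pos_eq; lra) ((U * L + 1) / (r * (u0 / 2)))) as [n Hn].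
  exists n. specialize (Hn n (le_n n)). rewrite Rabs_pos_eq in Hn by pos.
  assert (P : 0 < r * (u0 / 2)) by pos.
  apply Rge_le in Hn. apply Rmult_le_compat_l with (r := r * (u0 / 2)) in Hn; [|lra].
  replace (r * (u0 / 2) * ((U * L + 1) / (r * (u0 / 2)))) with (U * L + 1) in Hn by fin. lra. }
destruct Hgrow as [n Hn].
pose proof (RInt_Chasles (h n) 0 (t0 - r / 2) L (EX _ _ _) (EX _ _ _)) as C1.
pose proof (RInt_Chasles (h n) (t0 - r / 2) (t0 + r / 2) L (EX _ _ _) (EX _ _ _)) as C2.
rewrite Hint in C1. unfold plus in C1, C2; simpl in C1, C2.
assert (I1 : - U * (t0 - r / 2) <= RInt (h n) 0 (t0 - r / 2)).
{ apply Rle_trans with (RInt (fun _ => - U) 0 (t0 - r / 2)).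
  - rewrite RInt_const. unfold scal; simpl; unfold mult; simpl. lra.
  - apply RInt_le; auto; [lra | apply ex_RInt_const |]. intros; apply Hlow; lra. }
assert (I3 : - U * (L - (t0 + r / 2)) <= RInt (h n) (t0 + r / 2) L).
{ apply Rle_trans with (RInt (fun _ => - U) (t0 + r / 2) L).
  - rewrite RInt_const. unfold scal; simpl; unfold mult; simpl. lra.
  - apply RInt_le; auto; [lra | apply ex_RInt_const |]. intros; apply Hlow; lra. }
assert (I2 : r * (u0 / 2 * (1 + eta) ^ n) <= RInt (h n) (t0 - r / 2) (t0 + r / 2)).
{ apply Rle_trans with (RInt (fun _ => u0 / 2 * (1 + eta) ^ n) (t0 - r / 2) (t0 + r / 2)).
  - rewrite RInt_const. unfold scal; simpl; unfold mult; simpl. lra.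
  - apply RInt_le; auto; [lra | apply ex_RInt_const |]. intros; apply Hhigh. apply Rabs_le; lra. }
nra.
Qed.

Lemma fourier_zero t : G t = 0%C.
Proof.
assert (P : forall n : nat, forall t, G (t + INR n * L) = G t).
{ induction n as [|n IH]; intros s; [f_equal; simpl; lra|].
  rewrite S_INR. replace (s + (INR n + 1) * L) with (s + INR n * L + L) by ring. now rewrite Gp. }
assert (Q : forall n : Z, forall t, G (t + IZR n * L) = G t).
{ intros n s. destruct (Z_le_dec 0 n) as [H | H].
  - rewrite <- (Z2Nat.id n H), <- INR_IZR_INZ. fin.
  - rewrite <- (P (Z.to_nat (- n))). f_equal. rewrite INR_IZR_INZ, Z2Nat.id, opp_IZR by lia. lra. }
assert (Z0 : forall s, 0 <= s <= L -> G s = 0%C).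
{ assert (Zl : G 0 = 0%C).
  { apply NNPP; intros N. destruct (ccont_eps G 0 (Gc 0) (Cmod (G 0))) as (d & D & K); [now apply Cmod_gt_0|].
    set (s := Rmin (d / 2) (L / 2)). assert (Hs : 0 < s) by (apply Rmin_pos; lra).
    assert (s <= d / 2) by apply Rmin_l. assert (s <= L / 2) by apply Rmin_r.
    specialize (K s). rewrite Rabs_pos_eq in K by lra.
    rewrite fourier_zero_interior in K by lra. replace (0 - G 0)%C with (- G 0)%C in K by ring.
    rewrite Cmod_opp in K; lra. }
  intros s Hs. destruct (Req_dec s 0) as [-> | N0]; auto. destruct (Req_dec s L) as [-> | NL].
  - rewrite <- (Rplus_0_l L), Gp; fin.
  - apply fourier_zero_interior; lra. }
set (n := Int_part (t / L)).
rewrite <- (Q (- n)%Z t). apply Z0. rewrite opp_IZR.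
destruct (base_Int_part (t / L)) as [B1 B2]. fold n in B1, B2.
assert (E : t = t / L * L) by fin.
nra.
Qed.

End FourierUnique.

(** The sign-twisted case reduces to the periodic one by multiplication with a character of the same
    sign, which also shifts the admissible frequencies onto the integer ones. *)
Lemma fourier_unique L e (g : R -> C) : 0 < L -> e = 1 \/ e = -1 ->
  (forall t, ccont g t) -> (forall t, g (t + L) = (e * g t)%C) ->
  (forall k, Eit (k * L) = RtoC e -> CI (fun t => (g t * Eit (- k * t))%C) 0 L = 0%C) ->
  forall t, g t = 0%C.
Proof.
intros HL He Hc Hp H0 t.
assert (K0 : exists k0, Eit (k0 * L) = RtoC e).
{ destruct He as [-> | ->].
  - exists 0. rewrite Rmult_0_l. apply Eit_0.
  - exists (PI / L). replace (PI / L * L) with PI by fin. rewrite Eit_eq, cos_PI, sin_PI. fin. }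
destruct K0 as [k0 Hk0].
assert (Z : (g t * Eit (- k0 * t))%C = 0%C).
{ apply (fourier_zero L (fun t => (g t * Eit (- k0 * t))%C)); auto.
  - intros s; apply ccont_mult; auto; apply ccont_Eit_lin.
  - intros s. rewrite Hp. replace (- k0 * (s + L)) with (- k0 * s + - (k0 * L)) by ring.
    rewrite Eit_plus. pose proof (Eit_opp (k0 * L)) as Q. rewrite Hk0 in Q.
    transitivity (g s * Eit (- k0 * s) * (Eit (- (k0 * L)) * e))%C; [fin|]. rewrite Q; fin.
  - intros n. rewrite <- (H0 (k0 + IZR n * (2 * PI / L))).
    + apply CI_ext; intros s. rewrite <- Cmult_assoc, <- Eit_plus. do 2 f_equal. lra.
    + replace ((k0 + IZR n * (2 * PI / L)) * L) with (k0 * L + IZR n * (2 * PI)) by fin.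
      rewrite Eit_plus, Eit_IZR_2PI, Hk0. fin. }
assert (N : Eit (- k0 * t) <> 0%C) by (intros E; pose proof (Cmod_Eit (- k0 * t)) as Q; rewrite E, Cmod_0 in Q; lra).
apply NNPP; intros N2. exact (Cmult_neq_0 _ _ N2 N Z).
Qed.

(** * Modes of equivariant functions *)

Definition eqv (g : heis) (k : C) (f : heis -> C) : Prop := forall p, f (hmul g p) = (k * f p)%C.

Section Space.
Variables (v1 w1 w2 r e1 e2 e3 : R).
Hypothesis (Hv1 : 0 < v1) (Hw2 : 0 < w2) (Hr : 0 < r).
Hypothesis (He1 : e1 = 1 \/ e1 = -1) (He2 : e2 = 1 \/ e2 = -1) (He3 : e3 = 1 \/ e3 = -1).

(** A scalar component of a spinor, with equivariance asked at the generators [v], [w] and the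
    central element; [spinor_generators] extends it to the lattice. *)
Definition Sp (f : heis -> C) : Prop :=
  csmooth f /\ eqv (v1, 0, 0) e1 f /\ eqv (w1, w2, 0) e2 f /\ eqv (0, 0, r) e3 f.

Lemma Sp_plus f g : Sp f -> Sp g -> Sp (fun p => (f p + g p)%C).
Proof.
intros (F0 & F1 & F2 & F3) (G0 & G1 & G2 & G3).
split; [now apply csmooth_plus|]. split; [|split]; intros p.
- rewrite F1, G1; fin.
- rewrite F2, G2; fin.
- rewrite F3, G3; fin.
Qed.

Lemma Sp_scal (k : C) f : Sp f -> Sp (fun p => (k * f p)%C).
Proof.
intros (F0 & F1 & F2 & F3). split; [now apply csmooth_scal|]. split; [|split]; intros p.
- rewrite F1; fin.
- rewrite F2; fin.
- rewrite F3; fin.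
Qed.

Lemma Sp_zero : Sp (fun _ => 0%C).
Proof.
split; [apply csmooth_const|]. split; [|split]; intros p; fin.
Qed.

Lemma Sp_fields f : Sp f -> Sp (CX f) /\ Sp (CY f) /\ Sp (CZ f).
Proof.
intros (F0 & F1 & F2 & F3). destruct (csmooth_fields f F0) as (X & Y & Z),
(fields_equivariant f _ e1 F0 F1) as (X1 & Y1 & Z1),
(fields_equivariant f _ e2 F0 F2) as (X2 & Y2 & Z2),
(fields_equivariant f _ e3 F0 F3) as (X3 & Y3 & Z3).
easy.
Qed.

Lemma Sp_conj f : Sp f -> Sp (fun p => Cconj (f p)).
Proof.
intros (F0 & F1 & F2 & F3). split; [now apply csmooth_conj|].
assert (E : forall k : R, Cconj k = RtoC k) by (intros; apply Ceq; simpl; lra).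
split; [|split]; intros p; [rewrite F1 | rewrite F2 | rewrite F3]; now rewrite Cmult_conj, E.
Qed.

Lemma Sp_hcont f : Sp f -> hcont f.
Proof. intros (F & _). now apply csmooth_inv. Qed.

Lemma Sp_v f x y z : Sp f -> f (x + v1, y, z + v1 * y) = (e1 * f (x, y, z))%C.
Proof.
intros (_ & F & _). rewrite <- F. unfold hmul. f_equal. f_equal; fin.
Qed.

Lemma Sp_w f x y z : Sp f -> f (x + w1, y + w2, z + w1 * y) = (e2 * f (x, y, z))%C.
Proof.
intros (_ & _ & F & _). rewrite <- F. unfold hmul. f_equal. f_equal; fin.
Qed.

Lemma Sp_u f x y z : Sp f -> f (x, y, z + r) = (e3 * f (x, y, z))%C.
Proof.
intros (_ & _ & _ & F). rewrite <- F. unfold hmul. f_equal. f_equal; fin.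
Qed.

Lemma Cmod_sign (e : R) : e = 1 \/ e = -1 -> Cmod e = 1.
Proof. intros [-> | ->]; rewrite Cmod_R; [apply Rabs_R1 | apply Rabs_m1]. Qed.

Lemma reduce_coord (Q : R -> Prop) L : 0 < L -> (forall t, Q t -> Q (t + L)) ->
  (forall t, Q t -> Q (t - L)) -> forall t, Q t -> exists s, 0 <= s <= L /\ Q s.
Proof.
intros HL Hp Hm t Ht. set (n := Int_part (t / L)). exists (t - IZR n * L). split.
- destruct (base_Int_part (t / L)) as [B1 B2]. fold n in B1, B2.
  assert (E : t = t / L * L) by fin.
  nra.
- assert (P : forall m : nat, forall s, Q s -> Q (s + INR m * L) /\ Q (s - INR m * L)).
  { induction m as [|m IH]; intros s Hs.
    - rewrite Rmult_0_l, Rplus_0_r, Rminus_0_r; fin.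
    - destruct (IH s Hs) as [A B]. rewrite S_INR.
      + replace (s + (INR m + 1) * L) with (s + INR m * L + L) by ring.
      + replace (s - (INR m + 1) * L) with (s - INR m * L - L) by ring; fin. }
  destruct (Z_le_dec 0 n) as [H | H].
  + destruct (P (Z.to_nat n) t Ht) as [_ B]. rewrite INR_IZR_INZ, Z2Nat.id in B by auto. fin.
  + destruct (P (Z.to_nat (- n)) t Ht) as [B _]. rewrite INR_IZR_INZ, Z2Nat.id, opp_IZR in B by lia.
    replace (t - IZR n * L) with (t + - IZR n * L) by ring. fin.
Qed.

(** The modulus is invariant under the lattice. The order of reduction matters: [w] moves all
    coordinates and is used for [y], then [v] for [x] with [y] kept, and last the centre for [z]. *)
Lemma Sp_reduce f : Sp f -> forall x y z, exists x' y' z',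
  0 <= x' <= v1 /\ 0 <= y' <= w2 /\ 0 <= z' <= r /\ Cmod (f (x', y', z')) = Cmod (f (x, y, z)).
Proof.
intros Hf x y z. set (c := Cmod (f (x, y, z))).
assert (N1 : forall x y z, Cmod (f (x + v1, y, z + v1 * y)) = Cmod (f (x, y, z))) by (intros; rewrite Sp_v, Cmod_mult, Cmod_sign by auto; lra).
assert (N2 : forall x y z, Cmod (f (x + w1, y + w2, z + w1 * y)) = Cmod (f (x, y, z))) by (intros; rewrite Sp_w, Cmod_mult, Cmod_sign by auto; lra).
assert (N3 : forall x y z, Cmod (f (x, y, z + r)) = Cmod (f (x, y, z))) by (intros; rewrite Sp_u, Cmod_mult, Cmod_sign by auto; lra).
destruct (reduce_coord (fun y => exists x z, Cmod (f (x, y, z)) = c) w2 Hw2) with (t := y)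
  as (y' & Hy' & x1 & z1 & E1).
{ intros t (a & b & E). exists (a + w1), (b + w1 * t). now rewrite N2. }
{ intros t (a & b & E). exists (a - w1), (b - w1 * (t - w2)). rewrite <- N2, <- E.
  do 2 f_equal. f_equal; fin. }
{ eauto. }
destruct (reduce_coord (fun x => exists z, Cmod (f (x, y', z)) = c) v1 Hv1) with (t := x1)
  as (x' & Hx' & z2 & E2).
{ intros t (b & E). exists (b + v1 * y'). now rewrite N1. }
{ intros t (b & E). exists (b - v1 * y'). rewrite <- N1, <- E.
  do 2 f_equal. f_equal; fin. }
{ eauto. }
destruct (reduce_coord (fun z => Cmod (f (x', y', z)) = c) r Hr) with (t := z2) as (z' & Hz' & E3).
{ intros t E. now rewrite N3. }
{ intros t E. rewrite <- N3, <- E. do 2 f_equal. fin. }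
{ lra. }
exists x', y', z'; lra.
Qed.

Lemma hcont_box_bounded f a b c : hcont f -> exists M, forall x y z,
  0 <= x <= a -> 0 <= y <= b -> 0 <= z <= c -> Cmod (f (x, y, z)) <= M.
Proof.
intros Hf.
assert (HD : forall t : Compactness.Tn 3 R, exists d : posreal, forall x y z,
  Rabs (x - fst t) < d -> Rabs (y - fst (snd t)) < d -> Rabs (z - fst (snd (snd t))) < d ->
  Cmod (f (x, y, z) - f (fst t, fst (snd t), fst (snd (snd t))))%C < 1) by (intros (x & y & z & []); destruct (Hf x y z 1 Rlt_0_1) as (d & D & K); exists (mkposreal d D); fin).
set (delta := fun t => proj1_sig (constructive_indefinite_description _ (HD t))).
apply NNPP; intros N.
apply (compactness_list 3 (0, (0, (0, tt))) (a, (b, (c, tt))) delta). intros (l & Hl). apply N.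
exists (fold_right (fun t s => Rmax (Cmod (f (fst t, fst (snd t), fst (snd (snd t)))) + 1) s) 0 l).
intros x y z Hx Hy Hz.
destruct (Hl (x, (y, (z, tt)))) as (t & Ht & _ & Hc); [simpl; lra|].
assert (K : Cmod (f (x, y, z)) <= Cmod (f (fst t, fst (snd t), fst (snd (snd t)))) + 1).
{ assert (Q : Cmod (f (x, y, z) - f (fst t, fst (snd t), fst (snd (snd t))))%C < 1) by (destruct t as (t1 & t2 & t3 & []); destruct Hc as (H1 & H2 & H3 & _); exact (proj2_sig (constructive_indefinite_description _ (HD (t1, (t2, (t3, tt))))) x y z H1 H2 H3)).
  replace (f (x, y, z)) with (f (fst t, fst (snd t), fst (snd (snd t)))
    + (f (x, y, z) - f (fst t, fst (snd t), fst (snd (snd t)))))%C at 1 by ring.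
  Ctri. lra. }
eapply Rle_trans; [exact K|]. clear - Ht. induction l as [|s l IH]; [easy|].
destruct Ht as [-> | Ht]; [apply Rmax_l|]. eapply Rle_trans; [fin | apply Rmax_r].
Qed.

Lemma Sp_bounded f : Sp f -> exists M, forall p, Cmod (f p) <= M.
Proof.
intros Hf. destruct (hcont_box_bounded f v1 w2 r (Sp_hcont f Hf)) as [M HM].
exists M. intros [[x y] z]. destruct (Sp_reduce f Hf x y z) as (x' & y' & z' & Hx & Hy & Hz & <-). fin.
Qed.

(** * Fourier transforms along the centre and along v *)

(** The shear $z\mapsto z+xy$ turns the left action of [v] into a pure translation of [x], so that a
    second Fourier transform in [x] makes sense. *)
Definition Jt (c : R) (f : heis -> C) (x y : R) : C :=
  CI (fun z => (f (x, y, z + x * y)%R * Eit (- c * z))%C) 0 r.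

Definition Tt (c k : R) (f : heis -> C) (y : R) : C :=
  CI (fun x => (Jt c f x y * Eit (- k * x))%C) 0 v1.

Lemma hcont_integrand c f : hcont f ->
  hcont (fun p => let '(x, y, z) := p in (f (x, y, z + x * y)%R * Eit (- c * z))%C).
Proof.
intros Hf.
assert (H : hcont (fun p => ((let '(x, y, z) := p in f (x, y, (z + x * y)%R))
   * (let '(x, y, z) := p in Eit (- c * z)))%C)).
{ apply hcont_mult; [now apply hcont_shear|]. intros x y z eps He.
  destruct (ccont_eps (fun t => Eit (- c * t)) z (ccont_Eit_lin (- c) z) eps He) as (d & D & K).
  eauto. }
fin.
Qed.

Lemma Jt_cont2 c f x y : hcont f -> ccont2 (Jt c f) x y.
Proof.
intros Hf. apply (CI_cont2 (fun p => let '(x, y, z) := p in (f (x, y, z + x * y)%R * Eit (- c * z))%C)).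
- now apply hcont_integrand.
- lra.
Qed.

Lemma integrand_ccont c f x y z : hcont f -> ccont (fun z => (f (x, y, z + x * y)%R * Eit (- c * z))%C) z.
Proof.
intros Hf. apply (hcont_ccont_z (fun p => let '(x, y, z) := p in (f (x, y, z + x * y)%R * Eit (- c * z))%C)).
now apply hcont_integrand.
Qed.

Lemma Jt_plus c f g x y : hcont f -> hcont g ->
  Jt c (fun p => (f p + g p)%C) x y = (Jt c f x y + Jt c g x y)%C.
Proof.
intros Hf Hg. unfold Jt. rewrite <- CI_plus by (intros; now apply integrand_ccont).
apply CI_ext; intros; fin.
Qed.

Lemma Jt_scal c (k : C) f x y : hcont f -> Jt c (fun p => (k * f p)%C) x y = (k * Jt c f x y)%C.
Proof.
intros Hf. unfold Jt. rewrite <- CI_scal by (intros; now apply integrand_ccont).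
apply CI_ext; intros; fin.
Qed.

Lemma Jt_ccont_x c k f x y : hcont f -> ccont (fun x => (Jt c f x y * Eit (- k * x))%C) x.
Proof.
intros Hf. apply ccont_mult; [|apply ccont_Eit_lin]. apply (ccont2_fst (Jt c f)). now apply Jt_cont2.
Qed.

Lemma Tt_plus c k f g y : hcont f -> hcont g ->
  Tt c k (fun p => (f p + g p)%C) y = (Tt c k f y + Tt c k g y)%C.
Proof.
intros Hf Hg. unfold Tt. rewrite <- CI_plus by (intros; now apply Jt_ccont_x).
apply CI_ext; intros. rewrite Jt_plus; auto. fin.
Qed.

Lemma Tt_scal c k (a : C) f y : hcont f -> Tt c k (fun p => (a * f p)%C) y = (a * Tt c k f y)%C.
Proof.
intros Hf. unfold Tt. rewrite <- CI_scal by (intros; now apply Jt_ccont_x).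
apply CI_ext; intros. rewrite Jt_scal; auto. fin.
Qed.

Lemma rderiv_shear_y f x y z : csmooth f ->
  rderiv (fun y => f (x, y, z + x * y)) y (CY f (x, y, z + x * y)%R).
Proof.
intros Hf. destruct (csmooth_inv f Hf) as (Hc & fx & fy & fz & X & Y & Z & D),
(fields_partials f fx fy fz (proj1 (csmooth_inv _ Y)) D) as (_ & -> & _).
exact (rderiv_path_y f fx fy fz x y z x (proj1 (csmooth_inv _ Y)) D).
Qed.

Lemma hcont_ccont2_xz f x y z : hcont f -> ccont2 (fun b c => f (b, y, c)) x z.
Proof.
intros H; apply ccont2_eps; intros eps He. destruct (H x y z eps He) as (d & D & K).
exists d; split; auto; intros b c Hb Hc. apply K; auto. rewrite Rminus_diag, Rabs_R0; lra.
Qed.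

Lemma rderiv_shear_x f x y z : csmooth f ->
  rderiv (fun x => f (x, y, z + x * y)) x (CX f (x, y, z + x * y)%R + y * CZ f (x, y, z + x * y)%R)%C.
Proof.
intros Hf. destruct (csmooth_inv f Hf) as (Hc & fx & fy & fz & X & Y & Z & D),
(fields_partials f fx fy fz (proj1 (csmooth_inv _ Y)) D) as (-> & _ & ->).
assert (Dl : forall x, is_derive (fun t => z + t * y) x y) by (intros; auto_derive; lra).
pose proof (hcont_ccont2_xz fx x y (z + x * y) (proj1 (csmooth_inv _ X))) as [Q1 Q2].
split; Creim.
- evar_last; [apply (chain2 (fun b c => Re (f (b, y, c))) (fun b c => Re (fx (b, y, c)))
    (fun b c => Re (fz (b, y, c))) (fun t => t) (fun t => z + t * y) x 1 y)|]; auto.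
  + intros a b; exact (proj1 (proj1 (D a y b))).
  + intros a b; exact (proj1 (proj2 (proj2 (D a y b)))).
  + apply @is_derive_id.
  + lra.
- evar_last; [apply (chain2 (fun b c => Im (f (b, y, c))) (fun b c => Im (fx (b, y, c)))
    (fun b c => Im (fz (b, y, c))) (fun t => t) (fun t => z + t * y) x 1 y)|]; auto.
  + intros a b; exact (proj2 (proj1 (D a y b))).
  + intros a b; exact (proj2 (proj2 (proj2 (D a y b)))).
  + apply @is_derive_id.
  + lra.
Qed.

Lemma csmooth_hcont f : csmooth f -> hcont f.
Proof. now apply csmooth_inv. Qed.

Lemma integrand_ccont2_yz c f x y z : hcont f ->
  ccont2 (fun y z => (f (x, y, z + x * y)%R * Eit (- c * z))%C) y z.
Proof.
intros Hf. apply (hcont_ccont2_yz (fun p => let '(x, y, z) := p in (f (x, y, z + x * y)%R * Eit (- c * z))%C)).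
now apply hcont_integrand.
Qed.

Lemma integrand_ccont2_xz c f x y z : hcont f ->
  ccont2 (fun x z => (f (x, y, z + x * y)%R * Eit (- c * z))%C) x z.
Proof.
intros Hf. apply (hcont_ccont2_xz (fun p => let '(x, y, z) := p in (f (x, y, z + x * y)%R * Eit (- c * z))%C)).
now apply hcont_integrand.
Qed.

Lemma Jt_deriv_y c f x y : csmooth f -> rderiv (fun y => Jt c f x y) y (Jt c (CY f) x y).
Proof.
intros Hf. destruct (csmooth_fields f Hf) as (X & Y & Z).
apply (CI_param (fun y z => (f (x, y, z + x * y)%R * Eit (- c * z))%C)
  (fun y z => (CY f (x, y, z + x * y)%R * Eit (- c * z))%C)).
- intros y' z. eapply rderiv_val; [apply rderiv_mult; [now apply rderiv_shear_y | apply rderiv_const]|].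
  cbv beta; fin.
- intros y' z. apply integrand_ccont2_yz. now apply csmooth_hcont.
- intros y' z. apply integrand_ccont. now apply csmooth_hcont.
Qed.

Lemma Jt_deriv_x c f x y : csmooth f ->
  rderiv (fun x => Jt c f x y) x (Jt c (CX f) x y + y * Jt c (CZ f) x y)%C.
Proof.
intros Hf. destruct (csmooth_fields f Hf) as (X & Y & Z).
apply csmooth_hcont in X as X', Z as Z'.
eapply rderiv_val.
- apply (CI_param (fun x z => (f (x, y, z + x * y)%R * Eit (- c * z))%C)
    (fun x z => (CX f (x, y, z + x * y)%R * Eit (- c * z)
        + y * (CZ f (x, y, z + x * y)%R * Eit (- c * z)))%C)).
  + intros x' z. eapply rderiv_val; [apply rderiv_mult; [now apply rderiv_shear_x | apply rderiv_const]|].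
    cbv beta; fin.
  + intros x' z. apply ccont2_plus; [|apply ccont2_mult; [apply ccont2_const|]]; now apply integrand_ccont2_xz.
  + intros x' z. apply integrand_ccont. now apply csmooth_hcont.
- rewrite CI_plus, CI_scal; auto.
  + intros; now apply integrand_ccont.
  + intros; now apply integrand_ccont.
  + intros; apply ccont_mult; [apply ccont_const | now apply integrand_ccont].
Qed.

Lemma Tt_deriv c k f y : csmooth f -> rderiv (Tt c k f) y (Tt c k (CY f) y).
Proof.
intros Hf. destruct (csmooth_fields f Hf) as (X & Y & Z).
apply (CI_param (fun y x => (Jt c f x y * Eit (- k * x))%C) (fun y x => (Jt c (CY f) x y * Eit (- k * x))%C)).
- intros y' x. eapply rderiv_val; [apply rderiv_mult; [now apply Jt_deriv_y | apply rderiv_const]|].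
  cbv beta; fin.
- intros y' x. apply ccont2_mult; [|apply ccont2_Eit_lin2].
  apply (ccont2_swap (Jt c (CY f))), Jt_cont2. now apply csmooth_hcont.
- intros y' x. apply Jt_ccont_x. now apply csmooth_hcont.
Qed.

Lemma rderiv_in_z f x y z : csmooth f -> rderiv (fun z => f (x, y, z + x * y)) z (CZ f (x, y, z + x * y)%R).
Proof.
intros Hf. destruct (csmooth_inv f Hf) as (Hc & fx & fy & fz & X & Y & Z & D),
(fields_partials f fx fy fz (proj1 (csmooth_inv _ Y)) D) as (_ & _ & ->).
eapply rderiv_val; [apply (rderiv_comp_R (fun z => f (x, y, z)) (fun z => z + x * y) z (fz (x, y, z + x * y)%R) 1)|].
- exact (proj2 (proj2 (D x y (z + x * y)))).
- auto_derive; lra.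
- fin.
Qed.

Lemma Jt_Z c f x y : Sp f -> Eit (c * r) = RtoC e3 -> Jt c (CZ f) x y = (Ci * c * Jt c f x y)%C.
Proof.
intros Hf Hc. assert (Cf := proj1 Hf). destruct (csmooth_fields f Cf) as (X & Y & Z).
apply csmooth_hcont in Cf as Hf', Z as Z'.
assert (E : CI (fun z => (CZ f (x, y, z + x * y)%R * Eit (- c * z)
   + - (Ci * c) * (f (x, y, z + x * y)%R * Eit (- c * z)))%C) 0 r = 0%C).
{ rewrite (CI_FTC (fun z => (f (x, y, z + x * y)%R * Eit (- c * z))%C)).
  - replace (r + x * y) with (0 + x * y + r) by ring. rewrite Sp_u by auto.
    replace (- c * r) with (- (c * r)) by ring. pose proof (Eit_opp (c * r)) as Q. rewrite Hc in Q.
    rewrite Rmult_0_r, Eit_0.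
    transitivity (f (x, y, 0 + x * y)%R * (Eit (- (c * r)) * e3) - f (x, y, 0 + x * y)%R * 1)%C; [fin|].
    rewrite Q; fin.
  - intros z. eapply rderiv_val; [apply rderiv_mult; [now apply rderiv_in_z | apply rderiv_Eit_lin]|].
    rewrite RtoC_opp. fin.
  - intros z. apply ccont_plus; [now apply integrand_ccont|].
    apply ccont_mult; [apply ccont_const | now apply integrand_ccont]. }
rewrite CI_plus, CI_scal in E.
- fold (Jt c (CZ f) x y) in E. fold (Jt c f x y) in E.
  transitivity ((Jt c (CZ f) x y + - (Ci * c) * Jt c f x y) + Ci * c * Jt c f x y)%C; [fin|].
  rewrite E. fin.
- intros; now apply integrand_ccont.
- intros; now apply integrand_ccont.
- intros; apply ccont_mult; [apply ccont_const | now apply integrand_ccont].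
Qed.

Lemma Tt_Z c k f y : Sp f -> Eit (c * r) = RtoC e3 -> Tt c k (CZ f) y = (Ci * c * Tt c k f y)%C.
Proof.
intros Hf Hc. unfold Tt. rewrite <- CI_scal.
- apply CI_ext; intros x. rewrite Jt_Z; auto. fin.
- intros; apply Jt_ccont_x. now apply Sp_hcont.
Qed.

Lemma Jt_v c f x y : Sp f -> Jt c f (x + v1) y = (e1 * Jt c f x y)%C.
Proof.
intros Hf. unfold Jt. rewrite <- CI_scal by (intros; apply integrand_ccont; now apply Sp_hcont).
apply CI_ext; intros z. replace (z + (x + v1) * y) with (z + x * y + v1 * y) by ring.
rewrite Sp_v by auto. fin.
Qed.

(** In sheared coordinates the [x]-derivative is $X+yZ$. Integration by parts makes it $ik$, and $Z$
    becomes $ic$, so X acts as multiplication by $i(k-cy)$ while Y acts as $d/dy$: the harmonic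
    oscillator. *)
Lemma Tt_X c k f y : Sp f -> Eit (c * r) = RtoC e3 -> Eit (k * v1) = RtoC e1 ->
  Tt c k (CX f) y = (Ci * (k - c * y)%R * Tt c k f y)%C.
Proof.
intros Hf Hc Hk. assert (Cf := proj1 Hf). destruct (csmooth_fields f Cf) as (X & Y & Z).
apply csmooth_hcont in Cf as Hf', X as X'.
assert (E : CI (fun x => ((Jt c (CX f) x y * Eit (- k * x))
   + (Ci * (c * y)%R - Ci * k) * (Jt c f x y * Eit (- k * x)))%C) 0 v1 = 0%C).
{ rewrite (CI_FTC (fun x => (Jt c f x y * Eit (- k * x))%C)).
  - replace v1 with (0 + v1) at 1 by ring. rewrite Jt_v by auto.
    replace (- k * v1) with (- (k * v1)) by ring. pose proof (Eit_opp (k * v1)) as Q. rewrite Hk in Q.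
    rewrite Rmult_0_r, Eit_0.
    transitivity (Jt c f 0 y * (Eit (- (k * v1)) * e1) - Jt c f 0 y * 1)%C; [fin|]. rewrite Q; fin.
  - intros x. eapply rderiv_val; [apply rderiv_mult; [now apply Jt_deriv_x | apply rderiv_Eit_lin]|].
    rewrite Jt_Z by auto. rewrite RtoC_opp, RtoC_mult. fin.
  - intros x. apply ccont_plus; [now apply Jt_ccont_x|].
    apply ccont_mult; [apply ccont_const | now apply Jt_ccont_x]. }
rewrite CI_plus, CI_scal in E.
- fold (Tt c k f y) in E. fold (Tt c k (CX f) y) in E.
  transitivity ((Tt c k (CX f) y + (Ci * (c * y)%R - Ci * k) * Tt c k f y)
    - (Ci * (c * y)%R - Ci * k) * Tt c k f y)%C; [fin|].
  rewrite E, RtoC_minus. fin.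
- intros; now apply Jt_ccont_x.
- intros; now apply Jt_ccont_x.
- intros; apply ccont_mult; [apply ccont_const | now apply Jt_ccont_x].
Qed.

(** Fourier uniqueness is used twice: in [x] for [Jt], which is quasiperiodic thanks to the shear,
    then in [z]. *)
Lemma Tt_injective f : Sp f -> (forall c k, Eit (c * r) = RtoC e3 -> Eit (k * v1) = RtoC e1 ->
  forall y, Tt c k f y = 0%C) -> forall p, f p = 0%C.
Proof.
intros Hf H. assert (Hc := Sp_hcont f Hf).
assert (J0 : forall c, Eit (c * r) = RtoC e3 -> forall x y, Jt c f x y = 0%C).
{ intros c Hcr x y. apply (fourier_unique v1 e1 (fun x => Jt c f x y)); auto.
  - intros t. apply (ccont2_fst (Jt c f)). now apply Jt_cont2.
  - intros t. now apply Jt_v.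
  - eauto. }
intros [[x y] z].
pose proof (fourier_unique r e3 (fun z => f (x, y, z + x * y))) as K.
replace z with ((z - x * y) + x * y) by ring. apply K; auto.
- intros t. pose proof (hcont_ccont_z (fun p => let '(x, y, z) := p in f (x, y, z + x * y)) x y t (hcont_shear f Hc)) as Q.
  fin.
- intros t. replace (t + r + x * y) with (t + x * y + r) by ring. now apply Sp_u.
- eauto.
Qed.

Lemma Tt_bounded c k f : Sp f -> exists M, forall y, Cmod (Tt c k f y) <= M.
Proof.
intros Hf. destruct (Sp_bounded f Hf) as [M HM]. assert (Hc := Sp_hcont f Hf).
exists (M * (r - 0) * (v1 - 0)). intros y. apply CI_bound; [lra | |].
- intros; now apply Jt_ccont_x.
- intros x _. rewrite Cmod_mult, Cmod_Eit, Rmult_1_r. apply CI_bound; [lra| |].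
  + intros; now apply integrand_ccont.
  + intros z _. rewrite Cmod_mult, Cmod_Eit, Rmult_1_r. fin.
Qed.

Lemma Jt_shift c f x y : Sp f -> Eit (c * r) = RtoC e3 ->
  Jt c f (x + w1) (y + w2) = (e2 * Eit (c * (x * w2 + w1 * w2)) * Jt c f x y)%C.
Proof.
intros Hf Hc. assert (Hh := Sp_hcont f Hf).
set (s := - (x * w2 + w1 * w2)).
set (h := fun z => (f (x + w1, y + w2, z + (x + w1) * (y + w2))%R * Eit (- c * z))%C).
assert (E : CI (fun z => h (z + s)) 0 r = CI h 0 r).
{ apply CI_shift_periodic.
  - intros z. now apply integrand_ccont.
  - intros z; unfold h. replace (z + r + (x + w1) * (y + w2)) with (z + (x + w1) * (y + w2) + r) by ring.
    rewrite Sp_u by auto. replace (- c * (z + r)) with (- c * z + - (c * r)) by ring. rewrite Eit_plus.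
    pose proof (Eit_opp (c * r)) as Q. rewrite Hc in Q.
    transitivity (f (x + w1, y + w2, z + (x + w1) * (y + w2))%R * Eit (- c * z) * (Eit (- (c * r)) * e3))%C; [fin|].
    rewrite Q; fin. }
unfold Jt at 1. fold h. rewrite <- E. unfold Jt. rewrite <- CI_scal by (intros; now apply integrand_ccont).
apply CI_ext; intros z. unfold h, s.
replace (z + - (x * w2 + w1 * w2) + (x + w1) * (y + w2)) with (z + x * y + w1 * y) by ring.
rewrite Sp_w by auto. replace (- c * (z + - (x * w2 + w1 * w2))) with (c * (x * w2 + w1 * w2) + - c * z) by ring.
rewrite Eit_plus. fin.
Qed.

(** In sheared coordinates the action of [w] multiplies by $e^{icw_2x}$ up to a phase, which moves
    the frequency along [v] by $cw_2$. Modes in one orbit of this shift determine each other. *)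
Lemma Tt_shift c k f y : Sp f -> Eit (c * r) = RtoC e3 -> Eit (k * v1) = RtoC e1 ->
  Tt c k f (y + w2) = (e2 * Eit (c * (w1 * w2) - k * w1) * Tt c (k - c * w2) f y)%C.
Proof.
intros Hf Hc Hk. assert (Hh := Sp_hcont f Hf).
set (h := fun x => (Jt c f x (y + w2) * Eit (- k * x))%C).
assert (E : CI (fun x => h (x + w1)) 0 v1 = CI h 0 v1).
{ apply CI_shift_periodic.
  - intros x; unfold h. now apply Jt_ccont_x.
  - intros x; unfold h. rewrite Jt_v by auto.
    replace (- k * (x + v1)) with (- k * x + - (k * v1)) by ring. rewrite Eit_plus.
    pose proof (Eit_opp (k * v1)) as Q. rewrite Hk in Q.
    transitivity (Jt c f x (y + w2) * Eit (- k * x) * (Eit (- (k * v1)) * e1))%C; [fin|].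
    rewrite Q; fin. }
unfold Tt at 1. fold h. rewrite <- E. unfold Tt. rewrite <- CI_scal by (intros; now apply Jt_ccont_x).
apply CI_ext; intros x. unfold h. rewrite Jt_shift by auto.
replace (Eit (- (k - c * w2) * x)) with (Eit (c * w2 * x) * Eit (- k * x))%C by (rewrite <- Eit_plus; fin).
replace (- k * (x + w1)) with (- k * x + - (k * w1)) by ring.
replace (c * (x * w2 + w1 * w2)) with (c * w2 * x + c * (w1 * w2)) by ring.
replace (c * (w1 * w2) - k * w1) with (c * (w1 * w2) + - (k * w1)) by ring.
rewrite !Eit_plus. fin.
Qed.

(* Annihilation and creation operators on the modes of positive central frequency. *)
Definition opa (f : heis -> C) (p : heis) : C := (CX f p + - Ci * CY f p)%C.
Definition opb (f : heis -> C) (p : heis) : C := (CX f p + Ci * CY f p)%C.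

Lemma Sp_opa f : Sp f -> Sp (opa f).
Proof. intros H; destruct (Sp_fields f H) as (X & Y & _). apply Sp_plus; auto. now apply Sp_scal. Qed.

Lemma Sp_opb f : Sp f -> Sp (opb f).
Proof. intros H; destruct (Sp_fields f H) as (X & Y & _). apply Sp_plus; auto. now apply Sp_scal. Qed.

Lemma Tt_CY_deriv c k f y : Sp f -> rderiv (Tt c k f) y (Tt c k (CY f) y).
Proof. intros H; now apply Tt_deriv, H. Qed.

Lemma Tt_opa c k f y : Sp f -> Eit (c * r) = RtoC e3 -> Eit (k * v1) = RtoC e1 ->
  Tt c k (opa f) y = (Ci * (k - c * y)%R * Tt c k f y - Ci * Tt c k (CY f) y)%C.
Proof.
intros Hf Hc Hk. destruct (Sp_fields f Hf) as (X & Y & _). unfold opa.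
rewrite Tt_plus, Tt_scal, Tt_X; auto; try (now apply Sp_hcont); [fin|].
apply Sp_hcont. now apply Sp_scal.
Qed.

Lemma Tt_opb c k f y : Sp f -> Eit (c * r) = RtoC e3 -> Eit (k * v1) = RtoC e1 ->
  Tt c k (opb f) y = (Ci * (k - c * y)%R * Tt c k f y + Ci * Tt c k (CY f) y)%C.
Proof.
intros Hf Hc Hk. destruct (Sp_fields f Hf) as (X & Y & _). unfold opb.
rewrite Tt_plus, Tt_scal, Tt_X; auto; try (now apply Sp_hcont).
apply Sp_hcont. now apply Sp_scal.
Qed.

Lemma rderiv_unique h t l l' : rderiv h t l -> rderiv h t l' -> l = l'.
Proof.
intros H K. rewrite <- (Derive_C_unique h t l H). now apply Derive_C_unique.
Qed.

Lemma Tt_CY_opa c k f y : Sp f -> Eit (c * r) = RtoC e3 -> Eit (k * v1) = RtoC e1 ->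
  Tt c k (CY (opa f)) y = (- Ci * c * Tt c k f y + Ci * (k - c * y)%R * Tt c k (CY f) y
    - Ci * Tt c k (CY (CY f)) y)%C.
Proof.
intros Hf Hc Hk. destruct (Sp_fields f Hf) as (X & Y & _).
apply (rderiv_unique (Tt c k (opa f)) y); [apply Tt_CY_deriv; now apply Sp_opa|].
apply (rderiv_ext (fun y => (Ci * (k - c * y)%R * Tt c k f y - Ci * Tt c k (CY f) y)%C));
  [symmetry; now apply Tt_opa|].
eapply rderiv_val; [apply rderiv_minus; [apply rderiv_mult; [apply rderiv_scal, rderiv_RtoC|]|apply rderiv_scal]|].
- instantiate (1 := - c). auto_derive; lra.
- now apply Tt_CY_deriv.
- now apply Tt_CY_deriv.
- rewrite RtoC_opp. fin.
Qed.

Lemma Tt_CY_opb c k f y : Sp f -> Eit (c * r) = RtoC e3 -> Eit (k * v1) = RtoC e1 ->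
  Tt c k (CY (opb f)) y = (- Ci * c * Tt c k f y + Ci * (k - c * y)%R * Tt c k (CY f) y
    + Ci * Tt c k (CY (CY f)) y)%C.
Proof.
intros Hf Hc Hk. destruct (Sp_fields f Hf) as (X & Y & _).
apply (rderiv_unique (Tt c k (opb f)) y); [apply Tt_CY_deriv; now apply Sp_opb|].
apply (rderiv_ext (fun y => (Ci * (k - c * y)%R * Tt c k f y + Ci * Tt c k (CY f) y)%C));
  [symmetry; now apply Tt_opb|].
eapply rderiv_val; [apply rderiv_plus; [apply rderiv_mult; [apply rderiv_scal, rderiv_RtoC|]|apply rderiv_scal]|].
- instantiate (1 := - c). auto_derive; lra.
- now apply Tt_CY_deriv.
- now apply Tt_CY_deriv.
- rewrite RtoC_opp. fin.
Qed.

Lemma Ci_sq : (Ci * Ci)%C = (-1)%R.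
Proof. apply Ceq; simpl; lra. Qed.

(* [X - iY, X + iY] = 2i Z, read off from the transforms of both sides. *)
Lemma opa_opb_comm f : Sp f -> forall p, opa (opb f) p = (opb (opa f) p + 2 * Ci * CZ f p)%C.
Proof.
intros Hf p. destruct (Sp_fields f Hf) as (X & Y & Z).
assert (A := Sp_opa f Hf). assert (B := Sp_opb f Hf).
assert (AB := Sp_opa _ B). assert (BA := Sp_opb _ A).
assert (K : (opa (opb f) p + (-1 * opb (opa f) p + - (2 * Ci) * CZ f p))%C = 0%C).
{ apply (Tt_injective (fun p => (opa (opb f) p + (-1 * opb (opa f) p + - (2 * Ci) * CZ f p))%C)).
  - apply Sp_plus; auto. apply Sp_plus; now apply Sp_scal.
  - intros c k Hc Hk y.
    assert (H1 := Sp_hcont _ (Sp_scal (-1)%R _ BA)). assert (H2 := Sp_hcont _ (Sp_scal (- (2 * Ci)) _ Z)).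
    assert (H3 := Sp_hcont _ AB). assert (H4 := Sp_hcont _ BA). assert (H5 := Sp_hcont _ Z).
    rewrite Tt_plus, Tt_plus, !Tt_scal; auto; [|now apply hcont_plus].
    rewrite Tt_opa, Tt_opb, Tt_CY_opb, Tt_opb, Tt_opa, Tt_CY_opa, Tt_Z by auto.
    fin. }
replace (opa (opb f) p) with ((opa (opb f) p + (-1 * opb (opa f) p + - (2 * Ci) * CZ f p))
  + (opb (opa f) p + 2 * Ci * CZ f p))%C by ring.
rewrite K. fin.
Qed.

Lemma CI_conj h a b : (forall t, ccont h t) -> CI (fun t => Cconj (h t)) a b = Cconj (CI h a b).
Proof.
intros H. unfold CI, Cconj. f_equal.
apply (RInt_opp (V := R_CompleteNormedModule)). exact (proj2 (ccont_ex_RInt h a b H)).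
Qed.

Opaque CI.

Lemma sign_sq (e : R) : e = 1 \/ e = -1 -> (e * e)%C = 1%C.
Proof. intros [-> | ->]; fin. Qed.

Lemma Cmult_cancel (a b : C) : a <> 0%C -> (a * b)%C = 0%C -> b = 0%C.
Proof. intros Ha H. transitivity (/ a * (a * b))%C; [field; fin| rewrite H; fin]. Qed.

Lemma Cmult_cancel_r (a b : C) : a <> 0%C -> (b * a)%C = 0%C -> b = 0%C.
Proof. rewrite Cmult_comm; apply Cmult_cancel. Qed.

(** * Vanishing of oscillator modes *)

(** A convex function on the whole line that is bounded above is constant: a nonzero slope would
    carry a tangent past the bound. *)
Lemma bounded_convex (n n1 n2 : R -> R) M :
  (forall t, is_derive n t (n1 t)) -> (forall t, is_derive n1 t (n2 t)) ->
  (forall t, 0 <= n2 t) -> (forall t, n t <= M) -> forall t, n1 t = 0.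
Proof.
intros D1 D2 H2 HM t0.
assert (Mono : forall a b, a <= b -> n1 a <= n1 b).
{ intros a b Hab. destruct (MVT_gen n1 a b n2) as (c & Hc & E).
  - fin.
  - intros x _. apply continuity_pt_filterlim, (@ex_derive_continuous R_AbsRing R_NormedModule). eexists; fin.
  - specialize (H2 c). nra. }
assert (MV : forall a b, exists c, Rmin a b <= c <= Rmax a b /\ n b - n a = n1 c * (b - a)).
{ intros a b. destruct (MVT_gen n a b n1) as (c & Hc & E); eauto.
  intros x _. apply continuity_pt_filterlim, (@ex_derive_continuous R_AbsRing R_NormedModule). eexists; fin. }
destruct (Rtotal_order (n1 t0) 0) as [K | [K | K]]; auto.
(* The point where the tangent at [t0] reaches the height [M + 1]; by convexity the graph lies above
   it. *)
- set (b := t0 - (M - n t0 + 1) / (- n1 t0)).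
  assert (P : 0 < (M - n t0 + 1) / (- n1 t0)) by (specialize (HM t0); fin).
  destruct (MV t0 b) as (c & Hc & E). unfold b in Hc, E. rewrite Rmax_left in Hc by lra.
  assert (n1 c <= n1 t0) by (apply Mono; lra).
  assert (Q : (M - n t0 + 1) <= n1 c * (t0 - (M - n t0 + 1) / - n1 t0 - t0)) by (replace (M - n t0 + 1) with ((- n1 t0) * ((M - n t0 + 1) / - n1 t0)) at 1 by fin; nra).
  pose proof (HM (t0 - (M - n t0 + 1) / - n1 t0)). lra.
- set (b := t0 + (M - n t0 + 1) / n1 t0).
  assert (P : 0 < (M - n t0 + 1) / n1 t0) by (specialize (HM t0); fin).
  destruct (MV t0 b) as (c & Hc & E). unfold b in Hc, E. rewrite Rmin_left in Hc by lra.
  assert (n1 t0 <= n1 c) by (apply Mono; lra).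
  assert (Q : (M - n t0 + 1) <= n1 c * (t0 + (M - n t0 + 1) / n1 t0 - t0)) by (replace (M - n t0 + 1) with (n1 t0 * ((M - n t0 + 1) / n1 t0)) at 1 by fin; nra).
  pose proof (HM (t0 + (M - n t0 + 1) / n1 t0)). lra.
Qed.

Lemma is_derive_prod2 (f g h k : R -> R) x f' g' h' k' : is_derive f x f' -> is_derive g x g' ->
  is_derive h x h' -> is_derive k x k' ->
  is_derive (fun y => f y * g y + h y * k y) x (f' * g x + f x * g' + (h' * k x + h x * k')).
Proof.
rewrite !is_derive_Reals. intros F G H K.
exact (derivable_pt_lim_plus _ _ _ _ _ (derivable_pt_lim_mult _ _ _ _ _ F G) (derivable_pt_lim_mult _ _ _ _ _ H K)).
Qed.

Lemma Eit_inv_sign a (e : R) : Eit a = RtoC e -> (e = 1 \/ e = -1) -> Eit (- a) = RtoC e.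
Proof.
intros H He. pose proof (Eit_opp a) as K. rewrite H in K.
transitivity (Eit (- a) * e * e)%C.
- rewrite <- Cmult_assoc, <- RtoC_mult. replace (e * e) with 1 by nra. fin.
- rewrite K. fin.
Qed.

Section Mode.
Variables (c k : R).
Hypothesis (Hc : Eit (c * r) = RtoC e3) (Hk : Eit (k * v1) = RtoC e1).

Lemma mode_CY_cong F g (kap : C) : Sp F -> Sp g -> (forall y, Tt c k F y = (kap * Tt c k g y)%C) ->
  forall y, Tt c k (CY F) y = (kap * Tt c k (CY g) y)%C.
Proof.
intros HF Hg E y. apply (rderiv_unique (Tt c k F) y).
- apply Tt_deriv. apply HF.
- apply (rderiv_ext (fun y => (kap * Tt c k g y)%C)); auto.
  apply rderiv_scal, Tt_deriv. apply Hg.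
Qed.

Lemma mode_opa_cong F g (kap : C) : Sp F -> Sp g -> (forall y, Tt c k F y = (kap * Tt c k g y)%C) ->
  forall y, Tt c k (opa F) y = (kap * Tt c k (opa g) y)%C.
Proof.
intros HF Hg E y. rewrite !Tt_opa by auto.
rewrite E, (mode_CY_cong F g kap) by auto. fin.
Qed.

Lemma mode_opb_cong F g (kap : C) : Sp F -> Sp g -> (forall y, Tt c k F y = (kap * Tt c k g y)%C) ->
  forall y, Tt c k (opb F) y = (kap * Tt c k (opb g) y)%C.
Proof.
intros HF Hg E y. rewrite !Tt_opb by auto.
rewrite E, (mode_CY_cong F g kap) by auto. fin.
Qed.

Lemma mode_comm g y : Sp g -> Tt c k (opb (opa g)) y = (Tt c k (opa (opb g)) y + 2 * c * Tt c k g y)%C.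
Proof.
intros Hg. destruct (Sp_fields g Hg) as (_ & _ & Z).
assert (A := Sp_opa _ (Sp_opb _ Hg)).
replace (opb (opa g)) with (fun p => (opa (opb g) p + - (2 * Ci) * CZ g p)%C).
- assert (H1 := Sp_hcont _ A). assert (H2 := Sp_hcont _ (Sp_scal (- (2 * Ci)) _ Z)).
  assert (H3 := Sp_hcont _ Z).
  rewrite Tt_plus, Tt_scal, Tt_Z by auto.
  Cring.
- funext p.
  rewrite opa_opb_comm by auto. fin.
Qed.

(** The commutator of the two operators is $2c$ on the mode, so the eigenvalue of [opb] after [opa]
    rises by that amount with every application of [opa]. *)
Lemma ladder_step g (kap : R) : Sp g -> (forall y, Tt c k (opb (opa g)) y = (kap * Tt c k g y)%C) ->
  forall y, Tt c k (opb (opa (opa g))) y = ((kap + 2 * c)%R * Tt c k (opa g) y)%C.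
Proof.
intros Hg E y. assert (A := Sp_opa _ Hg). assert (B := Sp_opb _ A).
rewrite mode_comm by auto. rewrite (mode_opa_cong (opb (opa g)) g kap) by auto.
rewrite RtoC_plus, RtoC_mult. fin.
Qed.

Lemma mode_second g y : Sp g -> Tt c k (opb (opa g)) y =
  (Tt c k (CY (CY g)) y + (c - (k - c * y) ^ 2)%R * Tt c k g y)%C.
Proof.
intros Hg. assert (A := Sp_opa _ Hg).
rewrite Tt_opb, Tt_opa, Tt_CY_opa by auto.
Cring.
Qed.

(** The mode satisfies $T''=(\kappa-c+(k-cy)^2)T$ with positive potential. Then $|T|^2$ is convex
    and bounded, hence constant, and its vanishing second derivative forces $T=0$. *)
Lemma convex_zero g (kap : R) : Sp g -> c < kap -> (forall y, Tt c k (opb (opa g)) y = (kap * Tt c k g y)%C) ->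
  forall y, Tt c k g y = 0%C.
Proof.
intros Hg Hkap E.
destruct (Sp_fields g Hg) as (_ & Y & _),
(Tt_bounded c k g Hg) as [M HM]. set (a := fun y => Re (Tt c k g y)). set (b := fun y => Im (Tt c k g y)).
set (a1 := fun y => Re (Tt c k (CY g) y)). set (b1 := fun y => Im (Tt c k (CY g) y)).
set (a2 := fun y => Re (Tt c k (CY (CY g)) y)). set (b2 := fun y => Im (Tt c k (CY (CY g)) y)).
assert (D0 : forall y, is_derive a y (a1 y) /\ is_derive b y (b1 y)) by (intros y; destruct (Tt_deriv c k g y (proj1 Hg)) as [P Q]; fin).
assert (D1 : forall y, is_derive a1 y (a2 y) /\ is_derive b1 y (b2 y)) by (intros y; destruct (Tt_deriv c k (CY g) y (proj1 Y)) as [P Q]; split; fin).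
set (q := fun y => kap - c + (k - c * y) ^ 2).
assert (Eq : forall y, a2 y = q y * a y /\ b2 y = q y * b y).
{ intros y. pose proof (E y) as K. rewrite mode_second in K by auto.
  split; [apply (f_equal Re) in K | apply (f_equal Im) in K]; revert K; Creim; unfold a2, b2, a, b, q; lra. }
set (n := fun y => a y * a y + b y * b y).
set (n1 := fun y => 2 * (a y * a1 y + b y * b1 y)).
set (n2 := fun y => 2 * (a1 y * a1 y + b1 y * b1 y) + 2 * q y * n y).
assert (Dn : forall y, is_derive n y (n1 y)).
{ intros y. destruct (D0 y) as [P Q].
  replace (n1 y) with (a1 y * a y + a y * a1 y + (b1 y * b y + b y * b1 y)) by (unfold n1; lra).
  exact (is_derive_prod2 a a b b y _ _ _ _ P P Q Q). }
assert (Dn1 : forall y, is_derive n1 y (n2 y)).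
{ intros y. destruct (D0 y) as [P Q], (D1 y) as [P1 Q1], (Eq y) as [Ea Eb].
  replace (n2 y) with (2 * (a1 y * a1 y + a y * a2 y + (b1 y * b1 y + b y * b2 y)))
    by (unfold n2; rewrite Ea, Eb; unfold n; lra).
  exact (is_derive_scal _ y 2 _ (is_derive_prod2 a a1 b b1 y _ _ _ _ P P1 Q Q1)). }
assert (Hn0 : forall y, 0 <= n y) by (intros y; unfold n; nra).
assert (Hq : forall y, kap - c <= q y) by (intros y; unfold q; pose proof (pow2_ge_0 (k - c * y)); lra).
assert (Hn2 : forall y, 0 <= n2 y).
{ intros y. unfold n2. specialize (Hn0 y). specialize (Hq y).
  nra. }
assert (Z1 : forall y, n1 y = 0).
{ apply (bounded_convex n n1 n2 (M * M)); auto. intros y. specialize (HM y).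
  assert (EN : n y = Cmod (Tt c k g y) ^ 2) by (rewrite Cmod2_alt; unfold n, a, b; lra).
  pose proof (Cmod_ge_0 (Tt c k g y)). nra. }
intros y.
assert (Z2 : n2 y = 0).
{ rewrite <- (is_derive_unique _ _ _ (Dn1 y)). replace n1 with (fun _ : R => 0).
  - apply Derive_const.
  - funext p; fin. }
assert (n y = 0).
{ unfold n2 in Z2. specialize (Hn0 y). specialize (Hq y).
  nra. }
apply Cmod_eq_0. assert (EN : n y = Cmod (Tt c k g y) ^ 2) by (rewrite Cmod2_alt; unfold n, a, b; lra).
nra.
Qed.

(** The condition is the first-order equation $T'=(k-cy)T$, whose solutions are multiples of a
    Gaussian centred at $k/c$; the value at the centre decides. *)
Lemma gaussian_zero g : Sp g -> c <> 0 -> (forall y, Tt c k (opa g) y = 0%C) -> Tt c k g (k / c) = 0%C ->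
  forall y, Tt c k g y = 0%C.
Proof.
intros Hg Nc E E0 y.
assert (D : forall y, Tt c k (CY g) y = ((k - c * y)%R * Tt c k g y)%C).
{ intros t. pose proof (E t) as K. rewrite Tt_opa in K by auto. transitivity (Ci * (Ci * (k - c * t)%R * Tt c k g t - Ci * Tt c k (CY g) t)
    + (k - c * t)%R * Tt c k g t - (Ci * Ci + 1) * ((k - c * t)%R * Tt c k g t - Tt c k (CY g) t))%C; [fin|].
  rewrite K. Cring. }
set (h := fun y => (Tt c k g y * RtoC (exp (c / 2 * (y - k / c) ^ 2)))%C).
assert (Dh : forall y, rderiv h y 0).
{ intros t. eapply rderiv_val.
  - apply rderiv_mult; [apply (Tt_deriv c k g t (proj1 Hg)) | apply rderiv_RtoC].
    instantiate (1 := c * (t - k / c) * exp (c / 2 * (t - k / c) ^ 2)). auto_derive; auto.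
    fin.
  - rewrite D, RtoC_mult.
    replace (k - c * t) with (- (c * (t - k / c))) by fin. rewrite RtoC_opp. fin. }
assert (C0 : h y = h (k / c)).
{ destruct (Rle_dec (k / c) y).
  - apply (rderiv_zero_const h (k / c) y); fin.
  - symmetry. apply (rderiv_zero_const h y (k / c)); fin. }
unfold h in C0 at 2. rewrite E0, Cmult_0_l in C0.
refine (Cmult_cancel_r _ _ _ C0). apply RtoC_neq0.
pose proof (exp_pos (c / 2 * (y - k / c) ^ 2)); lra.
Qed.

End Mode.

(** The eigenvalue equation of the Dirac operator in a frame diagonalizing the Clifford action of
    the centre, with [s] equal to $1/\sqrt A$ and [Lam] the eigenvalue relative to the symmetry
    point. *)
Definition dsys (s Lam : R) (u v : heis -> C) : Prop := forall p,
  (- s * opb v p + Ci * CZ u p)%C = (Lam * u p)%C /\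
  (s * opa u p - Ci * CZ v p)%C = (Lam * v p)%C.

Lemma dsys_T s Lam u v c k : Sp u -> Sp v -> dsys s Lam u v ->
  Eit (c * r) = RtoC e3 ->
  (forall y, (- s * Tt c k (opb v) y)%C = ((Lam + c)%R * Tt c k u y)%C) /\
  (forall y, (s * Tt c k (opa u) y)%C = ((Lam - c)%R * Tt c k v y)%C).
Proof.
intros Hu Hv H Hc.
destruct (Sp_fields u Hu) as (_ & _ & Zu),
(Sp_fields v Hv) as (_ & _ & Zv).
assert (A := Sp_opa _ Hu). assert (B := Sp_opb _ Hv).
assert (hu := Sp_hcont _ Hu). assert (hv := Sp_hcont _ Hv).
assert (hA := Sp_hcont _ A). assert (hB := Sp_hcont _ B).
assert (hZu := Sp_hcont _ Zu). assert (hZv := Sp_hcont _ Zv).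
assert (hs : forall (a : C) f, hcont f -> hcont (fun p => (a * f p)%C)).
{ intros a f Hf. apply hcont_mult; auto. exists 1; split; [lra|].
  rewrite Cmod_diag; fin. }
split; intros y.
- assert (E : Tt c k (fun p => (- s * opb v p + Ci * CZ u p)%C) y = Tt c k (fun p => (Lam * u p)%C) y) by (f_equal; funext p; apply H).
  rewrite Tt_plus, !Tt_scal, Tt_Z in E by auto. transitivity ((- s * Tt c k (opb v) y + Ci * (Ci * c * Tt c k u y)) - Ci * Ci * (c * Tt c k u y))%C; [ring|].
  rewrite E. Cring.
- assert (E : Tt c k (fun p => (s * opa u p + - Ci * CZ v p)%C) y = Tt c k (fun p => (Lam * v p)%C) y).
  { f_equal. funext p. rewrite <- (proj2 (H p)). fin. }
  rewrite Tt_plus, !Tt_scal, Tt_Z in E by auto. transitivity ((s * Tt c k (opa u) y + - Ci * (Ci * c * Tt c k v y)) + Ci * Ci * (c * Tt c k v y))%C; [ring|].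
  rewrite E. Cring.
Qed.

Lemma Sp_iter_opa n u : Sp u -> Sp (Nat.iter n opa u).
Proof. intros Hu; induction n as [|n IH]; auto. now apply Sp_opa. Qed.

(** The components of the mode are coupled by [opa] and [opb], so [u] is an eigenfunction of [opb]
    after [opa]. High powers of [opa] kill it by convexity, and vanishing is carried back down the
    ladder; only at the level matching [Lam] does the value at the Gaussian centre have to be
    supplied. *)
Lemma nil_vanish s Lam u v c k : 0 < s -> 0 < c -> Sp u -> Sp v -> dsys s Lam u v ->
  Eit (c * r) = RtoC e3 -> Eit (k * v1) = RtoC e1 ->
  (forall n, Lam <> c -> Lam ^ 2 = c ^ 2 + 2 * INR n * c * s ^ 2 -> Tt c k (Nat.iter n opa u) (k / c) = 0%C) ->
  (forall y, Tt c k u y = 0%C) /\ (forall y, Tt c k v y = 0%C).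
Proof.
intros Hs Hc0 Hu Hv HD Hc Hk Hn.
destruct (dsys_T s Lam u v c k Hu Hv HD Hc) as [E1 E2].
assert (Ns : RtoC s <> 0%C) by (apply RtoC_neq0; lra).
assert (A := Sp_opa _ Hu). assert (B := Sp_opb _ Hv).
assert (F1 : forall y, Tt c k (opb v) y = (- ((Lam + c) / s)%R * Tt c k u y)%C).
{ intros y. unfold Rdiv. rewrite RtoC_mult, RtoC_inv by lra.
  transitivity (- / s * (- s * Tt c k (opb v) y))%C; [field; fin|]. rewrite E1. fin. }
assert (F2 : forall y, Tt c k (opa u) y = (((Lam - c) / s)%R * Tt c k v y)%C).
{ intros y. unfold Rdiv. rewrite RtoC_mult, RtoC_inv by lra.
  transitivity (/ s * (s * Tt c k (opa u) y))%C; [field; fin|]. rewrite E2. fin. }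
destruct (Req_dec Lam c) as [-> | NL].
(* For [Lam = c] the mode of [opa u] is 0, so [v] has eigenvalue $2c>c$ and vanishes by convexity;
   then [opb v = 0] forces [u] to vanish. *)
- assert (Zv : forall y, Tt c k v y = 0%C).
  { refine (convex_zero c k Hc Hk v (2 * c) Hv ltac:(lra) _). intros y.
    rewrite mode_comm by auto.
    rewrite (mode_opa_cong c k Hc Hk (opb v) u (- ((c + c) / s)%R)%C) by auto.
    rewrite F2. replace ((c - c) / s) with 0 by lra. rewrite RtoC_mult. fin. }
  split; auto. intros y.
  assert (Q : Tt c k (opb v) y = 0%C) by (rewrite (mode_opb_cong c k Hc Hk v v 0%C Hv Hv); [fin|]; intros t; rewrite Zv; fin).
  rewrite F1 in Q. refine (Cmult_cancel _ _ _ Q).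
  rewrite <- RtoC_opp. apply RtoC_neq0.
  assert (0 < (c + c) / s) by pos. lra.
(* The eigenvalue on the [j]-th power of [opa]: it starts at $-(\Lambda^2-c^2)/s^2$ and grows by
   $2c$ per step, and it is zero exactly when $\Lambda^2=c^2+2jcs^2$. *)
- set (kap := fun j : nat => - ((Lam - c) / s * ((Lam + c) / s)) + 2 * c * INR j).
  assert (L : forall j y, Tt c k (opb (opa (Nat.iter j opa u))) y = (kap j * Tt c k (Nat.iter j opa u) y)%C).
  { induction j as [|j IH]; intros y.
    - cbn [Nat.iter nat_rect]. rewrite (mode_opb_cong c k Hc Hk (opa u) v ((Lam - c) / s)%R) by auto.
      rewrite F1. unfold kap. rewrite Rmult_0_r, Rplus_0_r, RtoC_opp, RtoC_mult. fin.
    -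
      rewrite (ladder_step c k Hc Hk (Nat.iter j opa u) (kap j)); auto; [|now apply Sp_iter_opa].
      do 2 f_equal. unfold kap. rewrite S_INR. lra. }
  destruct (INR_unbounded ((c + (Lam - c) / s * ((Lam + c) / s)) / (2 * c))) as [J HJ].
  assert (HJ2 : c < kap J).
  { unfold kap. apply Rmult_lt_compat_l with (r := 2 * c) in HJ; [|lra].
    replace (2 * c * ((c + (Lam - c) / s * ((Lam + c) / s)) / (2 * c)))
      with (c + (Lam - c) / s * ((Lam + c) / s)) in HJ by fin. lra. }
  (* Descent from [J]: if the next power vanishes, a nonzero [kap j] kills the present one, and
     [kap j = 0] leaves a Gaussian, which the hypothesis on its centre kills. *)
  assert (ZJ : forall m, (m <= J)%nat -> forall y, Tt c k (Nat.iter (J - m) opa u) y = 0%C).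
  { induction m as [|m IH]; intros Hm y.
    - rewrite Nat.sub_0_r. exact (convex_zero c k Hc Hk _ (kap J) (Sp_iter_opa J u Hu) HJ2 (L J) y).
    - set (j := (J - S m)%nat). replace (J - m)%nat with (S j) in IH by lia.
      specialize (IH ltac:(lia)).
      assert (Sj : Sp (Nat.iter j opa u)) by now apply Sp_iter_opa.
      destruct (Req_dec (kap j) 0) as [K | K].
      + apply (gaussian_zero c k Hc Hk); auto; [lra|]. apply Hn; auto.
        unfold kap in K.
        assert (K2 : 2 * c * INR j * s ^ 2 = (Lam - c) * (Lam + c)) by (replace (2 * c * INR j) with ((Lam - c) / s * ((Lam + c) / s)) by lra; fin).
        lra.
      + assert (Q : Tt c k (opb (opa (Nat.iter j opa u))) y = 0%C) by (rewrite (mode_opb_cong c k Hc Hk _ (opa (Nat.iter j opa u)) 0%C (Sp_opa _ Sj) (Sp_opa _ Sj)); [fin|]; intros t; rewrite IH; fin).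
        rewrite L in Q. exact (Cmult_cancel _ _ (RtoC_neq0 _ K) Q). }
  assert (Zu : forall y, Tt c k u y = 0%C) by (specialize (ZJ J (le_n J)); now rewrite Nat.sub_diag in ZJ).
  split; auto. intros y.
  assert (Q : Tt c k (opa u) y = 0%C) by (rewrite (mode_opa_cong c k Hc Hk u u 0%C Hu Hu); [fin|]; intros t; rewrite Zu; fin).
  rewrite F2 in Q. refine (Cmult_cancel _ _ _ Q).
  apply RtoC_neq0. apply Rmult_integral_contrapositive_currified; [lra|]. apply Rinv_neq_0_compat; lra.
Qed.

(** * Torus modes *)

(** The second coordinate of the covector that has first coordinate [k] and takes the value $mw_2$
    on [w]; it makes [(k, ell k m)] a shifted dual lattice vector. *)
Definition ell (k m : R) : R := m - k * w1 / w2.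

(** The third Fourier transform, available at central frequency 0, where the action of [w] keeps [k]
    fixed and translates [y]. *)
Definition Ht (k m : R) (f : heis -> C) : C :=
  CI (fun y => (Tt 0 k f y * Eit (- ell k m * y))%C) 0 w2.

Lemma Ht_ccont k m f y : csmooth f -> ccont (fun y => (Tt 0 k f y * Eit (- ell k m * y))%C) y.
Proof.
intros Hf. apply ccont_mult; [|apply ccont_Eit_lin]. eapply rderiv_ccont, Tt_deriv; fin.
Qed.

Lemma Ht_plus k m f g : csmooth f -> csmooth g ->
  Ht k m (fun p => (f p + g p)%C) = (Ht k m f + Ht k m g)%C.
Proof.
intros Hf Hg. unfold Ht. rewrite <- CI_plus by (intros; now apply Ht_ccont).
apply CI_ext; intros. rewrite Tt_plus by (now apply csmooth_hcont). fin.
Qed.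

Lemma Ht_scal k m (a : C) f : csmooth f -> Ht k m (fun p => (a * f p)%C) = (a * Ht k m f)%C.
Proof.
intros Hf. unfold Ht. rewrite <- CI_scal by (intros; now apply Ht_ccont).
apply CI_ext; intros. rewrite Tt_scal by (now apply csmooth_hcont). fin.
Qed.

Lemma Ht_X k m f : Sp f -> e3 = 1 -> Eit (k * v1) = RtoC e1 -> Ht k m (CX f) = (Ci * k * Ht k m f)%C.
Proof.
intros Hf H3 Hk. unfold Ht. rewrite <- CI_scal by (intros; apply Ht_ccont; apply Hf).
apply CI_ext; intros y. rewrite Tt_X; auto.
- rewrite Rmult_0_l, Rminus_0_r. fin.
- rewrite Rmult_0_l, Eit_0, H3. fin.
Qed.

Lemma Ht_Z k m f : Sp f -> e3 = 1 -> Ht k m (CZ f) = 0%C.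
Proof.
intros Hf H3. unfold Ht. rewrite (CI_ext _ (fun _ => 0%C)).
- rewrite CI_const. fin.
- intros y. rewrite Tt_Z; auto; [fin|].
  rewrite Rmult_0_l, Eit_0, H3. fin.
Qed.

Lemma T0_shift k f y : Sp f -> e3 = 1 -> Eit (k * v1) = RtoC e1 ->
  Tt 0 k f (y + w2) = (e2 * Eit (- (k * w1)) * Tt 0 k f y)%C.
Proof.
intros Hf H3 Hk. rewrite Tt_shift; auto.
- rewrite !Rmult_0_l, !Rminus_0_r. do 3 f_equal. lra.
- rewrite Rmult_0_l, Eit_0, H3. fin.
Qed.

Lemma Ht_Y k m f : Sp f -> e3 = 1 -> Eit (k * v1) = RtoC e1 -> Eit (m * w2) = RtoC e2 ->
  Ht k m (CY f) = (Ci * ell k m * Ht k m f)%C.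
Proof.
intros Hf H3 Hk Hm. destruct (Sp_fields f Hf) as (_ & Y & _).
assert (E : CI (fun y => (Tt 0 k (CY f) y * Eit (- ell k m * y)
   + - (Ci * ell k m) * (Tt 0 k f y * Eit (- ell k m * y)))%C) 0 w2 = 0%C).
{ rewrite (CI_FTC (fun y => (Tt 0 k f y * Eit (- ell k m * y))%C)).
  - replace w2 with (0 + w2) at 1 by ring. rewrite T0_shift by auto.
    replace (- ell k m * w2) with (k * w1 + - (m * w2)) by (unfold ell; fin).
    rewrite Rmult_0_r, Eit_0, Eit_plus, (Eit_inv_sign (m * w2) e2) by auto.
    transitivity ((e2 * e2) * (Eit (- (k * w1)) * Eit (k * w1)) * Tt 0 k f 0 - Tt 0 k f 0)%C; [fin|].
    rewrite (sign_sq e2 He2), Eit_opp. fin.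
  - intros y. eapply rderiv_val; [apply rderiv_mult; [apply Tt_deriv; apply Hf | apply rderiv_Eit_lin]|].
    rewrite RtoC_opp. fin.
  - intros y. apply ccont_plus; [apply Ht_ccont, Y|].
    apply ccont_mult; [apply ccont_const | apply Ht_ccont, Hf]. }
rewrite CI_plus, CI_scal in E.
- fold (Ht k m f) in E. fold (Ht k m (CY f)) in E.
  transitivity ((Ht k m (CY f) + - (Ci * ell k m) * Ht k m f) + Ci * ell k m * Ht k m f)%C; [fin|].
  rewrite E; fin.
- intros; apply Ht_ccont, Hf.
- intros; apply Ht_ccont, Y.
- intros; apply ccont_mult; [apply ccont_const | apply Ht_ccont, Hf].
Qed.

Lemma Ht_injective k f : Sp f -> e3 = 1 -> Eit (k * v1) = RtoC e1 ->
  (forall m, Eit (m * w2) = RtoC e2 -> Ht k m f = 0%C) -> forall y, Tt 0 k f y = 0%C.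
Proof.
intros Hf H3 Hk H y.
assert (K : (Tt 0 k f y * Eit (k * w1 / w2 * y))%C = 0%C).
{ apply (fourier_unique w2 e2 (fun y => (Tt 0 k f y * Eit (k * w1 / w2 * y))%C)); auto.
  - intros t. apply ccont_mult; [|apply ccont_Eit_lin]. eapply rderiv_ccont, Tt_deriv. apply Hf.
  - intros t. rewrite T0_shift by auto.
    replace (k * w1 / w2 * (t + w2)) with (k * w1 / w2 * t + k * w1) by fin. rewrite Eit_plus.
    transitivity (e2 * (Eit (- (k * w1)) * Eit (k * w1)) * (Tt 0 k f t * Eit (k * w1 / w2 * t)))%C; [fin|].
    rewrite Eit_opp; fin.
  - intros m Hm. rewrite <- (H m Hm). apply CI_ext; intros t.
    rewrite <- Cmult_assoc, <- Eit_plus. do 2 f_equal. unfold ell. lra. }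
refine (Cmult_cancel_r _ _ _ K).
intros E. pose proof (Cmod_Eit (k * w1 / w2 * y)) as Q. rewrite E, Cmod_0 in Q; lra.
Qed.

Lemma torus_system s Lam u v k m : Sp u -> Sp v -> dsys s Lam u v -> e3 = 1 ->
  Eit (k * v1) = RtoC e1 -> Eit (m * w2) = RtoC e2 ->
  (- s * ((Ci * k - ell k m) * Ht k m v))%C = (Lam * Ht k m u)%C /\
  (s * ((Ci * k + ell k m) * Ht k m u))%C = (Lam * Ht k m v)%C.
Proof.
intros Hu Hv H H3 Hk Hm.
destruct (Sp_fields u Hu) as (Xu & Yu & Zu),
(Sp_fields v Hv) as (Xv & Yv & Zv).
assert (cs : forall (a : C) f, Sp f -> csmooth (fun p => (a * f p)%C)) by (intros a f Hf; apply csmooth_scal, Hf).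
assert (Sa : Sp (opa u)) by now apply Sp_opa. assert (Sb : Sp (opb v)) by now apply Sp_opb.
assert (Hb : Ht k m (opb v) = ((Ci * k - ell k m) * Ht k m v)%C).
{ unfold opb. rewrite (Ht_plus k m (CX v) (fun p => (Ci * CY v p)%C) (proj1 Xv) (cs _ _ Yv)),
    (Ht_scal k m Ci (CY v) (proj1 Yv)), (Ht_X k m v Hv H3 Hk), (Ht_Y k m v Hv H3 Hk Hm).
  Cring. }
assert (Ha : Ht k m (opa u) = ((Ci * k + ell k m) * Ht k m u)%C).
{ unfold opa. rewrite (Ht_plus k m (CX u) (fun p => (- Ci * CY u p)%C) (proj1 Xu) (cs _ _ Yu)),
    (Ht_scal k m (- Ci)%C (CY u) (proj1 Yu)), (Ht_X k m u Hu H3 Hk), (Ht_Y k m u Hu H3 Hk Hm).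
  Cring. }
split.
- assert (E : Ht k m (fun p => (- s * opb v p + Ci * CZ u p)%C) = Ht k m (fun p => (Lam * u p)%C)) by (f_equal; funext p; apply H).
  rewrite (Ht_plus k m (fun p => (- s * opb v p)%C) (fun p => (Ci * CZ u p)%C) (cs _ _ Sb) (cs _ _ Zu)),
    (Ht_scal k m (- s)%C (opb v) (proj1 Sb)), (Ht_scal k m Ci (CZ u) (proj1 Zu)),
    (Ht_scal k m Lam u (proj1 Hu)), Hb, (Ht_Z k m u Hu H3) in E.
  rewrite <- E. fin.
- assert (E : Ht k m (fun p => (s * opa u p + - Ci * CZ v p)%C) = Ht k m (fun p => (Lam * v p)%C)).
  { f_equal. funext p. rewrite <- (proj2 (H p)). fin. }
  rewrite (Ht_plus k m (fun p => (s * opa u p)%C) (fun p => (- Ci * CZ v p)%C) (cs _ _ Sa) (cs _ _ Zv)),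
    (Ht_scal k m s (opa u) (proj1 Sa)), (Ht_scal k m (- Ci)%C (CZ v) (proj1 Zv)),
    (Ht_scal k m Lam v (proj1 Hv)), Ha, (Ht_Z k m v Hv H3) in E.
  rewrite <- E. fin.
Qed.

(** The off-diagonal symbols multiply to $-(k^2+\ell^2)$, so eliminating one component multiplies
    the other by $\Lambda^2-s^2(k^2+\ell^2)$. At [Lam = 0] the equations decouple and the two
    components are tested separately. *)
Lemma torus_vanish s Lam u v k m : 0 < s -> Sp u -> Sp v -> dsys s Lam u v -> e3 = 1 ->
  Eit (k * v1) = RtoC e1 -> Eit (m * w2) = RtoC e2 ->
  (Lam ^ 2 = s ^ 2 * (k ^ 2 + ell k m ^ 2) -> Ht k m u = 0%C /\ (Lam = 0 -> Ht k m v = 0%C)) ->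
  Ht k m u = 0%C /\ Ht k m v = 0%C.
Proof.
intros Hs Hu Hv H H3 Hk Hm HL.
destruct (torus_system s Lam u v k m Hu Hv H H3 Hk Hm) as [E1 E2].
set (l := ell k m) in *. set (hu := Ht k m u) in *. set (hv := Ht k m v) in *.
assert (Q : ((Ci * k - l) * (Ci * k + l))%C = RtoC (- (k ^ 2 + l ^ 2))) by Cring.
assert (K1 : ((Lam ^ 2 - s ^ 2 * (k ^ 2 + l ^ 2))%R * hu)%C = 0%C).
{ transitivity (Lam * (Lam * hu) - s * s * RtoC (k ^ 2 + l ^ 2) * hu)%C.
  - rewrite RtoC_minus. replace (s ^ 2) with (s * s) by ring. replace (Lam ^ 2) with (Lam * Lam) by ring.
    rewrite !RtoC_mult. ring.
  - rewrite <- E1. transitivity (- s * (Ci * k - l) * (Lam * hv) - s * s * RtoC (k ^ 2 + l ^ 2) * hu)%C; [fin|].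
    rewrite <- E2. transitivity (- s * s * ((Ci * k - l) * (Ci * k + l)) * hu - s * s * RtoC (k ^ 2 + l ^ 2) * hu)%C; [fin|].
    rewrite Q, RtoC_opp. fin. }
assert (K2 : ((Lam ^ 2 - s ^ 2 * (k ^ 2 + l ^ 2))%R * hv)%C = 0%C).
{ transitivity (Lam * (Lam * hv) - s * s * RtoC (k ^ 2 + l ^ 2) * hv)%C.
  - rewrite RtoC_minus. replace (s ^ 2) with (s * s) by ring. replace (Lam ^ 2) with (Lam * Lam) by ring.
    rewrite !RtoC_mult. ring.
  - rewrite <- E2. transitivity (s * (Ci * k + l) * (Lam * hu) - s * s * RtoC (k ^ 2 + l ^ 2) * hv)%C; [fin|].
    rewrite <- E1. transitivity (- s * s * ((Ci * k - l) * (Ci * k + l)) * hv - s * s * RtoC (k ^ 2 + l ^ 2) * hv)%C; [fin|].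
    rewrite Q, RtoC_opp. fin. }
destruct (Req_dec (Lam ^ 2 - s ^ 2 * (k ^ 2 + l ^ 2)) 0) as [E0 | N0].
- destruct (HL ltac:(lra)) as [Z1 Z2]. split; [fin|].
  destruct (Req_dec Lam 0) as [L0 | NL]; [exact (Z2 L0)|].
  rewrite Z1, !Cmult_0_r in E2. exact (Cmult_cancel _ _ (RtoC_neq0 _ NL) (eq_sym E2)).
- split; [exact (Cmult_cancel _ _ (RtoC_neq0 _ N0) K1) | exact (Cmult_cancel _ _ (RtoC_neq0 _ N0) K2)].
Qed.

Lemma Eit_conj t : Cconj (Eit t) = Eit (- t).
Proof. rewrite !Eit_eq, cos_neg, sin_neg. fin. Qed.

Lemma Tt_conj c k f y : hcont f -> Tt (- c) (- k) f y = Cconj (Tt c k (fun p => Cconj (f p)) y).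
Proof.
intros Hf.
assert (Hf' : hcont (fun p => Cconj (f p))).
{ intros x y' z eps He. destruct (Hf x y' z eps He) as (d & D & K). exists d; split; auto; intros.
  rewrite <- Cminus_conj, Cmod_conj. fin. }
assert (J : forall x, Jt (- c) f x y = Cconj (Jt c (fun p => Cconj (f p)) x y)).
{ intros x. transitivity (CI (fun z => Cconj (Cconj (f (x, y, z + x * y)%R) * Eit (- c * z))) 0 r).
  - apply CI_ext; intros z. rewrite Cmult_conj, Eit_conj, Cconj_conj.
    replace (- - c * z) with (- (- c * z)) by ring. fin.
  - exact (CI_conj _ 0 r (fun z => integrand_ccont c (fun p => Cconj (f p)) x y z Hf')). }
transitivity (CI (fun x => Cconj (Jt c (fun p => Cconj (f p)) x y * Eit (- k * x))) 0 v1).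
- apply CI_ext; intros x. rewrite J, Cmult_conj, Eit_conj.
  replace (- - k * x) with (- (- k * x)) by ring. fin.
- exact (CI_conj _ 0 v1 (fun x => Jt_ccont_x c k (fun p => Cconj (f p)) x y Hf')).
Qed.

(** Conjugation exchanges [opa] and [opb]; the swap of components with one sign restores the system.
    As it reverses the central frequency, negative frequencies reduce to positive ones. *)
Lemma dsys_conj s Lam u v : Sp u -> Sp v -> dsys s Lam u v ->
  dsys s Lam (fun p => (-1 * Cconj (v p))%C) (fun p => Cconj (u p)).
Proof.
intros Hu Hv H p. destruct (H p) as [E1 E2],
(fields_conj u (proj1 Hu)) as (Xu & Yu & Zu), (fields_conj v (proj1 Hv)) as (Xv & Yv & Zv).
assert (Cv : csmooth (fun p => Cconj (v p))) by (apply csmooth_conj, Hv).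
destruct (fields_scal (-1)%C _ Cv) as (Xs & Ys & Zs).
assert (R0 : forall a : R, Cconj a = RtoC a) by (intros; apply Ceq; simpl; lra).
assert (I0 : Cconj Ci = (- Ci)%C) by (apply Ceq; simpl; lra).
apply (f_equal Cconj) in E1, E2. unfold opa, opb in *.
do 4 (rewrite ?Cplus_conj, ?Cminus_conj, ?Cmult_conj, ?Copp_conj, ?R0, ?I0 in E1).
do 4 (rewrite ?Cplus_conj, ?Cminus_conj, ?Cmult_conj, ?Copp_conj, ?R0, ?I0 in E2).
split.
- rewrite Xu, Yu, Zs, Zv.
  transitivity (- (s * (Cconj (CX u p) + - - Ci * Cconj (CY u p)) - - Ci * Cconj (CZ v p)))%C; [fin|].
  rewrite E2. fin.
- rewrite Xs, Ys, Xv, Yv, Zu.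
  transitivity (- s * (Cconj (CX v p) + - Ci * Cconj (CY v p)) + - Ci * Cconj (CZ u p))%C; [fin|].
  fin.
Qed.

Lemma Tt_center_shift c k g : Sp g -> c <> 0 -> Eit (c * r) = RtoC e3 -> Eit (k * v1) = RtoC e1 ->
  Eit (c * w2 * v1) = 1%C ->
  (Tt c (k + c * w2) g ((k + c * w2) / c) = 0%C <-> Tt c k g (k / c) = 0%C).
Proof.
intros Hg Nc Hc Hk Hw.
assert (Hk2 : Eit ((k + c * w2) * v1) = RtoC e1) by (replace ((k + c * w2) * v1) with (k * v1 + c * w2 * v1) by ring; rewrite Eit_plus, Hk, Hw; fin).
replace ((k + c * w2) / c) with (k / c + w2) by fin.
rewrite Tt_shift; auto.
replace (k + c * w2 - c * w2) with k by ring.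
split; intros H; [|rewrite H; fin].
refine (Cmult_cancel _ _ _ H). apply Cmult_neq_0.
- apply RtoC_neq0. lra.
- intros E. pose proof (Cmod_Eit (c * (w1 * w2) - (k + c * w2) * w1)) as Q. rewrite E, Cmod_0 in Q; lra.
Qed.

(** Vanishing at the Gaussian centre depends only on the class of [k] modulo $cw_2$, so finitely
    many conditions suffice for each central frequency. *)
Lemma Tt_center_shift_Z c k g (m : Z) : Sp g -> c <> 0 -> Eit (c * r) = RtoC e3 -> Eit (k * v1) = RtoC e1 ->
  Eit (c * w2 * v1) = 1%C ->
  (Tt c (k + IZR m * (c * w2)) g ((k + IZR m * (c * w2)) / c) = 0%C <-> Tt c k g (k / c) = 0%C).
Proof.
intros Hg Nc Hc Hk Hw.
assert (P : forall n : nat, forall k, Eit (k * v1) = RtoC e1 ->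
  Eit ((k + INR n * (c * w2)) * v1) = RtoC e1 /\
  (Tt c (k + INR n * (c * w2)) g ((k + INR n * (c * w2)) / c) = 0%C <-> Tt c k g (k / c) = 0%C)).
{ induction n as [|n IH]; intros q Hq.
  - rewrite Rmult_0_l, Rplus_0_r. easy.
  - destruct (IH q Hq) as [A B]. rewrite S_INR.
    replace (q + (INR n + 1) * (c * w2)) with ((q + INR n * (c * w2)) + c * w2) by ring. split.
    + rewrite Rmult_plus_distr_r, Eit_plus, A, Hw. fin.
    + rewrite <- B. now apply Tt_center_shift. }
destruct (Z_le_dec 0 m) as [H | H].
- destruct (P (Z.to_nat m) k Hk) as [_ B]. rewrite INR_IZR_INZ, Z2Nat.id in B by auto. fin.
- set (q := k + IZR m * (c * w2)).
  assert (Hq : Eit (q * v1) = RtoC e1).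
  {
    assert (Q : forall n : nat, Eit (INR n * (c * w2 * v1)) = 1%C) by (induction n as [|n IH]; [rewrite Rmult_0_l; apply Eit_0|]; rewrite S_INR, Rmult_plus_distr_r, Rmult_1_l, Eit_plus, IH, Hw; fin).
    unfold q. rewrite Rmult_plus_distr_r, Eit_plus, Hk.
    replace (IZR m * (c * w2) * v1) with (- (INR (Z.to_nat (- m)) * (c * w2 * v1))).
    - pose proof (Eit_opp (INR (Z.to_nat (- m)) * (c * w2 * v1))) as K. rewrite Q, Cmult_1_r in K. rewrite K. fin.
    - rewrite INR_IZR_INZ, Z2Nat.id, opp_IZR by lia. lra. }
  destruct (P (Z.to_nat (- m)) q Hq) as [_ B]. rewrite INR_IZR_INZ, Z2Nat.id, opp_IZR in B by lia.
  replace (q + - IZR m * (c * w2)) with k in B by (unfold q; lra). easy.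
Qed.

(** * Series of exponentials *)

Lemma CI_lsum {I} (f : I -> R -> C) l a b : (forall i t, ccont (f i) t) ->
  CI (fun t => lsum (fun i => f i t) l) a b = lsum (fun i => CI (f i) a b) l /\
  forall t, ccont (fun t => lsum (fun i => f i t) l) t.
Proof.
intros H; induction l as [|i l [IH1 IH2]]; simpl.
- split; [rewrite CI_const; fin|apply ccont_const].
- split; [|intros; now apply ccont_plus].
  rewrite <- IH1. apply CI_plus; fin.
Qed.

(** The list from [csummable_tail_uniform] works for all [t] at once, so the partial sums converge
    uniformly on the interval. *)
Lemma CI_CSum {I} (f : I -> R -> C) (M : I -> R) a b : a <= b ->
  (forall i t, ccont (f i) t) -> (forall i t, Cmod (f i t) <= M i) -> rsummable M ->
  (forall t, ccont (fun t => CSum (fun i => f i t)) t) ->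
  has_sum (fun i => CI (f i) a b) (CI (fun t => CSum (fun i => f i t)) a b).
Proof.
intros Hab Hc HM SM HC eps He.
destruct (csummable_tail_uniform M SM (eps / (b - a + 1))) as (l0 & N0 & H0).
{ pos. }
exists l0; split; auto. intros l Nl Il.
destruct (CI_lsum f l a b Hc) as [E C1]. rewrite <- E, <- CI_minus by auto.
eapply Rle_lt_trans; [apply (CI_bound _ a b (eps / (b - a + 1)) Hab)|].
- intros t. apply ccont_plus; auto. now apply ccont_opp.
- fin.
- unfold Rdiv. rewrite Rmult_assoc. rewrite <- (Rmult_1_r eps) at 2.
  apply Rmult_lt_compat_l; auto. apply Rmult_lt_reg_l with (b - a + 1); [lra|].
  rewrite <- Rmult_assoc, Rinv_r by lra. lra.
Qed.

Lemma exp_le_compat a b : a <= b -> exp a <= exp b.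
Proof. intros [H | ->]; [apply Rlt_le, exp_increasing, H | lra]. Qed.

(** Decay faster than every exponential. It makes the exponential series entire, and it survives
    multiplication by the nodes, that is, differentiation. *)
Definition rapid (b : Z -> C) : Prop :=
  forall R0, rsummable (fun m => Cmod (b m) * exp (R0 * Rabs (IZR m))).

Section ExpSeries.
Variables (k d : R).

Definition knode (m : Z) : R := k + IZR m * d.

Definition Gs (b : Z -> C) (w : C) : C := CSum (fun m => (b m * Cexp (knode m * w))%C).

Lemma rapid_knode b : rapid b -> rapid (fun m => (knode m * b m)%C).
Proof.
intros Hb R0. apply rsummable_le with (fun m => (Rabs k + Rabs d) * (Cmod (b m) * exp ((R0 + 1) * Rabs (IZR m)))).
- intros m. split.
  + pos.
  + rewrite Cmod_mult, Cmod_R. pose proof (Cmod_ge_0 (b m)) as B0.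
    pose proof (Rabs_pos (IZR m)) as M0. pose proof (Rabs_pos k). pose proof (Rabs_pos d).
    assert (E : 1 + Rabs (IZR m) <= exp (Rabs (IZR m))) by (destruct (Req_dec (Rabs (IZR m)) 0) as [-> | N]; [rewrite exp_0; lra|]; apply Rlt_le, exp_ineq1; lra).
    assert (K : Rabs (knode m) <= (Rabs k + Rabs d) * exp (Rabs (IZR m))) by (eapply Rle_trans; [apply Rabs_triang|]; rewrite Rabs_mult; nra).
    replace ((R0 + 1) * Rabs (IZR m)) with (Rabs (IZR m) + R0 * Rabs (IZR m)) by ring. rewrite exp_plus.
    replace ((Rabs k + Rabs d) * (Cmod (b m) * (exp (Rabs (IZR m)) * exp (R0 * Rabs (IZR m)))))
      with (((Rabs k + Rabs d) * exp (Rabs (IZR m))) * Cmod (b m) * exp (R0 * Rabs (IZR m))) by ring.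
    apply Rmult_le_compat_r; [pos|]. nra.
- apply rsummable_scal; auto. pos.
Qed.

Lemma Gs_term_bound b m w B : Rabs (Re w) <= B ->
  Cmod (b m * Cexp (knode m * w))%C <= exp (Rabs k * B) * (Cmod (b m) * exp ((Rabs d * B) * Rabs (IZR m))).
Proof.
intros Hw. rewrite Cmod_mult, Cmod_Cexp.
replace (exp (Rabs k * B) * (Cmod (b m) * exp (Rabs d * B * Rabs (IZR m))))
  with (Cmod (b m) * exp (Rabs k * B + Rabs d * B * Rabs (IZR m))) by (rewrite exp_plus; lra).
apply Rmult_le_compat_l; [pos|]. apply exp_le_compat.
replace (Re (knode m * w)%C) with (knode m * Re w) by (Creim; lra).
eapply Rle_trans; [apply Rle_abs|]. rewrite Rabs_mult.
assert (Rabs (knode m) <= Rabs k + Rabs d * Rabs (IZR m)) by (eapply Rle_trans; [apply Rabs_triang|]; rewrite Rabs_mult; lra).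
assert (0 <= Rabs (Re w)) by apply Rabs_pos.
apply Rle_trans with ((Rabs k + Rabs d * Rabs (IZR m)) * B); [|lra].
apply Rmult_le_compat; auto. pos.
Qed.

Lemma Gs_bound_summable b B : rapid b ->
  rsummable (fun m => exp (Rabs k * B) * (Cmod (b m) * exp ((Rabs d * B) * Rabs (IZR m)))).
Proof. intros Hb. apply rsummable_scal; fin. Qed.

Lemma Gs_summable b w : rapid b -> csummable (fun m => (b m * Cexp (knode m * w))%C).
Proof.
intros Hb. eapply csummable_le; [|apply (Gs_bound_summable b (Rabs (Re w)) Hb)].
intros m. apply Gs_term_bound. lra.
Qed.

Lemma Gs_deriv b w : rapid b -> cderiv (Gs b) w (Gs (fun m => (knode m * b m)%C) w).
Proof.
intros Hb.
apply (holo_sum_deriv (fun m w => (b m * Cexp (knode m * w))%C)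
  (fun m => exp (Rabs k * (Rabs (Re w) + 1)) * (Cmod (b m) * exp ((Rabs d * (Rabs (Re w) + 1)) * Rabs (IZR m)))) w 1).
- lra.
- intros m. apply Ent_mult; [apply Ent_const | apply Ent_exp].
- now apply Gs_bound_summable.
- intros m s Hs. apply Gs_term_bound.
  assert (R1 : Rabs (Re (s - w)%C) <= Cmod (s - w)%C) by apply re_le_Cmod.
  replace (Re s) with (Re w + Re (s - w)%C) by (Creim; lra).
  eapply Rle_trans; [apply Rabs_triang|]. lra.
- rewrite Cmod_diag; lra.
- intros m. apply cderiv_val with (b m * (Cexp (knode m * w) * (knode m * 1)))%C; [|fin].
  apply cderiv_scal. apply (cderiv_comp Cexp (fun w => (knode m * w)%C)); [|apply cderiv_cexp].
  apply cderiv_scal, cderiv_id.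
Qed.

Lemma Gs_smooth b q : rapid b -> csmooth q -> csmooth (fun p => Gs b (q p)).
Proof.
intros Hb Hq. apply (EAlg_smooth (fun g => exists b, rapid b /\ g = Gs b) q); auto.
- intros g (b' & Hb' & ->). exists (Gs (fun m => (knode m * b' m)%C)). split.
  + eexists; split; auto. now apply rapid_knode.
  + intros s. now apply Gs_deriv.
- apply (EAlg_comp (fun g => exists b, rapid b /\ g = Gs b)). eauto.
Qed.

End ExpSeries.

Lemma Rpower_exp_bound t : 0 <= t -> exp (- (2 * t)) <= Rpower (1 + t) (- (2)).
Proof.
intros Ht. apply exp_le_compat.
assert (ln (1 + t) <= t); [|lra].
rewrite <- (ln_exp t) at 2. destruct (Req_dec t 0) as [-> | N].
- rewrite exp_0. right. fin.
- apply Rlt_le, ln_increasing; [lra|]. apply exp_ineq1; lra.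
Qed.

(** Completing the square absorbs every linear term of the exponent; an extra $e^{-2|m|}$ is kept
    and compared with a p-series. *)
Lemma gaussian_rapid (b : Z -> C) al be : 0 < al ->
  (forall m, Cmod (b m) <= exp (- al * IZR m ^ 2 + be * Rabs (IZR m))) -> rapid b.
Proof.
intros Ha Hb R0. set (g := be + R0 + 2).
apply rsummable_le with (fun m => exp (g ^ 2 / (4 * al)) * Rpower (1 + Rabs (IZR m)) (- (2))).
- intros m. split; [pos|].
  apply Rle_trans with (exp (g ^ 2 / (4 * al)) * exp (- (2 * Rabs (IZR m)))).
  + eapply Rle_trans; [apply Rmult_le_compat_r; fin|].
    rewrite <- !exp_plus. apply exp_le_compat.
    set (t := Rabs (IZR m)). replace (IZR m ^ 2) with (t ^ 2) by (unfold t; now rewrite pow2_abs).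
    assert (0 <= (2 * al * t - g) ^ 2 / (4 * al)) by (apply Rmult_le_pos; [apply pow2_ge_0 | pos]).
    replace (g ^ 2 / (4 * al)) with ((2 * al * t - g) ^ 2 / (4 * al) - al * t ^ 2 + g * t) by fin.
    revert H. generalize ((2 * al * t - g) ^ 2 / (4 * al)). intros q Hq.
    replace g with (be + R0 + 2) by reflexivity. lra.
  + apply Rmult_le_compat_l; [pos|]. apply Rpower_exp_bound, Rabs_pos.
- apply rsummable_scal; [pos|]. apply (Z_pseries 2); lra.
Qed.

Lemma Eit_eq_1 x : Eit x = 1%C -> exists n : Z, x = IZR n * (2 * PI).
Proof.
intros H. rewrite Eit_eq in H. apply (f_equal fst) in H. cbn [fst RtoC] in H.
replace x with (2 * (x / 2)) in H by field. rewrite cos_2a_sin in H.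
destruct (sin_eq_0_0 (x / 2)) as [n Hn]; [nra|]. exists n. lra.
Qed.

Lemma Eit_IZR_mult x m : Eit x = 1%C -> Eit (IZR m * x) = 1%C.
Proof.
intros H. destruct (Eit_eq_1 x H) as [n ->].
rewrite <- Rmult_assoc, <- mult_IZR. apply Eit_IZR_2PI.
Qed.

Lemma CI_Eit_zero a L : a <> 0 -> Eit (a * L) = 1%C -> CI (fun t => Eit (a * t)) 0 L = 0%C.
Proof.
intros Ha H. assert (Na : RtoC a <> 0%C) by now apply RtoC_neq0.
rewrite (CI_FTC (fun t => (/ (Ci * a) * Eit (a * t))%C)).
- rewrite H, Rmult_0_r, Eit_0. fin.
- intros t. eapply rderiv_val; [apply rderiv_scal, rderiv_Eit_lin|]. field. split; [fin | apply Ci_neq0].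
- apply ccont_Eit_lin.
Qed.

Lemma CSum_scal {I} (a : C) (g : I -> C) : csummable g -> CSum (fun i => (a * g i)%C) = (a * CSum g)%C.
Proof. intros H. apply CSum_unique, has_sum_scal, csummable_has_sum, H. Qed.

Lemma CSum_ext {I} (g h : I -> C) : (forall i, g i = h i) -> CSum g = CSum h.
Proof. intros E; f_equal; now apply functional_extensionality. Qed.

(** * Theta series as ground states *)

Section Theta.
Variables (c k t2 : R).
Hypothesis (Hc0 : 0 < c) (Hc : Eit (c * r) = RtoC e3) (Hk : Eit (k * v1) = RtoC e1).
Hypothesis (Hcw : Eit (c * w2 * v1) = 1%C) (Ht2 : Eit t2 = RtoC e2).

(** With $k_m=k+mcw_2$ the real exponent is $-k_m^2/(2c)$ up to a constant, which together with the
    quadratic phase gives term [m] a Gaussian centred at $k_m/c$. The imaginary part is what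
    equivariance under [w] forces, [t2] being the angle of the sign [e2]. *)
Definition th_coef (m : Z) : C :=
  Cexp ((- (k * w2 * IZR m) - c * w2 ^ 2 * IZR m ^ 2 / 2)%R
        + Ci * (IZR m * t2 - w1 * (IZR m * k + c * w2 * (IZR m * (IZR m - 1) / 2)))%R)%C.

Definition th_phase (p : heis) : C :=
  (Ci * c * (hZ p - hX p * hY p) - (c / 2)%R * (hY p * hY p))%C.

Definition th_arg (p : heis) : C := (hY p + Ci * hX p)%C.

Definition theta (p : heis) : C := (Cexp (th_phase p) * Gs k (c * w2) th_coef (th_arg p))%C.

Lemma th_rapid : rapid th_coef.
Proof.
apply gaussian_rapid with (c * w2 ^ 2 / 2) (Rabs (k * w2)).
- pos.
- intros m. unfold th_coef. rewrite Cmod_Cexp. apply exp_le_compat.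
  match goal with |- Re (RtoC ?a + Ci * RtoC ?b)%C <= _ => replace (Re (RtoC a + Ci * RtoC b)%C) with a by (simpl; ring) end.
  assert (- (k * w2 * IZR m) <= Rabs (k * w2) * Rabs (IZR m)) by (rewrite <- Rabs_mult, <- Rabs_Ropp; apply Rle_abs).
  lra.
Qed.

Lemma csmooth_phase : csmooth th_phase.
Proof.
apply (csmooth_ext (fun p => (Ci * c * (hZ p + RtoC (-(1)) * (hX p * hY p)) + (- (c / 2))%R * (hY p * hY p))%C)).
{ intros p. unfold th_phase. rewrite !RtoC_opp. fin. }
apply csmooth_plus; [apply csmooth_scal, csmooth_plus | apply csmooth_scal, csmooth_mult];
  try (apply csmooth_coord; auto). apply csmooth_scal, csmooth_mult; apply csmooth_coord; fin.
Qed.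

Lemma csmooth_arg : csmooth th_arg.
Proof. apply csmooth_plus; [|apply csmooth_scal]; apply csmooth_coord; fin. Qed.

Lemma csmooth_theta : csmooth theta.
Proof.
apply csmooth_mult; [apply csmooth_Cexp, csmooth_phase | apply Gs_smooth; [apply th_rapid | apply csmooth_arg]].
Qed.

(** As a derivation, $X-iY$ annihilates both [th_phase] and [th_arg], hence every function of the
    two; the centre enters the phase only through $icz$. *)
Lemma theta_fields :
  (forall p, opa theta p = 0%C) /\ (forall p, CZ theta p = (Ci * c * theta p)%C).
Proof.
set (G' := Gs k (c * w2) (fun m => (knode k (c * w2) m * th_coef m)%C)).
assert (DG : forall w, cderiv (Gs k (c * w2) th_coef) w (G' w)) by (intros; apply Gs_deriv, th_rapid).
set (fx := fun p => (Cexp (th_phase p) * (- (Ci * c * hY p) * Gs k (c * w2) th_coef (th_arg p) + Ci * G' (th_arg p)))%C).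
set (fy := fun p => (Cexp (th_phase p) * ((- (Ci * c * hX p) - c * hY p) * Gs k (c * w2) th_coef (th_arg p) + G' (th_arg p)))%C).
set (fz := fun p => (Cexp (th_phase p) * (Ci * c * Gs k (c * w2) th_coef (th_arg p)))%C).
assert (HD : partials theta fx fy fz).
{ split; [|split].
  - eapply rderiv_val; [apply (rderiv_mult (fun t => Cexp (th_phase (t, y, z))) (fun t => Gs k (c * w2) th_coef (th_arg (t, y, z))))|].
    + apply rderiv_cexp. unfold th_phase, hY, hZ; cbn [fst snd].
      apply rderiv_minus; [apply rderiv_scal, rderiv_minus; [apply rderiv_const | apply rderiv_mult; [apply rderiv_id | apply rderiv_const]] | apply rderiv_const].
    + apply (rderiv_comp_C (Gs k (c * w2) th_coef) (fun t => th_arg (t, y, z))); auto.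
      unfold th_arg, hY; cbn [fst snd].
      apply rderiv_plus; [apply rderiv_const | apply rderiv_scal, rderiv_id].
    + unfold fx, hY; cbn [fst snd]. fin.
  - eapply rderiv_val; [apply (rderiv_mult (fun t => Cexp (th_phase (x, t, z))) (fun t => Gs k (c * w2) th_coef (th_arg (x, t, z))))|].
    + apply rderiv_cexp. unfold th_phase, hX, hZ; cbn [fst snd].
      apply rderiv_minus; [apply rderiv_scal, rderiv_minus; [apply rderiv_const | apply rderiv_scal, rderiv_id] | apply rderiv_scal, rderiv_mult; apply rderiv_id].
    + apply (rderiv_comp_C (Gs k (c * w2) th_coef) (fun t => th_arg (x, t, z))); auto.
      unfold th_arg, hX; cbn [fst snd].
      apply rderiv_plus; [apply rderiv_id | apply rderiv_const].
    + unfold fy, hX; cbn [fst snd]. unfold Rdiv. rewrite RtoC_mult, RtoC_inv by lra. fin.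
  - eapply rderiv_val; [apply (rderiv_mult (fun t => Cexp (th_phase (x, y, t))) (fun t => Gs k (c * w2) th_coef (th_arg (x, y, t))))|].
    + apply rderiv_cexp. unfold th_phase, hX, hY; cbn [fst snd].
      apply rderiv_minus; [apply rderiv_scal, rderiv_minus; [apply rderiv_id | apply rderiv_const] | apply rderiv_const].
    + unfold th_arg, hX, hY; cbn [fst snd]. apply rderiv_const.
    + unfold fz. fin. }
assert (Cy : hcont fy).
{ apply csmooth_hcont. apply csmooth_mult; [apply csmooth_Cexp, csmooth_phase|].
  assert (S1 : csmooth (fun p => Gs k (c * w2) th_coef (th_arg p))) by (apply Gs_smooth; [apply th_rapid | apply csmooth_arg]).
  assert (S2 : csmooth (fun p => G' (th_arg p))) by (apply Gs_smooth; [apply rapid_knode, th_rapid | apply csmooth_arg]).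
  apply csmooth_plus; auto. apply csmooth_mult; auto.
  apply (csmooth_ext (fun p => (- (Ci * c) * hX p + (- c) * hY p)%C)); [intros; fin|].
  apply csmooth_plus; apply csmooth_scal, csmooth_coord; fin. }
destruct (fields_partials theta fx fy fz Cy HD) as (EX & EY & EZ).
split; intros p.
- unfold opa. rewrite EX, EY. unfold fx, fy, fz.
  fin.
- rewrite EZ. unfold fz, theta. fin.
Qed.

Lemma knode_v m : Eit (knode k (c * w2) m * v1) = RtoC e1.
Proof.
unfold knode. rewrite Rmult_plus_distr_r, Eit_plus, Hk,
Rmult_assoc, (Eit_IZR_mult (c * w2 * v1) m Hcw). fin.
Qed.

Lemma theta_v : eqv (v1, 0, 0) e1 theta.
Proof.
intros [[x y] z]. unfold hmul, theta.
replace (th_phase (v1 + x, 0 + y, 0 + z + v1 * y)) with (th_phase (x, y, z)).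
2:{ unfold th_phase, hX, hY, hZ; cbn [fst snd]. rewrite !RtoC_plus, RtoC_mult. fin. }
replace (th_arg (v1 + x, 0 + y, 0 + z + v1 * y)) with (th_arg (x, y, z) + Ci * v1)%C.
2:{ unfold th_arg, hX, hY; cbn [fst snd]. rewrite !RtoC_plus. fin. }
set (w := th_arg (x, y, z)).
replace (Gs k (c * w2) th_coef (w + Ci * v1)) with (e1 * Gs k (c * w2) th_coef w)%C; [fin|].
unfold Gs. rewrite <- CSum_scal by (apply Gs_summable, th_rapid). apply CSum_ext; intros m.
replace (knode k (c * w2) m * (w + Ci * v1))%C with (knode k (c * w2) m * w + Ci * (knode k (c * w2) m * v1)%R)%C
  by (rewrite RtoC_mult; fin).
rewrite Cexp_plus. fold (Eit (knode k (c * w2) m * v1)). rewrite knode_v. fin.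
Qed.

(** Translation by [w] multiplies by the factor [pre] and moves the argument; together they turn
    term [m] into [e2] times term [m - 1], so the sum is merely reindexed. *)
Lemma theta_w : eqv (w1, w2, 0) e2 theta.
Proof.
intros [[x y] z]. unfold hmul, theta. set (w := th_arg (x, y, z)).
set (pre := (- (c * w2)%R * w - (c * w2 ^ 2 / 2)%R - Ci * (c * w1 * w2)%R)%C).
replace (th_phase (w1 + x, w2 + y, 0 + z + w1 * y)) with (th_phase (x, y, z) + pre)%C.
2:{ unfold pre, w, th_arg, th_phase, hX, hY. Cfield. }
replace (th_arg (w1 + x, w2 + y, 0 + z + w1 * y)) with (w + (w2 + Ci * w1))%C.
2:{ unfold w, th_arg, hX, hY; cbn [fst snd]. rewrite !RtoC_plus. fin. }
rewrite Cexp_plus, <- Cmult_assoc.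
replace (Cexp pre * Gs k (c * w2) th_coef (w + (w2 + Ci * w1)))%C with (e2 * Gs k (c * w2) th_coef w)%C; [fin|].
set (g := fun m => (e2 * (th_coef m * Cexp (knode k (c * w2) m * w)))%C).
apply (has_sum_unique g); [apply has_sum_scal, csummable_has_sum, Gs_summable, th_rapid|].
apply (has_sum_reindex (fun m => (m - 1)%Z)); [lia | intros i H; exfalso; apply (H (i + 1)%Z); lia|].
apply (has_sum_ext (fun m => (Cexp pre * (th_coef m * Cexp (knode k (c * w2) m * (w + (w2 + Ci * w1)))))%C)).
2:{ apply has_sum_scal, csummable_has_sum, Gs_summable, th_rapid. }
intros m. unfold g. rewrite <- Ht2. unfold Eit, th_coef. rewrite <- !Cexp_plus. f_equal.
unfold knode. rewrite minus_IZR. Cfield.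
Qed.

Lemma theta_center q : eqv (0, 0, q) (Eit (c * q)) theta.
Proof.
intros [[x y] z]. unfold hmul, theta.
replace (th_phase (0 + x, 0 + y, q + z + 0 * y)) with (th_phase (x, y, z) + Ci * (c * q)%R)%C.
2:{ unfold th_phase, hX, hY, hZ; cbn [fst snd]. rewrite !RtoC_plus, !RtoC_mult. fin. }
replace (th_arg (0 + x, 0 + y, q + z + 0 * y)) with (th_arg (x, y, z)).
2:{ unfold th_arg, hX, hY; cbn [fst snd]. rewrite !RtoC_plus. fin. }
rewrite Cexp_plus. unfold Eit. fin.
Qed.

Lemma theta_u : eqv (0, 0, r) e3 theta.
Proof. rewrite <- Hc. apply theta_center. Qed.

Lemma theta_Sp : Sp theta.
Proof.
split; [apply csmooth_theta | split; [apply theta_v | split; [apply theta_w | apply theta_u]]].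
Qed.

Lemma theta_Jt c' x y : Jt c' theta x y =
  (exp (- (c / 2 * (y * y))) * Gs k (c * w2) th_coef (y + Ci * x) * CI (fun z => Eit ((c - c') * z)) 0 r)%C.
Proof.
rewrite <- CI_scal by (apply ccont_Eit_lin).
apply CI_ext; intros z. unfold theta, th_phase, th_arg, hX, hY, hZ; cbn [fst snd].
replace (Ci * c * (RtoC (z + x * y)%R - x * y) - RtoC (c / 2)%R * (y * y))%C
  with (RtoC (- (c / 2 * (y * y)))%R + Ci * (c * z)%R)%C.
2:{ rewrite RtoC_plus, RtoC_opp, !RtoC_mult. fin. }
rewrite Cexp_plus, Cexp_RtoC. fold (Eit (c * z)).
replace ((c - c') * z) with (c * z + - c' * z) by ring. rewrite Eit_plus. fin.
Qed.

(** Termwise integration over [x], after dividing out the length [r] of the central integral and the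
    common Gaussian in [y]. By orthogonality only a node equal to [k'] survives. *)
Lemma theta_T_has_sum k' y :
  has_sum (fun m => (th_coef m * exp (knode k (c * w2) m * y) * CI (fun x => Eit ((knode k (c * w2) m - k') * x)) 0 v1)%C)
    (/ (r * exp (- (c / 2 * (y * y))))%R * Tt c k' theta y)%C.
Proof.
set (q := r * exp (- (c / 2 * (y * y)))).
assert (Q : 0 < q) by pos.
assert (Nq : RtoC q <> 0%C) by (apply RtoC_neq0; lra).
assert (HS : forall w, csummable (fun m => (th_coef m * Cexp (knode k (c * w2) m * w))%C)) by (intros; apply Gs_summable, th_rapid).
set (f := fun m x => (th_coef m * exp (knode k (c * w2) m * y) * Eit ((knode k (c * w2) m - k') * x))%C).
assert (Ef : forall m x, f m x = (Eit (- k' * x) * (th_coef m * Cexp (knode k (c * w2) m * (y + Ci * x))))%C).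
{ intros m x. unfold f. replace ((knode k (c * w2) m - k') * x) with (knode k (c * w2) m * x + - k' * x) by ring.
  rewrite Eit_plus. replace (knode k (c * w2) m * (y + Ci * x))%C
    with (RtoC (knode k (c * w2) m * y) + Ci * (knode k (c * w2) m * x)%R)%C by (rewrite !RtoC_mult; fin).
  rewrite Cexp_plus, Cexp_RtoC. fold (Eit (knode k (c * w2) m * x)). fin. }
assert (ES : forall x, CSum (fun m => f m x) = (Eit (- k' * x) * Gs k (c * w2) th_coef (y + Ci * x))%C).
{ intros x. unfold Gs. rewrite <- CSum_scal by apply HS. apply CSum_ext; fin. }
replace (/ q * Tt c k' theta y)%C with (CI (fun x => CSum (fun m => f m x)) 0 v1).
- apply (has_sum_ext (fun m => CI (f m) 0 v1)).
  { intros m. apply CI_scal, ccont_Eit_lin. }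
  apply (CI_CSum f (fun m => Cmod (th_coef m * Cexp (knode k (c * w2) m * y)))%C).
  + lra.
  + intros m t. apply ccont_mult; [apply ccont_const | apply ccont_Eit_lin].
  + intros m t. unfold f. rewrite Cmod_mult, Cmod_Eit, <- RtoC_mult, Cexp_RtoC. lra.
  + apply HS.
  + intros t. replace (fun t => CSum (fun m => f m t)) with (fun t => (Eit (- k' * t) * Gs k (c * w2) th_coef (y + Ci * t))%C)
      by (funext p; fin).
    apply ccont_mult; [apply ccont_Eit_lin|]. eapply rderiv_ccont.
    apply (rderiv_comp_C (Gs k (c * w2) th_coef) (fun t => (y + Ci * t)%C)); [apply Gs_deriv, th_rapid|].
    apply rderiv_plus; [apply rderiv_const | apply rderiv_scal, rderiv_id].
- unfold Tt. rewrite <- CI_scal by (intros; apply (Jt_ccont_x), csmooth_hcont, csmooth_theta).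
  apply CI_ext; intros x. rewrite ES, theta_Jt,
  (CI_ext _ (fun _ => 1%C)).
  + rewrite CI_const, <- (Cmult_1_l (Eit (- k' * x) * _)%C).
    replace (RtoC 1) with (/ q * q)%C at 1 by (field; fin). unfold q at 2. rewrite RtoC_mult.
    replace (r - 0) with r by ring. fin.
  + intros z. replace ((c - c) * z) with 0 by ring. apply Eit_0.
Qed.

Lemma theta_T_zero k' y : Eit (k' * v1) = RtoC e1 -> (forall m, k' <> knode k (c * w2) m) ->
  Tt c k' theta y = 0%C.
Proof.
intros Hk' N. assert (q : 0 < r * exp (- (c / 2 * (y * y)))) by pos.
apply (Cmult_cancel (/ (r * exp (- (c / 2 * (y * y))))%R)).
{ rewrite <- RtoC_inv by lra. apply RtoC_neq0, Rinv_neq_0_compat. lra. }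
apply (has_sum_unique (fun _ : Z => 0%C)); [|apply has_sum_zero].
eapply has_sum_ext; [|apply theta_T_has_sum]. intros m. cbv beta. rewrite CI_Eit_zero; [fin | specialize (N m); lra|].
replace ((knode k (c * w2) m - k') * v1) with (knode k (c * w2) m * v1 + - (k' * v1)) by ring.
rewrite Eit_plus, knode_v, (Eit_inv_sign (k' * v1) e1) by auto. now apply sign_sq.
Qed.

Lemma theta_T_center y : Tt c k theta y <> 0%C.
Proof.
intros E.
set (h := fun m => (th_coef m * exp (knode k (c * w2) m * y) * CI (fun x => Eit ((knode k (c * w2) m - k) * x)) 0 v1)%C).
assert (K : lsum h (0%Z :: nil) = 0%C).
{ apply (has_sum_unique h).
  - apply has_sum_finite; [repeat constructor; fin|].
    intros m Hm. unfold h. rewrite CI_Eit_zero; [fin| |].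
    + unfold knode. assert (m <> 0%Z) by (intros ->; apply Hm; simpl; fin).
      assert (IZR m <> 0) by (now apply not_0_IZR).
      assert (c * w2 <> 0) by nra.
      nra.
    + unfold knode. replace ((k + IZR m * (c * w2) - k) * v1) with (IZR m * (c * w2 * v1)) by ring.
      now apply Eit_IZR_mult.
  - pose proof (theta_T_has_sum k y) as S. rewrite E, Cmult_0_r in S. fin. }
simpl in K. rewrite Cplus_0_r in K. revert K. apply Cmult_neq_0; [apply Cmult_neq_0|].
- apply Cexp_neq0.
- apply RtoC_neq0. pose proof (exp_pos (knode k (c * w2) 0 * y)); lra.
- rewrite (CI_ext _ (fun _ => 1%C)).
  + rewrite CI_const, Cmult_1_r. apply RtoC_neq0; lra.
  + intros x. unfold knode. replace ((k + 0 * (c * w2) - k) * x) with 0 by ring. apply Eit_0.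
Qed.

End Theta.

(** * Eigenspinors built on the ground states *)

(** Equivariance under the whole one-parameter centre, not just its lattice part, so that Z acts as
    the scalar $ic$. *)
Definition zfreq (c : R) (f : heis -> C) : Prop := forall s, eqv (0, 0, s) (Eit (c * s)) f.

Lemma zfreq_plus c f g : zfreq c f -> zfreq c g -> zfreq c (fun p => (f p + g p)%C).
Proof. intros F G s p. rewrite F, G; fin. Qed.

Lemma zfreq_scal c (a : C) f : zfreq c f -> zfreq c (fun p => (a * f p)%C).
Proof. intros F s p. rewrite F; fin. Qed.

Lemma zfreq_conj c f : zfreq c f -> zfreq (- c) (fun p => Cconj (f p)).
Proof.
intros F s p. rewrite F, Cmult_conj, Eit_conj. now replace (- (c * s)) with (- c * s) by ring.
Qed.

Lemma zfreq_fields c f : csmooth f -> zfreq c f -> zfreq c (CX f) /\ zfreq c (CY f) /\ zfreq c (CZ f).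
Proof.
intros S F. split; [|split]; intros s; destruct (fields_equivariant f (0, 0, s) _ S (F s)) as (X & Y & Z); fin.
Qed.

Lemma zfreq_opa c f : csmooth f -> zfreq c f -> zfreq c (opa f).
Proof.
intros S F. destruct (zfreq_fields c f S F) as (X & Y & _).
apply zfreq_plus; auto. now apply zfreq_scal.
Qed.

Lemma zfreq_opb c f : csmooth f -> zfreq c f -> zfreq c (opb f).
Proof.
intros S F. destruct (zfreq_fields c f S F) as (X & Y & _).
apply zfreq_plus; auto. now apply zfreq_scal.
Qed.

Lemma zfreq_CZ c f p : csmooth f -> zfreq c f -> CZ f p = (Ci * c * f p)%C.
Proof.
intros S F. destruct (field_curves f S p) as (_ & _ & Z).
apply (rderiv_unique _ _ _ _ Z),
(rderiv_ext (fun t => (f p * Eit (c * t))%C)).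
- intros t. transitivity (f (hmul (0, 0, t) p)); [rewrite F; fin|].
  destruct p as [[x y] z]. unfold hmul. f_equal. f_equal; fin.
- eapply rderiv_val; [apply rderiv_scal, rderiv_Eit_lin|]. rewrite Rmult_0_r, Eit_0. fin.
Qed.

Lemma opa_scal (a : C) f : csmooth f -> opa (fun p => (a * f p)%C) = (fun p => (a * opa f p)%C).
Proof.
intros H. destruct (fields_scal a f H) as (X & Y & _). funext p.
unfold opa. rewrite X, Y. fin.
Qed.

Lemma opb_scal (a : C) f : csmooth f -> opb (fun p => (a * f p)%C) = (fun p => (a * opb f p)%C).
Proof.
intros H. destruct (fields_scal a f H) as (X & Y & _). funext p.
unfold opb. rewrite X, Y. fin.
Qed.

Lemma opa_plus f g : csmooth f -> csmooth g -> opa (fun p => (f p + g p)%C) = (fun p => (opa f p + opa g p)%C).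
Proof.
intros F G. destruct (fields_plus f g F G) as (X & Y & _). funext p.
unfold opa. rewrite X, Y. fin.
Qed.

Lemma opb_plus f g : csmooth f -> csmooth g -> opb (fun p => (f p + g p)%C) = (fun p => (opb f p + opb g p)%C).
Proof.
intros F G. destruct (fields_plus f g F G) as (X & Y & _). funext p.
unfold opb. rewrite X, Y. fin.
Qed.

Lemma csmooth_opa f : csmooth f -> csmooth (opa f).
Proof.
intros H. destruct (csmooth_fields f H) as (X & Y & _). apply csmooth_plus; auto. now apply csmooth_scal.
Qed.

Lemma csmooth_opb f : csmooth f -> csmooth (opb f).
Proof.
intros H. destruct (csmooth_fields f H) as (X & Y & _). apply csmooth_plus; auto. now apply csmooth_scal.
Qed.

Lemma csmooth_iter_opa n f : csmooth f -> csmooth (Nat.iter n opa f).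
Proof. intros H; induction n as [|n IH]; auto. now apply csmooth_opa. Qed.

Lemma csmooth_iter_opb n f : csmooth f -> csmooth (Nat.iter n opb f).
Proof. intros H; induction n as [|n IH]; auto. now apply csmooth_opb. Qed.

Lemma zfreq_iter_opa c n f : csmooth f -> zfreq c f -> zfreq c (Nat.iter n opa f).
Proof. intros S H; induction n as [|n IH]; auto. apply zfreq_opa; auto. now apply csmooth_iter_opa. Qed.

Lemma zfreq_iter_opb c n f : csmooth f -> zfreq c f -> zfreq c (Nat.iter n opb f).
Proof. intros S H; induction n as [|n IH]; auto. apply zfreq_opb; auto. now apply csmooth_iter_opb. Qed.

Lemma iter_opa_scal n (a : C) f : csmooth f ->
  Nat.iter n opa (fun p => (a * f p)%C) = (fun p => (a * Nat.iter n opa f p)%C).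
Proof.
intros H; induction n as [|n IH]; simpl; auto. rewrite IH. apply opa_scal. now apply csmooth_iter_opa.
Qed.

Lemma iter_opa_plus n f g : csmooth f -> csmooth g ->
  Nat.iter n opa (fun p => (f p + g p)%C) = (fun p => (Nat.iter n opa f p + Nat.iter n opa g p)%C).
Proof.
intros F G; induction n as [|n IH]; simpl; auto. rewrite IH. apply opa_plus; now apply csmooth_iter_opa.
Qed.

Section Basis.
Variables (s : R).
Hypothesis (Hs : 0 < s).

Lemma Sp_iter_opb n f : Sp f -> Sp (Nat.iter n opb f).
Proof. intros H; induction n as [|n IH]; auto. now apply Sp_opb. Qed.

Lemma zfreq_T c c' k f y : Sp f -> zfreq c' f -> c' <> c -> Eit (c * r) = RtoC e3 -> Tt c k f y = 0%C.
Proof.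
intros Hf F N Hc.
assert (E : Tt c k (CZ f) y = Tt c k (fun p => (Ci * c' * f p)%C) y).
{ f_equal. funext p. apply zfreq_CZ; auto. apply Hf. }
rewrite (Tt_Z c k f y Hf Hc), Tt_scal in E by (apply csmooth_hcont, Hf).
apply (Cmult_cancel (Ci * (c - c')%R)).
- apply Cmult_neq_0; [apply Ci_neq0 | apply RtoC_neq0; lra].
- rewrite RtoC_minus. transitivity (Ci * c * Tt c k f y - Ci * c' * Tt c k f y)%C; [fin|].
  rewrite E. fin.
Qed.

Lemma opab_freq c f : Sp f -> zfreq c f -> opa (opb f) = (fun p => (opb (opa f) p + - (2 * c) * f p)%C).
Proof.
intros Hf F. funext p.
rewrite (opa_opb_comm f Hf), (zfreq_CZ c) by (auto; apply Hf).
Cring.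
Qed.

Section Tower.
Variables (c : R) (f : heis -> C).
Hypothesis (Hf : Sp f) (Ff : zfreq c f) (Af : forall p, opa f p = 0%C).

(** Every creation operator that [opa] passes contributes the commutator $-2c$, and [opa] finally
    meets the ground state, which it annihilates. *)
Lemma opa_iter_opb n : opa (Nat.iter (S n) opb f) = (fun p => (- (2 * c * INR (S n))%R * Nat.iter n opb f p)%C).
Proof.
induction n as [|n IH].
- cbn [Nat.iter nat_rect]. rewrite (opab_freq c f Hf Ff).
  replace (opa f) with (fun p => (0 * f p)%C) by (funext p; rewrite Af; fin).
  rewrite (opb_scal 0 f (proj1 Hf)). funext p.
  rewrite Rmult_1_r, RtoC_mult. fin.
- assert (Sg := Sp_iter_opb (S n) f Hf). assert (Zg := zfreq_iter_opb c (S n) f (proj1 Hf) Ff).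
  change (Nat.iter (S (S n)) opb f) with (opb (Nat.iter (S n) opb f)).
  rewrite (opab_freq c _ Sg Zg), IH, opb_scal by (apply csmooth_iter_opb, Hf).
  funext p.
  change (Nat.iter (S n) opb f p) with (opb (Nat.iter n opb f) p).
  rewrite (S_INR (S n)), !RtoC_mult, RtoC_plus. fin.
Qed.

Lemma opb_opa_iter_opb n : opb (opa (Nat.iter n opb f)) = (fun p => (- (2 * c * INR n)%R * Nat.iter n opb f p)%C).
Proof.
destruct n as [|n].
- cbn [Nat.iter nat_rect].
  replace (opa f) with (fun p => (0 * f p)%C) by (funext p; rewrite Af; fin).
  rewrite (opb_scal 0 f (proj1 Hf)). funext p. rewrite Rmult_0_r. fin.
- rewrite opa_iter_opb. apply opb_scal, csmooth_iter_opb, Hf.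
Qed.

(** Lowering an [n]-th excited state [n] times returns the ground state with a nonzero factor; this
    makes the functional [nilc] nonzero on its own mode. *)
Lemma iter_opa_iter_opb n : 0 < c -> exists ka : C, ka <> 0%C /\
  Nat.iter n opa (Nat.iter n opb f) = (fun p => (ka * f p)%C).
Proof.
intros Hc. induction n as [|n (ka & K0 & IH)].
- exists 1%C. split; [apply RtoC_neq0; lra|]. funext p; simpl; fin.
- exists (- (2 * c * INR (S n))%R * ka)%C. split.
  + apply Cmult_neq_0; auto. rewrite <- RtoC_opp. apply RtoC_neq0.
    assert (0 < INR (S n)) by (apply lt_0_INR; lia). nra.
  + rewrite Nat.iter_succ_r, opa_iter_opb, iter_opa_scal by (apply csmooth_iter_opb, Hf).
    rewrite IH. funext p; fin.
Qed.

End Tower.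

(* Pairs [(u, v)] of components with respect to eigenvectors of the Clifford
   multiplication by the central direction. *)
Definition eigp (Lam : R) (g : heis -> C * C) : Prop :=
  Sp (fun p => fst (g p)) /\ Sp (fun p => snd (g p)) /\
  dsys s Lam (fun p => fst (g p)) (fun p => snd (g p)).

(** The quaternionic structure in the eigenframe: antilinear, with square -1, preserving the
    eigenvalue system and reversing the central frequency. *)
Definition Jp (g : heis -> C * C) (p : heis) : C * C := ((-1 * Cconj (snd (g p)))%C, Cconj (fst (g p))).

Lemma eigp_J Lam g : eigp Lam g -> eigp Lam (Jp g).
Proof.
intros (U & V & D). split; [|split].
- apply Sp_scal. now apply Sp_conj.
- now apply Sp_conj.
- exact (dsys_conj s Lam _ _ U V D).
Qed.

Lemma Jp_Jp g p : Jp (Jp g) p = ((-1 * fst (g p))%C, (-1 * snd (g p))%C).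
Proof.
unfold Jp; cbn [fst snd]. rewrite !Cconj_conj. f_equal. apply Ceq; simpl; lra.
Qed.

Definition zfp (c : R) (g : heis -> C * C) : Prop :=
  zfreq c (fun p => fst (g p)) /\ zfreq c (fun p => snd (g p)).

Lemma zfp_J c g : zfp c g -> zfp (- c) (Jp g).
Proof.
intros [U V]. split; [apply zfreq_scal|]; now apply zfreq_conj.
Qed.

(** The coefficient of level [n]: lower [n] times to the ground level and read the mode at the
    centre of its Gaussian, the one number left open in [nil_vanish]. *)
Definition nilc (c k : R) (n : nat) (g : heis -> C * C) : C := Tt c k (Nat.iter n opa (fun p => fst (g p))) (k / c).

Lemma nilc_zfp c k n c' g Lam : eigp Lam g -> zfp c' g -> c' <> c -> Eit (c * r) = RtoC e3 -> nilc c k n g = 0%C.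
Proof.
intros (U & _) [F _] N Hc. apply (zfreq_T c c'); auto.
- now apply Sp_iter_opa.
- apply zfreq_iter_opa; auto. apply U.
Qed.

Section NilMode.
Variables (c k t2 : R) (n : nat) (Lam : R).
Hypothesis (Hc0 : 0 < c) (Hc : Eit (c * r) = RtoC e3) (Hk : Eit (k * v1) = RtoC e1).
Hypothesis (Hcw : Eit (c * w2 * v1) = 1%C) (Ht2 : Eit t2 = RtoC e2).

Let th := theta c k t2.

(** The first component is the [n]-th excited state; the second is forced by the second equation of
    [dsys], where Z acts as $ic$. *)
Definition np (p : heis) : C * C :=
  (Nat.iter n opb (theta c k t2) p,
   ((s / (Lam - c))%R * opa (Nat.iter n opb (theta c k t2)) p)%C).

Lemma th_Sp : Sp th.
Proof. now apply theta_Sp. Qed.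

Lemma th_zfreq : zfreq c th.
Proof.
intros q. apply theta_center.
Qed.

Lemma np_zfp : zfp c np.
Proof.
assert (F : zfreq c (Nat.iter n opb th)) by (apply zfreq_iter_opb; [apply th_Sp | apply th_zfreq]).
split; auto. apply zfreq_scal, zfreq_opa; auto. apply csmooth_iter_opb, th_Sp.
Qed.

Lemma np_eigp : Lam <> c -> Lam ^ 2 = c ^ 2 + 2 * INR n * c * s ^ 2 -> eigp Lam np.
Proof.
intros NL HL. assert (St := th_Sp). assert (Sn := Sp_iter_opb n th St).
assert (A := Sp_opa _ Sn).
split; auto. split; [apply Sp_scal, A|].
destruct np_zfp as [Zu Zv]. intros p.
assert (Sv : csmooth (fun p => snd (np p))) by (apply csmooth_scal, A).
rewrite (zfreq_CZ c (fun p => fst (np p)) p (proj1 Sn) Zu), (zfreq_CZ c (fun p => snd (np p)) p Sv Zv).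
assert (NL' : Lam - c <> 0) by lra.
split.
- change (opb (fun p => snd (np p))) with (opb (fun p => ((s / (Lam - c))%R * opa (Nat.iter n opb th) p)%C)).
  rewrite (opb_scal _ _ (proj1 A)), (opb_opa_iter_opb c th St th_zfreq (proj1 (theta_fields c k t2 Hc0))).
  cbn [np fst]. fold th.
  transitivity ((s * (s / (Lam - c)) * (2 * c * INR n))%R * Nat.iter n opb th p + Ci * Ci * c * Nat.iter n opb th p)%C.
  { rewrite !RtoC_mult. fin. }
  replace (s * (s / (Lam - c)) * (2 * c * INR n)) with (Lam + c).
  + Cring.
  + apply Rmult_eq_reg_r with (Lam - c); auto. transitivity (Lam ^ 2 - c ^ 2); [lra|]. rewrite HL. fin.
- cbn [np snd]. fold th.
  set (q := opa (Nat.iter n opb th) p).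
  transitivity (s * q - Ci * Ci * c * (s / (Lam - c))%R * q)%C; [fin|].
  replace (RtoC s) with (RtoC ((Lam - c) * (s / (Lam - c)))) by (f_equal; fin).
  Cring.
Qed.

Lemma np_diag : nilc c k n np <> 0%C.
Proof.
destruct (iter_opa_iter_opb c th th_Sp th_zfreq (proj1 (theta_fields c k t2 Hc0)) n Hc0) as (ka & K0 & E).
unfold nilc. change (fun p => fst (np p)) with (Nat.iter n opb th). rewrite E. rewrite Tt_scal by (apply csmooth_hcont, th_Sp). apply Cmult_neq_0; auto.
now apply (theta_T_center c k t2).
Qed.

Lemma np_offdiag k' : Eit (k' * v1) = RtoC e1 -> (forall m, k' <> knode k (c * w2) m) -> nilc c k' n np = 0%C.
Proof.
intros Hk' N.
destruct (iter_opa_iter_opb c th th_Sp th_zfreq (proj1 (theta_fields c k t2 Hc0)) n Hc0) as (ka & K0 & E).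
unfold nilc. change (fun p => fst (np p)) with (Nat.iter n opb th). rewrite E. rewrite Tt_scal by (apply csmooth_hcont, th_Sp).
rewrite (theta_T_zero c k t2); auto. fin.
Qed.

End NilMode.

End Basis.

Lemma Eit_classify (q e x L : R) : e = 1 \/ e = -1 -> Eit (2 * PI * q) = RtoC e -> 0 < L ->
  (Eit (x * L) = RtoC e <-> exists n : Z, x = 2 * PI * (IZR n + q) / L).
Proof.
intros He Hq HL. split.
- intros H. destruct (Eit_eq_1 (x * L + - (2 * PI * q))) as [n Hn].
  { rewrite Eit_plus, H, (Eit_inv_sign _ e) by auto. now apply sign_sq. }
  exists n. apply Rmult_eq_reg_r with L; [|lra]. transitivity (IZR n * (2 * PI) + 2 * PI * q); [lra|]. fin.
- intros [n ->]. replace (2 * PI * (IZR n + q) / L * L) with (IZR n * (2 * PI) + 2 * PI * q) by fin.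
  rewrite Eit_plus, Eit_IZR_2PI, Hq. fin.
Qed.

Definition pscal (a : C) (g : heis -> C * C) (p : heis) : C * C := ((a * fst (g p))%C, (a * snd (g p))%C).
Definition pplus (g h : heis -> C * C) (p : heis) : C * C :=
  ((fst (g p) + fst (h p))%C, (snd (g p) + snd (h p))%C).

(** * The indexed modes and their dual functionals *)

Section Modes.
Variables (A q0 q1 q2 : R) (Nm : nat -> nat) (tor : bool).
Hypothesis (HA : 0 < A).
Hypothesis (Hq0 : Eit (2 * PI * q0) = RtoC e3) (Hq1 : Eit (2 * PI * q1) = RtoC e1) (Hq2 : Eit (2 * PI * q2) = RtoC e2).
Hypothesis (Bq0 : 0 < q0 <= 1) (Htor : tor = true <-> e3 = 1).
Hypothesis (HN : forall p, freq r q0 p * w2 * v1 = 2 * PI * INR (Nm p)).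

Let s := 1 / sqrt A.
Let t2 := 2 * PI * q2.
Let cf := freq r q0.

Definition kk (n : Z) : R := 2 * PI * (IZR n + q1) / v1.
Definition mm (n : Z) : R := 2 * PI * (IZR n + q2) / w2.
Definition nq (xi : Z * Z) : R := s * sqrt (kk (fst xi) ^ 2 + ell (kk (fst xi)) (mm (snd xi)) ^ 2).

Definition LamI (i : Idx) : R := lamI A r q0 nq i + 1 / (4 * A).

Let EP := eigp s.

Lemma s_pos : 0 < s.
Proof. apply Rdiv_lt_0_compat; [lra | now apply sqrt_lt_R0]. Qed.

Lemma s_sq : s ^ 2 = / A.
Proof.
unfold s. replace ((1 / sqrt A) ^ 2) with (/ (sqrt A * sqrt A)); [rewrite sqrt_sqrt; lra|].
pose proof (sqrt_lt_R0 A HA). fin.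
Qed.

Lemma cf_pos p : 0 < cf p.
Proof.
pose proof PI_RGT_0. pose proof (pos_INR p). pos.
Qed.

Lemma cf_inj p p' : cf p = cf p' -> p = p'.
Proof.
intros E. pose proof PI_RGT_0.
apply Rmult_eq_reg_r in E; [|apply Rinv_neq_0_compat; lra].
apply Rmult_eq_reg_l in E; [|lra]. apply INR_eq. lra.
Qed.

Lemma cf_r p : Eit (cf p * r) = RtoC e3.
Proof.
apply (Eit_classify q0 e3); auto. exists (Z.of_nat p). now rewrite <- INR_IZR_INZ.
Qed.

Lemma cf_all c : 0 < c -> Eit (c * r) = RtoC e3 -> exists p, c = cf p.
Proof.
intros Hc H. apply (Eit_classify q0 e3) in H; auto. destruct H as [n Hn].
assert (K : 0 < IZR n + q0).
{ apply Rmult_lt_reg_l with (2 * PI / r).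
  - pose proof PI_RGT_0. pos.
  - lra. }
assert (Hn0 : (0 <= n)%Z) by (assert (-1 < n)%Z; [apply lt_IZR; lra| lia]).
exists (Z.to_nat n). unfold cf, freq. rewrite INR_IZR_INZ, Z2Nat.id; fin.
Qed.

Lemma cf_w p : Eit (cf p * w2 * v1) = 1%C.
Proof.
rewrite HN. replace (2 * PI * INR (Nm p)) with (IZR (Z.of_nat (Nm p)) * (2 * PI)).
- apply Eit_IZR_2PI.
- rewrite <- INR_IZR_INZ. lra.
Qed.

Lemma Nm_pos p : (0 < Nm p)%nat.
Proof.
apply INR_lt. pose proof (cf_pos p) as K. pose proof PI_RGT_0.
apply Rmult_lt_reg_l with (2 * PI); [lra|]. rewrite <- HN, Rmult_0_r.
apply Rmult_lt_0_compat; [apply Rmult_lt_0_compat; fin| lra].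
Qed.

Lemma kk_v n : Eit (kk n * v1) = RtoC e1.
Proof. apply (Eit_classify q1 e1); auto. now exists n. Qed.

Lemma mm_w n : Eit (mm n * w2) = RtoC e2.
Proof. apply (Eit_classify q2 e2); auto. now exists n. Qed.

Lemma kk_all k : Eit (k * v1) = RtoC e1 -> exists n, k = kk n.
Proof. intros H. apply (Eit_classify q1 e1) in H; fin. Qed.

Lemma mm_all m : Eit (m * w2) = RtoC e2 -> exists n, m = mm n.
Proof. intros H. apply (Eit_classify q2 e2) in H; fin. Qed.

Lemma kk_inj n n' : kk n = kk n' -> n = n'.
Proof.
intros E. pose proof PI_RGT_0.
apply Rmult_eq_reg_r in E; [|apply Rinv_neq_0_compat; lra].
apply Rmult_eq_reg_l in E; [|lra]. apply eq_IZR. lra.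
Qed.

Lemma mm_inj n n' : mm n = mm n' -> n = n'.
Proof.
intros E. pose proof PI_RGT_0.
apply Rmult_eq_reg_r in E; [|apply Rinv_neq_0_compat; lra].
apply Rmult_eq_reg_l in E; [|lra]. apply eq_IZR. lra.
Qed.

(** The shift $cw_2$ is [Nm p] steps of the frequency lattice along [v], so a central frequency
    carries [Nm p] classes of modes, represented by [j < Nm p]. *)
Lemma kk_shift p n m : knode (kk n) (cf p * w2) m = kk (n + m * Z.of_nat (Nm p)).
Proof.
unfold knode, kk. replace (cf p * w2) with (2 * PI * INR (Nm p) / v1) by (unfold cf; rewrite <- HN; fin).
rewrite plus_IZR, mult_IZR, <- INR_IZR_INZ. lra.
Qed.

Definition tE (k m : R) (p : heis) : C := Eit (k * hX p + ell k m * hY p).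

Lemma tE_right k m p x y z : tE k m (hmul p (x, y, z)) = (tE k m p * Eit (k * x + ell k m * y))%C.
Proof.
destruct p as [[a b] d]. unfold tE, hmul, hX, hY; cbn [fst snd]. rewrite <- Eit_plus. fin.
Qed.

Lemma tE_left k m p x y z : tE k m (hmul (x, y, z) p) = (Eit (k * x + ell k m * y) * tE k m p)%C.
Proof.
destruct p as [[a b] d]. unfold tE, hmul, hX, hY; cbn [fst snd]. rewrite <- Eit_plus. fin.
Qed.

Lemma tE_smooth k m : csmooth (tE k m).
Proof.
apply (csmooth_ext (fun p => Cexp (Ci * (k * hX p + ell k m * hY p)))%C).
- intros p. unfold tE, Eit. now rewrite RtoC_plus, !RtoC_mult.
- apply csmooth_Cexp, csmooth_scal, csmooth_plus; apply csmooth_scal, csmooth_coord; fin.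
Qed.

Lemma tE_Sp k m : e3 = 1 -> Eit (k * v1) = RtoC e1 -> Eit (m * w2) = RtoC e2 -> Sp (tE k m).
Proof.
intros H3 Hk Hm. split; [apply tE_smooth|]. split; [|split]; intros p; rewrite tE_left.
- rewrite Rmult_0_r, Rplus_0_r, Hk. fin.
- replace (k * w1 + ell k m * w2) with (m * w2) by (unfold ell; fin). rewrite Hm. fin.
- rewrite !Rmult_0_r, Rplus_0_r, Eit_0, H3. fin.
Qed.

Lemma tE_zfreq k m : zfreq 0 (tE k m).
Proof. intros q p. rewrite tE_left. f_equal. fin. Qed.

Lemma tE_fields k m p : CX (tE k m) p = (Ci * k * tE k m p)%C /\
  CY (tE k m) p = (Ci * ell k m * tE k m p)%C /\ CZ (tE k m) p = 0%C.
Proof.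
split; [|split]; apply Derive_C_unique.
- apply (rderiv_ext (fun t => (tE k m p * Eit (k * t))%C)).
  + intros t. rewrite tE_right. do 2 f_equal. lra.
  + eapply rderiv_val; [apply rderiv_scal, rderiv_Eit_lin|]. rewrite Rmult_0_r, Eit_0. fin.
- apply (rderiv_ext (fun t => (tE k m p * Eit (ell k m * t))%C)).
  + intros t. rewrite tE_right. do 2 f_equal. lra.
  + eapply rderiv_val; [apply rderiv_scal, rderiv_Eit_lin|]. rewrite Rmult_0_r, Eit_0. fin.
- apply (rderiv_ext (fun t => tE k m p)).
  + intros t. rewrite tE_right, !Rmult_0_r, Rplus_0_r, Eit_0. fin.
  + apply rderiv_const.
Qed.

Lemma tE_opa k m : opa (tE k m) = (fun p => ((Ci * k + ell k m) * tE k m p)%C).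
Proof.
funext p. unfold opa. destruct (tE_fields k m p) as (-> & -> & _).
Cring.
Qed.

Lemma tE_opb k m : opb (tE k m) = (fun p => ((Ci * k - ell k m) * tE k m p)%C).
Proof.
funext p. unfold opb. destruct (tE_fields k m p) as (-> & -> & _).
Cring.
Qed.

Lemma Ht_tE_diag k m : Ht k m (tE k m) <> 0%C.
Proof.
assert (E : Ht k m (tE k m) = (w2 * (v1 * r))%R).
{ unfold Ht. rewrite (CI_ext _ (fun _ => RtoC (v1 * r))).
  - rewrite CI_const, <- RtoC_mult. fin.
  - intros y. unfold Tt. rewrite (CI_ext _ (fun _ => (r * Eit (ell k m * y))%C)).
    + rewrite CI_const, RtoC_mult. transitivity ((v1 - 0)%R * r * (Eit (- ell k m * y) * Eit (ell k m * y)))%C; [fin|].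
      replace (- ell k m * y) with (- (ell k m * y)) by ring. rewrite Eit_opp. replace (v1 - 0) with v1 by ring. fin.
    + intros x. unfold Jt. rewrite (CI_ext _ (fun _ => (Eit (k * x) * Eit (ell k m * y))%C)).
      * rewrite CI_const. transitivity ((r - 0)%R * (Eit (- k * x) * Eit (k * x)) * Eit (ell k m * y))%C; [fin|].
        replace (- k * x) with (- (k * x)) by ring. rewrite Eit_opp. replace (r - 0) with r by ring. fin.
      * intros z. unfold tE, hX, hY; cbn [fst snd]. rewrite Eit_plus.
        replace (- 0 * z) with 0 by ring. rewrite Eit_0. fin. }
rewrite E. apply RtoC_neq0. assert (0 < w2 * (v1 * r)) by pos. lra.
Qed.

Lemma Ht_tE_off k m k' m' : e3 = 1 -> Eit (k * v1) = RtoC e1 -> Eit (m * w2) = RtoC e2 ->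
  Eit (k' * v1) = RtoC e1 -> Eit (m' * w2) = RtoC e2 -> k <> k' \/ m <> m' -> Ht k m (tE k' m') = 0%C.
Proof.
intros H3 Hk Hm Hk' Hm' N. assert (S := tE_Sp k' m' H3 Hk' Hm').
destruct (Req_dec k k') as [E | Nk].
- subst k'.
  pose proof (Ht_Y k m _ S H3 Hk Hm) as Y.
  replace (CY (tE k m')) with (fun p => (Ci * ell k m' * tE k m' p)%C) in Y
    by (funext p; now destruct (tE_fields k m' p) as (_ & -> & _)).
  rewrite Ht_scal in Y by (apply tE_smooth).
  apply (Cmult_cancel (Ci * (m' - m)%R)).
  + apply Cmult_neq_0; [apply Ci_neq0 | apply RtoC_neq0; lra].
  + replace (m' - m) with (ell k m' - ell k m) by (unfold ell; lra). rewrite RtoC_minus.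
    transitivity (Ci * ell k m' * Ht k m (tE k m') - Ci * ell k m * Ht k m (tE k m'))%C; [fin|].
    rewrite Y. fin.
- pose proof (Ht_X k m _ S H3 Hk) as X.
  replace (CX (tE k' m')) with (fun p => (Ci * k' * tE k' m' p)%C) in X
    by (funext p; now destruct (tE_fields k' m' p) as (-> & _)).
  rewrite Ht_scal in X by (apply tE_smooth).
  apply (Cmult_cancel (Ci * (k' - k)%R)).
  + apply Cmult_neq_0; [apply Ci_neq0 | apply RtoC_neq0; lra].
  + rewrite RtoC_minus.
    transitivity (Ci * k' * Ht k m (tE k' m') - Ci * k * Ht k m (tE k' m'))%C; [fin|].
    rewrite X. fin.
Qed.

(** Away from [Lam = 0] the second component is forced by the first through the symbol of [opa]. At
    [Lam = 0] the two signs give the same value, and [b] selects the component that carries the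
    exponential instead. *)
Definition tp (k m Lam : R) (b : bool) (p : heis) : C * C :=
  if Req_dec_T Lam 0 then (if b then (tE k m p, RtoC 0) else (RtoC 0, tE k m p))
  else (tE k m p, (s * (Ci * k + ell k m) / Lam * tE k m p)%C).

Definition tc (k m Lam : R) (b : bool) (g : heis -> C * C) : C :=
  if Req_dec_T Lam 0 then (if b then Ht k m (fun p => fst (g p)) else Ht k m (fun p => snd (g p)))
  else Ht k m (fun p => fst (g p)).

Lemma zfreq_zero c : zfreq c (fun _ => RtoC 0).
Proof. intros q p. fin. Qed.

Lemma tp_zfp k m Lam b : zfp 0 (tp k m Lam b).
Proof.
unfold tp. destruct (Req_dec_T Lam 0); [destruct b|]; split;
  try apply tE_zfreq; try apply zfreq_zero. apply zfreq_scal, tE_zfreq.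
Qed.

Lemma tp_eigp k m Lam b : e3 = 1 -> Eit (k * v1) = RtoC e1 -> Eit (m * w2) = RtoC e2 ->
  Lam ^ 2 = s ^ 2 * (k ^ 2 + ell k m ^ 2) -> EP Lam (tp k m Lam b).
Proof.
intros H3 Hk Hm HL. assert (S := tE_Sp k m H3 Hk Hm).
assert (Z : Sp (fun _ => RtoC 0)) by apply Sp_zero.
assert (E0 : (fun _ : heis => RtoC 0) = (fun p => (0 * tE k m p)%C)) by (funext p; fin).
assert (Q : forall l : R, ((Ci * k - l) * (Ci * k + l))%C = RtoC (- (k ^ 2 + l ^ 2))) by (intros l; Cring).
assert (Za : opa (fun _ => RtoC 0) = fun _ => RtoC 0) by (rewrite E0, (opa_scal 0 _ (proj1 S)); funext p; fin).
assert (Zb : opb (fun _ => RtoC 0) = fun _ => RtoC 0) by (rewrite E0, (opb_scal 0 _ (proj1 S)); funext p; fin).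
assert (Zz : forall (a : C) p, CZ (fun p => (a * tE k m p)%C) p = 0%C).
{ intros a p. destruct (fields_scal a _ (proj1 S)) as (_ & _ & ->), (tE_fields k m p) as (_ & _ & ->). fin. }
assert (Zz0 : forall p, CZ (fun _ => RtoC 0) p = 0%C) by (rewrite E0; fin).
assert (Sp := s_pos).
unfold tp, EP, eigp. destruct (Req_dec_T Lam 0) as [-> | N].
- assert (HL' : k ^ 2 + ell k m ^ 2 = 0) by (apply Rmult_eq_reg_l with (s ^ 2); fin).
  assert (k = 0) by nra. assert (ell k m = 0) by nra.
  destruct b; cbn [fst snd].
  + split; auto. split; auto. intros p. change (fun p => tE k m p) with (tE k m).
    rewrite Zb, tE_opa, Zz0. destruct (tE_fields k m p) as (_ & _ & ->).
    split; [fin|]. replace (ell k m) with 0. replace k with 0 at 1. fin.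
  + split; auto. split; auto. intros p. change (fun p => tE k m p) with (tE k m).
    rewrite Za, tE_opb, Zz0. destruct (tE_fields k m p) as (_ & _ & ->).
    split; [|fin]. replace (ell k m) with 0. replace k with 0 at 1. fin.
- assert (NL : RtoC Lam <> 0%C) by now apply RtoC_neq0.
  cbn [fst snd]. split; auto. split; [apply Sp_scal, S|]. intros p. change (fun p => tE k m p) with (tE k m).
  rewrite (opb_scal _ _ (proj1 S)), tE_opb, tE_opa, Zz. destruct (tE_fields k m p) as (_ & _ & ->).
  split; [|field; fin].
  transitivity (- (s * s) * ((Ci * k - ell k m) * (Ci * k + ell k m)) / Lam * tE k m p)%C; [field; fin|].
  rewrite Q. transitivity (RtoC (s ^ 2 * (k ^ 2 + ell k m ^ 2)) / Lam * tE k m p)%C.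
  + rewrite RtoC_opp, RtoC_mult. replace (s ^ 2) with (s * s) by ring. rewrite RtoC_mult. field. fin.
  + rewrite <- HL. replace (Lam ^ 2) with (Lam * Lam) by ring. rewrite RtoC_mult. field. fin.
Qed.

Lemma Ht_zero k m : Ht k m (fun _ => RtoC 0) = 0%C.
Proof.
replace (fun _ : heis => RtoC 0) with (fun p => (0 * tE k m p)%C) by (funext p; fin).
rewrite Ht_scal by (apply tE_smooth). fin.
Qed.

Lemma tc_diag k m Lam b : tc k m Lam b (tp k m Lam b) <> 0%C.
Proof.
unfold tc, tp. destruct (Req_dec_T Lam 0); [destruct b|]; exact (Ht_tE_diag k m).
Qed.

Lemma tc_off k m k' m' Lam b b' : e3 = 1 -> Eit (k * v1) = RtoC e1 -> Eit (m * w2) = RtoC e2 ->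
  Eit (k' * v1) = RtoC e1 -> Eit (m' * w2) = RtoC e2 ->
  k <> k' \/ m <> m' \/ (b <> b' /\ Lam = 0) -> tc k m Lam b (tp k' m' Lam b') = 0%C.
Proof.
intros H3 Hk Hm Hk' Hm' N.
assert (Q : k <> k' \/ m <> m' -> Ht k m (tE k' m') = 0%C) by now apply Ht_tE_off.
destruct (Req_dec k k') as [E | Nk].
1: destruct (Req_dec m m') as [E' | Nm'].
- destruct N as [N | [N | [N NL]]]; [lra | lra|].
  unfold tc, tp. destruct (Req_dec_T Lam 0); auto.
  destruct b, b'; [lra | exact (Ht_zero k m) | exact (Ht_zero k m) | lra].
- unfold tc, tp. destruct (Req_dec_T Lam 0); [destruct b, b'|];
    [fin | exact (Ht_zero k m) | exact (Ht_zero k m) | fin | fin].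
- unfold tc, tp. destruct (Req_dec_T Lam 0); [destruct b, b'|];
    [fin | exact (Ht_zero k m) | exact (Ht_zero k m) | fin | fin].
Qed.

Lemma tc_zfp k m Lam b c' g : EP Lam g -> zfp c' g -> c' <> 0 -> e3 = 1 -> tc k m Lam b g = 0%C.
Proof.
intros (U & V & _) [FU FV] N H3.
assert (Z : forall f, Sp f -> zfreq c' f -> Ht k m f = 0%C).
{ intros f Sf F. unfold Ht. rewrite (CI_ext _ (fun _ => RtoC 0)); [rewrite CI_const; fin|].
  intros y. rewrite (zfreq_T 0 c'); auto; [fin|]. rewrite Rmult_0_l, Eit_0, H3. fin. }
unfold tc. destruct (Req_dec_T Lam 0); [destruct b|]; fin.
Qed.

Definition nilphi (p n : nat) (j : nat) (cj : bool) (Lam : R) : heis -> C * C :=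
  let g := np s (cf p) (kk (Z.of_nat j)) t2 n Lam in if cj then Jp g else g.

(** For negative frequencies the functional is composed with [Jp], which is antilinear; the outer
    conjugation makes the result complex linear again. *)
Definition nilco (p n j : nat) (cj : bool) (g : heis -> C * C) : C :=
  if cj then Cconj (nilc (cf p) (kk (Z.of_nat j)) n (Jp g)) else nilc (cf p) (kk (Z.of_nat j)) n g.

(** Excluding [Lam = cf p] removes the positive root at level 0: ground states occur with the
    negative sign alone. *)
Definition nilL (p n : nat) (Lam : R) : Prop := Lam <> cf p /\ Lam ^ 2 = cf p ^ 2 + 2 * INR n * cf p * s ^ 2.

Lemma nilphi_eigp p n j cj Lam : nilL p n Lam -> EP Lam (nilphi p n j cj Lam).
Proof.
intros [N L]. assert (K : EP Lam (np s (cf p) (kk (Z.of_nat j)) t2 n Lam)) by (apply (np_eigp s); auto; [apply cf_pos | apply cf_r | apply kk_v | apply cf_w]).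
destruct cj; auto. now apply eigp_J.
Qed.

Lemma nilphi_zfp p n j (cj : bool) Lam : zfp (if cj then - cf p else cf p) (nilphi p n j cj Lam).
Proof.
assert (K : zfp (cf p) (np s (cf p) (kk (Z.of_nat j)) t2 n Lam)) by (apply (np_zfp s); auto; [apply cf_pos | apply cf_r | apply kk_v | apply cf_w]).
destruct cj; auto. now apply zfp_J.
Qed.

Lemma nilc_scal c k n (a : C) g : csmooth (fun p => fst (g p)) ->
  nilc c k n (pscal a g) = (a * nilc c k n g)%C.
Proof.
intros H. unfold nilc, pscal; cbn [fst]. rewrite iter_opa_scal by auto.
apply Tt_scal. now apply csmooth_hcont, csmooth_iter_opa.
Qed.

Lemma nilc_plus c k n g h : csmooth (fun p => fst (g p)) -> csmooth (fun p => fst (h p)) ->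
  nilc c k n (pplus g h) = (nilc c k n g + nilc c k n h)%C.
Proof.
intros H K. unfold nilc, pplus; cbn [fst]. rewrite iter_opa_plus by auto.
apply Tt_plus; now apply csmooth_hcont, csmooth_iter_opa.
Qed.

Lemma nilc_JJ c k n g : csmooth (fun p => fst (g p)) -> nilc c k n (Jp (Jp g)) = (-1 * nilc c k n g)%C.
Proof.
intros H. rewrite <- nilc_scal by auto. f_equal. funext p. apply Jp_Jp.
Qed.

Lemma nil_diag p n j cj Lam : nilL p n Lam -> nilco p n j cj (nilphi p n j cj Lam) <> 0%C.
Proof.
intros HL.
assert (K : nilc (cf p) (kk (Z.of_nat j)) n (np s (cf p) (kk (Z.of_nat j)) t2 n Lam) <> 0%C) by (apply (np_diag s); auto; [apply cf_pos | apply cf_r | apply kk_v | apply cf_w]).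
pose proof (nilphi_eigp p n j false Lam HL) as E.
unfold nilco, nilphi in *. destruct cj; auto.
rewrite nilc_JJ by apply E. intros Z. apply (f_equal Cconj) in Z. rewrite Cconj_conj in Z.
replace (Cconj 0) with (RtoC 0) in Z by (apply Ceq; simpl; lra).
revert Z. apply Cmult_neq_0; auto. apply RtoC_neq0. lra.
Qed.

Lemma nilco_zfp p n j (cj : bool) c' g Lam : EP Lam g -> zfp c' g -> c' <> (if cj then - cf p else cf p) -> nilco p n j cj g = 0%C.
Proof.
intros E F N. unfold nilco. destruct cj.
- rewrite (nilc_zfp s (cf p) _ n (- c') (Jp g) Lam).
  + apply Ceq; simpl; lra.
  + now apply eigp_J.
  + now apply zfp_J.
  + lra.
  + apply cf_r.
- apply (nilc_zfp s (cf p) _ n c' g Lam); auto. apply cf_r.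
Qed.

Lemma nil_level_inj p n n' Lam : nilL p n Lam -> nilL p n' Lam -> n = n'.
Proof.
intros [_ H] [_ K]. apply INR_eq.
assert (0 < cf p * s ^ 2) by (apply Rmult_lt_0_compat; [apply cf_pos | apply pow_lt, s_pos]). nra.
Qed.

Lemma nil_off p n j (cj : bool) p' n' j' (cj' : bool) Lam : nilL p n Lam -> nilL p' n' Lam -> (j < Nm p)%nat -> (j' < Nm p')%nat ->
  (p, n, j, cj) <> (p', n', j', cj') -> nilco p n j cj (nilphi p' n' j' cj' Lam) = 0%C.
Proof.
intros HL HL' Hj Hj' N.
pose proof (nilphi_eigp p' n' j' cj' Lam HL') as E. pose proof (nilphi_zfp p' n' j' cj' Lam) as F.
destruct (Req_dec (if cj' then - cf p' else cf p') (if cj then - cf p else cf p)) as [D | D].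
2:{ now apply (nilco_zfp p n j cj (if cj' then - cf p' else cf p') _ Lam). }
assert (cj = cj') as <- by (pose proof (cf_pos p); pose proof (cf_pos p'); destruct cj, cj'; lra).
assert (p = p') as <- by (apply cf_inj; destruct cj; lra).
assert (n = n') as <- by (now apply (nil_level_inj p n n' Lam)).
assert (Nj : j <> j') by congruence.
assert (K : nilc (cf p) (kk (Z.of_nat j)) n (np s (cf p) (kk (Z.of_nat j')) t2 n Lam) = 0%C).
{ apply (np_offdiag s); auto; [apply cf_pos | apply cf_r | apply kk_v | apply cf_w | apply kk_v |].
  intros m. rewrite kk_shift. intros Q. apply kk_inj in Q.
  (* Both [j] and [j'] lie below [Nm p] and differ by a multiple of it. *)
  assert (m = 0)%Z by nia. lia. }
pose proof (nilphi_eigp p n j' false Lam HL') as E'.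
unfold nilco, nilphi in *. destruct cj; auto.
rewrite nilc_JJ by apply E'. rewrite K. apply Ceq; simpl; lra.
Qed.

Lemma nil_complete Lam g c k : EP Lam g ->
  (forall p n j, nilL p n Lam -> (j < Nm p)%nat -> nilco p n j false g = 0%C) ->
  0 < c -> Eit (c * r) = RtoC e3 -> Eit (k * v1) = RtoC e1 ->
  (forall y, Tt c k (fun p => fst (g p)) y = 0%C) /\ (forall y, Tt c k (fun p => snd (g p)) y = 0%C).
Proof.
intros (U & V & D) H Hc0 Hc Hk.
destruct (cf_all c Hc0 Hc) as [p ->], (kk_all k Hk) as [q ->].
apply (nil_vanish s Lam); auto; [apply s_pos|].
intros n NL HL. pose proof (Nm_pos p) as NP.
(* An arbitrary frequency index is reduced to its representative [j] modulo [Nm p];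
   [Tt_center_shift_Z] carries the vanishing along the orbit. *)
set (j := (q mod Z.of_nat (Nm p))%Z). set (m := (q / Z.of_nat (Nm p))%Z).
assert (Hj : (0 <= j < Z.of_nat (Nm p))%Z) by (apply Z.mod_pos_bound; lia).
assert (Eq : q = (j + m * Z.of_nat (Nm p))%Z) by (pose proof (Z.div_mod q (Z.of_nat (Nm p))); lia).
specialize (H p n (Z.to_nat j) (conj NL HL) ltac:(lia)).
unfold nilco in H. rewrite Z2Nat.id in H by lia.
rewrite Eq, <- kk_shift.
apply Tt_center_shift_Z; auto.
- now apply Sp_iter_opa.
- lra.
- apply kk_v.
- apply cf_w.
Qed.

Lemma conj_eq_0 (a : C) : Cconj a = 0%C -> a = 0%C.
Proof.
intros E. rewrite <- (Cconj_conj a), E. apply Ceq; simpl; lra.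
Qed.

(** The sign of the central frequency decides: positive modes vanish by the oscillator ladder,
    negative ones by the same argument for [Jp g], and frequency 0 by the torus transform.
    Injectivity of the transforms then kills [g]. *)
Lemma modes_complete Lam g : EP Lam g ->
  (forall p n j cj, nilL p n Lam -> (j < Nm p)%nat -> nilco p n j cj g = 0%C) ->
  (forall a b d, e3 = 1 -> Lam ^ 2 = s ^ 2 * (kk a ^ 2 + ell (kk a) (mm b) ^ 2) ->
     tc (kk a) (mm b) Lam d g = 0%C) ->
  forall p, g p = (RtoC 0, RtoC 0).
Proof.
intros E Hn HT p. assert (E' := E). destruct E' as (U & V & D).
assert (K : forall c k, Eit (c * r) = RtoC e3 -> Eit (k * v1) = RtoC e1 ->
  (forall y, Tt c k (fun p => fst (g p)) y = 0%C) /\ (forall y, Tt c k (fun p => snd (g p)) y = 0%C)).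
{ intros c k Hc Hk. destruct (Rtotal_order c 0) as [L | [-> | L]].
  - assert (Hc' : Eit (- c * r) = RtoC e3) by (replace (- c * r) with (- (c * r)) by ring; now apply Eit_inv_sign).
    assert (Hk' : Eit (- k * v1) = RtoC e1) by (replace (- k * v1) with (- (k * v1)) by ring; now apply Eit_inv_sign).
    destruct (nil_complete Lam (Jp g) (- c) (- k)) as [Q1 Q2]; auto; [now apply eigp_J | | lra |].
    { intros p' n j HL Hj. apply conj_eq_0. exact (Hn p' n j true HL Hj). }
    replace c with (- - c) by ring. replace k with (- - k) by ring.
    split; intros y; rewrite Tt_conj by (apply csmooth_hcont; first [apply U | apply V]).
    + rewrite Q2. apply Ceq; simpl; lra.
    + unfold Jp in Q1; cbn [fst] in Q1. specialize (Q1 y). rewrite Tt_scal in Q1 by (apply csmooth_hcont, csmooth_conj, V).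
      apply Cmult_cancel in Q1; [|apply RtoC_neq0; lra]. rewrite Q1. apply Ceq; simpl; lra.
  - rewrite Rmult_0_l, Eit_0 in Hc. assert (H3 : e3 = 1) by (apply (f_equal Re) in Hc; fin).
    assert (Q : forall m, Eit (m * w2) = RtoC e2 ->
      Ht k m (fun p => fst (g p)) = 0%C /\ Ht k m (fun p => snd (g p)) = 0%C).
    { intros m Hm. destruct (kk_all k Hk) as [a ->], (mm_all m Hm) as [b ->].
      apply (torus_vanish s Lam); auto; [apply s_pos|].
      intros HL. pose proof (HT a b true H3 HL) as T1. pose proof (HT a b false H3 HL) as T2.
      unfold tc in T1, T2. destruct (Req_dec_T Lam 0) as [L0 | NL]; [fin | exact (conj T1 (fun L0 => False_ind _ (NL L0)))]. }
    split.
    + exact (Ht_injective k _ U H3 Hk (fun m Hm => proj1 (Q m Hm))).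
    + exact (Ht_injective k _ V H3 Hk (fun m Hm => proj2 (Q m Hm))).
  - apply nil_complete with Lam; fin. }
assert (F : fst (g p) = 0%C) by (apply (Tt_injective (fun p => fst (g p)) U); intros c k Hc Hk; exact (proj1 (K c k Hc Hk))).
assert (S : snd (g p) = 0%C) by (apply (Tt_injective (fun p => snd (g p)) V); intros c k Hc Hk; exact (proj2 (K c k Hc Hk))).
rewrite (surjective_pairing (g p)), F, S. fin.
Qed.

Definition phiI (i : Idx) : heis -> C * C :=
  match i with
  | inl (inl ((p, n), (j, b, cj))) => nilphi p (S n) j cj (LamI i)
  | inl (inr (p, (j, cj))) => nilphi p 0 j cj (LamI i)
  | inr (xi, b) => tp (kk (fst xi)) (mm (snd xi)) (LamI i) b
  end.

Definition coefI (i : Idx) (g : heis -> C * C) : C :=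
  match i with
  | inl (inl ((p, n), (j, b, cj))) => nilco p (S n) j cj g
  | inl (inr (p, (j, cj))) => nilco p 0 j cj g
  | inr (xi, b) => tc (kk (fst xi)) (mm (snd xi)) (LamI i) b g
  end.

Lemma bsgn_sq b : bsgn b * bsgn b = 1.
Proof. destruct b; unfold bsgn; lra. Qed.

Lemma LamI_exc p n j b cj : LamI (inl (inl ((p, n), (j, b, cj)))) = bsgn b * nil_level A (cf p) (S n).
Proof. unfold LamI, lamI, cf. lra. Qed.

Lemma LamI_gr p j cj : LamI (inl (inr (p, (j, cj)))) = - cf p.
Proof. unfold LamI, lamI, cf. lra. Qed.

Lemma LamI_tor xi b : LamI (inr (xi, b)) = bsgn b * nq xi.
Proof. unfold LamI, lamI. lra. Qed.

Lemma nil_level_sq p n : nil_level A (cf p) n ^ 2 = cf p ^ 2 + 2 * INR n * cf p * s ^ 2.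
Proof.
unfold nil_level. rewrite pow2_sqrt.
- rewrite s_sq. lra.
- pose proof (cf_pos p). pos.
Qed.

Lemma nilL_exc p n j b cj : nilL p (S n) (LamI (inl (inl ((p, n), (j, b, cj))))).
Proof.
rewrite LamI_exc.
assert (E : (bsgn b * nil_level A (cf p) (S n)) ^ 2 = cf p ^ 2 + 2 * INR (S n) * cf p * s ^ 2) by (rewrite <- nil_level_sq; transitivity (bsgn b * bsgn b * nil_level A (cf p) (S n) ^ 2); [lra|]; rewrite bsgn_sq; lra).
split; auto. intros K. rewrite K in E. 
assert (0 < INR (S n)) by (apply lt_0_INR; lia). pose proof (cf_pos p). pose proof s_pos.
assert (0 < 2 * INR (S n) * cf p * s ^ 2); [|lra].
pos.
Qed.

Lemma nilL_gr p j cj : nilL p 0 (LamI (inl (inr (p, (j, cj))))).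
Proof. rewrite LamI_gr. pose proof (cf_pos p). split; [lra | simpl INR; lra]. Qed.

Lemma nilL_exc_idx p n j cj Lam : nilL p (S n) Lam -> exists b, LamI (inl (inl ((p, n), (j, b, cj)))) = Lam.
Proof.
intros [_ H]. rewrite <- nil_level_sq in H.
assert (K : Lam = nil_level A (cf p) (S n) \/ Lam = - nil_level A (cf p) (S n)) by nra.
destruct K as [-> | ->]; [exists true | exists false]; rewrite LamI_exc; unfold bsgn; lra.
Qed.

Lemma nilL_gr_idx p j cj Lam : nilL p 0 Lam -> LamI (inl (inr (p, (j, cj)))) = Lam.
Proof.
intros [N H]. simpl INR in H. rewrite LamI_gr.
nra.
Qed.

Lemma nq_sq xi : nq xi ^ 2 = s ^ 2 * (kk (fst xi) ^ 2 + ell (kk (fst xi)) (mm (snd xi)) ^ 2).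
Proof.
unfold nq. rewrite Rpow_mult_distr, pow2_sqrt; auto.
nra.
Qed.

Lemma LamI_tor_sq xi b : LamI (inr (xi, b)) ^ 2 = s ^ 2 * (kk (fst xi) ^ 2 + ell (kk (fst xi)) (mm (snd xi)) ^ 2).
Proof.
rewrite LamI_tor, <- nq_sq. transitivity (bsgn b * bsgn b * nq xi ^ 2); [lra|]. rewrite bsgn_sq; lra.
Qed.

Lemma phiI_eigp i : dom Nm tor i -> EP (LamI i) (phiI i).
Proof.
destruct i as [[[[p n] [[j b] cj]] | [p [j cj]]] | [xi b]]; intros H.
- apply nilphi_eigp, nilL_exc.
- apply nilphi_eigp, nilL_gr.
- apply tp_eigp; [now apply Htor | apply kk_v | apply mm_w | apply LamI_tor_sq].
Qed.

Lemma coefI_diag i : dom Nm tor i -> coefI i (phiI i) <> 0%C.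
Proof.
destruct i as [[[[p n] [[j b] cj]] | [p [j cj]]] | [xi b]]; intros H.
- exact (nil_diag p (S n) j cj _ (nilL_exc p n j b cj)).
- exact (nil_diag p 0 j cj _ (nilL_gr p j cj)).
- exact (tc_diag _ _ _ b).
Qed.

Lemma nil_tor_off p n j cj xi Lam b : nilL p n Lam -> tor = true ->
  Lam ^ 2 = s ^ 2 * (kk (fst xi) ^ 2 + ell (kk (fst xi)) (mm (snd xi)) ^ 2) ->
  nilco p n j cj (tp (kk (fst xi)) (mm (snd xi)) Lam b) = 0%C /\
  tc (kk (fst xi)) (mm (snd xi)) Lam b (nilphi p n j cj Lam) = 0%C.
Proof.
intros HL Ht HLam. assert (H3 : e3 = 1) by now apply Htor. pose proof (cf_pos p) as C0. split.
- apply (nilco_zfp p n j cj 0 _ Lam).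
  + apply tp_eigp; auto; [apply kk_v | apply mm_w].
  + apply tp_zfp.
  + destruct cj; lra.
- apply (tc_zfp _ _ _ _ (if cj then - cf p else cf p)); auto.
  + now apply nilphi_eigp.
  + apply nilphi_zfp.
  + destruct cj; lra.
Qed.

Lemma coefI_off i j : dom Nm tor i -> dom Nm tor j -> LamI i = LamI j -> i <> j -> coefI i (phiI j) = 0%C.
Proof.
destruct i as [[[[p n] [[k b] cj]] | [p [k cj]]] | [xi b]];
destruct j as [[[[p' n'] [[k' b'] cj']] | [p' [k' cj']]] | [xi' b']]; intros D D' EL N;
unfold phiI.
- pose proof (nilL_exc p n k b cj) as L. pose proof (nilL_exc p' n' k' b' cj') as L'. rewrite EL in L.
  apply (nil_off p (S n) k cj p' (S n') k' cj' _ L L' D D'). intros E. injection E; intros; subst.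
  rewrite !LamI_exc in EL. destruct b, b'; auto;
  assert (K : 0 < nil_level A (cf p') (S n')) by
    (assert (Q := nil_level_sq p' (S n')); destruct L' as [_ L']; unfold nil_level; apply sqrt_lt_R0;
     pose proof (cf_pos p'); assert (0 < INR (S n')) by (apply lt_0_INR; lia);
     assert (0 < 2 * INR (S n') * cf p' / A) by (apply Rdiv_lt_0_compat; auto; nra); nra);
  unfold bsgn in EL; lra.
- pose proof (nilL_exc p n k b cj) as L. pose proof (nilL_gr p' k' cj') as L'. rewrite EL in L.
  apply (nil_off p (S n) k cj p' 0 k' cj' _ L L' D D'). easy.
- pose proof (nilL_exc p n k b cj) as L. rewrite EL in L.
  exact (proj1 (nil_tor_off p (S n) k cj xi' _ b' L D' (LamI_tor_sq xi' b'))).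
- pose proof (nilL_gr p k cj) as L. pose proof (nilL_exc p' n' k' b' cj') as L'. rewrite EL in L.
  apply (nil_off p 0 k cj p' (S n') k' cj' _ L L' D D'). easy.
- pose proof (nilL_gr p k cj) as L. pose proof (nilL_gr p' k' cj') as L'. rewrite EL in L.
  apply (nil_off p 0 k cj p' 0 k' cj' _ L L' D D'). congruence.
- pose proof (nilL_gr p k cj) as L. rewrite EL in L.
  exact (proj1 (nil_tor_off p 0 k cj xi' _ b' L D' (LamI_tor_sq xi' b'))).
- pose proof (nilL_exc p' n' k' b' cj') as L. rewrite <- EL in L |- *.
  exact (proj2 (nil_tor_off p' (S n') k' cj' xi _ b L D (LamI_tor_sq xi b))).
- pose proof (nilL_gr p' k' cj') as L. rewrite <- EL in L |- *.
  exact (proj2 (nil_tor_off p' 0 k' cj' xi _ b L D (LamI_tor_sq xi b))).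
- rewrite <- EL. apply tc_off; try apply kk_v; try apply mm_w; [now apply Htor|].
  destruct xi as [x y], xi' as [x' y'].
  destruct (Z.eq_dec x x') as [-> | Nx]; [|left; intros E; apply Nx; now apply kk_inj].
  destruct (Z.eq_dec y y') as [-> | Ny]; [|right; left; intros E; apply Ny; now apply mm_inj].
  assert (Nb : b <> b') by congruence.
  rewrite !LamI_tor in EL. rewrite LamI_tor. unfold bsgn in *. destruct b, b'; lra.
Qed.

Lemma coefI_complete Lam g : EP Lam g -> (forall i, dom Nm tor i -> LamI i = Lam -> coefI i g = 0%C) ->
  forall p, g p = (RtoC 0, RtoC 0).
Proof.
intros E H. apply (modes_complete Lam); auto.
- intros p n j cj HL Hj. destruct n as [|n].
  + exact (H (inl (inr (p, (j, cj)))) Hj (nilL_gr_idx p j cj Lam HL)).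
  + destruct (nilL_exc_idx p n j cj Lam HL) as [b Hb]. exact (H (inl (inl ((p, n), (j, b, cj)))) Hj Hb).
- intros a b d H3 HL. assert (Ht : tor = true) by now apply Htor.
  assert (K : Lam = nq (a, b) \/ Lam = - nq (a, b)).
  { apply Rsqr_eq. unfold Rsqr. pose proof (nq_sq (a, b)) as Q. cbn [fst snd] in Q. lra. }
  assert (B : exists d', LamI (inr ((a, b), d')) = Lam) by (destruct K as [-> | ->]; [exists true | exists false]; rewrite LamI_tor; unfold bsgn; lra).
  (* At [Lam = 0] both values of the flag have eigenvalue 0, and they test the two components.
     Otherwise the functional is the same for both flags, and the sign of [Lam] determines which
     index supplies it. *)
  destruct (Req_dec_T Lam 0) as [L0 | NL] eqn:Ed.
  + assert (Q : LamI (inr ((a, b), d)) = Lam) by (rewrite LamI_tor; nra).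
    pose proof (H (inr ((a, b), d)) Ht Q) as R. unfold coefI in R. rewrite Q in R. fin.
  + destruct B as [d' Q]. pose proof (H (inr ((a, b), d')) Ht Q) as R.
    unfold coefI in R. rewrite Q in R. unfold tc in R |- *. rewrite Ed in R |- *. fin.
Qed.

Lemma Jp_lin g h a : Jp (pplus g (pscal a h)) = pplus (Jp g) (pscal (Cconj a) (Jp h)).
Proof.
funext p. unfold Jp, pplus, pscal; cbn [fst snd].
rewrite !Cplus_conj, !Cmult_conj. fin.
Qed.

Lemma pair_smooth Lam g : EP Lam g -> csmooth (fun p => fst (g p)) /\ csmooth (fun p => snd (g p)).
Proof. intros (U & V & _). split; [apply U | apply V]. Qed.

Lemma coefI_lin i g h (a : C) L : EP L g -> EP L h -> coefI i (pplus g (pscal a h)) = (coefI i g + a * coefI i h)%C.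
Proof.
intros Eg Eh. destruct (pair_smooth L g Eg) as [G1 G2], (pair_smooth L h Eh) as [K1 K2].
assert (Nl : forall c k n g h b, csmooth (fun p => fst (g p)) -> csmooth (fun p => fst (h p)) ->
  nilc c k n (pplus g (pscal b h)) = (nilc c k n g + b * nilc c k n h)%C) by (intros c k n g' h' b S1 S2; rewrite nilc_plus, nilc_scal; auto; now apply csmooth_scal).
assert (N : forall p n j cj, nilco p n j cj (pplus g (pscal a h)) = (nilco p n j cj g + a * nilco p n j cj h)%C).
{ unfold nilco. destruct cj; auto.
  rewrite Jp_lin, Nl.
  - now rewrite Cplus_conj, Cmult_conj, Cconj_conj.
  - apply csmooth_scal, csmooth_conj, G2.
  - apply csmooth_scal, csmooth_conj, K2. }
assert (Hl : forall k m f f', csmooth f -> csmooth f' -> Ht k m (fun p => (f p + a * f' p)%C) = (Ht k m f + a * Ht k m f')%C) by (intros k m f f' S1 S2; rewrite Ht_plus, Ht_scal; auto; now apply csmooth_scal).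
destruct i as [[[[p n] [[j b] cj]] | [p [j cj]]] | [xi b]]; unfold coefI; auto.
unfold tc. destruct (Req_dec_T (LamI (inr (xi, b))) 0); [destruct b|].
- exact (Hl _ _ _ _ G1 K1).
- exact (Hl _ _ _ _ G2 K2).
- exact (Hl _ _ _ _ G1 K1).
Qed.

End Modes.

End Space.

(** * Clifford multiplication and multiplicities *)

Lemma RtoC_m1 : RtoC (-1) = Copp (RtoC 1).
Proof. fin. Qed.

Lemma RtoC_2_add : RtoC 2 = (RtoC 1 + RtoC 1)%C.
Proof. fin. Qed.

Ltac Cnum := rewrite ?RtoC_m1, ?RtoC_opp, ?RtoC_2_add.

Definition cs (a : C) (u : C2) : C2 := ((a * fst u)%C, (a * snd u)%C).
Definition cp (u v : C2) : C2 := ((fst u + fst v)%C, (snd u + snd v)%C).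

Lemma scal_cs (a : C) (u : C2) : scal a u = cs a u.
Proof. fin. Qed.

Lemma plus_cp (u v : C2) : plus u v = cp u v.
Proof. fin. Qed.

Lemma zero_C2 : (zero : C2) = (RtoC 0, RtoC 0).
Proof. fin. Qed.

Lemma C2eq (u v : C2) : fst u = fst v -> snd u = snd v -> u = v.
Proof. destruct u, v; simpl; congruence. Qed.

Ltac C2ring := unfold cs, cp; apply C2eq; cbn [fst snd]; ring.

Section Clifford.
Variables (e1 e2 e3 : C2 -> C2).
Hypothesis (HE : clifford e1 e2 e3).

Lemma cl_lin e : e = e1 \/ e = e2 \/ e = e3 -> forall a b u v, e (cp (cs a u) (cs b v)) = cp (cs a (e u)) (cs b (e v)).
Proof.
intros He a b u v. pose proof (clifford_linear _ _ _ HE e He a b u v) as K.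
fin.
Qed.

Lemma cl_scal e : e = e1 \/ e = e2 \/ e = e3 -> forall a u, e (cs a u) = cs a (e u).
Proof.
intros He a u. replace (cs a u) with (cp (cs a u) (cs 0 u)) by C2ring.
rewrite cl_lin by auto. C2ring.
Qed.

Lemma cl_plus e : e = e1 \/ e = e2 \/ e = e3 -> forall u v, e (cp u v) = cp (e u) (e v).
Proof.
intros He u v. replace (cp u v) with (cp (cs 1 u) (cs 1 v)) by C2ring.
rewrite cl_lin by auto. C2ring.
Qed.

Lemma cl_mul (x y z : R) u : let m := fun u => cp (cp (cs x (e1 u)) (cs y (e2 u))) (cs z (e3 u)) in
  m (m u) = cs (- (x ^ 2 + y ^ 2 + z ^ 2))%R u.
Proof.
pose proof (clifford_square _ _ _ HE x y z u) as K. fin.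
Qed.

Lemma cl_sq e : e = e1 \/ e = e2 \/ e = e3 -> forall u, e (e u) = cs (-1) u.
Proof.
intros He u.
assert (P : forall x y z : R, x ^ 2 + y ^ 2 + z ^ 2 = 1 ->
  (forall u, cp (cp (cs x (e1 u)) (cs y (e2 u))) (cs z (e3 u)) = e u) -> e (e u) = cs (-1) u).
{ intros x y z H E. pose proof (cl_mul x y z u) as K. cbv beta zeta in K.
  rewrite !E in K. now rewrite K, H. }
destruct He as [-> | [-> | ->]]; [apply (P 1 0 0) | apply (P 0 1 0) | apply (P 0 0 1)]; try ring; intros; C2ring.
Qed.

(** Polarization: the Clifford relation is applied to the sum of two frame vectors, of squared norm
    2. Keeping the coordinates as parameters lets one proof serve every pair. *)
Lemma cl_anti e e' (x y z x' y' z' : R) :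
  e = e1 \/ e = e2 \/ e = e3 -> e' = e1 \/ e' = e2 \/ e' = e3 ->
  (x + x') ^ 2 + (y + y') ^ 2 + (z + z') ^ 2 = 2 ->
  (forall u, cp (cp (cs x (e1 u)) (cs y (e2 u))) (cs z (e3 u)) = e u) ->
  (forall u, cp (cp (cs x' (e1 u)) (cs y' (e2 u))) (cs z' (e3 u)) = e' u) ->
  forall u, e (e' u) = cs (-1) (e' (e u)).
Proof.
intros He He' Hn E E' u. pose proof (cl_mul (x + x') (y + y') (z + z') u) as K. cbv beta zeta in K.
assert (S : forall u, cp (cp (cs (x + x')%R (e1 u)) (cs (y + y')%R (e2 u))) (cs (z + z')%R (e3 u)) = cp (e u) (e' u)) by (intros w; rewrite <- E, <- E', !RtoC_plus; C2ring).
rewrite !S, Hn, !cl_plus, !cl_sq in K by auto.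
apply (f_equal (fun w => cp w (cs 2 u))) in K.
assert (K2 : cp (e (e' u)) (e' (e u)) = (RtoC 0, RtoC 0)).
{ transitivity (cp (cp (cp (cs (-1) u) (e' (e u))) (cp (e (e' u)) (cs (-1) u))) (cs 2 u)).
  - C2ring.
  - etransitivity; [|etransitivity; [exact K|]].
    + C2ring.
    + Cnum. C2ring. }
apply C2eq; [apply (f_equal fst) in K2 | apply (f_equal snd) in K2]; unfold cp in K2; cbn [fst snd] in K2;
  unfold cs; cbn [fst snd].
- transitivity ((fst (e (e' u)) + fst (e' (e u))) - fst (e' (e u)))%C; [fin|]. rewrite K2. fin.
- transitivity ((snd (e (e' u)) + snd (e' (e u))) - snd (e' (e u)))%C; [fin|]. rewrite K2. fin.
Qed.

Lemma cl_12 u : e1 (e2 u) = e3 u.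
Proof.
pose proof (clifford_orientation _ _ _ HE u) as K. replace (opp u) with (cs (-1) u) in K.
- apply (f_equal e3) in K. rewrite cl_sq, cl_scal in K by auto.
  transitivity (cs (-1) (cs (-1) (e1 (e2 u)))); [|rewrite K]; C2ring.
- destruct u as [a b]. unfold cs; cbn [fst snd]. change (opp (a, b)) with (Copp a, Copp b).
  fin.
Qed.

(** An eigenvector [wp] of [e3] for $i$ exists because [e3] cannot be the scalar $-i$ while
    anticommuting with [e1]. Then [wm = e1 wp] belongs to $-i$, and the orientation, in the form
    $e_1e_2=e_3$, determines [e2]. *)
Lemma clifford_frame : exists wp wm : C2,
  (fst wp * snd wm - snd wp * fst wm)%C <> 0%C /\
  forall a b : C,
    e1 (cp (cs a wp) (cs b wm)) = cp (cs (- b) wp) (cs a wm) /\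
    e2 (cp (cs a wp) (cs b wm)) = cp (cs (- Ci * b) wp) (cs (- Ci * a) wm) /\
    e3 (cp (cs a wp) (cs b wm)) = cp (cs (Ci * a) wp) (cs (- Ci * b) wm).
Proof.
assert (I1 : e1 = e1 \/ e1 = e2 \/ e1 = e3) by auto.
assert (A31 : forall u, e3 (e1 u) = cs (-1) (e1 (e3 u))) by (apply (cl_anti e3 e1 0 0 1 1 0 0); auto; [lra | |]; intros; C2ring).
assert (A21 : forall u, e2 (e1 u) = cs (-1) (e1 (e2 u))) by (apply (cl_anti e2 e1 0 1 0 1 0 0); auto; [lra | |]; intros; C2ring).
assert (Hci : forall u v : C2, cs Ci u = cs (- Ci) u -> u = (RtoC 0, RtoC 0)).
{ intros u _ E. apply C2eq; [apply (f_equal fst) in E | apply (f_equal snd) in E]; unfold cs in E; cbn [fst snd] in *.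
  - apply (Cmult_cancel (2 * Ci)); [apply Cmult_neq_0; [apply RtoC_neq0; lra| apply Ci_neq0]|].
    transitivity (Ci * fst u - - Ci * fst u)%C; [fin|]. rewrite E. fin.
  - apply (Cmult_cancel (2 * Ci)); [apply Cmult_neq_0; [apply RtoC_neq0; lra| apply Ci_neq0]|].
    transitivity (Ci * snd u - - Ci * snd u)%C; [fin|]. rewrite E. fin. }
assert (Hw : exists wp, wp <> (RtoC 0, RtoC 0) /\ e3 wp = cs Ci wp).
{ apply NNPP; intros N.
  assert (K : forall u, e3 u = cs (- Ci) u).
  (* Since [e3] squares to -1, $e_3u+iu$ is always in the eigenspace for $i$; if that space is zero,
     [e3] is the scalar $-i$. *)
  { intros u. set (w := cp (e3 u) (cs Ci u)).
    assert (W : e3 w = cs Ci w) by (unfold w; rewrite cl_plus, cl_sq, cl_scal by auto; apply C2eq; unfold cp, cs; cbn [fst snd]; rewrite Cmult_plus_distr_l, Cmult_assoc, Ci_sq; fin).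
    assert (Z : w = (RtoC 0, RtoC 0)) by (apply NNPP; eauto).
    unfold w, cp, cs in Z. apply C2eq; [apply (f_equal fst) in Z | apply (f_equal snd) in Z]; cbn [fst snd] in *;
      unfold cs; cbn [fst snd].
    - transitivity ((fst (e3 u) + Ci * fst u) - Ci * fst u)%C; [fin|]. rewrite Z. fin.
    - transitivity ((snd (e3 u) + Ci * snd u) - Ci * snd u)%C; [fin|]. rewrite Z. fin. }
  pose proof (A31 (RtoC 1, RtoC 0)) as Q. rewrite !K, cl_scal in Q by auto.
  set (w := e1 (RtoC 1, RtoC 0)) in *.
  assert (W0 : w = (RtoC 0, RtoC 0)) by (apply (Hci w w); rewrite Q; C2ring).
  assert (Q2 : e1 w = cs (-1) (RtoC 1, RtoC 0)) by (now apply cl_sq).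
  replace w with (cs 0 w) in Q2 at 1 by (rewrite W0; C2ring). rewrite cl_scal in Q2 by auto.
  apply (f_equal fst) in Q2. apply (f_equal Re) in Q2.
  revert Q2. simpl. lra. }
destruct Hw as (wp & Np & E3p). set (wm := e1 wp).
assert (E1m : e1 wm = cs (-1) wp) by now apply cl_sq.
assert (E3m : e3 wm = cs (- Ci) wm) by (unfold wm; rewrite A31, E3p, cl_scal by auto; C2ring).
assert (E2p : e2 wp = cs (- Ci) wm).
{ pose proof (cl_12 wp) as Q. apply (f_equal e1) in Q. rewrite cl_sq, E3p, cl_scal in Q by auto. fold wm in Q.
  transitivity (cs (-1) (cs (-1) (e2 wp))); [|rewrite Q]; C2ring. }
assert (E2m : e2 wm = cs (- Ci) wp) by (unfold wm; rewrite A21, cl_12, E3p; C2ring).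
assert (Ind : forall a b, cp (cs a wp) (cs b wm) = (RtoC 0, RtoC 0) -> a = 0%C /\ b = 0%C).
{ intros a b E.
  assert (Pa : forall a, cs a wp = (RtoC 0, RtoC 0) -> a = 0%C).
  { intros x Ex. apply NNPP; intros Nx. apply Np, C2eq.
    - apply (f_equal fst) in Ex. exact (Cmult_cancel _ _ Nx Ex).
    - apply (f_equal snd) in Ex. exact (Cmult_cancel _ _ Nx Ex). }
  assert (E' := E). apply (f_equal e3) in E'. rewrite cl_lin, E3p, E3m in E' by auto.
  replace (e3 (RtoC 0, RtoC 0)) with (RtoC 0, RtoC 0) in E'.
  2:{ replace (RtoC 0, RtoC 0) with (cs 0 wp) at 2 by C2ring. rewrite cl_scal by auto. C2ring. }
  assert (Ea : a = 0%C).
  { apply (Cmult_cancel (2 * Ci)); [apply Cmult_neq_0; [apply RtoC_neq0; lra| apply Ci_neq0]|].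
    apply Pa. transitivity (cp (cs Ci (cp (cs a wp) (cs b wm))) (cp (cs a (cs Ci wp)) (cs b (cs (- Ci) wm)))); [C2ring|].
    rewrite E, E'. C2ring. }
  split; auto.
  assert (Eb : cs b wm = (RtoC 0, RtoC 0)) by (rewrite <- E, Ea; C2ring).
  apply (f_equal e1) in Eb. rewrite cl_scal, E1m in Eb by auto.
  replace (e1 (RtoC 0, RtoC 0)) with (RtoC 0, RtoC 0) in Eb.
  2:{ replace (RtoC 0, RtoC 0) with (cs 0 wp) at 2 by C2ring. rewrite cl_scal by auto. C2ring. }
  apply Pa. transitivity (cs (-1) (cs b (cs (-1) wp))); [C2ring|]. rewrite Eb. C2ring. }
exists wp, wm. split.
- intros D. apply Np.
  destruct (Ind (snd wm) (- snd wp)%C) as [S1 S2].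
  { apply C2eq; unfold cp, cs; cbn [fst snd]; [|fin]. rewrite <- D. fin. }
  destruct (Ind (fst wm) (- fst wp)%C) as [F1 F2].
  { apply C2eq; unfold cp, cs; cbn [fst snd]; [fin|].
    transitivity (- (fst wp * snd wm - snd wp * fst wm))%C; [fin|]. rewrite D. fin. }
  apply C2eq; cbn [fst snd].
  + transitivity (- - fst wp)%C; [fin|]. rewrite F2. fin.
  + transitivity (- - snd wp)%C; [fin|]. rewrite S2. fin.
- intros a b. rewrite !cl_lin by auto. fold wm. rewrite E1m, E2p, E2m, E3p, E3m.
  split; [C2ring|]. split; C2ring.
Qed.

End Clifford.

(** * Multiplicities from dual functionals *)

Section Dual.
Context {I : Type}.
Variables (P : params) (chi : heis -> R) (e1 e2 e3 : C2 -> C2) (mu : R).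
Variables (L : list I) (phi : I -> heis -> C2) (co : I -> (heis -> C2) -> C).

Let E := eigenspinor P chi e1 e2 e3 mu.

Hypothesis (E0 : E (fun _ => zero)).
Hypothesis (Elin : forall f g (a : C), E f -> E g -> E (fun p => plus (f p) (scal a (g p)))).
Hypothesis (Ephi : forall i, In i L -> E (phi i)).
Hypothesis (Clin : forall i f g (a : C), E f -> E g ->
  co i (fun p => plus (f p) (scal a (g p))) = (co i f + a * co i g)%C).
Hypothesis (Cdiag : forall i, In i L -> co i (phi i) <> 0%C).
Hypothesis (Coff : forall i j, In i L -> In j L -> i <> j -> co i (phi j) = 0%C).
Hypothesis (Ccomplete : forall f, E f -> (forall i, In i L -> co i f = 0%C) -> forall p, f p = zero).
Hypothesis (HL : NoDup L).

Lemma dual_zero i : co i (fun _ => zero) = 0%C.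
Proof.
pose proof (Clin i (fun _ => zero) (fun _ => zero) 1 E0 E0) as K. cbv beta in K.
replace (fun _ : heis => plus (zero : C2) (scal (RtoC 1) (zero : C2))) with (fun _ : heis => (zero : C2)) in K.
- transitivity ((co i (fun _ => zero) + 1 * co i (fun _ => zero)) - co i (fun _ => zero))%C; [fin|].
  rewrite <- K. fin.
- funext _. rewrite scal_cs, plus_cp, zero_C2. C2ring.
Qed.

Definition combo (b : nat -> heis -> C2) (c : nat -> C) (n : nat) (p : heis) : C2 :=
  sum_n_m (fun i => scal (c i) (b i p)) 1 n.

Lemma combo_spec (b : nat -> heis -> C2) (d : nat -> I) c n :
  (forall i, (1 <= i <= length L)%nat -> b i = phi (d i)) ->
  (forall i, (1 <= i <= length L)%nat -> In (d i) L) ->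
  (forall i j, (1 <= i <= length L)%nat -> (1 <= j <= length L)%nat -> d i = d j -> i = j) ->
  (n <= length L)%nat -> E (combo b c n) /\
  forall j, (1 <= j <= length L)%nat -> co (d j) (combo b c n) =
    if le_lt_dec j n then (c j * co (d j) (phi (d j)))%C else 0%C.
Proof.
intros Hb Hd Hinj. induction n as [|n IH]; intros Hn.
-
  split; auto. intros j Hj. destruct (le_lt_dec j 0); [lia|]. apply dual_zero.
- assert (Es : combo b c (S n) = fun p => plus (combo b c n p) (scal (c (S n)) (b (S n) p))) by (funext p; apply sum_n_Sm; lia).
  destruct IH as [IE IC]; [lia|].
  assert (Eb : E (b (S n))) by (rewrite Hb by lia; apply Ephi, Hd; lia).
  rewrite Es. split; auto.
  intros j Hj. rewrite Clin, IC by auto. rewrite (Hb (S n)) by lia.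
  destruct (Nat.eq_dec j (S n)) as [-> | Nj].
  + destruct (le_lt_dec (S n) n); [lia|]. destruct (le_lt_dec (S n) (S n)); fin.
  + assert (Hn1 : (1 <= S n <= length L)%nat) by lia.
    rewrite (Coff (d j) (d (S n)) (Hd j Hj) (Hd _ Hn1) (fun Q => Nj (Hinj j (S n) Hj Hn1 Q))).
    destruct (le_lt_dec j n), (le_lt_dec j (S n)); fin.
Qed.

Lemma multiplicity_of_dual : multiplicity P chi e1 e2 e3 mu (length L).
Proof.
(* The empty list is separate, since [nth] below needs a default index; completeness alone then says
   that the eigenspace is 0. *)
destruct (length L) as [|n0] eqn:El.
- exists (fun _ _ => zero). split; auto. split; [lia|].
  exists (fun _ => 0%C). apply Ccomplete; auto.
  intros i Hi. destruct L; [destruct Hi | discriminate].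
- rewrite <- El.
  assert (Hi0 : exists i0 : I, True) by (destruct L as [|i0 l]; [discriminate | now exists i0]).
  (* The basis in [multiplicity] is numbered from 1, the list from 0. *)
  destruct Hi0 as [i0 _]. set (d := fun k => nth (k - 1) L i0).
  assert (Hd : forall i, (1 <= i <= length L)%nat -> In (d i) L) by (intros; apply nth_In; lia).
  assert (Hinj : forall i j, (1 <= i <= length L)%nat -> (1 <= j <= length L)%nat -> d i = d j -> i = j) by (intros i j Hi Hj Q; apply (proj1 (NoDup_nth L i0) HL) in Q; lia).
  set (b := fun k => phi (d k)).
  assert (Sp : forall c, E (combo b c (length L)) /\ forall j, (1 <= j <= length L)%nat ->
     co (d j) (combo b c (length L)) = (c j * co (d j) (phi (d j)))%C).
  { intros c. destruct (combo_spec b d c (length L)) as [Q1 Q2]; auto. split; auto.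
    intros j Hj. rewrite Q2 by auto. destruct (le_lt_dec j (length L)); fin. }
  exists b. split; [intros i Hi; apply Ephi, Hd, Hi|]. split.
  + intros c Hc i Hi. destruct (Sp c) as [_ Q]. specialize (Q i Hi).
    replace (combo b c (length L)) with (fun _ : heis => (zero : C2)) in Q.
    * rewrite dual_zero in Q. symmetry in Q. apply Cmult_cancel_r in Q; fin.
    * funext p. eauto.
  + intros f Hf. set (c := fun j => (co (d j) f / co (d j) (phi (d j)))%C). exists c. intros p.
    destruct (Sp c) as [Q1 Q2].
    pose proof (Elin f (combo b c (length L)) (-1) Hf Q1) as Eg.
    assert (Z : forall p, plus (f p) (scal (RtoC (-1)) (combo b c (length L) p)) = zero).
    { apply (Ccomplete _ Eg). intros i Hi. rewrite Clin by auto.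
      apply (In_nth L i i0) in Hi. destruct Hi as (k & Hk & Ek).
      assert (Ed : d (S k) = i) by (unfold d; rewrite <- Ek; f_equal; lia).
      rewrite <- Ed, Q2 by lia. unfold c. field. apply Cdiag, Hd. lia. }
    specialize (Z p). rewrite scal_cs, plus_cp, zero_C2 in Z.
    change (f p = combo b c (length L) p). set (w := combo b c (length L) p) in *.
    apply C2eq; [apply (f_equal fst) in Z | apply (f_equal snd) in Z]; unfold cp, cs in Z; cbn [fst snd] in Z;
      rewrite ?RtoC_m1 in Z.
    * transitivity ((fst (f p) + - (1) * fst w) + fst w)%C; [fin|]. rewrite Z. fin.
    * transitivity ((snd (f p) + - (1) * snd w) + snd w)%C; [fin|]. rewrite Z. fin.
Qed.

End Dual.

(** * Spinors in an eigenframe *)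

Lemma Z_iff_ind (Q : Z -> Prop) : Q 0%Z -> (forall n, Q n <-> Q (n + 1)%Z) -> forall n, Q n.
Proof.
intros H0 HS. apply Z.bi_induction; [intros x y ->; fin| fin | fin].
Qed.

Lemma smooth_iff (f : heis -> C2) : smooth f <-> csmooth (fun p => fst (f p)) /\ csmooth (fun p => snd (f p)).
Proof.
split.
- split; intros n; destruct (H n) as (A & B & D & E); fin.
- intros [H K] n. destruct (H n), (K n). fin.
Qed.

Section Spinors.
Variables (P : params) (chi : heis -> R) (eps1 eps2 eps3 : R) (e1 e2 e3 : C2 -> C2) (wp wm : C2).

Let v1 := par_r P * IZR (par_mv P) / par_w2 P.
Let w1 := par_r P * IZR (par_mw P) / par_w2 P.
Let w2 := par_w2 P.
Let r := par_r P.
Let s := 1 / sqrt (par_A P).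
Let D := (fst wp * snd wm - snd wp * fst wm)%C.

Hypothesis (HA : 0 < par_A P) (Hr : 0 < par_r P) (Hw2 : 0 < par_w2 P).
Hypothesis (Heps1 : eps1 = 1 \/ eps1 = -1) (Heps2 : eps2 = 1 \/ eps2 = -1) (Heps3 : eps3 = 1 \/ eps3 = -1).
Hypothesis (HC : clifford e1 e2 e3) (Hchi : spin_structure P eps1 eps2 eps3 chi).
Hypothesis (HD : D <> 0%C).
Hypothesis (Hfr : forall a b : C,
  e1 (cp (cs a wp) (cs b wm)) = cp (cs (- b) wp) (cs a wm) /\
  e2 (cp (cs a wp) (cs b wm)) = cp (cs (- Ci * b) wp) (cs (- Ci * a) wm) /\
  e3 (cp (cs a wp) (cs b wm)) = cp (cs (Ci * a) wp) (cs (- Ci * b) wm)).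

Lemma lattice_v : lattice_pt P 1 0 0 = (v1, 0, 0).
Proof. unfold lattice_pt, v1. f_equal; fin. Qed.

Lemma lattice_w : lattice_pt P 0 1 0 = (w1, w2, 0).
Proof. unfold lattice_pt, w1, w2. f_equal; fin. Qed.

Lemma lattice_u : lattice_pt P 0 0 1 = (0, 0, r).
Proof. unfold lattice_pt, r. f_equal; fin. Qed.

(** Signs square to 1, so equivariance at [x] is equivalent to equivariance at [g0 x] for each
    generator [g0]. Integer induction in both directions then reaches every lattice point from the
    identity. *)
Lemma spinor_generators (f : heis -> C2) :
  (forall g p, in_lattice P g -> f (hmul g p) = scal (RtoC (chi g)) (f p)) <->
  (forall p, f (hmul (v1, 0, 0) p) = cs eps1 (f p)) /\ (forall p, f (hmul (w1, w2, 0) p) = cs eps2 (f p)) /\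
  (forall p, f (hmul (0, 0, r) p) = cs eps3 (f p)).
Proof.
assert (L : forall a b c, in_lattice P (lattice_pt P a b c)) by (red; eauto).
split.
- rewrite <- lattice_v, <- lattice_w, <- lattice_u, <- (spin_v _ _ _ _ _ Hchi), <- (spin_w _ _ _ _ _ Hchi), <- (spin_r _ _ _ _ _ Hchi).
  fin.
- intros (V & W & U).
  set (G := fun x => forall p, f (hmul x p) = cs (chi x) (f p)).
  assert (Step : forall x g0 e, in_lattice P x -> in_lattice P g0 -> chi g0 = e ->
    (forall p, f (hmul g0 p) = cs e (f p)) -> (G x <-> G (hmul g0 x))).
  { intros x g0 e Lx Lg Ee Hg. subst e.
    assert (K : (RtoC (chi g0) * RtoC (chi g0))%C = 1%C) by (apply sign_sq; now apply (spin_sign _ _ _ _ _ Hchi)).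
    split; intros Gx p.
    - rewrite hmul_assoc, Hg, Gx, (spin_mul _ _ _ _ _ Hchi) by auto. rewrite RtoC_mult. C2ring.
    - pose proof (Gx p) as Q. rewrite hmul_assoc, Hg, (spin_mul _ _ _ _ _ Hchi), RtoC_mult in Q by auto.
      transitivity (cs (RtoC (chi g0) * RtoC (chi g0))%C (f (hmul x p))); [rewrite K; C2ring|].
      transitivity (cs (chi g0) (cs (chi g0) (f (hmul x p)))); [C2ring|]. rewrite Q.
      transitivity (cs (RtoC (chi g0) * RtoC (chi g0) * chi x)%C (f p)); [C2ring|]. rewrite K. fin. }
  assert (SU : forall a b c, G (lattice_pt P a b c) <-> G (lattice_pt P a b (c + 1))).
  { intros a b c. rewrite (Step (lattice_pt P a b c) (lattice_pt P 0 0 1) eps3); auto.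
    - replace (hmul (lattice_pt P 0 0 1) (lattice_pt P a b c)) with (lattice_pt P a b (c + 1)); [fin|].
      unfold hmul, lattice_pt; rewrite !plus_IZR; f_equal; fin.
    - apply (spin_r _ _ _ _ _ Hchi).
    - now rewrite lattice_u. }
  (* Noncommutativity of the lattice: left multiplication by [v] raises the central index by
     [par_mv P * b]; the induction hypothesis therefore ranges over all [c]. *)
  assert (SV : forall a b c, G (lattice_pt P a b c) <-> G (lattice_pt P (a + 1) b (c + par_mv P * b))).
  { intros a b c. rewrite (Step (lattice_pt P a b c) (lattice_pt P 1 0 0) eps1); auto.
    - replace (hmul (lattice_pt P 1 0 0) (lattice_pt P a b c)) with (lattice_pt P (a + 1) b (c + par_mv P * b)); [fin|].
      unfold hmul, lattice_pt; rewrite !plus_IZR, mult_IZR; f_equal; [fin|]. fin.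
    - apply (spin_v _ _ _ _ _ Hchi).
    - now rewrite lattice_v. }
  assert (SW : forall a b c, G (lattice_pt P a b c) <-> G (lattice_pt P a (b + 1) (c + par_mw P * b))).
  { intros a b c. rewrite (Step (lattice_pt P a b c) (lattice_pt P 0 1 0) eps2); auto.
    - replace (hmul (lattice_pt P 0 1 0) (lattice_pt P a b c)) with (lattice_pt P a (b + 1) (c + par_mw P * b)); [fin|].
      unfold hmul, lattice_pt; rewrite !plus_IZR, mult_IZR; f_equal; [fin|]. fin.
    - apply (spin_w _ _ _ _ _ Hchi).
    - now rewrite lattice_w. }
  assert (All : forall a b c, G (lattice_pt P a b c)).
  { intros a b. revert b. pattern a; apply Z_iff_ind.
    - intros b. pattern b; apply Z_iff_ind; clear b.
      + intros c. pattern c; apply Z_iff_ind; auto.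
        assert (I0 : forall p, hmul (lattice_pt P 0 0 0) p = p) by (intros [[x y] z]; unfold hmul, lattice_pt; f_equal; fin).
        assert (C1 : chi (lattice_pt P 0 0 0) = 1) by (pose proof (spin_mul _ _ _ _ _ Hchi _ _ (L 0 0 0)%Z (L 0 0 0)%Z) as Q; rewrite I0 in Q; destruct (spin_sign _ _ _ _ _ Hchi _ (L 0 0 0)%Z) as [Es | Es]; fin).
        intros p. rewrite I0, C1. C2ring.
      + intros b. split; intros H c.
        * replace c with ((c - par_mw P * b) + par_mw P * b)%Z by ring. apply (proj1 (SW _ _ _)), H.
        * apply (proj2 (SW _ _ _)), H.
    - split; intros H b c.
      + replace c with ((c - par_mv P * b) + par_mv P * b)%Z by ring. apply (proj1 (SV _ _ _)), H.
      + apply (proj2 (SV _ _ _)), H. }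
  intros g p (a & b & c & ->). apply All.
Qed.

Definition fr (g : heis -> C * C) (p : heis) : C2 := cp (cs (fst (g p)) wp) (cs (snd (g p)) wm).

(** Coordinates in the basis [wp], [wm] by Cramer's rule; [D] is the determinant. *)
Definition crd (f : heis -> C2) (p : heis) : C * C :=
  (((fst (f p) * snd wm - snd (f p) * fst wm) / D)%C, ((fst wp * snd (f p) - snd wp * fst (f p)) / D)%C).

Lemma fr_crd f : fr (crd f) = f.
Proof.
funext p. unfold fr, crd, cp, cs.
apply C2eq; cbn [fst snd]; unfold D; field; fin.
Qed.

Lemma crd_fr g : crd (fr g) = g.
Proof.
funext p. unfold fr, crd, cp, cs.
apply C2eq; cbn [fst snd]; unfold D; field; fin.
Qed.

Lemma csmooth_comb a b f g : csmooth f -> csmooth g -> csmooth (fun p => (f p * a + g p * b)%C).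
Proof.
intros F G. apply (csmooth_ext (fun p => (a * f p + b * g p)%C)); [intros; fin|].
apply csmooth_plus; now apply csmooth_scal.
Qed.

Lemma smooth_fr g : csmooth (fun p => fst (g p)) /\ csmooth (fun p => snd (g p)) <-> smooth (fr g).
Proof.
rewrite smooth_iff. split.
- split; now apply csmooth_comb.
-
  assert (E : forall p, g p = crd (fr g) p) by (now rewrite crd_fr).
  split; eapply csmooth_ext; try (intros p; rewrite E; unfold crd; cbn [fst snd]; reflexivity).
  + apply (csmooth_ext (fun p => (fst (fr g p) * (snd wm / D) + snd (fr g p) * (- fst wm / D))%C)).
    * intros p. field. fin.
    * now apply csmooth_comb.
  + apply (csmooth_ext (fun p => (snd (fr g p) * (fst wp / D) + fst (fr g p) * (- snd wp / D))%C)).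
    * intros p. field. fin.
    * now apply csmooth_comb.
Qed.

Lemma fields_comb a b f g p : csmooth f -> csmooth g ->
  CX (fun p => (f p * a + g p * b)%C) p = (CX f p * a + CX g p * b)%C /\
  CY (fun p => (f p * a + g p * b)%C) p = (CY f p * a + CY g p * b)%C /\
  CZ (fun p => (f p * a + g p * b)%C) p = (CZ f p * a + CZ g p * b)%C.
Proof.
intros F G.
replace (fun p => (f p * a + g p * b)%C) with (fun p => (a * f p + b * g p)%C)
  by (funext p0; fin).
destruct (fields_plus _ _ (csmooth_scal a f F) (csmooth_scal b g G)) as (-> & -> & ->),
(fields_scal a f F) as (-> & -> & ->), (fields_scal b g G) as (-> & -> & ->).
split; [|split]; fin.
Qed.

Lemma field_X_fst f p : field_X f p = (CX (fun p => fst (f p)) p, CX (fun p => snd (f p)) p).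
Proof. fin. Qed.
Lemma field_Y_fst f p : field_Y f p = (CY (fun p => fst (f p)) p, CY (fun p => snd (f p)) p).
Proof. fin. Qed.
Lemma field_Z_fst f p : field_Z f p = (CZ (fun p => fst (f p)) p, CZ (fun p => snd (f p)) p).
Proof. fin. Qed.

Lemma fields_fr g p : csmooth (fun p => fst (g p)) -> csmooth (fun p => snd (g p)) ->
  let u := fun p => fst (g p) in let v := fun p => snd (g p) in
  field_X (fr g) p = cp (cs (CX u p) wp) (cs (CX v p) wm) /\
  field_Y (fr g) p = cp (cs (CY u p) wp) (cs (CY v p) wm) /\
  field_Z (fr g) p = cp (cs (CZ u p) wp) (cs (CZ v p) wm).
Proof.
intros F S u v. rewrite field_X_fst, field_Y_fst, field_Z_fst. unfold fr, cp, cs; cbn [fst snd].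
destruct (fields_comb (fst wp) (fst wm) u v p F S) as (X1 & Y1 & Z1),
(fields_comb (snd wp) (snd wm) u v p F S) as (X2 & Y2 & Z2).
unfold u, v in *. rewrite X1, X2, Y1, Y2, Z1, Z2. fin.
Qed.

Lemma fr_inj (a b a' b' : C) : cp (cs a wp) (cs b wm) = cp (cs a' wp) (cs b' wm) -> a = a' /\ b = b'.
Proof.
intros E.
pose proof (crd_fr (fun _ => (a, b))) as K. pose proof (crd_fr (fun _ => (a', b'))) as K'.
assert (Q : fr (fun _ => (a, b)) = fr (fun _ => (a', b'))) by (funext p; fin).
rewrite Q, K' in K. apply (f_equal (fun h => h (0, 0, 0))) in K. split; congruence.
Qed.

(** In the eigenframe [e1] and [e2] are off-diagonal and combine X and Y into [opa] and [opb], while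
    [e3] acts diagonally by $\pm i$; the constant of the operator moves to the eigenvalue side. *)
Lemma dirac_fr g p mu : csmooth (fun p => fst (g p)) -> csmooth (fun p => snd (g p)) ->
  let u := fun p => fst (g p) in let v := fun p => snd (g p) in
  dirac P e1 e2 e3 (fr g) p = scal (RtoC mu) (fr g p) <->
  (- s * opb v p + Ci * CZ u p)%C = ((mu + 1 / (4 * par_A P))%R * u p)%C /\
  (s * opa u p - Ci * CZ v p)%C = ((mu + 1 / (4 * par_A P))%R * v p)%C.
Proof.
intros F S u v. destruct (fields_fr g p F S) as (X & Y & Z). fold u v in X, Y, Z.
assert (E : dirac P e1 e2 e3 (fr g) p =
  cp (cs (- s * opb v p + Ci * CZ u p + symmetry_point P * u p) wp)
     (cs (s * opa u p - Ci * CZ v p + symmetry_point P * v p) wm)).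
{ change (dirac P e1 e2 e3 (fr g) p) with (cp (cp (cp (e1 (cs s (field_X (fr g) p)))
    (e2 (cs s (field_Y (fr g) p)))) (e3 (field_Z (fr g) p))) (cs (symmetry_point P) (fr g p))).
  rewrite X, Y, Z.
  assert (Q : forall a b c : C, cs a (cp (cs b wp) (cs c wm)) = cp (cs (a * b) wp) (cs (a * c) wm)) by (intros; C2ring).
  rewrite !Q.
  destruct (Hfr (s * CX u p)%C (s * CX v p)%C) as (-> & _ & _),
  (Hfr (s * CY u p)%C (s * CY v p)%C) as (_ & -> & _),
  (Hfr (CZ u p) (CZ v p)) as (_ & _ & ->).
  unfold fr. change (fst (g p)) with (u p). change (snd (g p)) with (v p).
  unfold opa, opb. C2ring. }
change (scal (RtoC mu) (fr g p)) with (cs mu (fr g p)). rewrite E. unfold fr. change (fst (g p)) with (u p). change (snd (g p)) with (v p).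
replace (cs mu (cp (cs (u p) wp) (cs (v p) wm))) with (cp (cs (mu * u p) wp) (cs (mu * v p) wm)) by C2ring.
replace (mu + 1 / (4 * par_A P)) with (mu - symmetry_point P) by (unfold symmetry_point; lra).
rewrite RtoC_minus. split.
- intros K. apply fr_inj in K. destruct K as [K1 K2]. split.
  + transitivity ((- s * opb v p + Ci * CZ u p + symmetry_point P * u p) - symmetry_point P * u p)%C; [fin|]. rewrite K1. fin.
  + transitivity ((s * opa u p - Ci * CZ v p + symmetry_point P * v p) - symmetry_point P * v p)%C; [fin|]. rewrite K2. fin.
- intros [K1 K2]. rewrite K1, K2. f_equal; fin.
Qed.

Lemma eigenspinor_fr g mu : eigp v1 w1 w2 r eps1 eps2 eps3 s (mu + 1 / (4 * par_A P)) g <->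
  eigenspinor P chi e1 e2 e3 mu (fr g).
Proof.
unfold eigenspinor, spinor. rewrite spinor_generators, <- smooth_fr.
assert (EQ : forall x (e : R), (forall p, fr g (hmul x p) = cs e (fr g p)) <->
  eqv x e (fun p => fst (g p)) /\ eqv x e (fun p => snd (g p))).
{ split.
  - split; intros p; specialize (H p); unfold fr in H;
      (replace (cs e (cp (cs (fst (g p)) wp) (cs (snd (g p)) wm)))
        with (cp (cs (e * fst (g p)) wp) (cs (e * snd (g p)) wm)) in H by C2ring); now apply fr_inj in H.
  - intros [H1 H2] p. unfold fr. rewrite H1, H2. C2ring. }
rewrite !EQ. split.
- intros ((F & V & W & U) & (F' & V' & W' & U') & HDs). split; auto.
  intros p. apply dirac_fr; fin.
- intros (((F & F') & (V & V') & (W & W') & (U & U')) & HDs).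
  split; [exact (conj F (conj V (conj W U)))|]. split; [exact (conj F' (conj V' (conj W' U')))|].
  intros p. apply (dirac_fr g p mu); fin.
Qed.

End Spinors.

(** * The spectrum *)

Lemma dsys_lin s Lam u v u' v' (a : C) : csmooth u -> csmooth v -> csmooth u' -> csmooth v' ->
  dsys s Lam u v -> dsys s Lam u' v' ->
  dsys s Lam (fun p => (u p + a * u' p)%C) (fun p => (v p + a * v' p)%C).
Proof.
intros U V U' V' H H' p. destruct (H p) as [A B], (H' p) as [A' B'].
rewrite (opa_plus u (fun p => (a * u' p)%C) U (csmooth_scal a u' U')), (opa_scal a u' U'),
(opb_plus v (fun p => (a * v' p)%C) V (csmooth_scal a v' V')), (opb_scal a v' V').
destruct (fields_plus u _ U (csmooth_scal a u' U')) as (_ & _ & ->),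
(fields_plus v _ V (csmooth_scal a v' V')) as (_ & _ & ->),
(fields_scal a u' U') as (_ & _ & ->), (fields_scal a v' V') as (_ & _ & ->).
split.
- transitivity ((- s * opb v p + Ci * CZ u p) + a * (- s * opb v' p + Ci * CZ u' p))%C; [fin|].
  rewrite A, A'. fin.
- transitivity ((s * opa u p - Ci * CZ v p) + a * (s * opa u' p - Ci * CZ v' p))%C; [fin|].
  rewrite B, B'. fin.
Qed.

Lemma eigp_lin v1 w1 w2 r e1 e2 e3 s Lam g h (a : C) : eigp v1 w1 w2 r e1 e2 e3 s Lam g ->
  eigp v1 w1 w2 r e1 e2 e3 s Lam h -> eigp v1 w1 w2 r e1 e2 e3 s Lam (pplus g (pscal a h)).
Proof.
intros (U & V & H) (U' & V' & H').
assert (U2 := Sp_scal _ _ _ _ _ _ _ a _ U'). assert (V2 := Sp_scal _ _ _ _ _ _ _ a _ V').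
split; [exact (Sp_plus _ _ _ _ _ _ _ _ _ U U2)|]. split; [exact (Sp_plus _ _ _ _ _ _ _ _ _ V V2)|].
exact (dsys_lin s Lam _ _ _ _ a (proj1 U) (proj1 V) (proj1 U') (proj1 V') H H').
Qed.

Lemma eigp_zero v1 w1 w2 r e1 e2 e3 s Lam : eigp v1 w1 w2 r e1 e2 e3 s Lam (fun _ => (RtoC 0, RtoC 0)).
Proof.
assert (Z : forall c : C, (forall p, CX (fun _ => c) p = 0%C) /\ (forall p, CY (fun _ => c) p = 0%C) /\ (forall p, CZ (fun _ => c) p = 0%C)) by (split; [|split]; intros p; apply Derive_C_unique, rderiv_const).
split; [apply Sp_zero|]. split; [apply Sp_zero|]. intros p. cbn [fst snd].
destruct (Z 0%C) as (X & Y & Z'). unfold opa, opb. rewrite X, Y, Z'. split; fin.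
Qed.

Section Spectrum.
Variables (P : params) (chi : heis -> R) (eps1 eps2 eps3 : R) (e1 e2 e3 : C2 -> C2) (q0 q1 q2 : R)
  (Nm : nat -> nat) (tor : bool).

Let v1 := par_r P * IZR (par_mv P) / par_w2 P.
Let w1 := par_r P * IZR (par_mw P) / par_w2 P.
Let w2 := par_w2 P.
Let r := par_r P.
Let A := par_A P.

Hypothesis (HA : 0 < par_A P) (Hr : 0 < par_r P) (Hw2 : 0 < par_w2 P) (Hmv : (0 < par_mv P)%Z).
Hypothesis (Heps1 : eps1 = 1 \/ eps1 = -1) (Heps2 : eps2 = 1 \/ eps2 = -1) (Heps3 : eps3 = 1 \/ eps3 = -1).
Hypothesis (HC : clifford e1 e2 e3) (Hchi : spin_structure P eps1 eps2 eps3 chi).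
Hypothesis (Hq0 : Eit (2 * PI * q0) = RtoC eps3) (Hq1 : Eit (2 * PI * q1) = RtoC eps1) (Hq2 : Eit (2 * PI * q2) = RtoC eps2).
Hypothesis (Bq0 : 0 < q0 <= 1) (Htor : tor = true <-> eps3 = 1).
Hypothesis (HN : forall p, INR (Nm p) = IZR (par_mv P) * (INR p + q0)).

Definition mode_value (i : Idx) : R := lamI A r q0 (nq v1 w1 w2 A q1 q2) i.

Lemma v1_pos : 0 < v1.
Proof.
apply Rdiv_lt_0_compat; auto. apply Rmult_lt_0_compat; auto. now apply IZR_lt.
Qed.

Lemma HN_freq p : freq r q0 p * w2 * v1 = 2 * PI * INR (Nm p).
Proof. unfold freq, r, v1, w2. rewrite HN. fin. Qed.

Let Lm := LamI v1 w1 w2 r A q0 q1 q2.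
Let phi := phiI v1 w1 w2 r A q0 q1 q2.
Let co := coefI v1 w1 w2 r A q0 q1 q2.
Let EP := eigp v1 w1 w2 r eps1 eps2 eps3 (1 / sqrt A).

Lemma Lm_mode i : Lm i = mode_value i + 1 / (4 * A).
Proof. fin. Qed.

Lemma phi_eigp i : dom Nm tor i -> EP (Lm i) (phi i).
Proof. eapply (phiI_eigp v1 w1 w2 r eps1 eps2 eps3) with (Nm := Nm) (tor := tor); auto using v1_pos, HN_freq. Qed.

Lemma co_diag i : dom Nm tor i -> co i (phi i) <> 0%C.
Proof. eapply (coefI_diag v1 w1 w2 r eps1 eps2 eps3) with (Nm := Nm) (tor := tor); auto using v1_pos, HN_freq. Qed.

Lemma co_off i j : dom Nm tor i -> dom Nm tor j -> Lm i = Lm j -> i <> j -> co i (phi j) = 0%C.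
Proof. eapply (coefI_off v1 w1 w2 r eps1 eps2 eps3) with (Nm := Nm) (tor := tor); auto using v1_pos, HN_freq. Qed.

Lemma co_complete Lam g : EP Lam g -> (forall i, dom Nm tor i -> Lm i = Lam -> co i g = 0%C) ->
  forall p, g p = (RtoC 0, RtoC 0).
Proof. eapply (coefI_complete v1 w1 w2 r eps1 eps2 eps3) with (Nm := Nm) (tor := tor); auto using v1_pos, HN_freq. Qed.

Lemma co_lin i g h (a : C) L : EP L g -> EP L h -> co i (pplus g (pscal a h)) = (co i g + a * co i h)%C.
Proof. eapply coefI_lin; fin. Qed.

(** Transport of the dual system to spinors along [fr] and [crd]. The list of indices with value
    [mu] is left to the caller, since its finiteness comes from summability of the eta series. *)
Lemma mode_spectrum mu :
  (forall L, NoDup L -> (forall i, In i L <-> dom Nm tor i /\ mode_value i = mu) ->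
     multiplicity P chi e1 e2 e3 mu (length L)) /\
  (eigenvalue P chi e1 e2 e3 mu <-> exists i, dom Nm tor i /\ mode_value i = mu).
Proof.
destruct (clifford_frame e1 e2 e3 HC) as (wp & wm & HD & Hfr).
set (Lam := mu + 1 / (4 * A)).
assert (EF : forall g, EP Lam g <-> eigenspinor P chi e1 e2 e3 mu (fr wp wm g)) by (intros g; apply (eigenspinor_fr P chi eps1 eps2 eps3); fin).
assert (EC : forall f, eigenspinor P chi e1 e2 e3 mu f <-> EP Lam (crd wp wm f)) by (intros f; rewrite EF, fr_crd; fin).
assert (Cl : forall f g (a : C), crd wp wm (fun p => plus (f p) (scal a (g p))) = pplus (crd wp wm f) (pscal a (crd wp wm g))).
{ intros f g a. funext p.
  change (fun p => plus (f p) (scal a (g p))) with (fun p => cp (f p) (cs a (g p))).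
  unfold crd, pplus, pscal, cp, cs. apply C2eq; cbn [fst snd]; field; fin. }
assert (Cz : crd wp wm (fun _ => zero) = fun _ => (RtoC 0, RtoC 0)).
{ funext p. change (fun _ : heis => (zero : C2)) with (fun _ : heis => (RtoC 0, RtoC 0)).
  unfold crd. apply C2eq; cbn [fst snd]; field; fin. }
assert (LE : forall i, mode_value i = mu <-> Lm i = Lam).
{ intros i. rewrite Lm_mode. unfold Lam. lra. }
assert (Z0 : forall f, (forall p, crd wp wm f p = (RtoC 0, RtoC 0)) -> forall p, f p = zero).
{ intros f H p. rewrite <- (fr_crd wp wm HD f). unfold fr. rewrite H.
  change (zero : C2) with (RtoC 0, RtoC 0). C2ring. }
assert (EPz : EP Lam (fun _ => (RtoC 0, RtoC 0))) by apply eigp_zero.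
split.
- intros L NL HL.
  apply (multiplicity_of_dual P chi e1 e2 e3 mu L (fun i => fr wp wm (phi i)) (fun i f => co i (crd wp wm f))); auto.
  + apply EC. now rewrite Cz.
  + intros f g a Hf Hg. apply EC. rewrite Cl. apply eigp_lin; now apply EC.
  + intros i Hi. apply HL in Hi. destruct Hi as [Di Mi]. apply EF. apply LE in Mi. rewrite <- Mi. now apply phi_eigp.
  + intros i f g a Hf Hg. rewrite Cl. apply (co_lin i _ _ a Lam); now apply EC.
  + intros i Hi. apply HL in Hi. rewrite crd_fr by auto. now apply co_diag.
  + intros i j Hi Hj N. apply HL in Hi, Hj. rewrite crd_fr by auto. apply co_off; try tauto.
    destruct Hi as [_ Hi], Hj as [_ Hj]. apply LE in Hi, Hj. lra.
  + intros f Hf Hz. apply Z0. apply (co_complete Lam); [now apply EC|].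
    intros i Di Mi. apply Hz, HL. split; auto. now apply LE.
- split.
  + intros (f & Hf & p & Np). apply NNPP; intros N. apply Np, Z0. apply (co_complete Lam); [now apply EC|].
    intros i Di Mi. exfalso. apply N. exists i. split; auto. now apply LE.
  + intros (i & Di & Mi). apply LE in Mi. pose proof (phi_eigp i Di) as Ei. rewrite Mi in Ei.
    exists (fr wp wm (phi i)). split; [now apply EF|]. apply NNPP; intros N.
    apply (co_diag i Di).
    assert (E0 : phi i = fun _ => (RtoC 0, RtoC 0)).
    { rewrite <- (crd_fr wp wm HD (phi i)), <- Cz. f_equal. funext p.
      apply NNPP. eauto. }
    rewrite E0. pose proof (co_lin i _ _ 1%C Lam EPz EPz) as K.
    replace (pplus (fun _ => (RtoC 0, RtoC 0)) (pscal 1 (fun _ => (RtoC 0, RtoC 0)))) with (fun _ : heis => (RtoC 0, RtoC 0)) in K.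
    * set (x := co i (fun _ => (RtoC 0, RtoC 0))) in *. transitivity ((x + 1 * x) - x)%C; [fin|]. rewrite <- K. fin.
    * funext p. unfold pplus, pscal. cbn [fst snd]; fin.
Qed.

End Spectrum.

(** * Enumeration of the index set *)

Definition Z_nat (z : Z) : nat := (if Z_le_dec 0 z then 2 * Z.to_nat z else 2 * Z.to_nat (- z) + 1)%nat.

(** The three kinds of modes go to different residue classes modulo 3; within a kind the pairing
    function separates the indices. *)
Definition Idx_nat (i : Idx) : nat :=
  (match i with
  | inl (inl ((p, n), (j, b, cj))) =>
      3 * to_nat (to_nat (p, n), to_nat (j, 2 * Nat.b2n b + Nat.b2n cj))
  | inl (inr (p, (j, cj))) => 3 * to_nat (p, to_nat (j, Nat.b2n cj)) + 1
  | inr ((x, y), b) => 3 * to_nat (to_nat (Z_nat x, Z_nat y), Nat.b2n b) + 2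
  end)%nat.

Lemma to_nat_inj' a b c d : to_nat (a, b) = to_nat (c, d) -> a = c /\ b = d.
Proof. intros H. apply to_nat_inj in H. split; congruence. Qed.

Lemma Z_nat_inj x y : Z_nat x = Z_nat y -> x = y.
Proof. unfold Z_nat. destruct (Z_le_dec 0 x), (Z_le_dec 0 y); lia. Qed.

Lemma Idx_nat_inj i j : Idx_nat i = Idx_nat j -> i = j.
Proof.
destruct i as [[[[p n] [[k b] cj]] | [p [k cj]]] | [[x y] b]];
destruct j as [[[[p' n'] [[k' b'] cj']] | [p' [k' cj']]] | [[x' y'] b']]; unfold Idx_nat; intros E; try lia.
- assert (E1 : to_nat (to_nat (p, n), to_nat (k, (2 * Nat.b2n b + Nat.b2n cj)%nat))
    = to_nat (to_nat (p', n'), to_nat (k', (2 * Nat.b2n b' + Nat.b2n cj')%nat))) by lia.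
  apply to_nat_inj' in E1. destruct E1 as [E1 E2]. apply to_nat_inj' in E1, E2.
  destruct E1 as [-> ->], E2 as [-> E2].
  destruct b, b', cj, cj'; simpl in E2; fin.
- assert (E1 : to_nat (p, to_nat (k, Nat.b2n cj)) = to_nat (p', to_nat (k', Nat.b2n cj'))) by lia.
  apply to_nat_inj' in E1. destruct E1 as [-> E2]. apply to_nat_inj' in E2. destruct E2 as [-> E2].
  destruct cj, cj'; simpl in E2; fin.
- assert (E1 : to_nat (to_nat (Z_nat x, Z_nat y), Nat.b2n b) = to_nat (to_nat (Z_nat x', Z_nat y'), Nat.b2n b')) by lia.
  apply to_nat_inj' in E1. destruct E1 as [E1 E2]. apply to_nat_inj' in E1. destruct E1 as [E1 E3].
  apply Z_nat_inj in E1, E3. subst.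
  destruct b, b'; simpl in E2; fin.
Qed.

(** The next member at or above [n] is iterated from the successor, which lists an infinite set in
    increasing order; every member is reached, since the [n]-th value is at least [n]. *)
Lemma enumerate_nat (Q : nat -> Prop) : (forall n, exists m, (n <= m)%nat /\ Q m) ->
  exists e : nat -> nat, (forall x y, e x = e y -> x = y) /\ forall m, Q m <-> exists n, e n = m.
Proof.
intros H.
assert (Hmin : forall n, exists m, (n <= m)%nat /\ Q m /\ forall k, (n <= k)%nat -> Q k -> (m <= k)%nat).
{ intros n. destruct (H n) as (m & Hm & Qm). revert Hm Qm. induction m as [m IH] using lt_wf_ind. intros Hm Qm.
  destruct (classic (exists k, (n <= k < m)%nat /\ Q k)) as [(k & Hk & Qk) | N].
  - apply (IH k); fin.
  - exists m. split; [|split]; auto. intros k Hk Qk. apply Nat.nlt_ge. intros K. eauto. }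
destruct (choice _ Hmin) as [nx Hnx].
set (e := fix e n := match n with O => nx O | S n => nx (S (e n)) end).
assert (Inc : forall n k, (n < k)%nat -> (e n < e k)%nat).
{ induction 1 as [|k Hk IH]; simpl.
  - destruct (Hnx (S (e n))); lia.
  - destruct (Hnx (S (e k))); lia. }
exists e. split.
- intros x y E. destruct (lt_eq_lt_dec x y) as [[L | L] | L]; auto; apply Inc in L; lia.
- split.
  + intros Qm.
    assert (K : forall n, (exists k, e k = m) \/ (n <= e n)%nat /\ (forall k, (k <= n)%nat -> (e k < m)%nat) \/ (m < e O)%nat \/ exists k, (e k < m < e (S k))%nat).
    { induction n as [|n IH].
      - destruct (lt_eq_lt_dec (e O) m) as [[L | L] | L]; eauto.
        right; left. split; [lia|]. intros k Hk. replace k with O by lia. lia.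
      - destruct IH as [IH | [[I1 I2] | IH]]; auto.
        destruct (lt_eq_lt_dec (e (S n)) m) as [[L | L] | L]; eauto.
        + right; left. split; [pose proof (Inc n (S n)); lia|]. intros k Hk.
          destruct (Nat.eq_dec k (S n)) as [-> | N]; auto. apply I2; lia.
        + right; right. eauto. }
    destruct (K m) as [K1 | [[K1 K2] | [K1 | (k & K1 & K2)]]]; auto.
    * specialize (K2 m (le_n m)). lia.
    * simpl in K1. destruct (Hnx O) as (_ & _ & M). specialize (M m (Nat.le_0_l m) Qm). lia.
    * simpl in K2. destruct (Hnx (S (e k))) as (_ & _ & M). specialize (M m K1 Qm). lia.
  + intros [[|n] <-]; [exact (proj1 (proj2 (Hnx O))) | exact (proj1 (proj2 (Hnx (S (e n)))))].
Qed.

(** The injective sequence [g] inside [Q] guarantees that infinitely many codes occur, so the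
    enumeration by natural numbers is exact. *)
Lemma enumerate {I} (code : I -> nat) (Q : I -> Prop) (g : nat -> I) :
  (forall x y, code x = code y -> x = y) -> (forall n, Q (g n)) -> (forall x y, g x = g y -> x = y) ->
  exists e : nat -> I, (forall x y, e x = e y -> x = y) /\ forall i, Q i <-> exists n, e n = i.
Proof.
intros Hc Hg Gi.
destruct (enumerate_nat (fun m => exists i, Q i /\ code i = m)) as (e & Ei & He).
{ intros n. apply NNPP; intros N.
  assert (B : forall k, (code (g k) < n)%nat).
  { intros k. apply Nat.nle_gt. intros K. apply N. eauto. }
  assert (ND : NoDup (map (fun k => code (g k)) (seq 0 (S n)))) by (apply FinFun.Injective_map_NoDup; [|apply seq_NoDup]; intros x y E; fin).
  assert (IL : incl (map (fun k => code (g k)) (seq 0 (S n))) (seq 0 n)).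
  { intros m Hm. apply in_map_iff in Hm. destruct Hm as (k & <- & _). apply in_seq. specialize (B k). lia. }
  pose proof (NoDup_incl_length ND IL) as K. rewrite length_map, !length_seq in K. lia. }
assert (Hex : forall n, exists i, Q i /\ code i = e n) by (intros n; apply He; eauto).
destruct (choice _ Hex) as [h Hh]. exists h. split.
- intros x y E. apply Ei. destruct (Hh x) as [_ <-], (Hh y) as [_ <-]. now rewrite E.
- split.
  + intros Qi. destruct (proj1 (He (code i))) as [n Hn]; [eauto|]. exists n. apply Hc.
    destruct (Hh n) as [_ ->]. lia.
  + intros [n <-]. apply Hh.
Qed.

(** * Dependence on r *)

Lemma sign_angle (e : R) : e = 1 \/ e = -1 -> exists i : Z, Eit (2 * PI * (IZR i / 2)) = RtoC e.
Proof.
intros [-> | ->]; [exists 0%Z | exists 1%Z].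
- replace (2 * PI * (0 / 2)) with 0 by field. apply Eit_0.
- replace (2 * PI * (1 / 2)) with PI by field. rewrite Eit_eq, cos_PI, sin_PI. fin.
Qed.

(** Only positive central frequencies are indexed. For sign 1 the choice [q0 = 1] skips frequency 0,
    which belongs to the torus; for sign -1 it is 1/2, and [mv] is then even, so the number
    $mv(p+1/2)$ of theta series is an integer. *)
Lemma central_angle (mv : Z) (e : R) : (0 < mv)%Z -> e = 1 \/ e = -1 -> (Z.Odd mv -> e = 1) ->
  exists q0 (Nm : nat -> nat), 0 < q0 <= 1 /\ Eit (2 * PI * q0) = RtoC e /\
    forall p, INR (Nm p) = IZR mv * (INR p + q0).
Proof.
intros Hm He Ho. destruct He as [He | He].
- exists 1, (fun p => (Z.to_nat mv * (p + 1))%nat). split; [lra|]. split.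
  + rewrite He, Rmult_1_r. apply Eit_2PI.
  + intros p. rewrite mult_INR, plus_INR, (INR_IZR_INZ (Z.to_nat mv)), Z2Nat.id by lia. fin.
- destruct (Z.Even_or_Odd mv) as [[k Hk] | O]; [|specialize (Ho O); lra].
  exists (1 / 2), (fun p => (Z.to_nat k * (2 * p + 1))%nat). split; [lra|]. split.
  + rewrite He. replace (2 * PI * (1 / 2)) with PI by field. rewrite Eit_eq, cos_PI, sin_PI. fin.
  + intros p. rewrite mult_INR, plus_INR, mult_INR, (INR_IZR_INZ (Z.to_nat k)), Z2Nat.id, Hk, mult_IZR by lia.
    simpl. lra.
Qed.

Lemma scale_sqrt c x : 0 <= c -> c * sqrt x = sqrt (c * c * x).
Proof.
intros Hc. destruct (Rle_dec 0 x) as [H | H].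
- rewrite sqrt_mult, sqrt_square; auto. nra.
- rewrite !sqrt_neg_0; fin.
Qed.

Lemma eta_term_scale x r s : 0 < r -> eta_term (x / r) s = (Cexp (s * ln r) * eta_term x s)%C.
Proof.
intros Hr. destruct (Req_dec x 0) as [-> | N].
- replace (0 / r) with 0 by lra. rewrite eta_term_0. fin.
- unfold eta_term. replace (sign (x / r)) with (sign x).
  + replace (ln (Rabs (x / r))) with (ln (Rabs x) - ln r).
    * rewrite RtoC_minus. replace (- s * (ln (Rabs x) - ln r))%C with (s * ln r + - s * ln (Rabs x))%C by ring.
      rewrite Cexp_plus. fin.
    * unfold Rdiv. rewrite Rabs_mult, (Rabs_pos_eq (/ r)) by pos.
      rewrite ln_mult, ln_Rinv; auto; [now apply Rabs_pos_lt | pos].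
  + pose proof (Rinv_0_lt_compat r Hr) as Q. destruct (Rdichotomy _ _ N) as [L | L].
    * rewrite !sign_eq_m1; auto. nra.
    * rewrite !sign_eq_1; auto. pos.
Qed.

(** Every index with value [mu] contributes the same positive amount $|\mu|^{-5}$ to a convergent
    series; 5 lies in the region $\mathrm{Re}\,s>4$ of absolute convergence. *)
Lemma level_finite (lam : nat -> R) mu : mu <> 0 -> csummable (fun k => eta_term (lam k) 5) ->
  exists l, NoDup l /\ forall k, In k l <-> lam k = mu.
Proof.
intros Nm HS. destruct (rsummable_tail _ HS (Rpower (Rabs mu) (- (5)))) as (l0 & N0 & H0).
{ pos. }
exists (filter (fun k => if Req_dec_T (lam k) mu then true else false) l0). split; [now apply NoDup_filter|].
intros k. rewrite filter_In. destruct (Req_dec_T (lam k) mu) as [E | E]; [|lra].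
split; auto. apply NNPP; intros Nk.
assert (K : rsum (fun k => Cmod (eta_term (lam k) 5)) (k :: nil) < Rpower (Rabs mu) (- (5))) by (apply H0; [repeat constructor; fin|]; intros i [<- | []]; fin).
simpl in K. rewrite E, Cmod_eta_term in K by auto. simpl in K. lra.
Qed.

Section Family.
Variables (b1 b2 : R) (mv mw : Z) (q0 : R) (i1 i2 : Z) (Nm : nat -> nat) (tor : bool).
Hypothesis (hb1 : 0 < b1) (hb2 : 0 < b2) (hmv : (0 < mv)%Z) (Bq0 : 0 < q0 <= 1).
Hypothesis (HN : forall p, INR (Nm p) = IZR mv * (INR p + q0)).

(** The triangular coefficients, at [r = 1], of the dual lattice vectors divided by $\sqrt{b_1}$;
    [Dq] is the slant $w_1/w_2=mw/b_2^2$ of the lattice times [Aq]. *)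
Let Aq := 2 * PI * b2 / (IZR mv * sqrt b1).
Let Bq := 2 * PI / (b2 * sqrt b1).
Let Dq := Aq * (IZR mw / (b2 * b2)).

Definition base_value : Idx -> R := lamI b1 1 q0 (half_n Aq Bq Dq i1 i2).

Lemma mode_value_scale r i : 0 < r ->
  mode_value (heis_family b1 b2 mv mw r) q0 (IZR i1 / 2) (IZR i2 / 2) i = base_value i / r.
Proof.
intros Hr.
(* Writing [r] and [b1] as squares turns the identities between square roots into identities of
   rational functions. *)
assert (Hs : exists t, 0 < t /\ r = t * t) by (exists (sqrt r); split; [now apply sqrt_lt_R0 | symmetry; apply sqrt_sqrt; lra]).
assert (Hu : exists u, 0 < u /\ b1 = u * u) by (exists (sqrt b1); split; [now apply sqrt_lt_R0 | symmetry; apply sqrt_sqrt; lra]).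
destruct Hs as (t & Ht & Er), Hu as (u & Hu & Eb).
assert (St : sqrt r = t) by (rewrite Er; apply sqrt_square; lra).
assert (Su : sqrt b1 = u) by (rewrite Eb; apply sqrt_square; lra).
assert (Sut : sqrt (b1 * r) = u * t) by (rewrite sqrt_mult by lra; fin).
assert (Hmv : 0 < IZR mv) by now apply IZR_lt.
assert (Fq : forall p, freq r q0 p = freq 1 q0 p / r) by (intros; unfold freq; lra).
unfold mode_value, base_value, lamI, heis_family; cbn [par_A par_r par_w2 par_mv par_mw].
destruct i as [[[[p n] [[j b] cj]] | [p [j cj]]] | [[x y] b]].
- assert (E : nil_level (b1 * r) (freq r q0 p) (S n) = nil_level b1 (freq 1 q0 p) (S n) / r).
  { unfold nil_level. rewrite Fq.
    match goal with |- _ = sqrt ?a / r => replace (sqrt a / r) with (/ r * sqrt a) by (field; lra) end.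
    rewrite scale_sqrt by pos. f_equal. fin. }
  rewrite E. fin.
- rewrite Fq. fin.
- assert (E : nq (r * IZR mv / (b2 * sqrt r)) (r * IZR mw / (b2 * sqrt r)) (b2 * sqrt r) (b1 * r) (IZR i1 / 2) (IZR i2 / 2) (x, y)
    = half_n Aq Bq Dq i1 i2 (x, y) / r).
  { unfold nq, half_n, qn, qf, ell, kk, mm; cbn [fst snd]. rewrite St, Sut.
    match goal with |- _ = sqrt ?a / 2 / r => replace (sqrt a / 2 / r) with (/ (2 * r) * sqrt a) by (field; lra) end.
    rewrite !scale_sqrt.
    - f_equal. rewrite !plus_IZR, !mult_IZR. unfold Bq, Dq, Aq. rewrite Su, Er. fin.
    - pos.
    - pos. }
  rewrite E. fin.
Qed.

Lemma base_continuation : exists F : C -> C,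
  (forall s, 4 < Re s -> csummable (eta_fam Nm tor base_value s) /\ has_sum (eta_fam Nm tor base_value s) (F s)) /\
  (forall p, -1 < Re p -> cmero F p) /\ cholo F 0%C.
Proof.
assert (Hmv : 0 < IZR mv) by now apply IZR_lt. pose proof PI_RGT_0. pose proof (sqrt_lt_R0 b1 hb1).
apply (eta_continuation b1 (IZR mv) q0 Nm tor Aq Bq Dq i1 i2); auto; [lra | |].
- pos.
- pos.
Qed.

Lemma Nm_pos0 p : (0 < Nm p)%nat.
Proof.
apply INR_lt. rewrite HN. apply Rmult_lt_0_compat; [now apply IZR_lt|]. pose proof (pos_INR p). lra.
Qed.

(** One ground state per central frequency: an infinite supply of nonzero eigenvalues, as the
    enumeration needs. *)
Definition ground (p : nat) : Idx := inl (inr (p, (0%nat, true))).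

Lemma base_ground p : dom Nm tor (ground p) /\ base_value (ground p) < 0.
Proof.
split; [apply Nm_pos0|]. unfold base_value, lamI, ground, freq.
pose proof PI_RGT_0. pose proof (pos_INR p).
assert (0 < 1 / (4 * b1)) by pos.
nra.
Qed.

Lemma base_enumeration : exists e : nat -> Idx, (forall x y, e x = e y -> x = y) /\
  forall i, (dom Nm tor i /\ base_value i <> 0) <-> exists n, e n = i.
Proof.
apply (enumerate Idx_nat (fun i => dom Nm tor i /\ base_value i <> 0) ground).
- apply Idx_nat_inj.
- intros p. destruct (base_ground p). split; auto. lra.
- intros x y E. unfold ground in E. congruence.
Qed.

Section Manifold.
Variables (r eps1 eps2 eps3 : R) (e1 e2 e3 : C2 -> C2) (chi : heis -> R).
Let P := heis_family b1 b2 mv mw r.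
Hypothesis (Hr : 0 < r) (HC : clifford e1 e2 e3) (Hchi : spin_structure P eps1 eps2 eps3 chi).
Hypothesis (Heps1 : eps1 = 1 \/ eps1 = -1) (Heps2 : eps2 = 1 \/ eps2 = -1) (Heps3 : eps3 = 1 \/ eps3 = -1).
Hypothesis (Hq0 : Eit (2 * PI * q0) = RtoC eps3) (Hq1 : Eit (2 * PI * (IZR i1 / 2)) = RtoC eps1)
  (Hq2 : Eit (2 * PI * (IZR i2 / 2)) = RtoC eps2) (Htor : tor = true <-> eps3 = 1).

Lemma family_spectrum mu :
  (forall L, NoDup L -> (forall i, In i L <-> dom Nm tor i /\ base_value i / r = mu) ->
     multiplicity P chi e1 e2 e3 mu (length L)) /\
  (eigenvalue P chi e1 e2 e3 mu <-> exists i, dom Nm tor i /\ base_value i / r = mu).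
Proof.
assert (PA : 0 < par_A P) by now apply Rmult_lt_0_compat.
assert (PW : 0 < par_w2 P) by (apply Rmult_lt_0_compat; auto; now apply sqrt_lt_R0).
destruct (mode_spectrum P chi eps1 eps2 eps3 e1 e2 e3 q0 (IZR i1 / 2) (IZR i2 / 2) Nm tor) with (mu := mu) as [M E]; auto.
split.
- intros L NL HL. apply M; auto. intros i. unfold P. rewrite mode_value_scale by auto. fin.
- rewrite E. split; intros (i & Di & Mi); exists i; split; auto; unfold P in *;
      [rewrite mode_value_scale in Mi by auto | rewrite mode_value_scale by auto]; lra.
Qed.

Lemma family_eta F : 
  (forall s, 4 < Re s -> csummable (eta_fam Nm tor base_value s) /\ has_sum (eta_fam Nm tor base_value s) (F s)) ->
  (forall p, -1 < Re p -> cmero F p) -> cholo F 0%C -> eta_invariant P chi e1 e2 e3 (F 0%C).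
Proof.
intros HF HM HH. destruct base_enumeration as (e & Ei & He).
set (lam := fun k => base_value (e k) / r).
set (K := fun s : C => Cexp (s * ln r)).
assert (EK : Ent K) by (apply (Ent_ext (fun s => Cexp (ln r * s))%C); [intros; unfold K; fin| apply Ent_exp]).
assert (De : forall k, dom Nm tor (e k) /\ base_value (e k) <> 0) by (intros k; apply He; eauto).
assert (Et : forall k s, eta_term (lam k) s = (K s * eta_fam Nm tor base_value s (e k))%C).
{ intros k s. unfold lam. rewrite eta_term_scale by auto. unfold eta_fam.
  destruct (excluded_middle_informative (dom Nm tor (e k))) as [D | D]; [fin | destruct (De k); easy]. }
assert (Hsum : forall s, 4 < Re s -> csummable (fun k => eta_term (lam k) s) /\
  has_sum (fun k => eta_term (lam k) s) (K s * F s)%C).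
{ intros s Hs. destruct (HF s Hs) as [S1 S2].
  replace (fun k => eta_term (lam k) s) with (fun k => (K s * eta_fam Nm tor base_value s (e k))%C)
    by (funext p; fin).
  split.
  - apply (csummable_scal (K s) (fun k => eta_fam Nm tor base_value s (e k))).
    exact (rsummable_comp e (fun i => Cmod (eta_fam Nm tor base_value s i)) Ei S1).
  - apply has_sum_scal. rewrite <- (CSum_unique _ _ S2). apply (has_sum_comp e); auto.
    intros i Hi. unfold eta_fam. destruct (excluded_middle_informative (dom Nm tor i)) as [D | D]; auto.
    destruct (Req_dec (base_value i) 0) as [-> | N]; [apply eta_term_0|].
    destruct (proj1 (He i) (conj D N)) as [n Hn]. now elim (Hi n). }
(* 4 is the abscissa beyond which the series are summed, and 1 comes from the half-plane
   $\mathrm{Re}>-1$ of the continuation. *)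
exists lam, (fun s => (K s * F s)%C), 4, 1. split; [|split; [|split; [|split; [|split]]]].
- split.
  + intros k. destruct (De k) as [_ N]. apply Rmult_integral_contrapositive_currified; auto.
    apply Rinv_neq_0_compat. lra.
  + intros mu Nmu. destruct (level_finite lam mu Nmu) as (l & Nl & Hl).
    { apply Hsum. simpl. lra. }
    exists l. split; auto. split; auto. rewrite <- (length_map e).
    apply family_spectrum; [now apply FinFun.Injective_map_NoDup|].
    intros i. rewrite in_map_iff. split.
    * intros (k & <- & Hk). apply Hl in Hk. split; [apply De | fin].
    * intros [D E]. assert (N : base_value i <> 0) by nra.
      destruct (proj1 (He i) (conj D N)) as [n Hn]. exists n. split; auto. apply Hl. unfold lam. now rewrite Hn.
- intros s Hs. destruct (Hsum s Hs) as [S1 S2]. split.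
  + apply ex_series_rsummable. fin.
  + now apply is_series_has_sum.
- lra.
- intros p Hp. apply cmero_meromorphic, cmero_mult; [apply cmero_cholo; now apply cholo_Ent | fin].
- apply cholo_holomorphic, cholo_mult; auto. now apply cholo_Ent.
- unfold K. rewrite Cmult_0_l, Cexp_0. fin.
Qed.

End Manifold.

(* The nonzero base eigenvalues are bounded away from 0, whereas iterated dilation by [q] tends to 0. *)
Lemma base_not_invariant q : 0 < q < 1 ->
  ~ (forall i, dom Nm tor i -> exists j, dom Nm tor j /\ base_value j = q * base_value i).
Proof.
intros Hq H. destruct base_continuation as (F & HF & _ & _).
(* At an exponent of absolute convergence each single term is at most the bound [M] of the whole
   series, which keeps nonzero eigenvalues away from 0. *)
destruct (HF 5%C) as [[_ [M HM]] _]; [simpl; lra|].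
assert (B : forall i, dom Nm tor i -> base_value i <> 0 -> Rpower (Rabs (base_value i)) (- (5)) <= M).
{ intros i D N. specialize (HM (i :: nil) ltac:(repeat constructor; simpl; tauto)). simpl in HM.
  unfold eta_fam in HM. destruct (excluded_middle_informative (dom Nm tor i)); [|easy].
  rewrite Cmod_eta_term in HM by auto. simpl in HM. lra. }
assert (It : forall n, exists i, dom Nm tor i /\ base_value i = q ^ n * base_value (ground 0)).
{ induction n as [|n (i & Di & Ei)].
  - exists (ground 0). split; [apply base_ground | lra].
  - destruct (H i Di) as (j & Dj & Ej). exists j. split; auto. rewrite Ej, Ei. simpl. lra. }
destruct (base_ground 0) as [_ G]. set (x := Rabs (base_value (ground 0))) in *.
assert (Hx : 0 < x) by (apply Rabs_pos_lt; lra).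
assert (Lq : ln q < 0) by (rewrite <- ln_1; apply ln_increasing; lra).
(* Chosen so that $-5\ln(q^nx)>M$; with $e^t\ge1+t$ this exceeds the bound on a single term. *)
destruct (INR_unbounded ((5 * ln x + M) / (5 * - ln q))) as [n Hn],
(It n) as (i & Di & Ei).
assert (Qn : 0 < q ^ n) by pos.
assert (N : base_value i <> 0) by nra.
pose proof (B i Di N) as K. rewrite Ei, Rabs_mult, (Rabs_pos_eq (q ^ n)) in K by lra. fold x in K.
unfold Rpower in K. rewrite ln_mult, ln_pow in K by lra.
assert (L : M < - (5) * (INR n * ln q + ln x)).
{ apply (Rmult_lt_compat_r (5 * - ln q)) in Hn; [|lra].
  unfold Rdiv in Hn. rewrite Rmult_assoc, Rinv_l in Hn by lra. lra. }
pose proof (exp_ineq1_le (- (5) * (INR n * ln q + ln x))). lra.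
Qed.

End Family.

Lemma heis_family_inj b1 b2 mv mw r r' : 0 < b1 -> 0 < r -> 0 < r' -> r <> r' ->
  symmetry_point (heis_family b1 b2 mv mw r) <> symmetry_point (heis_family b1 b2 mv mw r').
Proof.
intros Hb Hr Hr' N E. unfold symmetry_point, heis_family in E; cbn [par_A] in E.
assert (K : 1 / (4 * (b1 * r)) = 1 / (4 * (b1 * r'))) by lra.
assert (R1 : / (b1 * r) = / (b1 * r')) by (replace (/ (b1 * r)) with (4 * (1 / (4 * (b1 * r)))) by fin; rewrite K; fin).
apply Rinv_eq_reg in R1. nra.
Qed.

Theorem corollary14 (b1 b2 : R) (mv mw : Z) (eps1 eps2 eps3 : R)
  (hb1 : 0 < b1) (hb2 : 0 < b2) (hmv : (0 < mv)%Z)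
  (heps1 : eps1 = 1 \/ eps1 = -1)
  (heps2 : eps2 = 1 \/ eps2 = -1)
  (heps3 : eps3 = 1 \/ eps3 = -1)
  (hodd : Z.Odd mv -> eps3 = 1)
  (e1 e2 e3 : C2 -> C2) (he : clifford e1 e2 e3)
  (chi : R -> heis -> R)
  (hchi : forall r, 0 < r ->
     spin_structure (heis_family b1 b2 mv mw r) eps1 eps2 eps3 (chi r)) :
  (exists c : C, forall r, 0 < r ->
     eta_invariant (heis_family b1 b2 mv mw r) (chi r) e1 e2 e3 c) /\
  (forall r r', 0 < r -> 0 < r' -> r <> r' ->
     ~ (forall mu,
          eigenvalue (heis_family b1 b2 mv mw r) (chi r) e1 e2 e3 mu <->
          eigenvalue (heis_family b1 b2 mv mw r') (chi r') e1 e2 e3 mu) /\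
     symmetry_point (heis_family b1 b2 mv mw r) <>
     symmetry_point (heis_family b1 b2 mv mw r')).
Proof.
destruct (sign_angle eps1 heps1) as [i1 H1], (sign_angle eps2 heps2) as [i2 H2],
(central_angle mv eps3 hmv heps3 hodd) as (q0 & Nm & B0 & H0 & HN).
set (tor := if Req_dec_T eps3 1 then true else false).
assert (Ht : tor = true <-> eps3 = 1) by (destruct (Req_dec_T eps3 1); split; discriminate || tauto).
split.
- destruct (base_continuation b1 b2 mv mw q0 i1 i2 Nm tor hb1 hb2 hmv B0 HN) as (F & F1 & F2 & F3).
  exists (F 0%C). intros r Hr.
  apply (family_eta b1 b2 mv mw q0 i1 i2 Nm tor) with (eps1 := eps1) (eps2 := eps2) (eps3 := eps3); fin.
- intros r r' Hr Hr' N. split; [|now apply heis_family_inj].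
  assert (Sp : forall r mu, 0 < r -> eigenvalue (heis_family b1 b2 mv mw r) (chi r) e1 e2 e3 mu <->
    exists i, dom Nm tor i /\ base_value b1 b2 mv mw q0 i1 i2 i / r = mu) by (intros x mu Hx; apply (family_spectrum b1 b2 mv mw q0 i1 i2 Nm tor) with (eps1 := eps1) (eps2 := eps2) (eps3 := eps3); fin).
  (* One inclusion suffices: if every eigenvalue for the larger parameter [y] also occurred for [x],
     the base spectrum would be carried into itself by the dilation $x/y<1$. *)
  assert (Key : forall x y, 0 < x < y -> ~ (forall mu,
     eigenvalue (heis_family b1 b2 mv mw y) (chi y) e1 e2 e3 mu ->
     eigenvalue (heis_family b1 b2 mv mw x) (chi x) e1 e2 e3 mu)).
  { intros x y Hxy H. apply (base_not_invariant b1 b2 mv mw q0 i1 i2 Nm tor hb1 hb2 hmv B0 HN (x / y)).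
    - split; [pos|]. apply Rmult_lt_reg_r with y; [lra|].
      unfold Rdiv. rewrite Rmult_assoc, Rinv_l by lra. lra.
    - intros i Di. specialize (H (base_value b1 b2 mv mw q0 i1 i2 i / y)).
      rewrite !Sp in H by lra. destruct H as (j & Dj & Ej); [eauto|]. exists j. split; auto.
      apply (f_equal (fun t => t * x)) in Ej. unfold Rdiv in Ej at 1. rewrite Rmult_assoc, Rinv_l in Ej by lra.
      lra. }
  intros H. destruct (Rdichotomy _ _ N) as [L | L].
  + apply (Key r r'); auto. apply H.
  + apply (Key r' r); auto. apply H.
Qed.
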